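(* Let $\varepsilon>0$ and $\theta>0$ be given. Then for $T$ large, and for $S$ any $\delta:=2\pi A/\log T$ well-spaced subset of zeros of $\zeta(s)$ with ordinates in $[T,2T]$, we have for all $$M_\theta(s)=\sum_{n\le T^\theta}\frac{a(n)}{n^s}\quad\text{with } a(n)\ll n^{\varepsilon'}\ (\text{for every }\varepsilon'>0)\text{ and } a(1)=1$$ that $$\frac1T\int_T^{2T}\left|1-\zeta(\tfrac12+it)M_\theta(\tfrac12+it)\right|^2dt\ \ge\ \frac{1+O(\varepsilon)}{1+\theta+\frac1A}\cdot\frac{\operatorname{Card}(S)}{\frac{T}{2\pi}\log T}+O(T^{-1+\varepsilon}).$$
   Context: $\zeta$ is the Riemann zeta-function; the ordinate of a zero $\rho=\beta+i\gamma$ is $\gamma$. $A>0$ is a constant. A set $S$ of zeros is $\delta$ well-spaced if the ordinates $\gamma,\gamma'$ of any two distinct elements of $S$ satisfy $|\gamma-\gamma'|\ge\delta$. $\operatorname{Card}(S)$ is the number of elements of $S$. The coefficients $a(n)$ are complex numbers. *)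

(* Defs.v *)
From Stdlib Require Import Reals List.
From Coquelicot Require Import Coquelicot.

Open Scope R_scope.

Definition Cexp (z : C) : C := (exp (Re z) * cos (Im z), exp (Re z) * sin (Im z)).

(** [n^(-s)]; meaningful for [n >= 1]. *)
Definition ninv_pow (n : nat) (s : C) : C := Cexp (- s * RtoC (ln (INR n)))%C.

Definition analytic_at (f : C -> C) (s0 : C) : Prop :=
  exists (r : R) (c : nat -> C), 0 < r /\
    forall s : C, Cmod (s - s0) < r ->
      @is_pseries C_AbsRing C_NormedModule c (s - s0)%C (f s).

(** The Riemann zeta-function is the analytic continuation of
    [sum_(n >= 1) n^(-s)], [Re s > 1], to the complex plane minus the point 1.
    By the identity theorem this determines [zeta] off 1; the value at the pole
    is left free. *)
Definition is_riemann_zeta (zeta : C -> C) : Prop :=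
  (forall s : C, 1 < Re s ->
     @is_series C_AbsRing C_NormedModule (fun n => ninv_pow (S n) s) (zeta s))
  /\ (forall s : C, s <> RtoC 1 -> analytic_at zeta s).

(** [sum_(1 <= n <= x) a(n) n^(-s)]; [a 0] plays no role. *)
Definition dirichlet_poly (a : nat -> C) (x : R) (s : C) : C :=
  @sum_n_m C_AbelianMonoid (fun n => (a n * ninv_pow n s)%C)
    1 (Z.to_nat (Int_part x)).

(** [a(n) << n^eps'] for every [eps' > 0], the implied constant being [K eps'].
    Recording the constants in [K] lets [a] vary with other parameters while
    the bound stays uniform. *)
Definition coeff_bound (K : R -> R) (a : nat -> C) : Prop :=
  forall (eps' : R) (n : nat), 0 < eps' -> (1 <= n)%nat ->
    Cmod (a n) <= K eps' * Rpower (INR n) eps'.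

Definition well_spaced (delta : R) (S : list C) : Prop :=
  forall rho rho' : C, In rho S -> In rho' S -> rho <> rho' ->
    delta <= Rabs (Im rho - Im rho').

(** A finite set of zeros with ordinates in [T, 2T], listed without repetition,
    so that its cardinality is [length S]. A well-spaced set ([delta > 0]) with
    ordinates in a bounded interval is automatically finite. *)
Definition zero_set (zeta : C -> C) (T : R) (S : list C) : Prop :=
  NoDup S /\
  forall rho : C, In rho S -> zeta rho = RtoC 0 /\ T <= Im rho <= 2 * T.

Definition mollified_mean_square (zeta : C -> C) (a : nat -> C) (theta T : R) : R :=
  / T * RInt (fun t : R =>
    Cmod (1 - zeta (1 / 2, t)%R * dirichlet_poly a (Rpower T theta) (1 / 2, t)%R)%C ^ 2)
    T (2 * T).

(* Main.v *)
(** Write [s = 1/2 + it - iz], so that [G z = zeta s * M s] is studied near the real [z]-axis against a weight of the shape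
    [sech^2 (a x / 2)] whose width [1 / a] is of order [(ln T)^2]. By the functional equation a zero of zeta may be replaced
    by one with the same ordinate and real part at least 1/2, which is a zero [la + i al] of [G] with [al >= 0].
    Each of these is moved along a level curve of [Re (e^(a z))] to the real axis by a factor of modulus at most 1 on
    the real axis, normalised to be 1 at a point [w] high in the strip. Integrating [G - Gh] around the strip against a kernel
    with a pole at [w] gives [int Re G <= int Re Gh] up to negligible terms, and since [|Gh| <= |G|] the weighted mean square of
    [1 - Gh] exceeds that of [1 - G] by a negligible amount at most. Now [1 - Gh] equals 1 at the moved zeros, which are still
    well spaced, and it is reproduced by a kernel whose Fourier transform lives on an interval of length about [(1 + theta) ln T].
    By duality and Montgomery and Vaughan's form of Hilbert's inequality its mean square is at least the weighted number
    of zeros over [(1 + theta) ln T + 2 pi / delta = (1 + theta + 1 / A) ln T]. Averaging over [t] gives the theorem. *)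
Require Import Defs.
From Stdlib Require Import Reals ZArith List Lra Lia Psatz Classical ClassicalEpsilon Permutation.
From Coquelicot Require Import Coquelicot.
Open Scope R_scope.

Notation RC := R_CompleteNormedModule (only parsing).
Notation RN := R_NormedModule (only parsing).

Ltac step_le := eapply Rle_trans.
Ltac mono_l := apply Rmult_le_compat_l.
Ltac mono_r := apply Rmult_le_compat_r.
Ltac div_pos := apply Rdiv_lt_0_compat.
Ltac mul_pos := apply Rmult_lt_0_compat.
Ltac cont_derive := apply (ex_derive_continuous (V := RN)); simpl; auto_derive; auto.

Ltac int_const := rewrite RInt_const; unfold scal; simpl; unfold mult; simpl.

(** The scales are forced. Put [l = ln T]. Moving a zero shifts it by [O(a)], which must be small
    against the spacing of order [1 / l]; on the far sides it costs a factor [exp] of twice the sum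
    of [a * al], over some [l ^ 3] zeros in a window of length of order [l ^ 2]. With [a] of order
    [1 / l ^ 2] the shift is negligible and the cost is a fixed power of [T], absorbed by the decay
    [exp (- (a * X))] at [X = l ^ 4]. The strip has height [PI / a], so on its upper edge [Re s] is
    about [2 * l ^ 2] and [1 - G] is negligible. The point [w] lies at a small angle [iota] below
    that edge: on the edge itself the two weights would agree exactly, but the kernel would be
    singular; the angle costs the factor [2 / (1 + cos iota)]. The length [(1 + theta) * ln T] is
    the exponent of growth of [G] per unit of distance to the left. Zeta is [O(t ^ (1 + L))] on
    [Re s >= - L], and a large fixed [L] brings [(1 + L) / L] close to 1, so crude bounds for zeta
    suffice; Abel-Plana summation gives them together with the functional equation. *)

Lemma Cmod_0_contra (z : C) : ~ 0 < Cmod z -> z = 0%C.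
Proof. intros H. apply Cmod_eq_0, Rle_antisym; [apply Rnot_lt_le, H|apply Cmod_ge_0]. Qed.

(** * Complex differentiation along paths and contour integrals *)

(** A remainder bound instead of a difference quotient: there is no division, and the point [w = z]
    needs no exclusion. *)
Definition cder (f : C -> C) (z d : C) : Prop := forall e, 0 < e -> exists r, 0 < r /\ forall w, Cmod (w - z) < r ->
    Cmod (f w - f z - d * (w - z)) <= e * Cmod (w - z).

Definition hol (f : C -> C) (z : C) : Prop := exists d, cder f z d.

Definition ccont (f : C -> C) (z : C) : Prop := forall e, 0 < e -> exists r, 0 < r /\ forall w, Cmod (w - z) < r ->
    Cmod (f w - f z) < e.

Definition rcont (f : R -> C) (t : R) : Prop :=
  continuous (fun t => fst (f t)) t /\ continuous (fun t => snd (f t)) t.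

Lemma C_eq (z w : C) : fst z = fst w -> snd z = snd w -> z = w.
Proof. intros; apply injective_projections; assumption. Qed.

Ltac csimp := unfold Cminus, Cmult, Cplus, Copp, RtoC, Ci, Re, Im, Cconj in *; simpl in *.
Ltac ceq := apply C_eq; csimp.

Lemma Cmod_triangle_minus (x y : C) : Cmod (x - y) <= Cmod x + Cmod y.
Proof. unfold Cminus. rewrite <- (Cmod_opp y). apply Cmod_triangle. Qed.

Lemma Cmod_rev_triangle (x y : C) : Cmod x - Cmod y <= Cmod (x - y).
Proof.
  pose proof (Cmod_triangle (x - y) y) as H. replace (x - y + y)%C with x in H by ring. lra.
Qed.

Lemma Cmod_minus_sym (x y : C) : Cmod (x - y) = Cmod (y - x).
Proof. rewrite <- Cmod_opp. f_equal. ring. Qed.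

Lemma Cmod_le_abs (z : C) : Cmod z <= Rabs (fst z) + Rabs (snd z).
Proof.
  unfold Cmod. pose proof (Rabs_pos (fst z)); pose proof (Rabs_pos (snd z)).
  rewrite <- (sqrt_Rsqr (Rabs (fst z) + Rabs (snd z))) by lra. apply sqrt_le_1_alt. unfold Rsqr.
  rewrite <- (pow2_abs (fst z)), <- (pow2_abs (snd z)). nra.
Qed.

Lemma Cmod_fst (z : C) : Rabs (fst z) <= Cmod z.
Proof. exact (re_le_Cmod z). Qed.

Lemma Cmod_snd (z : C) : Rabs (snd z) <= Cmod z.
Proof.
  pose proof (Rmax_Cmod z) as H. pose proof (Rmax_r (Rabs (fst z)) (Rabs (snd z))). lra.
Qed.

Lemma Cmod_sqr (z : C) : Cmod z ^ 2 = fst z ^ 2 + snd z ^ 2.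
Proof. exact (Cmod2_alt z). Qed.

Lemma Cmod_pos_neq (z : C) : z <> 0%C -> 0 < Cmod z.
Proof. intros H. apply Cmod_gt_0, H. Qed.

Lemma Cmod_neq_0 (z : C) : 0 < Cmod z -> z <> 0%C.
Proof. apply Cmod_gt_0. Qed.

Lemma Cmod_RtoC_pos (x : R) : 0 <= x -> Cmod (RtoC x) = x.
Proof. intros. rewrite Cmod_R. apply Rabs_pos_eq; assumption. Qed.

Lemma cder_ccont f z d : cder f z d -> ccont f z.
Proof.
  intros H e He. destruct (H 1 Rlt_0_1) as (r & Hr & Hw). exists (Rmin r (e / (2 + Cmod d))).
  pose proof (Cmod_ge_0 d) as Hd0. assert (He' : 0 < e / (2 + Cmod d)) by (div_pos; lra).
  split; [apply Rmin_pos; assumption|]. intros w Hd. destruct (Rmin_Rgt_l _ _ _ Hd) as [H1 H2]. specialize (Hw w H1).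
  replace (f w - f z)%C with ((f w - f z - d * (w - z)) + d * (w - z))%C by ring.
  eapply Rle_lt_trans; [apply Cmod_triangle|]. rewrite Cmod_mult. pose proof (Cmod_ge_0 (w - z)).
  apply Rle_lt_trans with ((1 + Cmod d) * Cmod (w - z)); [lra|]. apply (Rmult_lt_compat_l (2 + Cmod d)) in H2; [|lra].
  replace ((2 + Cmod d) * (e / (2 + Cmod d))) with e in H2 by (field; lra). nra.
Qed.

Lemma hol_ccont f z : hol f z -> ccont f z.
Proof. intros [d H]. eapply cder_ccont, H. Qed.

Lemma cder_local f g z d r : 0 < r -> (forall w, Cmod (w - z) < r -> f w = g w) -> cder f z d -> cder g z d.
Proof.
  intros Hr He H e Hpe. destruct (H e Hpe) as (r1 & Hr1 & Hw).
  exists (Rmin r r1). split; [apply Rmin_pos; assumption|]. intros w Hd. rewrite <- !He; [apply Hw| |].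
  - eapply Rlt_le_trans; [exact Hd|apply Rmin_r].
  - replace (z - z)%C with (RtoC 0) by ring. rewrite Cmod_0. exact Hr.
  - eapply Rlt_le_trans; [exact Hd|apply Rmin_l].
Qed.

Lemma hol_local f g z r : 0 < r -> (forall w, Cmod (w - z) < r -> f w = g w) -> hol f z -> hol g z.
Proof. intros Hr He [d H]. exists d. eapply cder_local; eauto. Qed.

Lemma cder_ext f g z d : (forall w, f w = g w) -> cder f z d -> cder g z d.
Proof. intros H. apply (cder_local f g z d 1); [lra|auto]. Qed.

Lemma hol_ext f g z : (forall w, f w = g w) -> hol f z -> hol g z.
Proof. intros H [d Hd]. exists d. eapply cder_ext; eauto. Qed.

Lemma cder_const c z : cder (fun _ => c) z 0.
Proof.
  intros e He. exists 1. split; [lra|]. intros w _.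
  replace (c - c - 0 * (w - z))%C with (RtoC 0) by ring. rewrite Cmod_0. pose proof (Cmod_ge_0 (w - z)). nra.
Qed.

Lemma cder_id z : cder (fun w => w) z 1.
Proof.
  intros e He. exists 1. split; [lra|]. intros w _.
  replace (w - z - 1 * (w - z))%C with (RtoC 0) by ring. rewrite Cmod_0. pose proof (Cmod_ge_0 (w - z)). nra.
Qed.

Lemma cder_plus f g z d d' : cder f z d -> cder g z d' -> cder (fun w => f w + g w)%C z (d + d').
Proof.
  intros Hf Hg e He. destruct (Hf (e / 2)) as (r1 & Hr1 & H1); [lra|].
  destruct (Hg (e / 2)) as (r2 & Hr2 & H2); [lra|].
  exists (Rmin r1 r2). split; [apply Rmin_pos; assumption|]. intros w Hd.
  specialize (H1 w (Rlt_le_trans _ _ _ Hd (Rmin_l _ _))). specialize (H2 w (Rlt_le_trans _ _ _ Hd (Rmin_r _ _))).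
  replace (f w + g w - (f z + g z) - (d + d') * (w - z))%C
    with ((f w - f z - d * (w - z)) + (g w - g z - d' * (w - z)))%C by ring. step_le; [apply Cmod_triangle|]. lra.
Qed.

Lemma cder_mult f g z d d' : cder f z d -> cder g z d' -> cder (fun w => f w * g w)%C z (d * g z + f z * d').
Proof.
  intros Hf Hg e He. pose proof (Cmod_ge_0 d) as P1. pose proof (Cmod_ge_0 d') as P2.
  pose proof (Cmod_ge_0 (f z)) as P3. pose proof (Cmod_ge_0 (g z)) as P4.
  set (M := 1 + Cmod (f z) + Cmod (g z) + Cmod d). assert (HM : 1 <= M) by (unfold M; lra).
  assert (He3 : 0 < e / (3 * M)) by (div_pos; lra). destruct (Hf (e / (3 * M)) He3) as (r1 & Hr1 & H1).
  destruct (Hg (e / (3 * M)) He3) as (r2 & Hr2 & H2).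
  destruct (cder_ccont _ _ _ Hg (Rmin 1 (e / (3 * M)))) as (r3 & Hr3 & H3); [apply Rmin_pos; lra|].
  exists (Rmin r1 (Rmin r2 r3)). split; [repeat apply Rmin_pos; assumption|]. intros w Hd.
  assert (Hd1 : Cmod (w - z) < r1) by (eapply Rlt_le_trans; [exact Hd|apply Rmin_l]). assert (Hd2 : Cmod (w - z) < r2)
    by (eapply Rlt_le_trans; [exact Hd|step_le; [apply Rmin_r|apply Rmin_l]]). assert (Hd3 : Cmod (w - z) < r3)
    by (eapply Rlt_le_trans; [exact Hd|step_le; [apply Rmin_r|apply Rmin_r]]).
  specialize (H1 w Hd1). specialize (H2 w Hd2). specialize (H3 w Hd3). destruct (Rmin_Rgt_l _ _ _ H3) as [H3a H3b].
  assert (Hgw : Cmod (g w) <= M).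
  { replace (g w) with ((g w - g z) + g z)%C by ring. step_le; [apply Cmod_triangle|]. unfold M; lra. }
  replace (f w * g w - f z * g z - (d * g z + f z * d') * (w - z))%C
    with ((f w - f z - d * (w - z)) * g w + f z * (g w - g z - d' * (w - z))
          + d * (w - z) * (g w - g z))%C by ring. step_le; [apply Cmod_triangle|].
  step_le; [apply Rplus_le_compat_r, Cmod_triangle|]. rewrite !Cmod_mult. pose proof (Cmod_ge_0 (w - z)) as Hwz.
  set (q := e / (3 * M)) in *. assert (Hq : q * M = e / 3) by (unfold q; field; lra).
  assert (Cmod (f w - f z - d * (w - z)) * Cmod (g w) <= (q * Cmod (w - z)) * M).
  { apply Rmult_le_compat; try apply Cmod_ge_0; assumption. }
  assert (Cmod (f z) * Cmod (g w - g z - d' * (w - z)) <= M * (q * Cmod (w - z))).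
  { apply Rmult_le_compat; try apply Cmod_ge_0; try assumption. unfold M; lra. }
  assert (Cmod d * Cmod (w - z) * Cmod (g w - g z) <= M * Cmod (w - z) * q).
  { apply Rmult_le_compat; try apply Cmod_ge_0; try lra.
    - apply Rmult_le_pos; assumption.
    - mono_r; [assumption|unfold M; lra]. }
  assert (q * Cmod (w - z) * M = e / 3 * Cmod (w - z)) by (rewrite <- Hq; ring). lra.
Qed.

Lemma cder_comp f g z d d' : cder f z d -> cder g (f z) d' -> cder (fun w => g (f w)) z (d' * d).
Proof.
  intros Hf Hg e He. pose proof (Cmod_ge_0 d) as P1. pose proof (Cmod_ge_0 d') as P2.
  set (q := Rmin 1 (e / (2 * (1 + Cmod d + Cmod d')))). assert (Hq : 0 < q) by (apply Rmin_pos; [lra|div_pos; lra]).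
  assert (Hq1 : q <= 1) by apply Rmin_l. assert (Hq2 : q * (1 + Cmod d + Cmod d') <= e / 2).
  { apply Rle_trans with (e / (2 * (1 + Cmod d + Cmod d')) * (1 + Cmod d + Cmod d')).
    - mono_r; [lra|apply Rmin_r].
    - right; field; lra. } destruct (Hg q Hq) as (r2 & Hr2 & H2). destruct (Hf q Hq) as (r1 & Hr1 & H1).
  destruct (cder_ccont _ _ _ Hf r2 Hr2) as (r3 & Hr3 & H3).
  exists (Rmin r1 r3). split; [apply Rmin_pos; assumption|]. intros w Hd.
  specialize (H1 w (Rlt_le_trans _ _ _ Hd (Rmin_l _ _))). specialize (H3 w (Rlt_le_trans _ _ _ Hd (Rmin_r _ _))).
  specialize (H2 _ H3). pose proof (Cmod_ge_0 (w - z)) as Hwz. replace (g (f w) - g (f z) - d' * d * (w - z))%C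
    with ((g (f w) - g (f z) - d' * (f w - f z)) + d' * (f w - f z - d * (w - z)))%C by ring.
  step_le; [apply Cmod_triangle|]. rewrite Cmod_mult. assert (Hfw : Cmod (f w - f z) <= (q + Cmod d) * Cmod (w - z)).
  { replace (f w - f z)%C with ((f w - f z - d * (w - z)) + d * (w - z))%C by ring.
    step_le; [apply Cmod_triangle|]. rewrite Cmod_mult. lra. }
  assert (q * Cmod (f w - f z) <= q * ((1 + Cmod d) * Cmod (w - z))).
  { mono_l; [lra|]. step_le; [exact Hfw|]. mono_r; lra. }
  assert (Cmod d' * Cmod (f w - f z - d * (w - z)) <= Cmod d' * (q * Cmod (w - z))).
  { mono_l; assumption. } assert (q * (1 + Cmod d + Cmod d') * Cmod (w - z) <= e / 2 * Cmod (w - z))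
    by (mono_r; assumption). assert (0 <= e * Cmod (w - z)) by (apply Rmult_le_pos; lra). lra.
Qed.

Lemma cder_Cinv (z : C) : z <> 0%C -> cder Cinv z (- / (z * z)).
Proof.
  intros Hz e He. pose proof (Cmod_pos_neq z Hz) as Hp. set (m := Cmod z) in *.
  assert (Hm3 : 0 < m * m * m) by (repeat mul_pos; assumption). assert (Hr : 0 < e * (m * m * m) / 2).
  { div_pos; [mul_pos; assumption|lra]. } exists (Rmin (m / 2) (e * (m * m * m) / 2)). split; [apply Rmin_pos; lra|].
  intros w Hd. assert (H1 : Cmod (w - z) < m / 2) by (eapply Rlt_le_trans; [exact Hd|apply Rmin_l]).
  assert (H2 : Cmod (w - z) < e * (m * m * m) / 2) by (eapply Rlt_le_trans; [exact Hd|apply Rmin_r]).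
  assert (Hw : m / 2 <= Cmod w).
  { pose proof (Cmod_rev_triangle z w) as Ht. rewrite Cmod_minus_sym in Ht. fold m in Ht. lra. }
  (* The remainder is exactly [(w - z)^2 / (z^2 w)], and [Cmod w >= m / 2] bounds it. *)
  assert (Hw0 : w <> 0%C) by (apply Cmod_neq_0; lra). replace (/ w - / z - - / (z * z) * (w - z))%C
    with ((w - z) * (w - z) * / (z * z * w))%C by (field; auto). rewrite !Cmod_mult, Cmod_inv, !Cmod_mult; fold m.
  2:{ repeat apply Cmult_neq_0; assumption. } pose proof (Cmod_ge_0 (w - z)) as Hwz.
  rewrite (Rmult_comm e), Rmult_assoc. mono_l; [assumption|]. apply Rle_trans with (Cmod (w - z) * (2 / (m * m * m))).
  - mono_l; [assumption|]. replace (2 / (m * m * m)) with (/ (m * m * (m / 2))) by (field; lra).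
    apply Rinv_le_contravar; [repeat mul_pos; lra|]. mono_l; [apply Rmult_le_pos; lra|assumption].
  - replace e with ((e * (m * m * m) / 2) * (2 / (m * m * m))) by (field; lra).
    mono_r; [|lra]. apply Rlt_le, Rdiv_lt_0_compat; lra.
Qed.

Lemma hol_const c z : hol (fun _ => c) z.
Proof. eexists; apply cder_const. Qed.
Lemma hol_id z : hol (fun w => w) z.
Proof. eexists; apply cder_id. Qed.
Lemma hol_plus f g z : hol f z -> hol g z -> hol (fun w => f w + g w)%C z.
Proof. intros [d H] [d' H']. eexists; apply cder_plus; eassumption. Qed.
Lemma hol_mult f g z : hol f z -> hol g z -> hol (fun w => f w * g w)%C z.
Proof. intros [d H] [d' H']. eexists; apply cder_mult; eassumption. Qed.
Lemma hol_opp f z : hol f z -> hol (fun w => - f w)%C z.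
Proof.
  intros H. apply (hol_ext (fun w => (RtoC (-1)) * f w)%C).
  - intros w. ceq; ring.
  - apply hol_mult; [apply hol_const|exact H].
Qed.
Lemma hol_minus f g z : hol f z -> hol g z -> hol (fun w => f w - g w)%C z.
Proof. intros H H'. apply hol_plus; [exact H|apply hol_opp, H']. Qed.
Lemma hol_minus_const c z : hol (fun w => w - c)%C z.
Proof. apply hol_minus; [apply hol_id|apply hol_const]. Qed.
Lemma hol_comp f g z : hol f z -> hol g (f z) -> hol (fun w => g (f w)) z.
Proof. intros [d H] [d' H']. eexists; apply cder_comp; eassumption. Qed.
Lemma hol_inv f z : hol f z -> f z <> 0%C -> hol (fun w => / f w)%C z.
Proof.
  intros H H0. apply (hol_comp f Cinv); [exact H|]. eexists; apply cder_Cinv, H0.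
Qed.
Lemma hol_div f g z : hol f z -> hol g z -> g z <> 0%C -> hol (fun w => f w / g w)%C z.
Proof. intros. apply hol_mult; [assumption|apply hol_inv; assumption]. Qed.

Lemma Cexp_plus (z w : C) : Cexp (z + w) = (Cexp z * Cexp w)%C.
Proof.
  unfold Cexp. ceq; rewrite exp_plus, ?cos_plus, ?sin_plus; ring.
Qed.
Lemma Cexp_0 : Cexp 0 = 1%C.
Proof. unfold Cexp. ceq; rewrite exp_0, ?cos_0, ?sin_0; ring. Qed.
Lemma Cmod_Cexp (z : C) : Cmod (Cexp z) = exp (fst z).
Proof.
  pose proof (exp_pos (fst z)). apply Rsqr_inj; [apply Cmod_ge_0|lra|].
  rewrite !Rsqr_pow2, Cmod_sqr. unfold Cexp, Re, Im; simpl. pose proof (sin2_cos2 (snd z)) as Hs. unfold Rsqr in Hs.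
  transitivity (exp (fst z) * exp (fst z) * (sin (snd z) * sin (snd z) + cos (snd z) * cos (snd z))); [ring|].
  rewrite Hs. ring.
Qed.
Lemma Cexp_neq_0 (z : C) : Cexp z <> 0%C.
Proof. apply Cmod_neq_0. rewrite Cmod_Cexp. apply exp_pos. Qed.
Lemma Cexp_opp (z : C) : Cexp (- z) = (/ Cexp z)%C.
Proof.
  assert (H : (Cexp z * Cexp (- z) = 1)%C).
  { rewrite <- Cexp_plus. replace (z + - z)%C with (RtoC 0) by ring. apply Cexp_0. }
  replace (Cexp (- z)) with (/ Cexp z * (Cexp z * Cexp (- z)))%C.
  - rewrite H. ring.
  - field. apply Cexp_neq_0.
Qed.
Lemma Cexp_RtoC (x : R) : Cexp (RtoC x) = RtoC (exp x).
Proof. unfold Cexp. ceq; rewrite ?cos_0, ?sin_0; ring. Qed.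
Lemma Cexp_conj (z : C) : Cexp (Cconj z) = Cconj (Cexp z).
Proof. unfold Cexp, Cconj, Re, Im; simpl. rewrite cos_neg, sin_neg. f_equal. ring. Qed.
Lemma Cexp_minus (z w : C) : Cexp (z - w) = (Cexp z / Cexp w)%C.
Proof. unfold Cminus. rewrite Cexp_plus, Cexp_opp. reflexivity. Qed.

Lemma ccont_rcont (f : C -> C) (p : R -> C) t : ccont f (p t) -> rcont p t -> rcont (fun t => f (p t)) t.
Proof.
  intros Hf [Hp1 Hp2]. assert (H : forall e, 0 < e -> locally t (fun u => Cmod (f (p u) - f (p t)) < e)).
  { intros e He. destruct (Hf e He) as (r & Hr & Hw). assert (Hr2 : 0 < r / 2) by lra.
    pose proof (proj1 (filterlim_locally _ _) Hp1 (mkposreal _ Hr2)) as L1.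
    pose proof (proj1 (filterlim_locally _ _) Hp2 (mkposreal _ Hr2)) as L2.
    generalize (filter_and _ _ L1 L2). apply filter_imp. intros u [B1 B2].
    apply Hw. eapply Rle_lt_trans; [apply Cmod_le_abs|]. change (Rabs (fst (p u) - fst (p t)) < r / 2) in B1.
    change (Rabs (snd (p u) - snd (p t)) < r / 2) in B2. simpl. unfold Rminus in *. lra. }
  split; apply filterlim_locally; intros e; generalize (H e (cond_pos e)); apply filter_imp; intros u Hu.
  - eapply Rle_lt_trans; [|exact Hu]. exact (Cmod_fst (f (p u) - f (p t))%C).
  - eapply Rle_lt_trans; [|exact Hu]. exact (Cmod_snd (f (p u) - f (p t))%C).
Qed.

Lemma hol_rcont (f : C -> C) (p : R -> C) t : hol f (p t) -> rcont p t -> rcont (fun t => f (p t)) t.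
Proof. intros H. apply ccont_rcont, hol_ccont, H. Qed.

Lemma rcont_const c t : rcont (fun _ => c) t.
Proof. split; apply continuous_const. Qed.
Lemma rcont_RtoC (f : R -> R) t : continuous f t -> rcont (fun t => RtoC (f t)) t.
Proof. intros H. split; [exact H|apply continuous_const]. Qed.
Lemma rcont_hline y t : rcont (fun t => (t, y)) t.
Proof. split; [apply continuous_id|apply continuous_const]. Qed.
Lemma rcont_vline x t : rcont (fun t => (x, t)) t.
Proof. split; [apply continuous_const|apply continuous_id]. Qed.
Lemma rcont_plus f g t : rcont f t -> rcont g t -> rcont (fun t => f t + g t)%C t.
Proof.
  intros [F1 F2] [G1 G2]. split; simpl.
  - apply (continuous_plus (fun t => fst (f t)) (fun t => fst (g t))); assumption.
  - apply (continuous_plus (fun t => snd (f t)) (fun t => snd (g t))); assumption.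
Qed.
Lemma rcont_opp f t : rcont f t -> rcont (fun t => - f t)%C t.
Proof.
  intros [F1 F2]. split; simpl.
  - apply (continuous_opp (fun t => fst (f t))); assumption.
  - apply (continuous_opp (fun t => snd (f t))); assumption.
Qed.
Lemma rcont_minus f g t : rcont f t -> rcont g t -> rcont (fun t => f t - g t)%C t.
Proof. intros F G. apply rcont_plus; [exact F|apply rcont_opp, G]. Qed.
Lemma rcont_mult f g t : rcont f t -> rcont g t -> rcont (fun t => f t * g t)%C t.
Proof.
  intros [F1 F2] [G1 G2]. split; simpl.
  - apply (continuous_minus (fun t => fst (f t) * fst (g t)) (fun t => snd (f t) * snd (g t)));
      apply (continuous_mult (K := R_AbsRing)); assumption.
  - apply (continuous_plus (fun t => fst (f t) * snd (g t)) (fun t => snd (f t) * fst (g t)));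
      apply (continuous_mult (K := R_AbsRing)); assumption.
Qed.
Lemma rcont_ext f g t : (forall t, f t = g t) -> rcont f t -> rcont g t.
Proof.
  intros H [F1 F2]; split; [eapply continuous_ext; [|exact F1]|eapply continuous_ext; [|exact F2]];
  intros; simpl; rewrite H; reflexivity.
Qed.
Lemma rcont_Cmod f t : rcont f t -> continuous (fun t => Cmod (f t)) t.
Proof.
  intros [F1 F2]. unfold Cmod. apply continuous_comp.
  - apply (continuous_plus (fun t => fst (f t) ^ 2) (fun t => snd (f t) ^ 2)).
    + apply (continuous_ext (fun t => fst (f t) * fst (f t))); [intros; simpl; ring|].
      apply (continuous_mult (K := R_AbsRing)); assumption.
    + apply (continuous_ext (fun t => snd (f t) * snd (f t))); [intros; simpl; ring|].
      apply (continuous_mult (K := R_AbsRing)); assumption.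
  - apply continuous_sqrt.
Qed.
Lemma rcont_Cmod2 f t : rcont f t -> continuous (fun t => Cmod (f t) ^ 2) t.
Proof.
  intros H. apply (continuous_ext (fun t => Cmod (f t) * Cmod (f t))); [intros; simpl; ring|].
  apply (continuous_mult (K := R_AbsRing)); apply rcont_Cmod, H.
Qed.

(** * Integrals of complex functions of a real variable *)

Definition rc_on (f : R -> C) (a b : R) := forall t, a <= t <= b -> rcont f t.

Definition CI (f : R -> C) (a b : R) : C := (RInt (fun t => fst (f t)) a b, RInt (fun t => snd (f t)) a b).

Lemma ex_RInt_cont (f : R -> R) a b : a <= b -> (forall t, a <= t <= b -> continuous f t) -> ex_RInt f a b.
Proof.
  intros Hab H. apply (ex_RInt_continuous (V := RC)). intros t. rewrite Rmin_left, Rmax_right by assumption. apply H.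
Qed.
Lemma rc_ex1 f a b : a <= b -> rc_on f a b -> ex_RInt (fun t => fst (f t)) a b.
Proof. intros Hab H. apply ex_RInt_cont; [assumption|]. intros t Ht. apply (H t Ht). Qed.
Lemma rc_ex2 f a b : a <= b -> rc_on f a b -> ex_RInt (fun t => snd (f t)) a b.
Proof. intros Hab H. apply ex_RInt_cont; [assumption|]. intros t Ht. apply (H t Ht). Qed.

Lemma CI_ext f g a b : a <= b -> (forall t, a <= t <= b -> f t = g t) -> CI f a b = CI g a b.
Proof.
  intros Hab H. unfold CI. f_equal; apply RInt_ext; intros t;
    rewrite Rmin_left, Rmax_right by assumption; intros Ht; rewrite H; [reflexivity|lra|reflexivity|lra].
Qed.

Lemma CI_plus f g a b : a <= b -> rc_on f a b -> rc_on g a b ->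
  CI (fun t => f t + g t)%C a b = (CI f a b + CI g a b)%C.
Proof.
  intros Hab F G. unfold CI. ceq.
  - apply (RInt_plus (V := RC)); apply rc_ex1; assumption.
  - apply (RInt_plus (V := RC)); apply rc_ex2; assumption.
Qed.
Lemma CI_scal c f a b : a <= b -> rc_on f a b -> CI (fun t => c * f t)%C a b = (c * CI f a b)%C.
Proof.
  intros Hab F. unfold CI. pose proof (rc_ex1 f a b Hab F) as E1. pose proof (rc_ex2 f a b Hab F) as E2. ceq.
  - rewrite (RInt_minus (V := RC) (fun t => fst c * fst (f t)) (fun t => snd c * snd (f t))).
    + rewrite (RInt_scal (V := RC) (fun t => fst (f t))) by assumption.
      rewrite (RInt_scal (V := RC) (fun t => snd (f t))) by assumption. reflexivity.
    + apply (ex_RInt_scal (V := RC)); assumption.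
    + apply (ex_RInt_scal (V := RC)); assumption.
  - rewrite (RInt_plus (V := RC) (fun t => fst c * snd (f t)) (fun t => snd c * fst (f t))).
    + rewrite (RInt_scal (V := RC) (fun t => fst (f t))) by assumption.
      rewrite (RInt_scal (V := RC) (fun t => snd (f t))) by assumption. reflexivity.
    + apply (ex_RInt_scal (V := RC)); assumption.
    + apply (ex_RInt_scal (V := RC)); assumption.
Qed.
Lemma rc_on_scal c f a b : rc_on f a b -> rc_on (fun t => c * f t)%C a b.
Proof. intros F t Ht. apply rcont_mult; [apply rcont_const|apply F, Ht]. Qed.
Lemma CI_minus f g a b : a <= b -> rc_on f a b -> rc_on g a b ->
  CI (fun t => f t - g t)%C a b = (CI f a b - CI g a b)%C.
Proof.
  intros Hab F G. rewrite (CI_ext _ (fun t => f t + (RtoC (-1)) * g t)%C); [|assumption|intros; ceq; ring].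
  rewrite CI_plus, CI_scal; try assumption; [|apply rc_on_scal; assumption]. ceq; ring.
Qed.
Lemma CI_chasles f a b c : a <= b -> b <= c -> rc_on f a c -> (CI f a b + CI f b c)%C = CI f a c.
Proof.
  intros Hab Hbc F. assert (Fa : rc_on f a b) by (intros t Ht; apply F; lra).
  assert (Fb : rc_on f b c) by (intros t Ht; apply F; lra). unfold CI. ceq.
  - apply (RInt_Chasles (V := RC)); apply rc_ex1; assumption.
  - apply (RInt_Chasles (V := RC)); apply rc_ex2; assumption.
Qed.
Lemma CI_point f a : CI f a a = 0%C.
Proof. unfold CI. ceq; apply (RInt_point (V := RC)). Qed.

(** Rotation by the integral's own conjugate: [|I|^2] is the real part of the integral of
    [Cconj I * f], hence at most [|I|] times the integral of [|f|]. *)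
Lemma CI_norm f a b : a <= b -> rc_on f a b -> Cmod (CI f a b) <= RInt (fun t => Cmod (f t)) a b.
Proof.
  intros Hab F. set (I := CI f a b). assert (EM : ex_RInt (fun t => Cmod (f t)) a b)
    by (apply ex_RInt_cont; [assumption|]; intros; apply rcont_Cmod, F; assumption).
  destruct (Req_dec (Cmod I) 0) as [H0|H0].
  { rewrite H0. apply RInt_ge_0; auto. intros; apply Cmod_ge_0. } pose proof (Cmod_ge_0 I) as Hp.
  assert (H : Cmod I * Cmod I <= Cmod I * RInt (fun t => Cmod (f t)) a b).
  { replace (Cmod I * Cmod I) with (Cmod I ^ 2) by ring. rewrite Cmod_sqr.
    replace (fst I ^ 2 + snd I ^ 2) with (fst (Cconj I * I)%C) by (simpl; ring).
    unfold I at 2. rewrite <- CI_scal by assumption. unfold CI; simpl fst.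
    rewrite <- (RInt_scal (V := RC) (fun t => Cmod (f t))) by assumption. apply RInt_le; [assumption| | |].
    - apply (rc_ex1 (fun t => Cconj I * f t)%C); [assumption|]. apply rc_on_scal, F.
    - apply (ex_RInt_scal (V := RC)); assumption.
    - intros t _. change (fst (Cconj I * f t)%C <= Cmod I * Cmod (f t)). rewrite <- (Cmod_conj I), <- Cmod_mult.
      step_le; [apply Rle_abs|apply Cmod_fst]. } apply Rmult_le_reg_l with (Cmod I); [lra|exact H].
Qed.

Lemma CI_bound f a b M : a <= b -> rc_on f a b -> (forall t, a <= t <= b -> Cmod (f t) <= M) ->
  Cmod (CI f a b) <= M * (b - a).
Proof.
  intros Hab F HM. step_le; [apply CI_norm; assumption|]. replace (M * (b - a)) with (RInt (fun _ => M) a b).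
  - apply RInt_le; [assumption| | |].
    + apply ex_RInt_cont; [assumption|]. intros; apply rcont_Cmod, F; assumption.
    + apply ex_RInt_const.
    + intros; apply HM; lra.
  - int_const. ring.
Qed.

Lemma CI_bound_g f (g : R -> R) a b : a <= b -> rc_on f a b -> (forall t, a <= t <= b -> continuous g t) ->
  (forall t, a <= t <= b -> Cmod (f t) <= g t) -> Cmod (CI f a b) <= RInt g a b.
Proof.
  intros Hab F Hg HM. step_le; [apply CI_norm; assumption|]. apply RInt_le; [assumption| | |].
  - apply ex_RInt_cont; [assumption|]. intros; apply rcont_Cmod, F; assumption.
  - apply ex_RInt_cont; assumption.
  - intros; apply HM; lra.
Qed.

Definition rder (f : R -> C) (t : R) (d : C) : Prop :=
  is_derive (fun t => fst (f t)) t (fst d) /\ is_derive (fun t => snd (f t)) t (snd d).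

Lemma CI_antider (F f : R -> C) a b : a <= b -> rc_on f a b ->
  (forall t, a <= t <= b -> rder F t (f t)) -> CI f a b = (F b - F a)%C.
Proof.
  intros Hab Hf H. unfold CI. ceq.
  - apply is_RInt_unique, (is_RInt_derive (V := RC) (fun t => fst (F t))); intros t;
      rewrite Rmin_left, Rmax_right by assumption; intros Ht; [apply (H t Ht)|apply (Hf t Ht)].
  - apply is_RInt_unique, (is_RInt_derive (V := RC) (fun t => snd (F t))); intros t;
      rewrite Rmin_left, Rmax_right by assumption; intros Ht; [apply (H t Ht)|apply (Hf t Ht)].
Qed.

Lemma cder_rder f (z d c : C) (t : R) (p : R -> C) : cder f (p t) d ->
  (forall u, p u = (z + RtoC u * c)%C) -> rder (fun u => f (p u)) t (d * c)%C.
Proof.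
  intros H Hp. assert (K : forall e, 0 < e -> exists r, 0 < r /\ forall u, Rabs (u - t) < r ->
    Cmod (f (p u) - f (p t) - d * c * RtoC (u - t))%C <= e * Rabs (u - t)).
  { intros e He. pose proof (Cmod_ge_0 c) as Hc. assert (He' : 0 < e / (1 + Cmod c)) by (div_pos; lra).
    destruct (H _ He') as (r & Hr & Hw). exists (r / (1 + Cmod c)). split; [div_pos; lra|]. intros u Hu.
    assert (E : (p u - p t = RtoC (u - t) * c)%C) by (rewrite !Hp, RtoC_minus; ring).
    assert (Em : Cmod (p u - p t) = Rabs (u - t) * Cmod c) by (rewrite E, Cmod_mult, Cmod_R; reflexivity).
    pose proof (Rabs_pos (u - t)) as Hup. apply (Rmult_lt_compat_r (1 + Cmod c)) in Hu; [|lra].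
    replace (r / (1 + Cmod c) * (1 + Cmod c)) with r in Hu by (field; lra). specialize (Hw (p u)). rewrite Em in Hw.
    replace (d * c * RtoC (u - t))%C with (d * (p u - p t))%C by (rewrite E; ring). step_le; [apply Hw; nra|].
    apply Rle_trans with (e / (1 + Cmod c) * (Rabs (u - t) * (1 + Cmod c))).
    - mono_l; [lra|]. nra.
    - right; field; lra. } split; apply is_derive_Reals; intros e He; destruct (K (e / 2)) as (r & Hr & Hw);
    try lra; exists (mkposreal r Hr); intros h Hh Hhr; specialize (Hw (t + h));
    replace (t + h - t) with h in Hw by ring; specialize (Hw Hhr); pose proof (Rabs_pos_lt h Hh) as Hp0.
  - apply Rle_lt_trans with (e / 2); [|lra]. apply Rmult_le_reg_r with (Rabs h); [assumption|].
    rewrite <- Rabs_mult. step_le; [|exact Hw]. step_le; [|apply Cmod_fst]. right. f_equal. simpl. field. assumption.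
  - apply Rle_lt_trans with (e / 2); [|lra]. apply Rmult_le_reg_r with (Rabs h); [assumption|].
    rewrite <- Rabs_mult. step_le; [|exact Hw]. step_le; [|apply Cmod_snd]. right. f_equal. simpl. field. assumption.
Qed.

Lemma rder_Cexp_line (u : C) t : rder (fun t => Cexp (RtoC t * u)) t (u * Cexp (RtoC t * u)).
Proof.
  unfold Cexp, Re, Im. split; simpl; auto_derive; auto; unfold Rminus; ring.
Qed.

Lemma rcont_rder f t d : rder f t d -> rcont f t.
Proof.
  intros [H1 H2]. split; apply (ex_derive_continuous (V := RN)); eexists; eassumption.
Qed.

Lemma Cmod_Cexp_le (z : C) : Cmod (Cexp z) <= exp (Cmod z).
Proof.
  rewrite Cmod_Cexp. destruct (Rle_lt_dec (Cmod z) (fst z)) as [H|H].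
  - right. f_equal. apply Rle_antisym; [|assumption]. step_le; [apply Rle_abs|apply Cmod_fst].
  - apply Rlt_le, exp_increasing, H.
Qed.

Lemma exp_le x y : x <= y -> exp x <= exp y.
Proof. intros [H|H]; [left; apply exp_increasing, H|right; congruence]. Qed.

Lemma Cexp_line_norm (u : C) t : 0 <= t <= 1 -> Cmod (Cexp (RtoC t * u)) <= exp (Cmod u).
Proof.
  intros Ht. step_le; [apply Cmod_Cexp_le|]. apply exp_le.
  rewrite Cmod_mult, Cmod_R, Rabs_pos_eq by lra. pose proof (Cmod_ge_0 u). nra.
Qed.

(** One round of a bootstrap: a bound for [g] becomes a bound for [G - G 0] with an extra factor
    [Cmod u]. Three rounds give the Taylor remainders of [Cexp] of orders one to three. *)
Lemma Cexp_step (u : C) (g : R -> C) (G : R -> C) M : (forall t, rder G t (u * g t)%C) -> (forall t, rcont g t) ->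
  (forall t, 0 <= t <= 1 -> Cmod (g t) <= M) -> forall s, 0 <= s <= 1 -> Cmod (G s - G 0) <= Cmod u * M.
Proof.
  intros H Hg HM s Hs. rewrite <- (CI_antider G (fun t => u * g t)%C 0 s); [|lra| |].
  - step_le.
    + apply (CI_bound _ 0 s (Cmod u * M)); [lra| |].
      * intros t _. apply rcont_mult; [apply rcont_const|apply Hg].
      * intros t Ht. rewrite Cmod_mult. mono_l; [apply Cmod_ge_0|apply HM; lra].
    + assert (0 <= Cmod u * M); [|nra].
      apply Rmult_le_pos; [apply Cmod_ge_0|]. step_le; [apply Cmod_ge_0|apply (HM 0); lra].
  - intros t _. apply rcont_mult; [apply rcont_const|apply Hg].
  - intros t _. apply H.
Qed.

Lemma Cexp_bound1 (u : C) : forall s, 0 <= s <= 1 -> Cmod (Cexp (RtoC s * u) - 1) <= Cmod u * exp (Cmod u).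
Proof.
  intros s Hs. replace (RtoC 1) with (Cexp (RtoC 0 * u)) by (rewrite Cmult_0_l; apply Cexp_0).
  apply (Cexp_step u (fun t => Cexp (RtoC t * u)) (fun t => Cexp (RtoC t * u))); auto.
  - intros t. apply rder_Cexp_line.
  - intros t. eapply rcont_rder, rder_Cexp_line.
  - apply Cexp_line_norm.
Qed.

Lemma Cexp_bound2 (u : C) : forall s, 0 <= s <= 1 ->
  Cmod (Cexp (RtoC s * u) - 1 - RtoC s * u) <= Cmod u * (Cmod u * exp (Cmod u)).
Proof.
  intros s Hs. pose proof (Cexp_step u (fun t => Cexp (RtoC t * u) - 1)%C (fun t => Cexp (RtoC t * u) - RtoC t * u)%C
    (Cmod u * exp (Cmod u))) as K. cbv beta in K. replace (Cexp (RtoC s * u) - 1 - RtoC s * u)%C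
    with (Cexp (RtoC s * u) - RtoC s * u - (Cexp (RtoC 0 * u) - RtoC 0 * u))%C.
  2:{ rewrite Cmult_0_l, Cexp_0. ring. } apply K; auto.
  - intros t. unfold Cexp, Re, Im. split; simpl; auto_derive; auto; unfold Rminus; ring.
  - intros t. apply rcont_minus; [eapply rcont_rder, rder_Cexp_line|apply rcont_const].
  - intros t Ht. apply Cexp_bound1, Ht.
Qed.

Lemma Cexp_bound3 (u : C) : forall s, 0 <= s <= 1 ->
  Cmod (Cexp (RtoC s * u) - 1 - RtoC s * u - RtoC (s * s / 2) * u * u) <= Cmod u * (Cmod u * (Cmod u * exp (Cmod u))).
Proof.
  intros s Hs. pose proof (Cexp_step u (fun t => Cexp (RtoC t * u) - 1 - RtoC t * u)%C
    (fun t => Cexp (RtoC t * u) - RtoC t * u - RtoC (t * t / 2) * u * u)%C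
    (Cmod u * (Cmod u * exp (Cmod u)))) as K. cbv beta in K.
  replace (Cexp (RtoC s * u) - 1 - RtoC s * u - RtoC (s * s / 2) * u * u)%C
    with (Cexp (RtoC s * u) - RtoC s * u - RtoC (s * s / 2) * u * u -
       (Cexp (RtoC 0 * u) - RtoC 0 * u - RtoC (0 * 0 / 2) * u * u))%C.
  2:{ rewrite Cmult_0_l, Cexp_0. replace (0 * 0 / 2) with 0 by lra. ring. } apply K; auto.
  - intros t. unfold Cexp, Re, Im. split; simpl; auto_derive; auto; unfold Rminus; field.
  - intros t. apply rcont_minus; [apply rcont_minus; [eapply rcont_rder, rder_Cexp_line|apply rcont_const]|].
    apply rcont_mult; [apply rcont_RtoC, continuous_id|apply rcont_const].
  - intros t Ht. apply Cexp_bound2, Ht.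
Qed.

Lemma cder_Cexp (z : C) : cder Cexp z (Cexp z).
Proof.
  intros e He. pose proof (exp_pos (fst z)) as Hp. set (K := exp (fst z) * exp 1).
  assert (HK : 0 < K) by (mul_pos; [assumption|apply exp_pos]).
  exists (Rmin 1 (e / K)). split; [apply Rmin_pos; [lra|div_pos; assumption]|]. intros w Hd.
  destruct (Rmin_Rgt_l _ _ _ Hd) as [H1 H2]. set (u := (w - z)%C) in *.
  replace w with (z + u)%C by (unfold u; ring). rewrite Cexp_plus. replace (Cexp z * Cexp u - Cexp z - Cexp z * u)%C
    with (Cexp z * (Cexp (RtoC 1 * u) - 1 - RtoC 1 * u))%C by (rewrite Cmult_1_l; ring). rewrite Cmod_mult, Cmod_Cexp.
  pose proof (Cexp_bound2 u 1 ltac:(lra)) as B. pose proof (Cmod_ge_0 u) as Hu.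
  apply Rle_trans with (exp (fst z) * (Cmod u * (Cmod u * exp 1))).
  - mono_l; [lra|]. step_le; [exact B|]. mono_l; [assumption|]. mono_l; [assumption|]. apply exp_le; lra.
  - replace (exp (fst z) * (Cmod u * (Cmod u * exp 1))) with ((K * Cmod u) * Cmod u) by (unfold K; ring).
    mono_r; [assumption|]. apply (Rmult_lt_compat_l K) in H2; [|assumption].
    replace (K * (e / K)) with e in H2 by (field; lra). lra.
Qed.

Lemma hol_Cexp z : hol Cexp z.
Proof. eexists; apply cder_Cexp. Qed.

Lemma hol_Cexp_comp f z : hol f z -> hol (fun w => Cexp (f w)) z.
Proof. intros H. apply (hol_comp f Cexp); [exact H|apply hol_Cexp]. Qed.

(** * Cauchy's theorem and residues on rectangles *)

Definition RI (f : C -> C) (x0 x1 y0 y1 : R) : C :=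
  (CI (fun t => f (t, y0)) x0 x1 + Ci * CI (fun t => f (x1, t)) y0 y1
   - CI (fun t => f (t, y1)) x0 x1 - Ci * CI (fun t => f (x0, t)) y0 y1)%C.

Definition in_rect (x0 x1 y0 y1 : R) (z : C) : Prop := x0 <= fst z <= x1 /\ y0 <= snd z <= y1.

Definition cont_on_rect f x0 x1 y0 y1 := forall z, in_rect x0 x1 y0 y1 z -> ccont f z.
Definition hol_on_rect f x0 x1 y0 y1 := forall z, in_rect x0 x1 y0 y1 z -> hol f z.

Lemma rc_h f x0 x1 y : (forall t, x0 <= t <= x1 -> ccont f (t, y)) -> rc_on (fun t => f (t, y)) x0 x1.
Proof. intros H t Ht. apply (ccont_rcont f (fun t => (t, y))); [apply H, Ht|apply rcont_hline]. Qed.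
Lemma rc_v f y0 y1 x : (forall t, y0 <= t <= y1 -> ccont f (x, t)) -> rc_on (fun t => f (x, t)) y0 y1.
Proof. intros H t Ht. apply (ccont_rcont f (fun t => (x, t))); [apply H, Ht|apply rcont_vline]. Qed.

Lemma RI_split_x f x0 x1 x2 y0 y1 : x0 <= x1 -> x1 <= x2 ->
  (forall t, x0 <= t <= x2 -> ccont f (t, y0)) -> (forall t, x0 <= t <= x2 -> ccont f (t, y1)) ->
  RI f x0 x2 y0 y1 = (RI f x0 x1 y0 y1 + RI f x1 x2 y0 y1)%C.
Proof.
  intros H01 H12 C0 C1. unfold RI.
  rewrite <- (CI_chasles (fun t => f (t, y0)) x0 x1 x2) by (try assumption; apply rc_h, C0).
  rewrite <- (CI_chasles (fun t => f (t, y1)) x0 x1 x2) by (try assumption; apply rc_h, C1). ring.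
Qed.
Lemma RI_split_y f x0 x1 y0 y1 y2 : y0 <= y1 -> y1 <= y2 ->
  (forall t, y0 <= t <= y2 -> ccont f (x0, t)) -> (forall t, y0 <= t <= y2 -> ccont f (x1, t)) ->
  RI f x0 x1 y0 y2 = (RI f x0 x1 y0 y1 + RI f x0 x1 y1 y2)%C.
Proof.
  intros H01 H12 C0 C1. unfold RI.
  rewrite <- (CI_chasles (fun t => f (x0, t)) y0 y1 y2) by (try assumption; apply rc_v, C0).
  rewrite <- (CI_chasles (fun t => f (x1, t)) y0 y1 y2) by (try assumption; apply rc_v, C1). ring.
Qed.

Lemma hline_int F f y a b : a <= b -> (forall t, a <= t <= b -> cder F (t, y) (f (t, y))) ->
  (forall t, a <= t <= b -> ccont f (t, y)) -> CI (fun t => f (t, y)) a b = (F (b, y) - F (a, y))%C.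
Proof.
  intros Hab H Hc. apply (CI_antider (fun t => F (t, y))); [assumption|apply rc_h, Hc|].
  intros t Ht. rewrite <- (Cmult_1_r (f (t, y))).
  apply (cder_rder F (0, y) (f (t, y)) 1 t (fun t => (t, y))); [apply H, Ht|]. intros u. ceq; ring.
Qed.
Lemma vline_int F f x a b : a <= b -> (forall t, a <= t <= b -> cder F (x, t) (f (x, t))) ->
  (forall t, a <= t <= b -> ccont f (x, t)) -> (Ci * CI (fun t => f (x, t)) a b)%C = (F (x, b) - F (x, a))%C.
Proof.
  intros Hab H Hc. rewrite <- CI_scal by (try assumption; apply rc_v, Hc).
  apply (CI_antider (fun t => F (x, t))); [assumption|apply rc_on_scal, rc_v, Hc|].
  intros t Ht. rewrite (Cmult_comm Ci). apply (cder_rder F (x, 0) (f (x, t)) Ci t (fun t => (x, t))); [apply H, Ht|].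
  intros u. ceq; ring.
Qed.

Lemma RI_primitive F f x0 x1 y0 y1 : x0 <= x1 -> y0 <= y1 ->
  (forall z, in_rect x0 x1 y0 y1 z -> cder F z (f z)) -> cont_on_rect f x0 x1 y0 y1 -> RI f x0 x1 y0 y1 = 0%C.
Proof.
  intros Hx Hy H Hc. unfold RI.
  rewrite (hline_int F f y0), (hline_int F f y1), (vline_int F f x1), (vline_int F f x0); try assumption;
    try (intros t Ht; first [apply H|apply Hc]; split; simpl; lra). ring.
Qed.

Definition on_bd (x0 x1 y0 y1 : R) (z : C) : Prop :=
  in_rect x0 x1 y0 y1 z /\ (fst z = x0 \/ fst z = x1 \/ snd z = y0 \/ snd z = y1).

Ltac on_side := split; [split; simpl; lra|simpl; lra].

Lemma RI_sub_scal f g (c : C) x0 x1 y0 y1 : x0 <= x1 -> y0 <= y1 ->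
  (forall z, on_bd x0 x1 y0 y1 z -> ccont f z) -> (forall z, on_bd x0 x1 y0 y1 z -> ccont g z) ->
  RI (fun z => f z - c * g z)%C x0 x1 y0 y1 = (RI f x0 x1 y0 y1 - c * RI g x0 x1 y0 y1)%C.
Proof.
  intros Hx Hy F G. unfold RI. assert (H : forall y, y = y0 \/ y = y1 -> CI (fun t => f (t, y) - c * g (t, y))%C x0 x1
     = (CI (fun t => f (t, y)) x0 x1 - c * CI (fun t => g (t, y)) x0 x1)%C).
  { intros y E. rewrite CI_minus, CI_scal; try assumption; try reflexivity; try apply rc_on_scal; apply rc_h; intros; first [apply F|apply G]; on_side. }
  assert (V : forall x, x = x0 \/ x = x1 -> CI (fun t => f (x, t) - c * g (x, t))%C y0 y1
     = (CI (fun t => f (x, t)) y0 y1 - c * CI (fun t => g (x, t)) y0 y1)%C).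
  { intros x E. rewrite CI_minus, CI_scal; try assumption; try reflexivity; try apply rc_on_scal; apply rc_v; intros; first [apply F|apply G]; on_side. }
  rewrite !H, !V by auto. ring.
Qed.

Lemma RI_bound f x0 x1 y0 y1 M : x0 <= x1 -> y0 <= y1 ->
  (forall z, on_bd x0 x1 y0 y1 z -> ccont f z) -> (forall z, on_bd x0 x1 y0 y1 z -> Cmod (f z) <= M) ->
  Cmod (RI f x0 x1 y0 y1) <= 2 * M * ((x1 - x0) + (y1 - y0)).
Proof.
  intros Hx Hy Hc HM. unfold RI.
  assert (H : forall y, y = y0 \/ y = y1 -> Cmod (CI (fun t => f (t, y)) x0 x1) <= M * (x1 - x0)).
  { intros y E. apply CI_bound; [assumption|apply rc_h|]; intros t Ht; [apply Hc|apply HM]; on_side. }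
  assert (V : forall x, x = x0 \/ x = x1 -> Cmod (Ci * CI (fun t => f (x, t)) y0 y1)%C <= M * (y1 - y0)).
  { intros x E. rewrite Cmod_mult, Cmod_Ci, Rmult_1_l.
    apply CI_bound; [assumption|apply rc_v|]; intros t Ht; [apply Hc|apply HM]; on_side. }
  step_le; [apply Cmod_triangle_minus|]. step_le; [apply Rplus_le_compat_r, Cmod_triangle_minus|].
  step_le; [apply Rplus_le_compat_r, Rplus_le_compat_r, Cmod_triangle|].
  pose proof (H y0 (or_introl eq_refl)). pose proof (H y1 (or_intror eq_refl)).
  pose proof (V x0 (or_introl eq_refl)). pose proof (V x1 (or_intror eq_refl)). lra.
Qed.

(** Compactness by subdivision: a failing rectangle has a failing quarter, nested failing rectangles
    shrink to a point, and near that point [P] holds. Only the depth and the lower left corner are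
    carried, since the depth fixes the sides. *)
Lemma bisection_principle (P : nat -> R -> R -> Prop) (A B x0 y0 : R) : 0 <= A -> 0 <= B ->
  (forall n x y, P (S n) x y -> P (S n) (x + A / 2 ^ S n) y -> P (S n) x (y + B / 2 ^ S n) ->
     P (S n) (x + A / 2 ^ S n) (y + B / 2 ^ S n) -> P n x y) -> (forall u v, x0 <= u <= x0 + A -> y0 <= v <= y0 + B ->
     exists r, 0 < r /\ forall n x y, A / 2 ^ n + B / 2 ^ n < r ->
       x0 <= x -> x + A / 2 ^ n <= x0 + A -> y0 <= y -> y + B / 2 ^ n <= y0 + B ->
       x <= u <= x + A / 2 ^ n -> y <= v <= y + B / 2 ^ n -> P n x y) -> P O x0 y0.
Proof.
  intros HA HB Hsplit Hloc. apply NNPP. intros Hnot. assert (Hstep : forall n (p : R * R), ~ P n (fst p) (snd p) ->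
    exists q : R * R, ~ P (S n) (fst q) (snd q) /\ (fst p <= fst q /\ fst q + A / 2 ^ S n <= fst p + A / 2 ^ n) /\
      (snd p <= snd q /\ snd q + B / 2 ^ S n <= snd p + B / 2 ^ n)).
  { intros n [x y] Hp; simpl fst in *; simpl snd in *.
    assert (E : forall D, 0 <= D -> 0 <= D / 2 ^ S n /\ D / 2 ^ n = D / 2 ^ S n + D / 2 ^ S n).
    { intros D HD. pose proof (pow_lt 2 n ltac:(lra)). split.
      - apply Rmult_le_pos; [assumption|]. apply Rlt_le, Rinv_0_lt_compat, pow_lt. lra.
      - simpl. field. lra. } destruct (E A HA) as [A1 A2]. destruct (E B HB) as [B1 B2].
    destruct (classic (P (S n) x y)) as [H1|H1].
    2:{ exists (x, y). cbn [fst snd]. split; [assumption|]. rewrite A2, B2. lra. }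
    destruct (classic (P (S n) (x + A / 2 ^ S n) y)) as [H2|H2].
    2:{ exists (x + A / 2 ^ S n, y). cbn [fst snd]. split; [assumption|]. rewrite A2, B2. lra. }
    destruct (classic (P (S n) x (y + B / 2 ^ S n))) as [H3|H3].
    2:{ exists (x, y + B / 2 ^ S n). cbn [fst snd]. split; [assumption|]. rewrite A2, B2. lra. }
    destruct (classic (P (S n) (x + A / 2 ^ S n) (y + B / 2 ^ S n))) as [H4|H4].
    2:{ exists (x + A / 2 ^ S n, y + B / 2 ^ S n). cbn [fst snd]. split; [assumption|]. rewrite A2, B2. lra. }
    exfalso. apply Hp, Hsplit; assumption. } pose (T := fun n => {p : R * R | ~ P n (fst p) (snd p)}).
  (* Choice turns the existence of a failing quarter into a sequence [sq] of failing corners. *)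
  pose (nxt := fun n (p : T n) => constructive_indefinite_description _ (Hstep n (proj1_sig p) (proj2_sig p))).
  pose (sq := fix sq n : T n := match n return T n with | O => exist _ (x0, y0) Hnot
     | S m => exist _ (proj1_sig (nxt m (sq m))) (proj1 (proj2_sig (nxt m (sq m)))) end).
  pose (X := fun n => fst (proj1_sig (sq n))). pose (Y := fun n => snd (proj1_sig (sq n))).
  assert (HX : forall n, X n <= X (S n) /\ X (S n) + A / 2 ^ S n <= X n + A / 2 ^ n).
  { intros n. unfold X. cbn [sq proj1_sig]. apply (proj2_sig (nxt n (sq n))). }
  assert (HY : forall n, Y n <= Y (S n) /\ Y (S n) + B / 2 ^ S n <= Y n + B / 2 ^ n).
  { intros n. unfold Y. cbn [sq proj1_sig]. apply (proj2_sig (nxt n (sq n))). }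
  assert (HP : forall n, ~ P n (X n) (Y n)) by (intros n; exact (proj2_sig (sq n))).
  (* Nested intervals, used once for each coordinate. *)
  assert (Lim : forall (D : R) (Z : nat -> R) z0, 0 <= D -> Z O = z0 ->
    (forall n, Z n <= Z (S n) /\ Z (S n) + D / 2 ^ S n <= Z n + D / 2 ^ n) ->
    (forall n, z0 <= Z n /\ Z n + D / 2 ^ n <= z0 + D) /\ exists l, forall n, Z n <= l <= Z n + D / 2 ^ n).
  { intros D Z z0 HD HZ0 HZ. assert (Pz : forall n, 0 <= D / 2 ^ n).
    { intros n. apply Rmult_le_pos; [assumption|]. apply Rlt_le, Rinv_0_lt_compat, pow_lt. lra. }
    assert (M1 : forall n k, Z n <= Z (n + k)%nat).
    { intros n k; induction k as [|k IH]; [rewrite Nat.add_0_r; lra|].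
      rewrite Nat.add_succ_r. destruct (HZ (n + k)%nat). lra. }
    assert (M2 : forall n k, Z (n + k)%nat + D / 2 ^ (n + k) <= Z n + D / 2 ^ n).
    { intros n k; induction k as [|k IH]; [rewrite Nat.add_0_r; lra|].
      rewrite Nat.add_succ_r. destruct (HZ (n + k)%nat). lra. } split.
    { intros n. pose proof (M1 O n) as N1. pose proof (M2 O n) as N2. simpl in N1, N2.
      rewrite HZ0 in N1, N2. replace (D / 1) with D in N2 by lra. lra. }
    assert (M3 : forall n m, Z m <= Z n + D / 2 ^ n).
    { intros n m. destruct (Nat.le_gt_cases n m) as [H|H].
      - replace m with (n + (m - n))%nat by lia. pose proof (M2 n (m - n)%nat).
        pose proof (Pz (n + (m - n))%nat). lra.
      - replace n with (m + (n - m))%nat by lia. pose proof (M1 m (n - m)%nat).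
        pose proof (Pz (m + (n - m))%nat). lra. }
    destruct (completeness (fun r => exists n, r = Z n)) as [l [Hl1 Hl2]].
    - exists (Z O + D / 2 ^ 0). intros r [n ->]. apply M3.
    - exists (Z O), O. reflexivity.
    - exists l. intros n. split.
      + apply Hl1. exists n. reflexivity.
      + apply Hl2. intros r [m ->]. apply M3. } destruct (Lim A X x0 HA eq_refl HX) as [BX [u Hu]].
  destruct (Lim B Y y0 HB eq_refl HY) as [BY [v Hv]]. destruct (Hloc u v) as (r & Hr & Hrn).
  - pose proof (Hu O) as H0. destruct (BX O). simpl in H0, H1. replace (A / 1) with A in * by lra. unfold X in *; simpl in *. lra.
  - pose proof (Hv O) as H0. destruct (BY O). simpl in H0, H1. replace (B / 1) with B in * by lra. unfold Y in *; simpl in *. lra.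
  - assert (exists n, A / 2 ^ n + B / 2 ^ n < r) as [n Hn].
    { destruct (pow_lt_1_zero (/ 2)) with (y := r / (A + B + 1)) as [N HN].
      - rewrite Rabs_pos_eq; lra.
      - div_pos; lra.
      - exists N. specialize (HN N (le_n N)). rewrite Rabs_pos_eq in HN by (apply pow_le; lra). rewrite pow_inv in HN.
        apply Rle_lt_trans with ((A + B + 1) * / 2 ^ N).
        + unfold Rdiv. assert (0 < / 2 ^ N) by (apply Rinv_0_lt_compat, pow_lt; lra). nra.
        + apply (Rmult_lt_compat_l (A + B + 1)) in HN; [|lra].
          replace ((A + B + 1) * (r / (A + B + 1))) with r in HN by (field; lra). exact HN. }
    apply (HP n), Hrn; try apply BX; try apply BY; try assumption; auto.
Qed.

Lemma cder_affine (c d z : C) : cder (fun w => c * w + d * w * w / 2)%C z (c + d * z).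
Proof.
  replace (c + d * z)%C with ((0 * z + c * 1) + (((0 * z + d * 1) * z + (d * z) * 1) * / 2 + (d * z * z) * 0))%C.
  2:{ field. } apply cder_plus.
  - apply (cder_mult (fun _ => c) (fun w => w)); [apply cder_const|apply cder_id].
  - apply (cder_mult (fun w => d * w * w)%C (fun _ => / 2)%C); [|apply cder_const].
    apply (cder_mult (fun w => d * w)%C (fun w => w)); [|apply cder_id].
    apply (cder_mult (fun _ => d) (fun w => w)); [apply cder_const|apply cder_id].
Qed.

(** Near each point [f] is affine up to [e] times the distance, and affine functions have
    primitives; so a small rectangle contributes at most a multiple of [e] times its size squared, a
    bound that survives gluing. *)
Theorem goursat f x0 x1 y0 y1 : x0 <= x1 -> y0 <= y1 -> hol_on_rect f x0 x1 y0 y1 -> RI f x0 x1 y0 y1 = 0%C.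
Proof.
  intros Hx Hy Hf. apply Cmod_0_contra. intros Hpos. set (A := x1 - x0). set (B := y1 - y0).
  assert (HA : 0 <= A) by (unfold A; lra). assert (HB : 0 <= B) by (unfold B; lra).
  (* With this [e] the bound for the whole rectangle, [4 * e * (A + B) ^ 2], falls short of the
     modulus of the integral. *)
  set (e := Cmod (RI f x0 x1 y0 y1) / (4 * (A + B) ^ 2 + 1)). pose proof (pow2_ge_0 (A + B)) as HAB.
  assert (He : 0 < e) by (div_pos; lra).
  (* The bound is quadratic in the side, hence exactly additive over four quarters. *)
  set (P := fun (n : nat) x y => x0 <= x -> x + A / 2 ^ n <= x1 -> y0 <= y -> y + B / 2 ^ n <= y1 ->
     Cmod (RI f x (x + A / 2 ^ n) y (y + B / 2 ^ n)) <= 4 * e * ((A + B) / 2 ^ n) ^ 2). assert (H : P O x0 y0).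
  { apply (bisection_principle P A B); try assumption.
    - intros n x y H1 H2 H3 H4 X0 X1 Y0 Y1.
      assert (E : forall D, 0 <= D -> 0 <= D / 2 ^ S n /\ D / 2 ^ n = D / 2 ^ S n + D / 2 ^ S n).
      { intros D HD. pose proof (pow_lt 2 n ltac:(lra)). split.
        - apply Rmult_le_pos; [assumption|]. apply Rlt_le, Rinv_0_lt_compat, pow_lt. lra.
        - simpl. field. lra. } destruct (E A HA) as [A1 A2]. destruct (E B HB) as [B1 B2].
      destruct (E (A + B)) as [_ AB2]; [lra|]. unfold P in H1, H2, H3, H4.
      rewrite A2 in X1 |- *. rewrite B2 in Y1 |- *. rewrite AB2.
      set (a := A / 2 ^ S n) in *. set (b := B / 2 ^ S n) in *. set (q := (A + B) / 2 ^ S n) in *.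
      assert (Hc : forall s t, x0 <= s <= x1 -> y0 <= t <= y1 -> ccont f (s, t)).
      { intros s t Hs Ht. apply hol_ccont, Hf. split; assumption. }
      rewrite (RI_split_x f x (x + a) (x + (a + a))) by (try lra; intros; apply Hc; lra).
      rewrite (RI_split_y f x (x + a) y (y + b) (y + (b + b))) by (try lra; intros; apply Hc; lra).
      rewrite (RI_split_y f (x + a) (x + (a + a)) y (y + b) (y + (b + b))) by (try lra; intros; apply Hc; lra).
      replace (x + (a + a)) with (x + a + a) in * by ring. replace (y + (b + b)) with (y + b + b) in * by ring.
      specialize (H1 ltac:(lra) ltac:(lra) ltac:(lra) ltac:(lra)).
      specialize (H2 ltac:(lra) ltac:(lra) ltac:(lra) ltac:(lra)).
      specialize (H3 ltac:(lra) ltac:(lra) ltac:(lra) ltac:(lra)).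
      specialize (H4 ltac:(lra) ltac:(lra) ltac:(lra) ltac:(lra)). step_le; [apply Cmod_triangle|].
      step_le; [apply Rplus_le_compat; apply Cmod_triangle|].
      replace (4 * e * (q + q) ^ 2) with (4 * (4 * e * q ^ 2)) by ring. lra.
    - intros u v Hu Hv. destruct (Hf (u, v)) as [d Hd]; [split; simpl; unfold A, B in *; lra|].
      destruct (Hd e He) as (r & Hr & Hw).
      exists r. split; [assumption|]. intros n x y Hn X0 X1 Y0 Y1 Hxu Hyv _ _ _ _.
      set (a := A / 2 ^ n) in *. set (b := B / 2 ^ n) in *. assert (Ha : 0 <= a) by lra. assert (Hb : 0 <= b) by lra.
      replace ((A + B) / 2 ^ n) with (a + b) by (unfold a, b; field; apply pow_nonzero; lra).
      set (g := fun w => (f (u, v) + d * (w - (u, v)))%C). assert (Cf : cont_on_rect f x (x + a) y (y + b)).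
      { intros z [Z1 Z2]. apply hol_ccont, Hf. split; unfold A, B in *; lra. } assert (Hg : forall z, hol g z).
      { intros z. apply hol_plus; [apply hol_const|]. apply hol_mult; [apply hol_const|apply hol_minus_const]. }
      assert (Zg : RI g x (x + a) y (y + b) = 0%C).
      { apply (RI_primitive (fun w => (f (u, v) - d * (u, v)) * w + d * w * w / 2)%C); try lra; [|intros z _; apply hol_ccont, Hg].
        intros z _. replace (g z) with ((f (u, v) - d * (u, v)) + d * z)%C by (unfold g; ring). apply cder_affine. }
      replace (RI f x (x + a) y (y + b)) with (RI (fun w => f w - 1 * g w)%C x (x + a) y (y + b)).
      2:{ rewrite RI_sub_scal, Zg; try lra; [ring|intros z [Hz _]; apply Cf, Hz|intros z _; apply hol_ccont, Hg]. }
      step_le; [apply (RI_bound _ _ _ _ _ (e * (a + b)))|]; try lra.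
      + intros z [Hz _]. apply hol_ccont, hol_minus; [apply Hf; destruct Hz; split; unfold A, B in *; lra|].
        apply hol_mult; [apply hol_const|apply Hg].
      + intros z [[Z1 Z2] _]. assert (Hm : Cmod (z - (u, v)) <= a + b).
        { step_le; [apply Cmod_le_abs|]. destruct z as [zx zy]; simpl in *.
          apply Rplus_le_compat; apply Rabs_le; lra. }
        replace (f z - 1 * g z)%C with (f z - f (u, v) - d * (z - (u, v)))%C by (unfold g; ring).
        step_le; [apply Hw|].
        * eapply Rle_lt_trans; [exact Hm|assumption].
        * mono_l; lra.
      + replace (x + a - x) with a by ring. replace (y + b - y) with b by ring.
        assert (0 <= e * (a + b) ^ 2) by (apply Rmult_le_pos; [lra|apply pow2_ge_0]). nra. }
  unfold P in H. simpl in H. replace (x0 + A / 1) with x1 in H by (unfold A; lra).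
  replace (y0 + B / 1) with y1 in H by (unfold B; lra). specialize (H ltac:(lra) ltac:(lra) ltac:(lra) ltac:(lra)).
  replace ((A + B) / 1 * ((A + B) / 1 * 1)) with ((A + B) ^ 2) in H by (simpl; field).
  assert (E : e * (4 * (A + B) ^ 2 + 1) = Cmod (RI f x0 x1 y0 y1)) by (unfold e; field; lra). nra.
Qed.

Lemma RI_ext_bd f g x0 x1 y0 y1 : x0 <= x1 -> y0 <= y1 ->
  (forall z, on_bd x0 x1 y0 y1 z -> f z = g z) -> RI f x0 x1 y0 y1 = RI g x0 x1 y0 y1.
Proof.
  intros Hx Hy H. unfold RI. 
  rewrite (CI_ext (fun t => f (t, y0)) (fun t => g (t, y0))), (CI_ext (fun t => f (t, y1)) (fun t => g (t, y1))),
    (CI_ext (fun t => f (x0, t)) (fun t => g (x0, t))), (CI_ext (fun t => f (x1, t)) (fun t => g (x1, t)));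
    try assumption; try reflexivity; intros; apply H; on_side.
Qed.

Lemma RI_point_x f x0 y0 y1 : RI f x0 x0 y0 y1 = 0%C.
Proof. unfold RI. rewrite !CI_point. ring. Qed.
Lemma RI_point_y f x0 x1 y0 : RI f x0 x1 y0 y0 = 0%C.
Proof. unfold RI. rewrite !CI_point. ring. Qed.

(** The rest of the rectangle splits into four pieces to which Goursat's theorem applies. An inner
    side may coincide with an outer one, so [p] may lie on the boundary or in a corner, provided [f]
    is continuous there. *)
Lemma RI_localize f x0 xl xr x1 y0 yl yr y1 (p : C) : x0 <= xl <= xr -> xr <= x1 -> y0 <= yl <= yr -> yr <= y1 ->
  (x0 = xl \/ xl < fst p) -> (xr = x1 \/ fst p < xr) -> (y0 = yl \/ yl < snd p) -> (yr = y1 \/ snd p < yr) ->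
  (forall z, in_rect x0 x1 y0 y1 z -> z <> p -> hol f z) -> (in_rect x0 x1 y0 y1 p -> ccont f p \/ xl < fst p < xr /\ yl < snd p < yr) ->
  RI f x0 x1 y0 y1 = RI f xl xr yl yr.
Proof.
  intros Hx1 Hx2 Hy1 Hy2 Px1 Px2 Py1 Py2 H Hp. destruct p as [px py]; simpl in *.
  assert (Hc : forall a b, x0 <= a <= x1 -> y0 <= b <= y1 -> (a <= xl \/ xr <= a \/ b <= yl \/ yr <= b) -> ccont f (a, b)).
  { intros a b Ha Hb Hn. assert (R : in_rect x0 x1 y0 y1 (a, b)) by (split; simpl; lra).
    destruct (classic ((a, b) = (px, py))) as [E|E]; [|apply hol_ccont, H; assumption].
    rewrite E in R. destruct (Hp R) as [Q|Q]; [rewrite E; exact Q|]. injection E; intros; lra. }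
  assert (Z : forall u v w z, x0 <= u <= v -> v <= x1 -> y0 <= w <= z -> z <= y1 ->
    (u = v \/ w = z \/ px < u \/ v < px \/ py < w \/ z < py) -> RI f u v w z = 0%C).
  { intros u v w z Hu Hv Hw Hz [->|[->|Hn]]; [apply RI_point_x|apply RI_point_y|].
    apply goursat; try lra. intros [a b] [A B]; simpl in *. apply H; [split; simpl; lra|]. intros E. injection E; intros. lra. }
  rewrite (RI_split_x f x0 xl x1), (RI_split_x f xl xr x1) by (try lra; intros; apply Hc; lra).
  rewrite (RI_split_y f xl xr y0 yl y1), (RI_split_y f xl xr yl yr y1) by (try lra; intros; apply Hc; lra).
  rewrite (Z x0 xl), (Z xr x1), (Z xl xr y0 yl), (Z xl xr yr y1) by lra. ring.
Qed.

(** After cutting down to a small square about [p], clipped to the rectangle, the integral is at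
    most a bound for [f] times the perimeter. A corner is allowed, and one occurs at the origin in
    [abel_plana_left]. *)
Lemma RI_removable f x0 x1 y0 y1 (p : C) : x0 <= x1 -> y0 <= y1 -> cont_on_rect f x0 x1 y0 y1 ->
  (forall z, in_rect x0 x1 y0 y1 z -> z <> p -> hol f z) -> RI f x0 x1 y0 y1 = 0%C.
Proof.
  intros Hx Hy Hcc H. destruct (classic (in_rect x0 x1 y0 y1 p)) as [Hin|Hout].
  2:{ apply goursat; try assumption. intros z Hz. apply H; [assumption|]. intros ->. contradiction. }
  apply Cmod_0_contra. intros Hpos.
  destruct (Hcc p Hin 1 Rlt_0_1) as (r & Hr & Hw). pose proof Hin as [[P1 P2] [P3 P4]].
  set (M := Cmod (f p) + 1). assert (HM : 1 <= M) by (unfold M; pose proof (Cmod_ge_0 (f p)); lra).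
  (* The clipped square has sides at most [2 * e], which gives [8 * M * e] against [9 * M * e <= K];
     [r / 3] keeps the square inside the disc where [f] is bounded by [M]. *)
  set (K := Cmod (RI f x0 x1 y0 y1)) in *. set (e := Rmin (r / 3) (K / (9 * M))).
  assert (He : 0 < e) by (apply Rmin_pos; [lra|div_pos; lra]). assert (He1 : e <= r / 3) by apply Rmin_l.
  assert (He2 : 9 * M * e <= K).
  { apply Rle_trans with (9 * M * (K / (9 * M))); [mono_l; [lra|apply Rmin_r]|]. right; field; lra. }
  assert (Lo : forall a q, a <= q -> a <= Rmax a (q - e) <= q /\ q - e <= Rmax a (q - e) /\ (a = Rmax a (q - e) \/ Rmax a (q - e) < q))
    by (intros; apply Rmax_case_strong; intros; repeat split; lra).
  assert (Hi : forall a q, q <= a -> q <= Rmin a (q + e) <= a /\ Rmin a (q + e) <= q + e /\ (Rmin a (q + e) = a \/ q < Rmin a (q + e)))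
    by (intros; apply Rmin_case_strong; intros; repeat split; lra).
  pose proof (Lo x0 (fst p) P1) as Xl. pose proof (Hi x1 (fst p) P2) as Xr. pose proof (Lo y0 (snd p) P3) as Yl. pose proof (Hi y1 (snd p) P4) as Yr.
  set (xl := Rmax x0 (fst p - e)) in *. set (xr := Rmin x1 (fst p + e)) in *.
  set (yl := Rmax y0 (snd p - e)) in *. set (yr := Rmin y1 (snd p + e)) in *. clearbody xl xr yl yr.
  assert (E : RI f x0 x1 y0 y1 = RI f xl xr yl yr) by (apply (RI_localize _ _ _ _ _ _ _ _ _ p); try tauto; try lra; left; apply Hcc, Hin).
  assert (K <= 2 * M * ((xr - xl) + (yr - yl))).
  { unfold K. rewrite E. apply RI_bound; try lra.
    - intros z [[Z1 Z2] _]. apply Hcc. split; lra.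
    - intros z [[Z1 Z2] _]. assert (Cmod (f z - f p) < 1).
      { apply Hw. eapply Rle_lt_trans; [apply Cmod_le_abs|].
        assert (Rabs (fst (z - p)%C) <= e) by (apply Rabs_le; simpl; lra). assert (Rabs (snd (z - p)%C) <= e) by (apply Rabs_le; simpl; lra). lra. }
      replace (f z) with (f p + (f z - f p))%C by ring. step_le; [apply Cmod_triangle|]. unfold M. lra. } nra.
Qed.

(** [/ (t - i s e)] has the odd real part [t / (t^2 + e^2)], and the imaginary part
    [s e / (t^2 + e^2)] with primitive [s * atan (t / e)]. *)
Lemma CI_inv_line e s : 0 < e -> s = 1 \/ s = -1 -> CI (fun t => / (t, (- (s * e))%R))%C (- e) e = (0, s * (PI / 2)).
Proof.
  intros He Hs. assert (Hs2 : s * s = 1) by nra. assert (Hp : forall t, 0 < t ^ 2 + e ^ 2) by (intros; nra).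
  assert (D : forall t, rder (fun t => (/ 2 * ln (t ^ 2 + e ^ 2), s * atan (t / e))) t (/ (t, (- (s * e))%R))%C).
  { intros t. specialize (Hp t). unfold Cinv; cbn [fst snd].
    replace (t ^ 2 + (- (s * e)) ^ 2) with (t ^ 2 + e ^ 2) by nra. split; cbn [fst snd].
    - auto_derive; [nra|]. field. nra.
    - auto_derive; [lra|]. field. nra. }
  rewrite (CI_antider (fun t => (/ 2 * ln (t ^ 2 + e ^ 2), s * atan (t / e)))); [|lra| |].
  - ceq.
    + replace (- e * (- e * 1)) with (e * (e * 1)) by ring. ring.
    + replace (e / e) with 1 by (field; lra). replace (- e / e) with (- (1)) by (field; lra).
      rewrite atan_opp, atan_1. field.
  - intros t _. split.
    + apply (continuous_ext (fun t => t / (t ^ 2 + e ^ 2))).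
      { intros u. unfold Cinv; simpl. f_equal. nra. }
      apply (ex_derive_continuous (V := RN)). auto_derive. specialize (Hp t). nra.
    + apply (continuous_ext (fun t => s * e / (t ^ 2 + e ^ 2))).
      { intros u. unfold Cinv; simpl. f_equal; nra. }
      apply (ex_derive_continuous (V := RN)). auto_derive. specialize (Hp t). nra.
  - intros t _. apply D.
Qed.

Lemma CI_shift f a b c : a <= b -> rc_on f (a + c) (b + c) -> CI f (a + c) (b + c) = CI (fun t => f (t + c)) a b.
Proof.
  intros Hab F. unfold CI. assert (E : forall g : R -> R, ex_RInt g (a + c) (b + c) ->
     RInt g (a + c) (b + c) = RInt (fun t => g (t + c)) a b).
  { intros g Eg. pose proof (RInt_comp_lin (V := RC) g 1 c a b) as K.
    replace (1 * a + c) with (a + c) in K by ring. replace (1 * b + c) with (b + c) in K by ring.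
    rewrite <- (K Eg). apply RInt_ext. intros t _.
    change (1 * g (1 * t + c) = g (t + c)). rewrite !Rmult_1_l. reflexivity. }
  f_equal; apply E; [apply rc_ex1|apply rc_ex2]; try assumption; lra.
Qed.

Lemma ccont_inv_sub p z : z <> p -> ccont (fun z => / (z - p))%C z.
Proof.
  intros Hz. apply hol_ccont, hol_inv; [apply hol_minus_const|].
  intros E. apply Hz. replace z with ((z - p) + p)%C by ring. rewrite E. ring.
Qed.

Lemma RI_inv_square (p : C) e : 0 < e ->
  RI (fun z => / (z - p))%C (fst p - e) (fst p + e) (snd p - e) (snd p + e) = (0, 2 * PI).
Proof.
  intros He. destruct p as [px py]; simpl fst; simpl snd. unfold RI.
  assert (NE : forall a b, (a <> px \/ b <> py) -> ccont (fun z => / (z - (px, py)))%C (a, b)).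
  { intros a b Hn. apply ccont_inv_sub. intros E. injection E; intros. lra. }
  replace (px - e) with (- e + px) by ring. replace (px + e) with (e + px) by ring.
  replace (py - e) with (- e + py) by ring. replace (py + e) with (e + py) by ring.
  rewrite (CI_shift (fun t => / ((t, (- e + py)%R) - (px, py)))%C) by (try lra; apply (rc_h (fun z => / (z - (px, py)))%C); intros; apply NE; lra).
  rewrite (CI_shift (fun t => / ((t, (e + py)%R) - (px, py)))%C) by (try lra; apply (rc_h (fun z => / (z - (px, py)))%C); intros; apply NE; lra).
  rewrite (CI_shift (fun t => / (((- e + px)%R, t) - (px, py)))%C) by (try lra; apply (rc_v (fun z => / (z - (px, py)))%C); intros; apply NE; lra).
  rewrite (CI_shift (fun t => / (((e + px)%R, t) - (px, py)))%C) by (try lra; apply (rc_v (fun z => / (z - (px, py)))%C); intros; apply NE; lra).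
  assert (Nz : forall s t : R, s <> 0 -> (t, s) <> (0, 0)) by (intros s t Hs E; injection E; intros; lra).
  assert (J : forall s, s = 1 \/ s = -1 -> rc_on (fun t => / (t, (- (s * e))%R))%C (- e) e).
  { intros s Hs. apply (rc_h Cinv). intros t _. apply hol_ccont. eexists. apply cder_Cinv. apply Nz. nra. }
  pose proof (CI_inv_line e 1 He ltac:(lra)) as J1. pose proof (CI_inv_line e (-1) He ltac:(lra)) as J2.
  (* Dividing by [i] turns vertical sides into horizontal ones, so that [CI_inv_line] serves all
     four. *)
  assert (MC : forall z : C, z <> 0%C -> (/ (Ci * z) = - Ci * / z)%C).
  { intros z Hz. assert (Ci <> 0)%C by (intros E; injection E; intros; lra).
    assert (CC : (Ci * Ci = - (1))%C) by (ceq; ring).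
    replace (/ (Ci * z))%C with (/ Ci * / z)%C by (field; auto). f_equal.
    replace (- Ci)%C with (/ Ci * - (Ci * Ci))%C by (field; auto). rewrite CC. ring. }
  rewrite (CI_ext _ (fun t => / (t, (- (1 * e))%R))%C (-e) e) by (try lra; intros; f_equal; ceq; ring). rewrite J1.
  rewrite (CI_ext (fun t => / (((t + px)%R, (e + py)%R) - (px, py)))%C (fun t => / (t, (- (-1 * e))%R))%C (-e) e)
    by (try lra; intros; f_equal; ceq; ring). rewrite J2.
  rewrite (CI_ext (fun t => / (((e + px)%R, (t + py)%R) - (px, py)))%C (fun t => (- Ci) * / (t, (- (1 * e))%R))%C (-e) e).
  2: lra.
  2:{ intros t _. rewrite <- MC by (apply Nz; lra). f_equal. ceq; ring. }
  rewrite CI_scal by (try lra; apply J; auto). rewrite J1.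
  rewrite (CI_ext (fun t => / (((- e + px)%R, (t + py)%R) - (px, py)))%C (fun t => (- Ci) * / (t, (- (-1 * e))%R))%C (-e) e).
  2: lra.
  2:{ intros t _. rewrite <- MC by (apply Nz; lra). f_equal. ceq; ring. }
  rewrite CI_scal by (try lra; apply J; auto). rewrite J2. ceq; field.
Qed.

(** On a small square about [p], [f] differs from [c / (z - p)] by a small multiple of
    [/ Cmod (z - p)]. Perimeter over distance does not depend on the size of the square, so the
    error tends to 0. *)
Theorem residue f x0 x1 y0 y1 (p c : C) : x0 < fst p < x1 -> y0 < snd p < y1 ->
  (forall z, in_rect x0 x1 y0 y1 z -> z <> p -> hol f z) ->
  (forall e, 0 < e -> exists r, 0 < r /\ forall z, 0 < Cmod (z - p) < r -> Cmod ((z - p) * f z - c) <= e) ->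
  RI f x0 x1 y0 y1 = ((0, 2 * PI)%R * c)%C.
Proof.
  intros Hx Hy Hf Hlim. destruct p as [px py]; simpl in Hx, Hy. set (p := (px, py)) in *.
  set (D := (RI f x0 x1 y0 y1 - (0, 2 * PI)%R * c)%C). enough (HD : D = 0%C).
  { replace (RI f x0 x1 y0 y1) with (D + (0, 2 * PI)%R * c)%C by (unfold D; ring). rewrite HD. ring. }
  (* On the square of half-side [e] the error is at most [Cmod D / 9 / e] and the perimeter is
     [8 * e], which leaves [8 / 9 * Cmod D]. *)
  apply Cmod_0_contra. intros Hpos. destruct (Hlim (Cmod D / 9)) as (r & Hr & Hw); [lra|].
  set (e := Rmin (r / 3) (Rmin (Rmin (px - x0) (x1 - px)) (Rmin (py - y0) (y1 - py)))).
  assert (He : 0 < e) by (repeat apply Rmin_pos; lra). assert (He1 : e <= r / 3) by apply Rmin_l.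
  assert (He2 : e <= Rmin (Rmin (px - x0) (x1 - px)) (Rmin (py - y0) (y1 - py))) by apply Rmin_r.
  assert (He3 : e <= px - x0 /\ e <= x1 - px /\ e <= py - y0 /\ e <= y1 - py).
  { pose proof (Rmin_l (Rmin (px - x0) (x1 - px)) (Rmin (py - y0) (y1 - py))).
    pose proof (Rmin_r (Rmin (px - x0) (x1 - px)) (Rmin (py - y0) (y1 - py))).
    pose proof (Rmin_l (px - x0) (x1 - px)). pose proof (Rmin_r (px - x0) (x1 - px)).
    pose proof (Rmin_l (py - y0) (y1 - py)). pose proof (Rmin_r (py - y0) (y1 - py)). lra. }
  assert (Bd : forall z, on_bd (px - e) (px + e) (py - e) (py + e) z ->
     z <> p /\ in_rect x0 x1 y0 y1 z /\ e <= Cmod (z - p) /\ Cmod (z - p) < r).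
  { intros [zx zy] [[Z1 Z2] Z3]; cbn [fst snd] in *. assert (Hge : e <= Cmod ((zx, zy) - p)).
    { pose proof (Cmod_fst ((zx, zy) - p)%C) as F1. pose proof (Cmod_snd ((zx, zy) - p)%C) as F2.
      unfold p in *; simpl in F1, F2. destruct Z3 as [-> | [-> | [-> | ->]]].
      - rewrite Rabs_left in F1 by lra. lra.
      - rewrite Rabs_pos_eq in F1 by lra. lra.
      - rewrite Rabs_left in F2 by lra. lra.
      - rewrite Rabs_pos_eq in F2 by lra. lra. } repeat split; cbn [fst snd]; try lra.
    - intros E. rewrite E in Hge. replace (p - p)%C with (RtoC 0) in Hge by ring. rewrite Cmod_0 in Hge. lra.
    - eapply Rle_lt_trans; [apply Cmod_le_abs|]. unfold p; simpl.
      assert (Rabs (zx + - px) <= e) by (apply Rabs_le; lra).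
      assert (Rabs (zy + - py) <= e) by (apply Rabs_le; lra). lra. }
  assert (E1 : RI f x0 x1 y0 y1 = RI f (px - e) (px + e) (py - e) (py + e)).
  { apply (RI_localize _ _ _ _ _ _ _ _ _ p); unfold p; simpl; try lra; first [exact Hf|intros _; right; lra]. }
  assert (Hfc : forall z, on_bd (px - e) (px + e) (py - e) (py + e) z -> ccont f z).
  { intros z Hz. destruct (Bd z Hz) as (B1 & B2 & _). apply hol_ccont, Hf; assumption. }
  assert (Hgc : forall z, on_bd (px - e) (px + e) (py - e) (py + e) z -> ccont (fun z => / (z - p))%C z)
    by (intros z Hz; apply ccont_inv_sub, (Bd z Hz)).
  pose proof (RI_inv_square p e He) as S. unfold p in S at 2 3 4 5; simpl fst in S; simpl snd in S.
  assert (E3 : D = RI (fun z => f z - c * / (z - p))%C (px - e) (px + e) (py - e) (py + e)).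
  { unfold D. rewrite RI_sub_scal, S, E1 by (try lra; assumption). ring. }
  assert (B : Cmod D <= 2 * (Cmod D / 9 / e) * ((px + e - (px - e)) + (py + e - (py - e)))).
  { rewrite E3 at 1. apply RI_bound; try lra.
    - intros z Hz. destruct (Bd z Hz) as (B1 & B2 & _). apply hol_ccont, hol_minus; [apply Hf; assumption|].
      apply hol_mult; [apply hol_const|]. apply hol_inv; [apply hol_minus_const|].
      intros E. apply B1. replace z with ((z - p) + p)%C by ring. rewrite E. ring.
    - intros z Hz. destruct (Bd z Hz) as (B1 & B2 & B3 & B4).
      assert (Hn : (z - p)%C <> 0%C) by (apply Cmod_neq_0; lra).
      replace (f z - c * / (z - p))%C with (((z - p) * f z - c) * / (z - p))%C by (field; assumption).
      rewrite Cmod_mult, Cmod_inv by assumption. apply Rmult_le_compat; [apply Cmod_ge_0| |apply Hw; lra|].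
      + apply Rlt_le, Rinv_0_lt_compat; lra.
      + apply Rinv_le_contravar; lra. }
  replace (2 * (Cmod D / 9 / e) * ((px + e - (px - e)) + (py + e - (py - e)))) with (8 / 9 * Cmod D) in B by (field; lra).
  lra.
Qed.

Corollary residue_quotient (u : C -> C) x0 x1 y0 y1 (p : C) :
  x0 < fst p < x1 -> y0 < snd p < y1 -> hol_on_rect u x0 x1 y0 y1 ->
  RI (fun z => u z / (z - p))%C x0 x1 y0 y1 = ((0, 2 * PI)%R * u p)%C.
Proof.
  intros Hx Hy Hu. apply (residue _ _ _ _ _ p); try assumption.
  - intros z Hz Hn. apply hol_div; [apply Hu, Hz|apply hol_minus_const|].
    intros E. apply Hn. replace z with ((z - p) + p)%C by ring. rewrite E. ring.
  - intros e He. assert (Hp : ccont u p) by (apply hol_ccont, Hu; split; lra).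
    destruct (Hp e He) as (r & Hr & Hw). exists r. split; [assumption|]. intros z [Z1 Z2].
    replace ((z - p) * (u z / (z - p)) - u p)%C with (u z - u p)%C by (field; apply Cmod_neq_0; assumption).
    left. apply Hw, Z2.
Qed.

(** * The identity theorem *)

Lemma rc_bounded f a b : a <= b -> rc_on f a b -> exists M, forall t, a <= t <= b -> Cmod (f t) <= M.
Proof.
  intros Hab F. destruct (continuity_ab_maj (fun t => Cmod (f t)) a b Hab) as (m & Hm & _).
  - intros c Hc. apply continuity_pt_filterlim, rcont_Cmod, F, Hc.
  - exists (Cmod (f m)). exact Hm.
Qed.

Lemma bd_bounded f x0 x1 y0 y1 : x0 <= x1 -> y0 <= y1 -> (forall z, on_bd x0 x1 y0 y1 z -> ccont f z) ->
  exists M, 0 <= M /\ forall z, on_bd x0 x1 y0 y1 z -> Cmod (f z) <= M.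
Proof.
  intros Hx Hy Hc. assert (Bd : forall a b, (x0 <= a <= x1 /\ y0 <= b <= y1) ->
     (a = x0 \/ a = x1 \/ b = y0 \/ b = y1) -> on_bd x0 x1 y0 y1 (a, b)).
  { intros a b H1 H2. split; [split; simpl; tauto|exact H2]. }
  destruct (rc_bounded (fun t => f (t, y0)) x0 x1) as [M1 H1]; [assumption|apply rc_h; intros; apply Hc, Bd; lra|].
  destruct (rc_bounded (fun t => f (t, y1)) x0 x1) as [M2 H2]; [assumption|apply rc_h; intros; apply Hc, Bd; lra|].
  destruct (rc_bounded (fun t => f (x0, t)) y0 y1) as [M3 H3]; [assumption|apply rc_v; intros; apply Hc, Bd; lra|].
  destruct (rc_bounded (fun t => f (x1, t)) y0 y1) as [M4 H4]; [assumption|apply rc_v; intros; apply Hc, Bd; lra|].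
  exists (Rabs M1 + Rabs M2 + Rabs M3 + Rabs M4).
  pose proof (Rabs_pos M1); pose proof (Rabs_pos M2); pose proof (Rabs_pos M3); pose proof (Rabs_pos M4).
  pose proof (Rle_abs M1); pose proof (Rle_abs M2); pose proof (Rle_abs M3); pose proof (Rle_abs M4).
  split; [lra|]. intros [zx zy] [[Z1 Z2] [E | [E | [E | E]]]]; simpl in Z1, Z2, E; subst.
  - specialize (H3 zy Z2); lra.
  - specialize (H4 zy Z2); lra.
  - specialize (H1 zx Z1); lra.
  - specialize (H2 zx Z1); lra.
Qed.

Lemma polar (z : C) : z <> 0%C -> exists v : C, Cexp v = z /\ fst v = ln (Cmod z).
Proof.
  intros Hz. pose proof (Cmod_pos_neq z Hz) as Hp. set (m := Cmod z) in *. pose proof (Cmod_sqr z) as E. fold m in E.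
  set (a := fst z / m). set (b := snd z / m). assert (Eab : a ^ 2 + b ^ 2 = 1).
  { unfold a, b. replace ((fst z / m) ^ 2 + (snd z / m) ^ 2) with ((fst z ^ 2 + snd z ^ 2) / m ^ 2) by (field; lra).
    rewrite <- E. field. lra. } assert (Ha : -1 <= a <= 1) by nra. assert (Hs : exists th, cos th = a /\ sin th = b).
  { destruct (Rle_lt_dec 0 b) as [Hb|Hb].
    - exists (acos a). split; [apply cos_acos, Ha|]. rewrite sin_acos by assumption.
      replace (1 - Rsqr a) with (Rsqr b) by (unfold Rsqr; nra). apply sqrt_Rsqr, Hb.
    - exists (- acos a). rewrite cos_neg, sin_neg. split; [apply cos_acos, Ha|]. rewrite sin_acos by assumption.
      replace (1 - Rsqr a) with (Rsqr (- b)) by (unfold Rsqr; nra). rewrite sqrt_Rsqr; lra. }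
  destruct Hs as (th & Hc & Hs). exists (ln m, th). split; [|reflexivity].
  unfold Cexp, Re, Im; simpl. rewrite exp_ln, Hc, Hs by assumption. unfold a, b. apply C_eq; simpl; field; lra.
Qed.

(** With [w = c + Cexp v] the disc becomes a left half-plane in which [D'] vanishes far to the left.
    Cauchy's formula is applied to [D'] times [Cexp (ph v)], where [ph] is 0 at the point sought and
    has real part at most [- la * c0] on the part of the boundary where [D'] need not vanish; a
    large [la] then gives the contradiction. *)
Lemma identity_disc (D : C -> C) (c : C) (rho r : R) : 0 < rho ->
  (forall w, Cmod (w - c) < r -> hol D w) -> (forall w, Cmod (w - c) < rho -> D w = 0%C) ->
  forall w, Cmod (w - c) < r -> D w = 0%C.
Proof.
  intros Hrho Hh Hz z0 Hz0. destruct (Rlt_le_dec (Cmod (z0 - c)) rho) as [Hlt|Hge]; [apply Hz, Hlt|].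
  assert (Hn : (z0 - c)%C <> 0%C) by (apply Cmod_neq_0; lra). destruct (polar _ Hn) as (v0 & Ev & Fv).
  set (m := Cmod (z0 - c)) in *. destruct v0 as [p q]; simpl in Fv. assert (Hm : 0 < m) by lra.
  assert (Hlr : ln m < ln r) by (apply ln_increasing; lra).
  assert (Hlm : ln rho <= ln m) by (destruct Hge as [H|H]; [left; apply ln_increasing; lra|right; congruence]).
  (* [A * k = / 2] makes the quadratic term of [ph] cost half of the linear gain on the right side;
     [Y] is so large that [- A * y ^ 2] wins on top and bottom. The left side, at distance [d], lies
     where [D'] vanishes. *)
  set (k := (ln r - ln m) / 2). assert (Hk : 0 < k) by (unfold k; lra).
  set (d := ln m - ln rho + 1). assert (Hd : 1 <= d) by (unfold d; lra).
  set (A := / (2 * k)). assert (HA : 0 < A) by (apply Rinv_0_lt_compat; lra).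
  assert (HAk : A * k = / 2) by (unfold A; field; lra). set (Y := (d + k) + (d + 1 + k)).
  assert (HY : d + A * (d + k) ^ 2 + 1 <= A * Y ^ 2).
  { assert (Y ^ 2 >= (d + k) ^ 2 + 2 * k * (d + 1)) by (unfold Y; nra).
    apply Rle_trans with (A * ((d + k) ^ 2 + 2 * k * (d + 1))); [|mono_l; lra].
    replace (A * ((d + k) ^ 2 + 2 * k * (d + 1))) with (A * (d + k) ^ 2 + 2 * (A * k) * (d + 1)) by ring.
    rewrite HAk. lra. } set (D' := fun v => D (c + Cexp v)%C).
  assert (Habs : forall v, (c + Cexp v - c)%C = Cexp v) by (intros; ring).
  assert (HD' : forall v : C, fst v <= p + k -> hol D' v).
  { intros v Hv. apply (hol_comp (fun v => c + Cexp v)%C D).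
    - apply hol_plus; [apply hol_const|apply hol_Cexp].
    - apply Hh. rewrite Habs, Cmod_Cexp. assert (0 < r) by lra. rewrite <- (exp_ln r) by assumption.
      apply exp_increasing. unfold k in Hv. lra. } assert (HD0 : forall v : C, fst v < ln rho -> D' v = 0%C).
  { intros v Hv. apply Hz. rewrite Habs, Cmod_Cexp, <- (exp_ln rho) by assumption. apply exp_increasing, Hv. }
  set (x0 := p - d). set (x1 := p + k). set (y0 := q - Y). set (y1 := q + Y). assert (HYp : 0 < Y) by (unfold Y; lra).
  destruct (bd_bounded (fun v => D' v / (v - (p, q)))%C x0 x1 y0 y1) as (M & HM0 & HM).
  { unfold x0, x1; lra. } { unfold y0, y1; lra. }
  { intros z [[Z1 Z2] Z3]. apply hol_ccont, hol_div; [apply HD'; unfold x1 in *; lra| |].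
    - apply hol_minus_const.
    - intros E. assert (E1 := f_equal fst E). assert (E2 := f_equal snd E). simpl in E1, E2.
      unfold x0, x1, y0, y1 in *. lra. } set (c0 := Rmin (k / 2) 1). assert (Hc0 : 0 < c0) by (apply Rmin_pos; lra).
  assert (Key : forall la, 0 <= la -> 2 * PI * Cmod (D' (p, q)) <= 2 * (M * exp (- (la * c0))) * ((x1 - x0) + (y1 - y0))).
  { intros la Hla. set (ph := fun v : C => (RtoC la * (- (v - (p, q)) + RtoC A * ((v - (p, q)) * (v - (p, q)))))%C).
    assert (Hph : forall v, hol ph v).
    { intros v. unfold ph. assert (hol (fun v => v - (p, q))%C v) by (apply hol_minus_const).
      apply hol_mult; [apply hol_const|]. apply hol_plus; [apply hol_opp; assumption|].
      apply hol_mult; [apply hol_const|apply hol_mult; assumption]. }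
    pose proof (residue_quotient (fun v => D' v * Cexp (ph v))%C x0 x1 y0 y1 (p, q)) as Rs.
    assert (E : Cexp (ph (p, q)) = 1%C).
    { unfold ph. replace ((p, q) - (p, q))%C with (RtoC 0) by (ceq; ring).
      replace (la * (- 0 + A * (0 * 0)))%C with (RtoC 0) by ring. apply Cexp_0. }
    cbv beta in Rs. rewrite E, Cmult_1_r in Rs.
    replace (2 * PI * Cmod (D' (p, q))) with (Cmod ((0, 2 * PI)%R * D' (p, q))).
    2:{ rewrite Cmod_mult. f_equal. unfold Cmod; simpl.
        replace (0 * (0 * 1) + 2 * PI * (2 * PI * 1)) with (Rsqr (2 * PI)) by (unfold Rsqr; ring).
        apply sqrt_Rsqr. pose proof PI_RGT_0. lra. } rewrite <- Rs.
    2:{ unfold x0, x1; simpl; lra. } 2:{ unfold y0, y1; simpl; lra. }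
    2:{ intros z [Z1 Z2]. apply hol_mult; [apply HD'; unfold x1 in *; lra|apply hol_Cexp_comp, Hph]. } apply RI_bound.
    - unfold x0, x1; lra.
    - unfold y0, y1; lra.
    - intros z [[Z1 Z2] Z3]. apply hol_ccont, hol_div.
      + apply hol_mult; [apply HD'; unfold x1 in *; lra|apply hol_Cexp_comp, Hph].
      + apply hol_minus_const.
      + intros E0. assert (E1 := f_equal fst E0). assert (E2 := f_equal snd E0). simpl in E1, E2.
        unfold x0, x1, y0, y1 in *. lra.
    - intros z Hz'. specialize (HM z Hz').
      replace (D' z * Cexp (ph z) / (z - (p, q)))%C with ((D' z / (z - (p, q))) * Cexp (ph z))%C by (unfold Cdiv; ring).
      rewrite Cmod_mult. destruct (Rlt_le_dec (fst z) (ln rho)) as [Hl|Hr].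
      { rewrite HD0 by assumption. replace (0 / (z - (p, q)))%C with (RtoC 0) by (unfold Cdiv; ring).
        rewrite Cmod_0, Rmult_0_l. apply Rmult_le_pos; [assumption|left; apply exp_pos]. }
      apply Rmult_le_compat; [apply Cmod_ge_0|apply Cmod_ge_0|assumption|]. rewrite Cmod_Cexp. apply exp_le.
      destruct z as [zx zy]. destruct Hz' as [[Z1 Z2] Z3]. cbn [fst snd] in *. unfold ph. csimp.
      set (x := zx + - p). set (y := zy + - q). assert (Hx : - d <= x <= k) by (unfold x, x0, x1 in *; lra).
      match goal with |- ?l <= _ => replace l with (la * (- x + A * (x ^ 2 - y ^ 2))) by ring end.
      enough (- x + A * (x ^ 2 - y ^ 2) <= - c0) by nra.
      assert (Hc1 : c0 <= k / 2) by apply Rmin_l. assert (Hc2 : c0 <= 1) by apply Rmin_r. destruct Z3 as [Z3|[Z3|Z3]].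
      + exfalso. unfold x0, d in *. lra.
      + assert (x = k) as -> by (unfold x, x1 in *; lra).
        replace (A * (k ^ 2 - y ^ 2)) with (A * k * k - A * y ^ 2) by ring. rewrite HAk.
        assert (0 <= A * y ^ 2) by (apply Rmult_le_pos; [lra|apply pow2_ge_0]). lra.
      + assert (Ey : y ^ 2 = Y ^ 2) by (unfold y, y0, y1 in *; destruct Z3 as [-> | ->]; ring).
        rewrite Ey. assert (A * x ^ 2 <= A * (d + k) ^ 2) by (mono_l; [lra|nra]). lra. }
  assert (E0 : D z0 = D' (p, q)).
  { unfold D'. rewrite Ev. f_equal. ring. } rewrite E0. apply Cmod_0_contra. intros Hpos.
  set (S := (x1 - x0) + (y1 - y0)) in *. assert (HS : 0 < S) by (unfold S, x0, x1, y0, y1; lra).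
  set (m0 := Cmod (D' (p, q))) in *. pose proof PI2_3_2 as HPI. assert (Hla : 0 <= 2 * M * S / (m0 * c0)).
  { apply Rmult_le_pos; [apply Rmult_le_pos; [lra|lra]|]. left. apply Rinv_0_lt_compat, Rmult_lt_0_compat; lra. }
  specialize (Key _ Hla). replace (2 * M * S / (m0 * c0) * c0) with (2 * M * S / m0) in Key by (field; lra).
  set (t := 2 * M * S / m0) in *. assert (Ht : t * m0 = 2 * M * S) by (unfold t; field; lra).
  assert (Ht0 : 0 <= t) by (unfold t; apply Rmult_le_pos; [nra|left; apply Rinv_0_lt_compat; lra]).
  pose proof (exp_ineq1_le t) as Hexp. rewrite exp_Ropp in Key.
  assert (Hi : exp t * / exp t = 1) by (apply Rinv_r, Rgt_not_eq, exp_pos).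
  assert (Hi0 : 0 < / exp t) by (apply Rinv_0_lt_compat, exp_pos). assert (t * / exp t <= 1) by nra.
  replace (2 * (M * / exp t) * S) with (m0 * (t * / exp t)) in Key by (rewrite <- Rmult_assoc, (Rmult_comm m0), Ht; ring).
  nra.
Qed.

(** Continuation along the segment by discs of a fixed radius, with steps shorter than half of
    it. *)
Theorem identity_segment (D : C -> C) (c z : C) (rho r : R) : 0 < rho -> 0 < r ->
  (forall t w, 0 <= t <= 1 -> Cmod (w - (c + RtoC t * (z - c))) < r -> hol D w) ->
  (forall w, Cmod (w - c) < rho -> D w = 0%C) -> D z = 0%C.
Proof.
  intros Hrho Hr Hh Hz. destruct (INR_unbounded (2 * Cmod (z - c) / r)) as [n Hn]. assert (Hn0 : 0 < INR n).
  { eapply Rle_lt_trans; [|exact Hn]. apply Rmult_le_pos; [pose proof (Cmod_ge_0 (z - c)); lra|].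
    left; apply Rinv_0_lt_compat, Hr. } set (r' := Rmin rho (r / 2)). assert (Hr' : 0 < r') by (apply Rmin_pos; lra).
  assert (Hr2 : r' <= r / 2) by apply Rmin_r.
  assert (HI : forall k, (k <= n)%nat -> forall w, Cmod (w - (c + RtoC (INR k / INR n) * (z - c))) < r' -> D w = 0%C).
  { induction k as [|k IH]; intros Hk w Hw.
    - apply Hz. eapply Rlt_le_trans; [|apply (Rmin_l rho (r / 2))].
      simpl in Hw. replace (0 / INR n) with 0 in Hw by (field; lra).
      replace (w - c)%C with (w - (c + 0 * (z - c)))%C by ring. exact Hw.
    - assert (Hkn : INR k <= INR n) by (apply le_INR; lia). assert (Ht : 0 <= INR k / INR n <= 1).
      { split; [apply Rmult_le_pos; [apply pos_INR|left; apply Rinv_0_lt_compat, Hn0]|].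
        apply Rmult_le_reg_r with (INR n); [assumption|]. unfold Rdiv. rewrite Rmult_assoc, Rinv_l; lra. }
      apply (identity_disc D (c + RtoC (INR k / INR n) * (z - c))%C r' r Hr').
      + intros w' Hw'. apply (Hh _ _ Ht Hw').
      + apply IH. lia.
      + rewrite S_INR in Hw. replace (w - (c + RtoC (INR k / INR n) * (z - c)))%C
          with ((w - (c + RtoC ((INR k + 1) / INR n) * (z - c))) + RtoC (/ INR n) * (z - c))%C.
        2:{ replace ((INR k + 1) / INR n) with (INR k / INR n + / INR n) by (field; lra). rewrite RtoC_plus. ring. }
        eapply Rle_lt_trans; [apply Cmod_triangle|]. rewrite Cmod_mult, Cmod_R, Rabs_pos_eq.
        2:{ left; apply Rinv_0_lt_compat, Hn0. } assert (/ INR n * Cmod (z - c) < r / 2); [|lra].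
        apply Rmult_lt_reg_l with (INR n); [assumption|]. rewrite <- Rmult_assoc, Rinv_r, Rmult_1_l by lra.
        apply (Rmult_lt_compat_r r) in Hn; [|assumption].
        replace (2 * Cmod (z - c) / r * r) with (2 * Cmod (z - c)) in Hn by (field; lra). lra. }
  apply (HI n (le_n n)). replace (INR n / INR n) with 1 by (field; lra).
  replace (z - (c + 1 * (z - c)))%C with (RtoC 0) by ring. rewrite Cmod_0. exact Hr'.
Qed.

(** * The principal logarithm and complex powers *)

(** The half-angle formula: one smooth expression on the whole plane cut along the negative real
    axis, without cases by quadrant. *)
Definition Carg (z : C) : R := 2 * atan (snd z / (Cmod z + fst z)).
Definition Clog (z : C) : C := (ln (Cmod z), Carg z).
Definition slit (z : C) : Prop := 0 < Cmod z + fst z.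

Lemma slit_Re (z : C) : 0 < fst z -> slit z.
Proof. intros H. unfold slit. pose proof (Cmod_ge_0 z). lra. Qed.

Lemma slit_Im (z : C) : snd z <> 0 -> slit z.
Proof.
  intros H. unfold slit. pose proof (Cmod_ge_0 z). pose proof (Cmod_sqr z).
  assert (0 < snd z ^ 2) by (apply pow2_gt_0, H). nra.
Qed.

Lemma slit_mod (z : C) : slit z -> 0 < Cmod z.
Proof.
  intros H. unfold slit in H. pose proof (Cmod_fst z). pose proof (Rle_abs (fst z)).
  destruct (Cmod_ge_0 z) as [H2|H2]; [exact H2|]. lra.
Qed.

Lemma slit_neq (z : C) : slit z -> z <> 0%C.
Proof. intros H. apply Cmod_neq_0, slit_mod, H. Qed.

Lemma Cexp_Clog (z : C) : slit z -> Cexp (Clog z) = z.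
Proof.
  intros H. pose proof (slit_mod z H) as Hm. unfold slit in H. pose proof (Cmod_sqr z) as E.
  unfold Cexp, Clog, Re, Im; simpl fst; simpl snd. rewrite exp_ln by assumption.
  set (m := Cmod z) in *. destruct z as [x y]; simpl in *. unfold Carg; simpl. fold m. set (u := y / (m + x)).
  assert (Hu : 1 + u ^ 2 = 2 * m / (m + x)).
  { unfold u. replace (1 + (y / (m + x)) ^ 2) with (((m + x) ^ 2 + y ^ 2) / (m + x) ^ 2) by (field; lra).
    replace ((m + x) ^ 2 + y ^ 2) with (2 * m * (m + x)) by nra. field. lra. } assert (Hp : 0 < 1 + u ^ 2) by nra.
  rewrite cos_2a, sin_2a, cos_atan, sin_atan. assert (Hs : sqrt (1 + u²) * sqrt (1 + u²) = 1 + u ^ 2).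
  { rewrite sqrt_sqrt; unfold Rsqr; nra. } assert (Hs0 : sqrt (1 + u²) <> 0).
  { intros E0. rewrite E0 in Hs. lra. } set (q := sqrt (1 + u²)) in *. apply C_eq; simpl.
  - replace (1 / q * (1 / q) - u / q * (u / q)) with ((1 - u ^ 2) / (q * q)) by (field; assumption).
    rewrite Hs, Hu. replace (1 - u ^ 2) with (2 - (1 + u ^ 2)) by ring. rewrite Hu. field. lra.
  - replace (2 * (u / q) * (1 / q)) with (2 * u / (q * q)) by (field; assumption).
    rewrite Hs, Hu. unfold u. field. lra.
Qed.

Lemma continuous_ccont (f : C -> C) (z : C) :
  continuous (T := C_UniformSpace) (U := R_UniformSpace) (fun z => fst (f z)) z ->
  continuous (T := C_UniformSpace) (U := R_UniformSpace) (fun z => snd (f z)) z -> ccont f z.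
Proof.
  intros H1 H2 e He. assert (He2 : 0 < e / 2) by lra.
  pose proof (proj1 (filterlim_locally _ _) H1 (mkposreal _ He2)) as L1.
  pose proof (proj1 (filterlim_locally _ _) H2 (mkposreal _ He2)) as L2. destruct (filter_and _ _ L1 L2) as [d Hd].
  exists d. split; [apply cond_pos|]. intros w Hw. destruct (Hd w) as [B1 B2].
  { split.
    - eapply Rle_lt_trans; [|exact Hw]. exact (Cmod_fst (w - z)%C).
    - eapply Rle_lt_trans; [|exact Hw]. exact (Cmod_snd (w - z)%C). } eapply Rle_lt_trans; [apply Cmod_le_abs|].
  change (Rabs (fst (f w) - fst (f z)) < e / 2) in B1. change (Rabs (snd (f w) - snd (f z)) < e / 2) in B2.
  simpl. unfold Rminus in *. lra.
Qed.

Lemma continuous_Cmod (z : C) : continuous (T := C_UniformSpace) (U := R_UniformSpace) Cmod z.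
Proof.
  apply filterlim_locally. intros e. assert (H : 0 < e / 2) by (pose proof (cond_pos e); lra).
  exists (mkposreal _ H). intros w [B1 B2].
  change (Rabs (fst w - fst z) < e / 2) in B1. change (Rabs (snd w - snd z) < e / 2) in B2.
  change (Rabs (Cmod w - Cmod z) < e). assert (Cmod (w - z) < e).
  { eapply Rle_lt_trans; [apply Cmod_le_abs|]. simpl. unfold Rminus in *. lra. }
  pose proof (Cmod_rev_triangle w z). pose proof (Cmod_rev_triangle z w) as H3.
  rewrite Cmod_minus_sym in H3. apply Rabs_lt_between'. lra.
Qed.

Lemma ccont_Clog (z : C) : slit z -> ccont Clog z.
Proof.
  intros H. pose proof (slit_mod z H) as Hm. apply continuous_ccont; unfold Clog; cbn [fst snd].
  - apply (continuous_comp (U := C_UniformSpace) Cmod ln); [apply continuous_Cmod|].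
    apply (ex_derive_continuous (V := RN)). exists (/ Cmod z). apply is_derive_Reals, derivable_pt_lim_ln, Hm.
  - unfold Carg.
    apply (continuous_comp (U := C_UniformSpace) (fun z : C => snd z / (Cmod z + fst z)) (fun u => 2 * atan u)).
    + apply (continuous_mult (U := C_UniformSpace) (K := R_AbsRing)).
      * apply continuous_snd.
      * apply (continuous_comp (U := C_UniformSpace) (fun z : C => Cmod z + fst z) Rinv).
        -- apply (continuous_plus (U := C_UniformSpace) (V := RN) Cmod fst); [apply continuous_Cmod|apply continuous_fst].
        -- apply continuous_Rinv. unfold slit in H. lra.
    + cont_derive.
Qed.

(** The inverse function argument: [u = Clog w - Clog z] is small by continuity, [w = z * Cexp u],
    and [Cexp u - 1 = u + O(u^2)]. *)
Lemma cder_Clog (z : C) : slit z -> cder Clog z (/ z).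
Proof.
  intros H e He. pose proof (slit_mod z H) as Hm. pose proof (slit_neq z H) as Hz. pose proof (ccont_Clog z H) as Hc.
  set (m := Cmod z) in *. assert (Hem : 0 < e * m) by (mul_pos; assumption).
  destruct (Hc (Rmin (/ 6) (e * m / 6))) as (r1 & Hr1 & H1); [apply Rmin_pos; lra|].
  exists (Rmin r1 (Cmod z + fst z)/2).
  assert (Hs : 0 < Rmin r1 (Cmod z + fst z)) by (apply Rmin_pos; [assumption|exact H]). split; [lra|]. intros w Hw.
  assert (Hw1 : Cmod (w - z) < r1) by (pose proof (Rmin_l r1 (Cmod z + fst z)); lra).
  assert (Hw2 : Cmod (w - z) < (Cmod z + fst z) / 2) by (pose proof (Rmin_r r1 (Cmod z + fst z)); lra).
  assert (Hsw : slit w).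
  { unfold slit. pose proof (Cmod_rev_triangle z w) as T. rewrite Cmod_minus_sym in T.
    pose proof (Cmod_fst (w - z)%C) as F. simpl in F. apply Rabs_le_between in F. lra. }
  specialize (H1 w Hw1). set (u := (Clog w - Clog z)%C) in *. destruct (Rmin_Rgt_l _ _ _ H1) as [U1 U2].
  assert (Ew : w = (z * Cexp u)%C).
  { unfold u. rewrite Cexp_minus, !Cexp_Clog by assumption. field. assumption. }
  pose proof (Cexp_bound2 u 1 ltac:(lra)) as B. rewrite Cmult_1_l in B. pose proof (Cmod_ge_0 u) as Hu0.
  assert (Hexp : exp (Cmod u) <= 3).
  { apply Rle_trans with (exp 1); [apply exp_le; lra|apply exp_le_3]. }
  assert (B' : Cmod (Cexp u - 1 - u) <= 3 * Cmod u ^ 2).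
  { step_le; [exact B|]. replace (3 * Cmod u ^ 2) with (Cmod u * (Cmod u * 3)) by ring.
    mono_l; [assumption|]. mono_l; assumption. } assert (L : m * (Cmod u / 2) <= Cmod (w - z)).
  { rewrite Ew. replace (z * Cexp u - z)%C with (z * (u - - (Cexp u - 1 - u)))%C by ring.
    rewrite Cmod_mult. fold m. mono_l; [lra|].
    pose proof (Cmod_rev_triangle u (- (Cexp u - 1 - u))%C) as T. rewrite Cmod_opp in T. nra. }
  replace (u - / z * (w - z))%C with (- (Cexp u - 1 - u))%C.
  2:{ rewrite Ew. field. assumption. } rewrite Cmod_opp. step_le; [exact B'|].
  apply Rle_trans with (e * (m * (Cmod u / 2))); [nra|]. mono_l; lra.
Qed.

(** The principal branch of [z ^ (- s)], with the sign convention of [ninv_pow]. *)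
Definition Cpw (z s : C) : C := Cexp (- s * Clog z).

Lemma cder_Cpw_base (z s : C) : slit z -> cder (fun z => Cpw z s) z (- s * Cpw z s / z)%C.
Proof.
  intros H. replace (- s * Cpw z s / z)%C with (Cpw z s * (0 * Clog z + - s * / z))%C by (unfold Cdiv; ring).
  apply (cder_comp (fun z => (- s * Clog z)%C) Cexp); [|apply cder_Cexp].
  apply (cder_mult (fun _ => (- s)%C) Clog); [apply cder_const|apply cder_Clog, H].
Qed.

Lemma hol_Cpw_base (s : C) (z : C) : slit z -> hol (fun z => Cpw z s) z.
Proof. intros H. eexists. apply cder_Cpw_base, H. Qed.

Lemma hol_Cpw_exp z s : hol (fun s => Cpw z s) s.
Proof. apply hol_Cexp_comp, hol_mult; [apply hol_opp, hol_id|apply hol_const]. Qed.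

Lemma Cpw_plus z s s' : Cpw z (s + s') = (Cpw z s * Cpw z s')%C.
Proof. unfold Cpw. rewrite <- Cexp_plus. f_equal. ring. Qed.

Lemma Cpw_m1 z : slit z -> Cpw z (- (1))%C = z.
Proof. intros H. unfold Cpw. replace (- - (1) * Clog z)%C with (Clog z) by ring. apply Cexp_Clog, H. Qed.

Lemma cder_Cpw_prim (z s : C) : slit z -> s <> 1%C -> cder (fun z => Cpw z (s - 1) / (1 - s))%C z (Cpw z s).
Proof.
  intros H Hs. assert (Hs' : (1 - s)%C <> 0%C).
  { intros E. apply Hs. replace s with (1 - (1 - s))%C by ring. rewrite E. ring. }
  replace (Cpw z s) with ((- (s - 1) * Cpw z (s - 1) / z) * / (1 - s) + Cpw z (s - 1) * 0)%C.
  - apply (cder_mult (fun z => Cpw z (s - 1)) (fun _ => / (1 - s))%C); [apply cder_Cpw_base, H|apply cder_const].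
  - replace (Cpw z (s - 1)) with (Cpw z s * z)%C.
    + field. split; [assumption|apply slit_neq, H].
    + unfold Cminus. rewrite Cpw_plus, Cpw_m1 by assumption. reflexivity.
Qed.

Lemma Cmod_Cpw z s : Cmod (Cpw z s) = exp (- fst s * ln (Cmod z) + snd s * Carg z).
Proof. unfold Cpw. rewrite Cmod_Cexp. f_equal. simpl. ring. Qed.

Lemma Clog_RtoC x : 0 < x -> Clog (RtoC x) = RtoC (ln x).
Proof.
  intros H. unfold Clog, Carg. rewrite Cmod_R, Rabs_pos_eq by lra. simpl.
  unfold Rdiv. rewrite Rmult_0_l, atan_0, Rmult_0_r. reflexivity.
Qed.

Lemma ninv_pow_Cpw n s : (1 <= n)%nat -> ninv_pow n s = Cpw (RtoC (INR n)) s.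
Proof.
  intros H. unfold ninv_pow, Cpw. rewrite Clog_RtoC; [reflexivity|]. apply lt_0_INR. lia.
Qed.

Lemma Carg_bound z : Rabs (Carg z) <= PI.
Proof.
  unfold Carg. destruct (atan_bound (snd z / (Cmod z + fst z))). apply Rabs_le. lra.
Qed.

Lemma atan_le_id x : 0 <= x -> atan x <= x.
Proof.
  intros [H|<-]; [|rewrite atan_0; lra]. assert (Hb : atan x < PI / 2) by apply atan_bound.
  assert (Hp : 0 < atan x) by (rewrite <- atan_0; apply atan_increasing, H). rewrite <- (tan_atan x) at 2.
  assert (D : forall c, 0 <= c <= atan x -> derivable_pt_lim (fun u => tan u - u) c (tan c ^ 2)).
  { intros c Hc. apply is_derive_Reals.
    assert (Hcos : cos c <> 0) by (apply Rgt_not_eq, cos_gt_0; pose proof PI_RGT_0; lra).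
    unfold tan. auto_derive; [assumption|]. field. assumption. }
  destruct (MVT_cor2 (fun u => tan u - u) (fun u => tan u ^ 2) 0 (atan x) Hp D) as (c & E & _).
  rewrite tan_0 in E. assert (0 <= tan c ^ 2) by apply pow2_ge_0. nra.
Qed.

(** In [zeta_growth] this keeps [t * Carg z] below [y] at [z = c + i y] when [t <= c]. *)
Lemma Carg_le z : 0 < fst z -> 0 <= snd z -> Carg z <= snd z / fst z.
Proof.
  intros Hx Hy. unfold Carg. assert (Hm : fst z <= Cmod z) by (step_le; [apply Rle_abs|apply Cmod_fst]).
  assert (H0 : 0 <= snd z / (Cmod z + fst z)).
  { apply Rmult_le_pos; [assumption|]. left. apply Rinv_0_lt_compat. lra. }
  apply Rle_trans with (2 * (snd z / (Cmod z + fst z))).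
  { pose proof (atan_le_id _ H0). lra. } apply Rle_trans with (2 * (snd z / (2 * fst z))); [|right; field; lra].
  mono_l; [lra|]. mono_l; [assumption|]. apply Rinv_le_contravar; lra.
Qed.

Lemma Carg_nonpos z : 0 < fst z -> snd z <= 0 -> Carg z <= 0.
Proof.
  intros Hx Hy. unfold Carg. pose proof (Cmod_ge_0 z). assert (snd z / (Cmod z + fst z) <= 0).
  { apply Ropp_le_cancel. rewrite Ropp_0. replace (- (snd z / (Cmod z + fst z))) with ((- snd z) / (Cmod z + fst z)) by (field; lra).
    apply Rmult_le_pos; [lra|]. left. apply Rinv_0_lt_compat. lra. }
  assert (atan (snd z / (Cmod z + fst z)) <= 0); [|lra].
  destruct H0 as [H0|H0]; [rewrite <- atan_0; left; apply atan_increasing, H0|rewrite H0, atan_0; lra].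
Qed.

(** * Improper integrals and their dependence on a parameter *)

Definition pcont (f : R -> C) : Prop := forall t, 0 < t -> rcont f t.

Lemma pcont_on f a b : pcont f -> 0 < a -> rc_on f a b.
Proof. intros H Ha t Ht. apply H. lra. Qed.

(** Integrals over the open half-line, with truncation at both ends. *)
Definition imp (f : R -> C) (l : C) : Prop := forall e, 0 < e -> exists a0 b0, 0 < a0 /\ a0 <= b0 /\
    forall a b, 0 < a <= a0 -> b0 <= b -> Cmod (CI f a b - l) <= e.

Lemma imp_unique f l l' : imp f l -> imp f l' -> l = l'.
Proof.
  intros H H'. enough (E : (l - l')%C = 0%C).
  { replace l with ((l - l') + l')%C by ring. rewrite E. ring. }
  apply Cmod_eq_0, Rle_antisym; [|apply Cmod_ge_0]. apply Rnot_lt_le. intros Hp.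
  destruct (H (Cmod (l - l') / 3)) as (a & b & Ha & Hab & K); [lra|].
  destruct (H' (Cmod (l - l') / 3)) as (a' & b' & Ha' & Hab' & K'); [lra|].
  specialize (K (Rmin a a') (Rmax b b')). specialize (K' (Rmin a a') (Rmax b b')).
  assert (0 < Rmin a a') by (apply Rmin_pos; assumption).
  specialize (K (conj H0 (Rmin_l _ _)) (Rmax_l _ _)). specialize (K' (conj H0 (Rmin_r _ _)) (Rmax_r _ _)).
  set (I := CI f (Rmin a a') (Rmax b b')) in *. assert (Cmod (l - l') <= Cmod (I - l') + Cmod (I - l)); [|lra].
  replace (l - l')%C with ((I - l') - (I - l))%C by ring. apply Cmod_triangle_minus.
Qed.

Definition Imp (f : R -> C) : C := epsilon (inhabits (RtoC 0)) (imp f).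

Lemma Imp_spec f l : imp f l -> imp f (Imp f).
Proof. intros H. unfold Imp. apply epsilon_spec. exists l. exact H. Qed.
Lemma Imp_eq f l : imp f l -> Imp f = l.
Proof. intros H. apply (imp_unique f); [eapply Imp_spec, H|exact H]. Qed.

Lemma imp_ext f g l : (forall t, 0 < t -> f t = g t) -> imp f l -> imp g l.
Proof.
  intros E H e He. destruct (H e He) as (a & b & Ha & Hab & K). exists a, b. repeat split; try assumption.
  intros a' b' Ha' Hb'. rewrite <- (CI_ext f g); [apply K; assumption|lra|]. intros; apply E; lra.
Qed.

Lemma imp_plus f g l l' : pcont f -> pcont g -> imp f l -> imp g l' -> imp (fun t => f t + g t)%C (l + l').
Proof.
  intros F G H H' e He. destruct (H (e / 2)) as (a & b & Ha & Hab & K); [lra|].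
  destruct (H' (e / 2)) as (a' & b' & Ha' & Hab' & K'); [lra|]. exists (Rmin a a'), (Rmax b b').
  pose proof (Rmin_l a a'). pose proof (Rmin_r a a'). pose proof (Rmax_l b b'). pose proof (Rmax_r b b').
  split; [apply Rmin_pos; assumption|]. split; [lra|]. intros x y Hx Hy.
  rewrite CI_plus; [|lra|apply pcont_on; [assumption|lra]|apply pcont_on; [assumption|lra]].
  replace (CI f x y + CI g x y - (l + l'))%C with ((CI f x y - l) + (CI g x y - l'))%C by ring.
  step_le; [apply Cmod_triangle|].
  specialize (K x y ltac:(lra) ltac:(lra)). specialize (K' x y ltac:(lra) ltac:(lra)). lra.
Qed.

Lemma imp_scal c f l : pcont f -> imp f l -> imp (fun t => c * f t)%C (c * l).
Proof.
  intros F H e He. pose proof (Cmod_ge_0 c) as Hc.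
  destruct (H (e / (1 + Cmod c))) as (a & b & Ha & Hab & K); [div_pos; lra|].
  exists a, b. repeat split; try assumption. intros x y Hx Hy.
  rewrite CI_scal; [|lra|apply pcont_on; [assumption|lra]].
  replace (c * CI f x y - c * l)%C with (c * (CI f x y - l))%C by ring. rewrite Cmod_mult.
  specialize (K x y Hx Hy). pose proof (Cmod_ge_0 (CI f x y - l)).
  apply Rle_trans with ((1 + Cmod c) * (e / (1 + Cmod c))); [nra|right; field; lra].
Qed.

Lemma pcont_scal c f : pcont f -> pcont (fun t => c * f t)%C.
Proof. intros F t Ht. apply rcont_mult; [apply rcont_const|apply F, Ht]. Qed.

Lemma imp_minus f g l l' : pcont f -> pcont g -> imp f l -> imp g l' -> imp (fun t => f t - g t)%C (l - l').
Proof.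
  intros F G H H'. apply (imp_ext (fun t => f t + (RtoC (-1)) * g t)%C); [intros; ceq; ring|].
  replace (l - l')%C with (l + RtoC (-1) * l')%C by (ceq; ring).
  apply imp_plus; try assumption; [apply pcont_scal, G|apply imp_scal; assumption].
Qed.

Lemma imp_le f l B : (forall a b, 0 < a <= b -> Cmod (CI f a b) <= B) -> imp f l -> Cmod l <= B.
Proof.
  intros H Hi. apply Rnot_lt_le. intros Hlt. destruct (Hi ((Cmod l - B) / 2)) as (a & b & Ha & Hab & K); [lra|].
  specialize (K a b ltac:(lra) ltac:(lra)). specialize (H a b ltac:(lra)).
  pose proof (Cmod_rev_triangle l (CI f a b)) as T. rewrite Cmod_minus_sym in T. lra.
Qed.

Lemma mono_limit (g : R -> R) B : (forall t, 0 < t -> continuous g t) -> (forall t, 0 < t -> 0 <= g t) ->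
  (forall a b, 0 < a <= b -> RInt g a b <= B) -> exists L, forall e, 0 < e -> exists a0 b0, 0 < a0 /\ a0 <= b0 /\
    forall a b, 0 < a <= a0 -> b0 <= b -> L - e <= RInt g a b <= L.
Proof.
  intros Hc Hp HB. destruct (completeness (fun r => exists a b, 0 < a <= b /\ r = RInt g a b)) as [L [HL1 HL2]].
  - exists B. intros r (a & b & Hab & ->). apply HB, Hab.
  - exists (RInt g 1 1), 1, 1. split; [lra|reflexivity].
  - exists L. intros e He.
    destruct (classic (exists a b, 0 < a <= b /\ L - e < RInt g a b)) as [(a & b & Hab & H)|Hn].
    + exists a, b. split; [lra|]. split; [lra|]. intros a' b' Ha' Hb'. split.
      * assert (Ex : forall u v, 0 < u <= v -> ex_RInt g u v).
        { intros u v Huv. apply ex_RInt_cont; [lra|]. intros; apply Hc; lra. }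
        rewrite <- (RInt_Chasles g a' a b'), <- (RInt_Chasles g a b b') by (apply Ex; lra).
        assert (0 <= RInt g a' a) by (apply RInt_ge_0; [lra|apply Ex; lra|intros; apply Hp; lra]).
        assert (0 <= RInt g b b') by (apply RInt_ge_0; [lra|apply Ex; lra|intros; apply Hp; lra]).
        unfold plus; simpl. lra.
      * apply HL1. exists a', b'. split; [lra|reflexivity].
    + exfalso. assert (L <= L - e); [|lra]. apply HL2. intros r (a & b & Hab & ->).
      apply Rnot_lt_le. intros Hlt. apply Hn. exists a, b. split; assumption.
Qed.

(** Dominated convergence by monotonicity: for a real or imaginary part [h] of [f], the function
    [h + g] is nonnegative, so [mono_limit] gives limits for [h + g] and for [g], hence for [h]. *)
Lemma imp_ex f (g : R -> R) B : pcont f -> (forall t, 0 < t -> continuous g t) ->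
  (forall t, 0 < t -> Cmod (f t) <= g t) -> (forall a b, 0 < a <= b -> RInt g a b <= B) ->
  exists l, imp f l /\ Cmod l <= B.
Proof.
  intros F Hg Hfg HB. assert (Hg0 : forall t, 0 < t -> 0 <= g t).
  { intros t Ht. step_le; [apply Cmod_ge_0|apply Hfg, Ht]. }
  assert (Ex : forall h : R -> R, (forall t, 0 < t -> continuous h t) -> forall u v, 0 < u <= v -> ex_RInt h u v).
  { intros h Hh u v Huv. apply ex_RInt_cont; [lra|]. intros; apply Hh; lra. }
  destruct (mono_limit g B Hg Hg0 HB) as (L0 & HL0).
  assert (Part : forall h : R -> R, (forall t, 0 < t -> continuous h t) -> (forall t, 0 < t -> Rabs (h t) <= g t) ->
     exists L, forall e, 0 < e -> exists a0 b0, 0 < a0 /\ a0 <= b0 /\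
       forall a b, 0 < a <= a0 -> b0 <= b -> Rabs (RInt h a b - L) <= e).
  { intros h Hh Hhg. destruct (mono_limit (fun t => h t + g t) (B + B)) as (L1 & HL1).
    - intros t Ht. apply (continuous_plus h g); auto.
    - intros t Ht. specialize (Hhg t Ht). apply Rabs_le_between in Hhg. lra.
    - intros a b Hab. rewrite (RInt_plus (V := RC)) by (apply Ex; auto). unfold plus; simpl. specialize (HB a b Hab).
      assert (RInt h a b <= RInt g a b); [|lra]. apply RInt_le; [lra|apply Ex; auto|apply Ex; auto|]. intros t Ht.
      step_le; [apply Rle_abs|apply Hhg; lra].
    - exists (L1 - L0). intros e He. destruct (HL0 (e / 2)) as (a & b & Ha & Hab & K); [lra|].
      destruct (HL1 (e / 2)) as (a' & b' & Ha' & Hab' & K'); [lra|]. exists (Rmin a a'), (Rmax b b').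
      pose proof (Rmin_l a a'). pose proof (Rmin_r a a'). pose proof (Rmax_l b b'). pose proof (Rmax_r b b').
      split; [apply Rmin_pos; assumption|]. split; [lra|]. intros x y Hx Hy.
      specialize (K x y ltac:(lra) ltac:(lra)). specialize (K' x y ltac:(lra) ltac:(lra)).
      rewrite (RInt_plus (V := RC)) in K' by (apply Ex; auto; lra).
      unfold plus in K'; simpl in K'. apply Rabs_le. lra. } destruct (Part (fun t => fst (f t))) as (L1 & HL1).
  { intros t Ht. apply (F t Ht). }
  { intros t Ht. step_le; [apply Cmod_fst|apply Hfg, Ht]. } destruct (Part (fun t => snd (f t))) as (L2 & HL2).
  { intros t Ht. apply (F t Ht). }
  { intros t Ht. step_le; [apply Cmod_snd|apply Hfg, Ht]. } assert (HI : imp f (L1, L2)).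
  { intros e He. destruct (HL1 (e / 2)) as (a & b & Ha & Hab & K); [lra|].
    destruct (HL2 (e / 2)) as (a' & b' & Ha' & Hab' & K'); [lra|]. exists (Rmin a a'), (Rmax b b').
    pose proof (Rmin_l a a'). pose proof (Rmin_r a a'). pose proof (Rmax_l b b'). pose proof (Rmax_r b b').
    split; [apply Rmin_pos; assumption|]. split; [lra|]. intros x y Hx Hy.
    specialize (K x y ltac:(lra) ltac:(lra)). specialize (K' x y ltac:(lra) ltac:(lra)).
    step_le; [apply Cmod_le_abs|]. unfold CI; simpl. unfold Rminus in *. lra. }
  exists (L1, L2). split; [exact HI|]. apply (imp_le f); [|exact HI]. intros a b Hab. step_le; [|apply HB, Hab].
  apply CI_bound_g; [lra|apply pcont_on; [assumption|lra]| |]; intros; [apply Hg|apply Hfg]; lra.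
Qed.

Lemma RInt_exp_le M c a b : 0 <= M -> 0 < c -> 0 < a <= b -> RInt (fun t => M * exp (- (c * t))) a b <= M / c.
Proof.
  intros HM Hc Hab.
  assert (E : is_RInt (fun t => M * exp (- (c * t))) a b (- (M / c) * exp (- (c * b)) - - (M / c) * exp (- (c * a)))).
  { apply (is_RInt_derive (V := RC) (fun t => - (M / c) * exp (- (c * t)))).
    - intros t _. auto_derive; [auto|]. field. lra.
    - intros t _. cont_derive. } rewrite (is_RInt_unique _ _ _ _ E). pose proof (exp_pos (- (c * b))).
  assert (exp (- (c * a)) <= 1) by (rewrite <- exp_0; apply exp_le; nra).
  assert (0 <= M / c) by (apply Rmult_le_pos; [assumption|left; apply Rinv_0_lt_compat, Hc]). nra.
Qed.

Lemma continuous_Mexp M c t : continuous (fun t => M * exp (- (c * t))) t.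
Proof. cont_derive. Qed.

Lemma imp_ex_exp f M c : pcont f -> 0 < c -> (forall t, 0 < t -> Cmod (f t) <= M * exp (- (c * t))) ->
  exists l, imp f l /\ Cmod l <= M / c.
Proof.
  intros F Hc H. apply (imp_ex f (fun t => M * exp (- (c * t)))); try assumption.
  - intros; apply continuous_Mexp.
  - intros; apply RInt_exp_le; try assumption.
    specialize (H 1 Rlt_0_1). pose proof (exp_pos (- (c * 1))). pose proof (Cmod_ge_0 (f 1)). nra.
Qed.

Lemma Imp_bound f M c : pcont f -> 0 < c -> (forall t, 0 < t -> Cmod (f t) <= M * exp (- (c * t))) ->
  imp f (Imp f) /\ Cmod (Imp f) <= M / c.
Proof.
  intros F Hc H. destruct (imp_ex_exp f M c F Hc H) as (l & Hl & Hb). rewrite (Imp_eq f l Hl). split; assumption.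
Qed.

Lemma sqr_exp_le x r : 0 < r -> 0 <= x -> x * x <= 4 / (r * r) * exp (r * x).
Proof.
  intros Hr Hx.  assert (K : (r * x) * (r * x) / 4 <= exp (r * x)).
  { assert (0 <= r * x) by nra. set (u := r * x) in *. clearbody u.
    pose proof (exp_ineq1_le (u / 2)). replace u with (u / 2 + u / 2) at 3 by field. rewrite exp_plus. nra. }
  apply Rmult_le_reg_l with (r * r / 4); [nra|].
  replace (r * r / 4 * (4 / (r * r) * exp (r * x))) with (exp (r * x)) by (field; lra). lra.
Qed.

(** Differentiation under the integral sign. In the second-order remainder one factor
    [exp (r * Cmod (L t))] of the domination pays for moving [s] within radius [r], a second one for
    [Cmod (L t) ^ 2]. *)
Lemma imp_param (A L : R -> C) (s0 : C) r M c : pcont A -> pcont L -> 0 < r -> 0 < c ->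
  (forall t, 0 < t -> Cmod (A t) * Cmod (Cexp (- s0 * L t)) * exp (2 * r * Cmod (L t)) <= M * exp (- (c * t))) ->
  (forall s, Cmod (s - s0) < r -> imp (fun t => A t * Cexp (- s * L t))%C (Imp (fun t => A t * Cexp (- s * L t))%C)) /\
  hol (fun s => Imp (fun t => A t * Cexp (- s * L t))%C) s0.
Proof.
  intros HA HL Hr Hc Hdom. assert (PC : forall s, pcont (fun t => A t * Cexp (- s * L t))%C).
  { intros s t Ht. apply rcont_mult; [apply HA, Ht|].
    apply (hol_rcont Cexp (fun t => - s * L t)%C); [apply hol_Cexp|].
    apply rcont_mult; [apply rcont_const|apply HL, Ht]. }
  assert (Ex : forall s, Cmod (s - s0) < r -> imp (fun t => A t * Cexp (- s * L t))%C (Imp (fun t => A t * Cexp (- s * L t))%C)).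
  { intros s Hs. apply (Imp_bound _ M c); [apply PC|assumption|]. intros t Ht. step_le; [|apply Hdom, Ht].
    replace (- s * L t)%C with (- s0 * L t + - (s - s0) * L t)%C by ring.
    rewrite Cexp_plus, !Cmod_mult, <- Rmult_assoc. mono_l.
    - apply Rmult_le_pos; apply Cmod_ge_0.
    - step_le; [apply Cmod_Cexp_le|]. apply exp_le. rewrite Cmod_mult, Cmod_opp. pose proof (Cmod_ge_0 (L t)). nra. }
  split; [exact Ex|]. set (F := fun s => Imp (fun t => A t * Cexp (- s * L t))%C) in *.
  set (D := fun t => (A t * Cexp (- s0 * L t) * - L t)%C). assert (PD : pcont D).
  { intros t Ht. apply rcont_mult; [apply PC, Ht|apply rcont_opp, HL, Ht]. }
  destruct (imp_ex_exp D (M / r) c PD Hc) as (d & Hd & _).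
  { intros t Ht. unfold D. rewrite !Cmod_mult, Cmod_opp.
    pose proof (Cmod_ge_0 (A t)). pose proof (Cmod_ge_0 (Cexp (- s0 * L t))). pose proof (Cmod_ge_0 (L t)).
    specialize (Hdom t Ht). pose proof (exp_ineq1_le (2 * r * Cmod (L t))) as He.
    replace (M / r * exp (- (c * t))) with ((M * exp (- (c * t))) / r) by (field; lra).
    apply Rmult_le_reg_r with r; [assumption|]. unfold Rdiv. rewrite (Rmult_assoc _ (/ r)), Rinv_l, Rmult_1_r by lra.
    step_le; [|exact Hdom]. rewrite Rmult_assoc. mono_l; [apply Rmult_le_pos; assumption|]. nra. }
  exists d. intros e He. set (B := 4 * M / (r * r) / c). assert (HM : 0 <= M).
  { specialize (Hdom 1 Rlt_0_1). pose proof (exp_pos (- (c * 1))).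
    assert (0 <= Cmod (A 1) * Cmod (Cexp (- s0 * L 1)) * exp (2 * r * Cmod (L 1))).
    { repeat apply Rmult_le_pos; try apply Cmod_ge_0. left; apply exp_pos. } nra. } assert (HB : 0 <= B).
  { unfold B. apply Rmult_le_pos; [apply Rmult_le_pos; [lra|]|]; left; apply Rinv_0_lt_compat; nra. }
  exists (Rmin r (e / (1 + B))). split; [apply Rmin_pos; [assumption|div_pos; lra]|]. intros s Hs.
  destruct (Rmin_Rgt_l _ _ _ Hs) as [Hs1 Hs2]. set (h := (s - s0)%C) in *.
  assert (H0 : Cmod (s0 - s0) < r) by (replace (s0 - s0)%C with (RtoC 0) by ring; rewrite Cmod_0; assumption).
  assert (HI : imp (fun t => (A t * Cexp (- s * L t) - A t * Cexp (- s0 * L t)) - h * D t)%C (F s - F s0 - h * d)%C).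
  { apply imp_minus.
    - intros t Ht. apply rcont_minus; apply PC, Ht.
    - apply pcont_scal, PD.
    - apply imp_minus; [apply PC|apply PC|apply Ex, Hs1|apply Ex, H0].
    - apply imp_scal; assumption. } replace (d * h)%C with (h * d)%C by ring. pose proof (Cmod_ge_0 h) as Hh.
  apply Rle_trans with (Cmod h ^ 2 * B).
  2:{ assert (Cmod h * (1 + B) <= e).
      { apply Rle_trans with (e / (1 + B) * (1 + B)); [mono_r; lra|right; field; lra]. } nra. }
  assert (PI' : pcont (fun t => (A t * Cexp (- s * L t) - A t * Cexp (- s0 * L t)) - h * D t)%C).
  { intros t Ht. apply rcont_minus; [apply rcont_minus; apply PC, Ht|apply pcont_scal; assumption]. }
  destruct (imp_ex_exp _ (Cmod h ^ 2 * (4 * M / (r * r))) c PI' Hc) as (l & Hl & Hlb).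
  2:{ rewrite (imp_unique _ _ _ HI Hl). step_le; [exact Hlb|]. right. unfold B. field. lra. } intros t Ht. unfold D.
  replace (- s * L t)%C with (- s0 * L t + 1 * (- h * L t))%C by (unfold h; ring). rewrite Cexp_plus.
  replace (A t * (Cexp (- s0 * L t) * Cexp (1 * (- h * L t))) - A t * Cexp (- s0 * L t) -
      h * (A t * Cexp (- s0 * L t) * - L t))%C
    with (A t * Cexp (- s0 * L t) * (Cexp (1 * (- h * L t)) - 1 - 1 * (- h * L t)))%C by ring. rewrite !Cmod_mult.
  pose proof (Cexp_bound2 (- h * L t)%C 1 ltac:(lra)) as Bd. rewrite !Cmod_mult, Cmod_opp in Bd.
  pose proof (Cmod_ge_0 (A t)). pose proof (Cmod_ge_0 (Cexp (- s0 * L t))). pose proof (Cmod_ge_0 (L t)) as HLt.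
  specialize (Hdom t Ht). set (x := Cmod (L t)) in *. set (P := Cmod (A t) * Cmod (Cexp (- s0 * L t))) in *.
  assert (HP : 0 <= P) by (apply Rmult_le_pos; assumption).
  apply Rle_trans with (P * (Cmod h ^ 2 * (4 / (r * r)) * exp (2 * r * x))).
  - mono_l; [assumption|]. step_le; [exact Bd|].
    replace (Cmod h * x * (Cmod h * x * exp (Cmod h * x))) with (Cmod h ^ 2 * ((x * x) * exp (Cmod h * x))) by ring.
    rewrite (Rmult_assoc (Cmod h ^ 2)). mono_l; [apply pow2_ge_0|].
    replace (2 * r * x) with (r * x + r * x) by ring. rewrite exp_plus, <- Rmult_assoc.
    apply Rmult_le_compat; [nra|left; apply exp_pos|apply sqr_exp_le; assumption|]. apply exp_le. nra.
  - replace (P * (Cmod h ^ 2 * (4 / (r * r)) * exp (2 * r * x)))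
      with ((Cmod h ^ 2 * (4 / (r * r))) * (P * exp (2 * r * x))) by ring.
    replace (Cmod h ^ 2 * (4 * M / (r * r)) * exp (- (c * t)))
      with ((Cmod h ^ 2 * (4 / (r * r))) * (M * exp (- (c * t)))) by (field; lra). mono_l; [|exact Hdom].
    apply Rmult_le_pos; [apply pow2_ge_0|]. left. div_pos; nra.
Qed.

(** * The Abel-Plana formula and the continuation of zeta *)

Lemma is_series_Cmod_lim (u : nat -> C) (l : C) : @is_series C_AbsRing C_NormedModule u l ->
  forall e, 0 < e -> exists N, forall n, (N <= n)%nat -> Cmod (@sum_n C_AbelianMonoid u n - l)%C < e.
Proof.
  intros H e He.
  pose proof (proj1 (filterlim_locally_ball_norm (K := C_AbsRing) (U := C_NormedModule) _ _) H (mkposreal e He)) as [N HN].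
  exists N. intros n Hn. specialize (HN n Hn). exact HN.
Qed.

Lemma sum_n_S (u : nat -> C) n : @sum_n C_AbelianMonoid u (S n) = (@sum_n C_AbelianMonoid u n + u (S n))%C.
Proof. apply (sum_Sn (G := C_AbelianMonoid)). Qed.

Lemma pow_n_C (x : C) k : @pow_n C_Ring x k = Cpow x k.
Proof. induction k as [|k IH]; [reflexivity|]. simpl. rewrite IH. reflexivity. Qed.

Lemma is_pseries_C (c : nat -> C) (x l : C) : @is_pseries C_AbsRing C_NormedModule c x l ->
  @is_series C_AbsRing C_NormedModule (fun k => (Cpow x k * c k)%C) l.
Proof.
  intros H. eapply (is_series_ext (K := C_AbsRing) (V := C_NormedModule)); [|exact H].
  intros k. cbv beta. rewrite <- pow_n_C. reflexivity.
Qed.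

(** Convergence at distance [q] bounds [Cmod (c k) * q ^ k], and within [q / 2] the tail is
    dominated by a geometric series. This order suffices for the derivative of [f] and for that of
    its quotient by a linear factor. *)
Lemma pseries_third_order (c : nat -> C) (f : C -> C) (s0 : C) r : 0 < r ->
  (forall s : C, Cmod (s - s0) < r -> @is_pseries C_AbsRing C_NormedModule c (s - s0)%C (f s)) ->
  exists K r', 0 <= K /\ 0 < r' /\ forall s, Cmod (s - s0) < r' ->
    Cmod (f s - c 0%nat - c 1%nat * (s - s0) - c 2%nat * (s - s0) * (s - s0)) <= K * Cmod (s - s0) ^ 3.
Proof.
  intros Hr H. set (q := r / 2). assert (Hq : 0 < q) by (unfold q; lra).
  assert (HB : exists M, 0 <= M /\ forall k, Cmod (c k) * q ^ k <= M).
  { specialize (H (s0 + RtoC q)%C). replace (s0 + RtoC q - s0)%C with (RtoC q) in H by ring.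
    rewrite Cmod_R, Rabs_pos_eq in H by lra. specialize (H ltac:(unfold q; lra)). apply is_pseries_C in H.
    destruct (is_series_Cmod_lim _ _ H 1 Rlt_0_1) as [N HN]. set (u := fun k => (Cpow (RtoC q) k * c k)%C) in *.
    assert (Eu : forall k, Cmod (u k) = Cmod (c k) * q ^ k).
    { intros k. unfold u. rewrite Cmod_mult, Cmod_pow, Cmod_R, Rabs_pos_eq by lra. ring. }
    assert (Hfin : forall n, exists M, 0 <= M /\ forall k, (k <= n)%nat -> Cmod (u k) <= M).
    { induction n as [|n [M [HM0 HM]]].
      - exists (Cmod (u O)). split; [apply Cmod_ge_0|]. intros k Hk. replace k with O by lia. lra.
      - exists (M + Cmod (u (S n))). pose proof (Cmod_ge_0 (u (S n))). split; [lra|]. intros k Hk.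
        destruct (Nat.eq_dec k (S n)) as [->|]; [lra|]. specialize (HM k ltac:(lia)). lra. }
    destruct (Hfin N) as [M [HM0 HM]]. exists (M + 2). split; [lra|]. intros k. rewrite <- Eu.
    destruct (Nat.le_gt_cases k N) as [Hk|Hk]; [specialize (HM k Hk); lra|]. destruct k as [|k]; [lia|].
    pose proof (HN (S k) ltac:(lia)) as A1. pose proof (HN k ltac:(lia)) as A2. rewrite sum_n_S in A1.
    set (P := @sum_n C_AbelianMonoid u k) in *. set (l := f _) in *.
    replace (u (S k)) with ((P + u (S k) - l) - (P - l))%C by ring. step_le; [apply Cmod_triangle_minus|]. lra. }
  destruct HB as (M & HM0 & HM). exists (2 * M / q ^ 3), (q / 2). assert (Hq3 : 0 < q ^ 3) by (apply pow_lt; lra).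
  split; [apply Rmult_le_pos; [lra|left; apply Rinv_0_lt_compat, Hq3]|]. split; [lra|].
  intros s Hs. specialize (H s ltac:(unfold q in *; lra)). apply is_pseries_C in H.
  set (h := (s - s0)%C) in *. set (u := fun k => (Cpow h k * c k)%C) in *.
  assert (Eu : forall k, u k = (Cpow h k * c k)%C) by reflexivity.
  set (x := Cmod h) in *. assert (Hx : 0 <= x) by apply Cmod_ge_0. set (y := x / q). assert (Hy : 0 <= y <= / 2).
  { unfold y. split; [apply Rmult_le_pos; [assumption|left; apply Rinv_0_lt_compat, Hq]|].
    apply Rmult_le_reg_r with q; [assumption|]. unfold Rdiv. rewrite Rmult_assoc, Rinv_l by lra. lra. }
  assert (Ek : forall k, Cmod (u k) <= M * y ^ k).
  { intros k. rewrite Eu, Cmod_mult, Cmod_pow. fold x.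
    replace x with (y * q) by (unfold y; field; lra). rewrite Rpow_mult_distr.
    assert (0 <= y ^ k) by (apply pow_le; lra). specialize (HM k). nra. }
  (* The subtracted term makes the geometric bound inductive; each step uses [y <= / 2]. *)
  assert (Part : forall n, Cmod (@sum_n C_AbelianMonoid u (S (S n)) - (u 0%nat + u 1%nat + u 2%nat)) <= 2 * M * y ^ 3 - 2 * M * y ^ (3 + n)).
  { induction n as [|n IH].
    - rewrite !sum_n_S. unfold sum_n. rewrite sum_n_n.
      replace (u 0%nat + u 1%nat + u 2%nat - (u 0%nat + u 1%nat + u 2%nat))%C with (RtoC 0) by ring.
      rewrite Cmod_0. simpl (3 + 0)%nat. lra.
    - rewrite sum_n_S. specialize (Ek (S (S (S n)))). 
      match goal with |- Cmod (?a + ?b - ?c) <= _ => replace (a + b - c)%C with ((a - c) + b)%C by ring end.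
      step_le; [apply Cmod_triangle|]. replace (3 + S n)%nat with (S (3 + n)) by lia. simpl (3 + n)%nat in *.
      change (y ^ S (S (S (S n)))) with (y * y ^ S (S (S n))).
      assert (HY : 0 <= y ^ S (S (S n))) by (apply pow_le; lra). set (Y := y ^ S (S (S n))) in *.
      assert (0 <= M * Y * (1 - 2 * y)) by (apply Rmult_le_pos; [apply Rmult_le_pos; assumption|lra]). lra. }
  assert (Hlim : Cmod (f s - (u 0%nat + u 1%nat + u 2%nat)) <= 2 * M * y ^ 3).
  { apply Rnot_lt_le. intros Hlt. set (g := Cmod (f s - (u 0%nat + u 1%nat + u 2%nat)) - 2 * M * y ^ 3) in *.
    destruct (is_series_Cmod_lim _ _ H g ltac:(unfold g; lra)) as [N HN].
    specialize (HN (S (S N)) ltac:(lia)). specialize (Part N).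
    assert (0 <= 2 * M * y ^ (3 + N)) by (apply Rmult_le_pos; [lra|apply pow_le; lra]).
    set (P := @sum_n C_AbelianMonoid u (S (S N))) in *.
    assert (Cmod (f s - (u 0%nat + u 1%nat + u 2%nat)) <= Cmod (P - (u 0%nat + u 1%nat + u 2%nat)) + Cmod (P - f s)).
    { replace (f s - (u 0%nat + u 1%nat + u 2%nat))%C with ((P - (u 0%nat + u 1%nat + u 2%nat)) - (P - f s))%C by ring.
      apply Cmod_triangle_minus. } unfold g in HN. lra. } rewrite !Eu in Hlim. simpl Cpow in Hlim.
  replace (f s - c 0%nat - c 1%nat * h - c 2%nat * h * h)%C
    with (f s - (1 * c 0%nat + h * 1 * c 1%nat + h * (h * 1) * c 2%nat))%C by ring.
  step_le; [exact Hlim|]. right. unfold y. field. lra.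
Qed.

Lemma analytic_expansion (f : C -> C) (s0 : C) : analytic_at f s0 ->
  exists c1 c2 K r, 0 <= K /\ 0 < r /\ forall s, Cmod (s - s0) < r ->
    Cmod (f s - f s0 - c1 * (s - s0) - c2 * (s - s0) * (s - s0)) <= K * Cmod (s - s0) ^ 3.
Proof.
  intros (r & c & Hr & H). destruct (pseries_third_order c f s0 r Hr H) as (K & r' & HK & Hr' & H').
  assert (E : f s0 = c 0%nat).
  { specialize (H' s0). replace (s0 - s0)%C with (RtoC 0) in H' by ring. rewrite Cmod_0 in H'.
    specialize (H' Hr'). replace (K * 0 ^ 3) with 0 in H' by (simpl; ring).
    replace (f s0 - c 0%nat - c 1%nat * 0 - c 2%nat * 0 * 0)%C with (f s0 - c 0%nat)%C in H' by ring.
    assert (E0 : (f s0 - c 0%nat)%C = 0%C) by (apply Cmod_eq_0, Rle_antisym; [exact H'|apply Cmod_ge_0]).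
    replace (f s0) with ((f s0 - c 0%nat) + c 0%nat)%C by ring. rewrite E0. ring. }
  exists (c 1%nat), (c 2%nat), K, r'. rewrite E. auto.
Qed.

Lemma cder_of_quadratic (f : C -> C) z d K r : 0 < r -> 0 <= K ->
  (forall w, Cmod (w - z) < r -> Cmod (f w - f z - d * (w - z)) <= K * Cmod (w - z) ^ 2) -> cder f z d.
Proof.
  intros Hr HK H e He. exists (Rmin r (e / (1 + K))). split; [apply Rmin_pos; [assumption|div_pos; lra]|].
  intros w Hw. destruct (Rmin_Rgt_l _ _ _ Hw) as [H1 H2].
  step_le; [apply H, H1|]. pose proof (Cmod_ge_0 (w - z)) as Hp. assert ((1 + K) * Cmod (w - z) <= e).
  { apply Rle_trans with ((1 + K) * (e / (1 + K))); [mono_l; lra|right; field; lra]. } nra.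
Qed.

Lemma analytic_hol f s0 : analytic_at f s0 -> hol f s0.
Proof.
  intros H. destruct (analytic_expansion f s0 H) as (c1 & c2 & K & r & HK & Hr & Hw).
  exists c1. pose proof (Cmod_ge_0 c2) as Hc2.
  apply (cder_of_quadratic f s0 c1 (K + Cmod c2) (Rmin 1 r)); [apply Rmin_pos; lra|lra|]. intros w Hd.
  destruct (Rmin_Rgt_l _ _ _ Hd) as [H1 H2]. specialize (Hw w H2). set (h := (w - s0)%C) in *.
  replace (f w - f s0 - c1 * h)%C with ((f w - f s0 - c1 * h - c2 * h * h) + c2 * h * h)%C by ring.
  step_le; [apply Cmod_triangle|]. rewrite !Cmod_mult. pose proof (Cmod_ge_0 h) as Hh.
  assert (Cmod h ^ 3 <= Cmod h ^ 2) by (simpl; nra).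
  assert (K * Cmod h ^ 3 <= K * Cmod h ^ 2) by (mono_l; assumption). nra.
Qed.

(** The value [c1] at [p] is meant to be the derivative of [f] there; with [f p = 0] this makes the
    quotient holomorphic. *)
Definition Cquot (f : C -> C) (p c1 s : C) : C := if Req_EM_T (Cmod (s - p)) 0 then c1 else (f s / (s - p))%C.

Lemma Cmod_sub_0 (s p : C) : Cmod (s - p) = 0 -> s = p.
Proof. intros H. apply Cmod_eq_0 in H. replace s with ((s - p) + p)%C by ring. rewrite H. ring. Qed.

Lemma Cquot_off f p c1 s : s <> p -> Cquot f p c1 s = (f s / (s - p))%C.
Proof. intros H. unfold Cquot. destruct Req_EM_T as [E|E]; [|reflexivity]. exfalso. apply H, Cmod_sub_0, E. Qed.
Lemma Cquot_at f p c1 : Cquot f p c1 p = c1.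
Proof. unfold Cquot. destruct Req_EM_T as [E|E]; [reflexivity|]. exfalso. apply E. replace (p - p)%C with (RtoC 0) by ring. apply Cmod_0. Qed.

Lemma expansion_divide (f : C -> C) (p c1 c2 : C) K r : 0 <= K -> 0 < r -> f p = 0%C -> (forall s, Cmod (s - p) < r ->
    Cmod (f s - f p - c1 * (s - p) - c2 * (s - p) * (s - p)) <= K * Cmod (s - p) ^ 3) -> hol (Cquot f p c1) p.
Proof.
  intros HK Hr H0 H. exists c2. apply (cder_of_quadratic _ _ _ K r Hr HK).
  intros w Hw. rewrite Cquot_at. specialize (H w Hw). rewrite H0 in H. pose proof (Cmod_ge_0 (w - p)) as Hp.
  destruct (Req_dec (Cmod (w - p)) 0) as [E|E].
  - apply Cmod_sub_0 in E. subst w. rewrite Cquot_at.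
    replace (c1 - c1 - c2 * (p - p))%C with (RtoC 0) by ring. rewrite Cmod_0.
    apply Rmult_le_pos; [assumption|apply pow2_ge_0].
  - assert (Hn : (w - p)%C <> 0%C) by (intros E1; apply E; rewrite E1; apply Cmod_0).
    rewrite Cquot_off by (intros ->; apply Hn; ring).
    apply Rmult_le_reg_r with (Cmod (w - p)); [lra|]. rewrite <- Cmod_mult.
    replace ((f w / (w - p) - c1 - c2 * (w - p)) * (w - p))%C
      with (f w - 0 - c1 * (w - p) - c2 * (w - p) * (w - p))%C by (field; assumption).
    step_le; [exact H|]. right. ring.
Qed.

Lemma hol_Cquot_off f p c1 s : s <> p -> hol f s -> hol (Cquot f p c1) s.
Proof.
  intros Hs Hf. assert (Hn : (s - p)%C <> 0%C).
  { intros E. apply Hs. replace s with ((s - p) + p)%C by ring. rewrite E. ring. }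
  apply (hol_local (fun s => f s / (s - p))%C _ s (Cmod (s - p))).
  - apply Cmod_pos_neq, Hn.
  - intros w Hw. symmetry. apply Cquot_off. intros ->. rewrite Cmod_minus_sym in Hw. lra.
  - apply hol_div; [assumption|apply hol_minus_const|exact Hn].
Qed.

(** Lets [exp x] absorb every power of [x] up to a constant. For [x > 1] the bound is
    [ln y <= y - 1] at [y = x / (K + 1)]. *)
Lemma ln_growth K x0 : 0 < x0 -> 0 <= K -> exists B, 0 <= B /\ forall x, x0 <= x -> K * Rabs (ln x) <= B + x.
Proof.
  intros Hx0 HK. exists (K * Rabs (ln x0) + (K + 1) * Rabs (ln (K + 1))).
  assert (P1 : 0 <= K * Rabs (ln x0)) by (apply Rmult_le_pos; [assumption|apply Rabs_pos]).
  assert (P2 : 0 <= (K + 1) * Rabs (ln (K + 1))) by (apply Rmult_le_pos; [lra|apply Rabs_pos]).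
  split; [lra|]. intros x Hx. destruct (Rle_lt_dec x 1) as [H1|H1].
  - assert (ln x0 <= ln x) by (destruct Hx as [H|H]; [left; apply ln_increasing; lra|right; congruence]).
    assert (ln x <= 0) by (rewrite <- ln_1; destruct H1 as [H1|H1]; [left; apply ln_increasing; lra|right; congruence]).
    rewrite (Rabs_left1 (ln x)) by assumption. rewrite (Rabs_left1 (ln x0)) in * by lra.
    assert (K * - ln x <= K * - ln x0) by (mono_l; lra). lra.
  - assert (Hl : 0 < ln x) by (rewrite <- ln_1; apply ln_increasing; lra). rewrite (Rabs_pos_eq (ln x)) by lra.
    assert (E : ln x = ln (x / (K + 1)) + ln (K + 1)).
    { rewrite <- ln_mult; [f_equal; field; lra| |lra]. div_pos; lra. }
    assert (B1 : ln (x / (K + 1)) <= x / (K + 1) - 1).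
    { pose proof (exp_ineq1_le (ln (x / (K + 1)))) as Eper. rewrite exp_ln in Eper; [lra|]. div_pos; lra. }
    pose proof (Rle_abs (ln (K + 1))). apply Rle_trans with ((K + 1) * ln x); [nra|].
    apply Rle_trans with ((K + 1) * (x / (K + 1) - 1 + Rabs (ln (K + 1)))).
    + mono_l; lra.
    + replace ((K + 1) * (x / (K + 1) - 1 + Rabs (ln (K + 1)))) with (x - (K + 1) + (K + 1) * Rabs (ln (K + 1))) by (field; lra).
      lra.
Qed.

(** * The periodic kernel and its residues *)

Definition twopii : C := (0, 2 * PI).
Definition Eper (z : C) : C := Cexp (twopii * z).

Lemma hol_Eper z : hol Eper z.
Proof. apply hol_Cexp_comp, hol_mult; [apply hol_const|apply hol_id]. Qed.

Lemma Cmod_Eper z : Cmod (Eper z) = exp (- (2 * PI * snd z)).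
Proof. unfold Eper, twopii. rewrite Cmod_Cexp. f_equal. simpl. ring. Qed.

Lemma Eper_shift (n : nat) z : Eper (z + RtoC (INR n)) = Eper z.
Proof.
  unfold Eper. rewrite Cmult_plus_distr_l, Cexp_plus. replace (Cexp (twopii * RtoC (INR n))) with (RtoC 1); [ring|].
  unfold Cexp, twopii; ceq.
  - replace (0 * INR n - 2 * PI * 0) with 0 by ring. rewrite exp_0.
    replace (0 * 0 + 2 * PI * INR n) with (0 + 2 * INR n * PI) by ring. rewrite cos_period, cos_0. ring.
  - replace (0 * INR n - 2 * PI * 0) with 0 by ring. rewrite exp_0.
    replace (0 * 0 + 2 * PI * INR n) with (0 + 2 * INR n * PI) by ring. rewrite sin_period, sin_0. ring.
Qed.

Lemma Eper_real (x : R) y : Eper (x, y) = (RtoC (exp (- (2 * PI * y))) * (cos (2 * PI * x), sin (2 * PI * x))%R)%C.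
Proof.
  unfold Eper, Cexp, twopii, Re, Im. simpl. replace (0 * x - 2 * PI * y) with (- (2 * PI * y)) by ring.
  replace (0 * y + 2 * PI * x) with (2 * PI * x) by ring. ceq; ring.
Qed.

Lemma Eper_half (n : nat) y : Eper (INR n + / 2, y) = RtoC (- exp (- (2 * PI * y))).
Proof.
  replace (INR n + / 2, y) with ((/ 2, y)%R + RtoC (INR n))%C by (ceq; ring).
  rewrite Eper_shift, Eper_real. replace (2 * PI * / 2) with PI by field. rewrite cos_PI, sin_PI. ceq; ring.
Qed.

Lemma Eper_int0 y : Eper (0, y) = RtoC (exp (- (2 * PI * y))).
Proof. rewrite Eper_real. replace (2 * PI * 0) with 0 by ring. rewrite cos_0, sin_0. ceq; ring. Qed.

Lemma Eper_neq_1 (n : nat) (z : C) : Rabs (fst z - INR n) <= / 2 -> z <> RtoC (INR n) -> (Eper z - 1)%C <> 0%C.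
Proof.
  intros Hd Hz E. apply Hz. assert (E0 : Eper (z - RtoC (INR n)) = 1%C).
  { replace (RtoC 1) with ((Eper z - 1) + 1)%C by (rewrite E; ring). rewrite <- (Eper_shift n (z - INR n)).
    replace (z - INR n + INR n)%C with z by ring. ring. } assert (Es : snd z = 0).
  { assert (Em := f_equal Cmod E0). rewrite Cmod_Eper, Cmod_1 in Em. simpl in Em.
    rewrite <- exp_0 in Em. apply exp_inv in Em. pose proof PI_RGT_0. nra. } destruct z as [x y]; simpl in *. subst y.
  replace ((x, 0)%R - RtoC (INR n))%C with ((x - INR n)%R, 0%R) in E0 by (ceq; ring).
  rewrite Eper_real in E0. replace (- (2 * PI * 0)) with 0 in E0 by ring. rewrite exp_0 in E0.
  assert (Ec := f_equal fst E0). simpl in Ec. set (d := x - INR n) in *.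
  replace (2 * PI * d) with (2 * (PI * d)) in Ec by ring. rewrite cos_2a_sin in Ec.
  assert (Hsin : sin (PI * d) = 0) by nra. pose proof PI_RGT_0 as HPI. apply Rabs_le_between in Hd. assert (d = 0).
  { destruct (Rtotal_order d 0) as [H|[H|H]]; [|assumption|].
    - assert (0 < sin (PI * - d)) by (apply sin_gt_0; nra).
      replace (PI * - d) with (- (PI * d)) in H0 by ring. rewrite sin_neg in H0. lra.
    - assert (0 < sin (PI * d)) by (apply sin_gt_0; nra). lra. } unfold d in *. ceq; lra.
Qed.

Lemma exp_quotient_limit (e : R) : 0 < e -> exists r, 0 < r /\ forall u : C, 0 < Cmod u < r ->
  Cmod (u / (Cexp u - 1) - 1) <= e /\ (Cexp u - 1)%C <> 0%C /\ Cmod u / 2 <= Cmod (Cexp u - 1).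
Proof.
  intros He. exists (Rmin (/ 6) (e / 6)). split; [apply Rmin_pos; lra|]. intros u [U0 U].
  destruct (Rmin_Rgt_l _ _ _ U) as [U1 U2]. pose proof (Cexp_bound2 u 1 ltac:(lra)) as B. rewrite Cmult_1_l in B.
  assert (Hexp : exp (Cmod u) <= 3) by (apply Rle_trans with (exp 1); [apply exp_le; lra|apply exp_le_3]).
  assert (B' : Cmod (Cexp u - 1 - u) <= 3 * Cmod u ^ 2).
  { step_le; [exact B|]. replace (3 * Cmod u ^ 2) with (Cmod u * (Cmod u * 3)) by ring. mono_l; [lra|]. mono_l; lra. }
  assert (L : Cmod u / 2 <= Cmod (Cexp u - 1)).
  { replace (Cexp u - 1)%C with (u - - (Cexp u - 1 - u))%C by ring.
    pose proof (Cmod_rev_triangle u (- (Cexp u - 1 - u))%C) as T. rewrite Cmod_opp in T. nra. }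
  assert (Hn : (Cexp u - 1)%C <> 0%C) by (apply Cmod_neq_0; lra). split; [|split; assumption].
  replace (u / (Cexp u - 1) - 1)%C with (- (Cexp u - 1 - u) * / (Cexp u - 1))%C by (field; assumption).
  rewrite Cmod_mult, Cmod_opp, Cmod_inv by assumption. apply Rle_trans with (3 * Cmod u ^ 2 * / (Cmod u / 2)).
  - apply Rmult_le_compat; [apply Cmod_ge_0|left; apply Rinv_0_lt_compat; lra|assumption|].
    apply Rinv_le_contravar; lra.
  - replace (3 * Cmod u ^ 2 * / (Cmod u / 2)) with (6 * Cmod u) by (field; lra). lra.
Qed.

Lemma twopii_neq_0 : twopii <> 0%C.
Proof. intros E. injection E. pose proof PI_RGT_0. lra. Qed.

(** The kernel [/ (Eper z - 1)] has residue [/ twopii] at every integer, which cancels the factor of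
    the residue theorem. *)
Lemma residue_integer (n : nat) (f : C -> C) H : (1 <= n)%nat -> 0 < H ->
  hol_on_rect f (INR n - / 2) (INR n + / 2) (- H) H ->
  RI (fun z => f z / (Eper z - 1))%C (INR n - / 2) (INR n + / 2) (- H) H = f (RtoC (INR n)).
Proof.
  intros Hn HH Hf. set (p := RtoC (INR n)). rewrite (residue _ _ _ _ _ p (f p / twopii)%C).
  - change (0, 2 * PI) with twopii. field. apply twopii_neq_0.
  - simpl; lra.
  - simpl; lra.
  - intros z Hz Hp. apply hol_div; [apply Hf, Hz|apply hol_minus; [apply hol_Eper|apply hol_const]|].
    apply (Eper_neq_1 n); [|assumption]. destruct Hz. apply Rabs_le. lra.
  - intros e He. assert (Hcf : ccont f p) by (apply hol_ccont, Hf; split; simpl; lra).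
    pose proof (Cmod_ge_0 (f p)) as Hfp. assert (Htp : 1 <= Cmod twopii).
    { step_le; [|apply Cmod_snd]. simpl. pose proof PI2_3_2. apply Rle_trans with (2 * PI); [unfold PI2 in *; lra|apply Rle_abs]. }
    destruct (Hcf (Rmin 1 (e / 4))) as (r1 & Hr1 & H1); [apply Rmin_pos; lra|].
    destruct (exp_quotient_limit (Rmin 1 (e / (4 * (1 + Cmod (f p)))))) as (r2 & Hr2 & H2).
    { apply Rmin_pos; [lra|div_pos; lra]. }
    exists (Rmin r1 (r2 / Cmod twopii)). split; [apply Rmin_pos; [assumption|div_pos; lra]|]. intros z [Z0 Z].
    destruct (Rmin_Rgt_l _ _ _ Z) as [Z1 Z2]. specialize (H1 z Z1). set (u := (twopii * (z - p))%C).
    assert (EU : Eper z = Cexp u).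
    { change (Eper z = Eper (z - p)%C). rewrite <- (Eper_shift n (z - p)%C). f_equal. unfold p. ring. }
    destruct (H2 u) as (B1 & B2 & _).
    { unfold u. rewrite Cmod_mult. split; [mul_pos; lra|]. apply (Rmult_lt_compat_l (Cmod twopii)) in Z2; [|lra].
      replace (Cmod twopii * (r2 / Cmod twopii)) with r2 in Z2 by (field; lra). exact Z2. } rewrite EU.
    replace ((z - p) * (f z / (Cexp u - 1)) - f p / twopii)%C
      with (/ twopii * ((f z - f p) * (u / (Cexp u - 1)) + f p * (u / (Cexp u - 1) - 1)))%C.
    2:{ unfold u in B2 |- *. field. split; first [exact B2|apply twopii_neq_0]. }
    rewrite Cmod_mult, Cmod_inv by apply twopii_neq_0. set (w := (u / (Cexp u - 1))%C) in *.
    assert (W1 : Cmod (w - 1) <= 1) by (step_le; [exact B1|apply Rmin_l]).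
    assert (W2 : Cmod (w - 1) <= e / (4 * (1 + Cmod (f p)))) by (step_le; [exact B1|apply Rmin_r]).
    assert (W3 : Cmod w <= 2).
    { replace w with ((w - 1) + 1)%C by ring. step_le; [apply Cmod_triangle|]. rewrite Cmod_1. lra. }
    assert (F1 : Cmod (f z - f p) <= e / 4) by (left; eapply Rlt_le_trans; [exact H1|apply Rmin_r]).
    assert (T : Cmod ((f z - f p) * w + f p * (w - 1)) <= e).
    { step_le; [apply Cmod_triangle|]. rewrite !Cmod_mult.
      assert (Cmod (f z - f p) * Cmod w <= e / 4 * 2) by (apply Rmult_le_compat; try apply Cmod_ge_0; assumption).
      assert (Cmod (f p) * Cmod (w - 1) <= (1 + Cmod (f p)) * (e / (4 * (1 + Cmod (f p))))).
      { apply Rmult_le_compat; try apply Cmod_ge_0; lra. }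
      replace ((1 + Cmod (f p)) * (e / (4 * (1 + Cmod (f p))))) with (e / 4) in * by (field; lra). lra. }
    assert (/ Cmod twopii <= 1) by (rewrite <- Rinv_1; apply Rinv_le_contravar; lra).
    pose proof (Cmod_ge_0 ((f z - f p) * w + f p * (w - 1))%C).
    assert (0 < / Cmod twopii) by (apply Rinv_0_lt_compat; lra). nra.
Qed.

Lemma CI_reflect f a b : a <= b -> rc_on f (- b) (- a) -> CI f (- b) (- a) = CI (fun t => f (- t)) a b.
Proof.
  intros Hab F. unfold CI.
  assert (E : forall g : R -> R, ex_RInt g (- b) (- a) -> RInt g (- b) (- a) = RInt (fun t => g (- t)) a b).
  { intros g Eg. pose proof (RInt_comp_lin (V := RC) g (-1) 0 a b) as K.
    replace (-1 * a + 0) with (- a) in K by ring. replace (-1 * b + 0) with (- b) in K by ring.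
    specialize (K (ex_RInt_swap (V := RN) _ _ _ Eg)).
    rewrite <- (opp_RInt_swap (V := RC)) by (apply (ex_RInt_swap (V := RN)), Eg).
    rewrite <- K. rewrite <- (RInt_opp (V := RC)).
    - apply RInt_ext. intros t _. change (- (-1 * g (-1 * t + 0)) = g (- t)).
      replace (-1 * t + 0) with (- t) by ring. ring.
    - apply (ex_RInt_comp_lin (V := RN) g (-1) 0 a b).
      replace (-1 * a + 0) with (- a) by ring. replace (-1 * b + 0) with (- b) by ring.
      apply (ex_RInt_swap (V := RN)), Eg. } f_equal; apply E; [apply rc_ex1|apply rc_ex2]; try assumption; lra.
Qed.

Definition tends (F : R -> C) (l : C) : Prop :=
  forall e, 0 < e -> exists H0, 0 < H0 /\ forall H, H0 <= H -> Cmod (F H - l) <= e.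

Lemma imp_from0 f l : (forall t, 0 <= t -> rcont f t) -> imp f l -> tends (fun H => CI f 0 H) l.
Proof.
  intros F Hi e He. destruct (Hi (e / 2)) as (a0 & b0 & Ha0 & Hab & K); [lra|].
  destruct (rc_bounded f 0 a0) as [M HM]; [lra|intros t Ht; apply F; lra|].
  assert (HM0 : 0 <= M) by (step_le; [apply Cmod_ge_0|apply (HM 0); lra]). exists b0. split; [lra|]. intros H HH.
  set (a := Rmin a0 (e / (2 * (1 + M)))). assert (Ha : 0 < a) by (apply Rmin_pos; [assumption|div_pos; lra]).
  assert (Ha1 : a <= a0) by apply Rmin_l. assert (Ha2 : (1 + M) * a <= e / 2).
  { apply Rle_trans with ((1 + M) * (e / (2 * (1 + M)))); [mono_l; [lra|apply Rmin_r]|right; field; lra]. }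
  specialize (K a H ltac:(lra) HH). rewrite <- (CI_chasles f 0 a H) by (try lra; intros t Ht; apply F; lra).
  assert (B : Cmod (CI f 0 a) <= M * (a - 0)).
  { apply CI_bound; [lra|intros t Ht; apply F; lra|intros t Ht; apply HM; lra]. }
  replace (CI f 0 a + CI f a H - l)%C with (CI f 0 a + (CI f a H - l))%C by ring.
  step_le; [apply Cmod_triangle|]. nra.
Qed.

(** [sg = 1] and [sg = -1] are the two halves of the Abel-Plana integral on the line [Re z = c]. *)
Definition apv (sg c : R) (s : C) (t : R) : C :=
  (RtoC (/ (1 + exp (2 * PI * t))) * Cexp (- s * Clog (c, (sg * t)%R)))%C.
Definition APV (sg c : R) (s : C) : C := Imp (apv sg c s).

Lemma rcont_apw t : rcont (fun t => RtoC (/ (1 + exp (2 * PI * t)))) t.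
Proof.
  apply rcont_RtoC, (ex_derive_continuous (V := RN)). auto_derive. pose proof (exp_pos (2 * PI * t)). lra.
Qed.

Lemma rcont_clog_line sg c t : 0 < c -> rcont (fun t => Clog (c, (sg * t)%R)) t.
Proof.
  intros Hc. apply (ccont_rcont Clog (fun t => (c, sg * t))).
  - apply ccont_Clog, slit_Re. exact Hc.
  - split; [apply continuous_const|]. cont_derive.
Qed.

Lemma apw_le t : Cmod (RtoC (/ (1 + exp (2 * PI * t)))) <= exp (- (2 * PI * t)).
Proof.
  pose proof (exp_pos (2 * PI * t)). rewrite Cmod_R, Rabs_pos_eq.
  - rewrite exp_Ropp. apply Rinv_le_contravar; lra.
  - left. apply Rinv_0_lt_compat. lra.
Qed.

Lemma Cmod_Clog_le z : Cmod (Clog z) <= Rabs (ln (Cmod z)) + PI.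
Proof.
  step_le; [apply Cmod_le_abs|]. unfold Clog; simpl. pose proof (Carg_bound z). lra.
Qed.

Lemma Cmod_half c t : 0 < c -> c <= Cmod (c, t) <= c + Rabs t.
Proof.
  intros Hc. split.
  - step_le; [|apply (Cmod_fst (c, t))]. apply Rle_abs.
  - step_le; [apply Cmod_le_abs|]. simpl. rewrite (Rabs_pos_eq c); lra.
Qed.

Lemma PI_gt_3 : 3 <= PI.
Proof. pose proof PI2_3_2. unfold PI2 in *. lra. Qed.

Lemma APV_ok sg c s : sg = 1 \/ sg = -1 -> / 2 <= c -> imp (apv sg c s) (APV sg c s) /\ hol (APV sg c) s.
Proof.
  intros Hsg Hc. set (K := Cmod s + 2). assert (HK : 0 <= K) by (unfold K; pose proof (Cmod_ge_0 s); lra).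
  destruct (ln_growth K (/ 2)) as (B & HB & Hln); [lra|assumption|].
  destruct (imp_param (fun t => RtoC (/ (1 + exp (2 * PI * t)))) (fun t => Clog (c, (sg * t)%R)) s 1
    (exp (B + c + K * PI)) 1) as [P1 P2]; try lra.
  - intros t _. apply rcont_apw.
  - intros t _. apply rcont_clog_line. lra.
  - intros t Ht. assert (Hz : c <= Cmod (c, sg * t) <= c + t).
    { pose proof (Cmod_half c (sg * t) ltac:(lra)) as Hz. rewrite Rabs_mult, (Rabs_pos_eq t) in Hz by lra.
      replace (Rabs sg) with 1 in Hz; [lra|]. destruct Hsg as [-> | ->]; [rewrite Rabs_pos_eq; lra|rewrite Rabs_left; lra]. }
    set (L := Clog (c, (sg * t)%R)) in *.
    apply Rle_trans with (exp (- (2 * PI * t)) * (exp (Cmod s * Cmod L) * exp (2 * 1 * Cmod L))).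
    + rewrite Rmult_assoc. apply Rmult_le_compat.
      * apply Cmod_ge_0.
      * apply Rmult_le_pos; [apply Cmod_ge_0|left; apply exp_pos].
      * apply apw_le.
      * mono_r; [left; apply exp_pos|]. step_le; [apply Cmod_Cexp_le|]. rewrite Cmod_mult, Cmod_opp. lra.
    + rewrite <- !exp_plus. apply exp_le.
      assert (HL : Cmod L <= Rabs (ln (Cmod (c, sg * t))) + PI) by apply Cmod_Clog_le.
      specialize (Hln (Cmod (c, sg * t)) ltac:(lra)).
      assert (K * Cmod L <= K * (Rabs (ln (Cmod (c, sg * t))) + PI)) by (mono_l; assumption).
      assert (Cmod s * Cmod L + 2 * 1 * Cmod L = K * Cmod L) by (unfold K; ring).
      pose proof PI_gt_3. assert (3 * t <= PI * t) by nra. lra.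
  - split; [|exact P2]. apply (P1 s). replace (s - s)%C with (RtoC 0) by ring. rewrite Cmod_0. lra.
Qed.

Lemma Cpw_mod_bound s x0 : 0 < x0 -> exists B, 0 <= B /\ forall z, x0 <= Cmod z -> Cmod (Cpw z s) <= exp (B + Cmod z).
Proof.
  intros Hx0. destruct (ln_growth (Cmod s) x0 Hx0 (Cmod_ge_0 s)) as (B & HB & H).
  exists (B + Cmod s * PI). pose proof (Cmod_ge_0 s). pose proof PI_RGT_0.
  split; [assert (0 <= Cmod s * PI) by (apply Rmult_le_pos; lra); lra|]. intros z Hz.
  unfold Cpw. step_le; [apply Cmod_Cexp_le|]. apply exp_le. rewrite Cmod_mult, Cmod_opp.
  specialize (H _ Hz). pose proof (Cmod_Clog_le z). 
  assert (Cmod s * Cmod (Clog z) <= Cmod s * (Rabs (ln (Cmod z)) + PI)) by (mono_l; lra). lra.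
Qed.

(** [c ^ (1 - s) / (1 - s)], a primitive of [z ^ (- s)]. With its two integrals added, [APW] is a
    discrete primitive: [n ^ (- s)] is its increment from [n - / 2] to [n + / 2], so Dirichlet sums
    telescope. *)
Definition APprim (c : R) (s : C) : C := (Cpw (RtoC c) (s - 1) / (1 - s))%C.
Definition APW (c : R) (s : C) : C := (APprim c s + Ci * (APV 1 c s - APV (-1) c s))%C.

(** Two forms of one kernel, differing by [Cpw z s]: [fup] decays in the upper half-plane, [fdn] in
    the lower one. *)
Definition fup (s z : C) : C := (Cpw z s * (Eper z * / (Eper z - 1)))%C.
Definition fdn (s z : C) : C := (Cpw z s * / (Eper z - 1))%C.

Lemma fup_fdn s z : (Eper z - 1)%C <> 0%C -> fup s z = (fdn s z + Cpw z s)%C.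
Proof. intros H. unfold fup, fdn. field. exact H. Qed.
Lemma hol_fdn s z : slit z -> (Eper z - 1)%C <> 0%C -> hol (fdn s) z.
Proof.
  intros Hs H. apply hol_mult; [apply hol_Cpw_base, Hs|].
  apply hol_inv; [apply hol_minus; [apply hol_Eper|apply hol_const]|exact H].
Qed.
Lemma hol_fup s z : slit z -> (Eper z - 1)%C <> 0%C -> hol (fup s) z.
Proof.
  intros Hs H. apply (hol_ext (fun z => Eper z * fdn s z)%C); [intros; unfold fup, fdn; ring|].
  apply hol_mult; [apply hol_Eper|apply hol_fdn; assumption].
Qed.
Lemma Eper_off_axis x t : t <> 0 -> (Eper (x, t) - 1)%C <> 0%C.
Proof.
  intros Ht E. assert (E0 : Eper (x, t) = 1%C) by (replace (Eper (x, t)) with ((Eper (x, t) - 1) + 1)%C by ring; rewrite E; ring).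
  apply (f_equal Cmod) in E0. rewrite Cmod_Eper, Cmod_1 in E0. simpl in E0.
  rewrite <- exp_0 in E0. apply exp_inv in E0. pose proof PI_RGT_0. nra.
Qed.
Lemma rcont_apv sg c s t : 0 < c -> rcont (apv sg c s) t.
Proof.
  intros Hc. apply rcont_mult; [apply rcont_apw|].
  apply (hol_rcont Cexp (fun t => - s * Clog (c, (sg * t)%R))%C); [apply hol_Cexp|].
  apply rcont_mult; [apply rcont_const|apply rcont_clog_line, Hc].
Qed.

(** On a line through a half-integer [Eper] is real and negative, and both kernels reduce to the
    pole-free weight [/ (1 + exp (2 * PI * t))]. *)
Lemma kernel_half c s : 0 < c -> (forall t, Eper (c, t) = RtoC (- exp (- (2 * PI * t)))) ->
  (forall t, fup s (c, t) = apv 1 c s t) /\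
  (forall H, 0 < H -> CI (fun t => fdn s (c, t)) (- H) 0 = (- CI (apv (-1) c s) 0 H)%C).
Proof.
  intros Hc E. split; [intros t|intros H HH].
  - unfold fup, apv. rewrite E. replace (1 * t) with t by ring. unfold Cpw. set (X := Cexp _). rewrite exp_Ropp.
    pose proof (exp_pos (2 * PI * t)) as Hp. set (q := exp (2 * PI * t)) in *. assert (0 < / q) by (apply Rinv_0_lt_compat, Hp).
    rewrite <- RtoC_minus, <- RtoC_inv, <- RtoC_mult by lra.
    replace (- / q * / (- / q - 1)) with (/ (1 + q)) by (field; lra). ring.
  - replace (CI (fun t => fdn s (c, t)) (- H) 0) with (CI (fun t => fdn s (c, t)) (- H) (- 0)) by (f_equal; ring).
    rewrite (CI_reflect (fun t => fdn s (c, t)) 0 H); [|lra|].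
    + rewrite (CI_ext _ (fun t => RtoC (-1) * apv (-1) c s t)%C), CI_scal; try lra; [ceq; ring|intros t _; apply rcont_apv, Hc|].
      intros t _. unfold fdn, apv. rewrite E. replace (-1 * t) with (- t) by ring. unfold Cpw. set (X := Cexp _).
      replace (- (2 * PI * - t)) with (2 * PI * t) by ring.
      pose proof (exp_pos (2 * PI * t)) as Hp. set (q := exp (2 * PI * t)) in *.
      rewrite <- RtoC_minus, <- RtoC_inv by lra. replace (/ (- q - 1)) with (-1 * / (1 + q)) by (field; lra). rewrite RtoC_mult. ring.
    + apply rc_v. intros t _. apply hol_ccont, hol_fdn; [apply slit_Re, Hc|]. rewrite E. pose proof (exp_pos (- (2 * PI * t))).
      intros E0. apply (f_equal fst) in E0. simpl in E0. lra.
Qed.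

Lemma Cmod_plus_le (x y : C) a b : Cmod x <= a -> Cmod y <= b -> Cmod (x + y) <= a + b.
Proof. intros. step_le; [apply Cmod_triangle|]. lra. Qed.

(** The common shape of the limits in [abel_plana_step] and [abel_plana_left]: four vertical
    integrals, with the horizontal sides in [Rest]. *)
Lemma tends_identity (F1 F2 F3 F4 Rest : R -> C) (l1 l2 l3 l4 A c1 c2 c3 c4 : C) :
  tends F1 l1 -> tends F2 l2 -> tends F3 l3 -> tends F4 l4 -> tends Rest 0 ->
  (forall H, 0 < H -> (A + c1 * F1 H + c2 * F2 H + c3 * F3 H + c4 * F4 H + Rest H)%C = 0%C) ->
  (A + c1 * l1 + c2 * l2 + c3 * l3 + c4 * l4)%C = 0%C.
Proof.
  intros T1 T2 T3 T4 T5 Id. apply Cmod_0_contra. intros Hpos. set (S := (A + c1 * l1 + c2 * l2 + c3 * l3 + c4 * l4)%C) in *.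
  set (M := 1 + Cmod c1 + Cmod c2 + Cmod c3 + Cmod c4).
  pose proof (Cmod_ge_0 c1) as Q1. pose proof (Cmod_ge_0 c2) as Q2. pose proof (Cmod_ge_0 c3) as Q3. pose proof (Cmod_ge_0 c4) as Q4.
  assert (HM : 0 < M) by (unfold M; lra). set (e := Cmod S / (2 * M)). assert (He : 0 < e) by (div_pos; lra).
  destruct (T1 e He) as (H1 & P1 & K1). destruct (T2 e He) as (H2 & P2 & K2). destruct (T3 e He) as (H3 & P3 & K3).
  destruct (T4 e He) as (H4 & P4 & K4). destruct (T5 e He) as (H5 & P5 & K5). set (h := H1 + H2 + H3 + H4 + H5).
  specialize (K1 h ltac:(unfold h; lra)). specialize (K2 h ltac:(unfold h; lra)). specialize (K3 h ltac:(unfold h; lra)).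
  specialize (K4 h ltac:(unfold h; lra)). specialize (K5 h ltac:(unfold h; lra)). specialize (Id h ltac:(unfold h; lra)).
  assert (E : (- S)%C = (c1 * (F1 h - l1) + c2 * (F2 h - l2) + c3 * (F3 h - l3) + c4 * (F4 h - l4) + (Rest h - 0))%C).
  { replace (- S)%C with ((A + c1 * F1 h + c2 * F2 h + c3 * F3 h + c4 * F4 h + Rest h) - S)%C by (rewrite Id; ring). unfold S. ring. }
  assert (B : Cmod S <= M * e).
  { rewrite <- Cmod_opp, E. replace (M * e) with (Cmod c1 * e + Cmod c2 * e + Cmod c3 * e + Cmod c4 * e + e) by (unfold M; ring).
    repeat apply Cmod_plus_le; try (rewrite Cmod_mult; mono_l); assumption. }
  assert (M * e = Cmod S / 2) by (unfold e; field; lra). lra.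
Qed.

(** [z ^ (- s)] is at most a constant times [exp (Cmod z)], which the decay [exp (- (2 * PI * H))]
    of the kernels outweighs. *)
Lemma horizontal_tails s x0 x1 : 0 <= x0 -> x0 <= x1 <= x0 + 1 ->
  tends (fun H => CI (fun t => fdn s (t, (- H)%R)) x0 x1 - CI (fun t => fup s (t, H)) x0 x1)%C 0.
Proof.
  intros Hx0 Hx1. destruct (Cpw_mod_bound s 1 Rlt_0_1) as (B & HB & HBz). set (C0 := 4 * exp (B + x1)).
  assert (HC0 : 0 < C0) by (unfold C0; pose proof (exp_pos (B + x1)); lra).
  assert (K : forall H, 1 <= H -> Cmod (CI (fun t => fdn s (t, (- H)%R)) x0 x1 - CI (fun t => fup s (t, H)) x0 x1) <= C0 * exp (- H)).
  { intros H HH. pose proof PI_gt_3 as HPI. set (q := exp (2 * PI * H)).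
    assert (Hq : 2 <= q) by (unfold q; pose proof (exp_ineq1_le (2 * PI * H)); nra).
    assert (Hiq : 0 < / q <= / 2) by (split; [apply Rinv_0_lt_compat; lra|apply Rinv_le_contravar; lra]).
    assert (Hd : exp (B + (x1 + H)) * (2 * / q) <= C0 / 2 * exp (- H)).
    { unfold C0, q. rewrite <- exp_Ropp. replace (4 * exp (B + x1) / 2 * exp (- H)) with (2 * (exp (B + x1) * exp (- H))) by field.
      rewrite <- Rmult_assoc, (Rmult_comm _ 2), Rmult_assoc, <- !exp_plus. mono_l; [lra|]. apply exp_le. nra. }
    assert (S : forall t y, y = H \/ y = - H -> slit (t, y)) by (intros t y Hy; apply slit_Im; simpl; lra).
    assert (N : forall t y, y = H \/ y = - H -> (Eper (t, y) - 1)%C <> 0%C) by (intros t y Hy; apply Eper_off_axis; lra).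
    assert (P : forall t y, x0 <= t <= x1 -> y = H \/ y = - H -> Cmod (Cpw (t, y) s) <= exp (B + (x1 + H))).
    { intros t y Ht Hy. assert (Ey : Rabs y = H) by (destruct Hy as [-> | ->]; [apply Rabs_pos_eq; lra|rewrite Rabs_left; lra]).
      step_le; [apply HBz|apply exp_le, Rplus_le_compat_l].
      - step_le; [|apply (Cmod_snd (t, y))]. simpl; lra.
      - step_le; [apply Cmod_le_abs|]. simpl. rewrite Ey, Rabs_pos_eq; lra. }
    assert (F : forall X1 X2 : C, Cmod X1 <= C0 / 2 * exp (- H) * (x1 - x0) -> Cmod X2 <= C0 / 2 * exp (- H) * (x1 - x0) ->
      Cmod (X1 - X2) <= C0 * exp (- H)).
    { intros X1 X2 A1 A2. step_le; [apply Cmod_triangle_minus|].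
      assert (0 < C0 / 2 * exp (- H)) by (mul_pos; [lra|apply exp_pos]). nra. } apply F; (apply CI_bound; [lra| |]).
    - apply rc_h. intros t Ht. apply hol_ccont, hol_fdn; auto.
    - intros t Ht. unfold fdn. rewrite Cmod_mult, Cmod_inv by auto. step_le; [|exact Hd].
      apply Rmult_le_compat; [apply Cmod_ge_0|left; apply Rinv_0_lt_compat, Cmod_pos_neq; auto|apply P; auto|].
      pose proof (Cmod_rev_triangle (Eper (t, (- H)%R)) 1) as T. rewrite Cmod_1, Cmod_Eper in T. simpl in T.
      replace (- (2 * PI * - H)) with (2 * PI * H) in T by ring. fold q in T.
      replace (2 * / q) with (/ (q / 2)) by (field; lra). apply Rinv_le_contravar; lra.
    - apply rc_h. intros t Ht. apply hol_ccont, hol_fup; auto.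
    - intros t Ht. unfold fup. rewrite Cmod_mult. step_le; [|exact Hd].
      apply Rmult_le_compat; try apply Cmod_ge_0; [apply P; auto|]. rewrite Cmod_mult, Cmod_inv, Cmod_Eper by auto. simpl.
      pose proof (Cmod_rev_triangle 1 (Eper (t, H))) as T. rewrite Cmod_1, Cmod_Eper, Cmod_minus_sym in T. simpl in T.
      rewrite exp_Ropp in *. fold q in T. fold q. rewrite Rmult_comm. mono_r; [lra|].
      replace 2 with (/ / 2) by field. apply Rinv_le_contravar; lra. }
  intros e He. exists (1 + C0 / e). assert (Hce : 0 < C0 / e) by (div_pos; assumption). split; [lra|]. intros H HH.
  cbv beta. match goal with |- Cmod (Cminus ?X ?Z) <= _ => replace (Cminus X Z) with X by ring end. step_le; [apply K; lra|].
  rewrite exp_Ropp. pose proof (exp_ineq1_le H). apply Rmult_le_reg_r with (exp H); [apply exp_pos|].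
  rewrite Rmult_assoc, Rinv_l, Rmult_1_r by (apply Rgt_not_eq, exp_pos).
  apply Rle_trans with (e * (C0 / e)); [right; field; lra|]. mono_l; lra.
Qed.

(** The residue theorem for [fdn] around [n]. In the upper half [fdn] is [fup] minus [Cpw], and
    Goursat's theorem carries the integral of [Cpw] to the real axis, where it is a difference of
    values of [APprim]; the height then tends to infinity. *)
Lemma abel_plana_step (n : nat) (s : C) : (1 <= n)%nat -> s <> 1%C ->
  Cpw (RtoC (INR n)) s = (APW (INR n + / 2) s - APW (INR n - / 2) s)%C.
Proof.
  intros Hn Hs. assert (Hn1 : 1 <= INR n) by (apply (le_INR 1); assumption).
  set (c := INR n - / 2). set (d := INR n + / 2). set (g := fun z => Cpw z s).
  assert (Hcd : c <= d) by (unfold c, d; lra). assert (Hc : / 2 <= c) by (unfold c; lra).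
  assert (Ed : forall t, Eper (d, t) = RtoC (- exp (- (2 * PI * t)))) by (intros; apply Eper_half).
  assert (Ec : forall t, Eper (c, t) = RtoC (- exp (- (2 * PI * t)))).
  { intros t. unfold c. destruct n as [|m]; [lia|]. rewrite S_INR. replace (INR m + 1 - / 2) with (INR m + / 2) by lra. apply Eper_half. }
  destruct (kernel_half d s ltac:(lra) Ed) as [Ud Ld]. destruct (kernel_half c s ltac:(lra) Ec) as [Uc Lc].
  assert (Gh : forall z, 0 < fst z -> hol g z) by (intros z Hz; apply hol_Cpw_base, slit_Re, Hz).
  assert (NEv : forall x t, x = c \/ x = d -> (Eper (x, t) - 1)%C <> 0%C).
  { intros x t Hx E. pose proof (exp_pos (- (2 * PI * t))). destruct Hx; subst x; [rewrite Ec in E|rewrite Ed in E];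
      apply (f_equal fst) in E; simpl in E; lra. }
  assert (T : forall sg x, sg = 1 \/ sg = -1 -> / 2 <= x -> tends (fun H => CI (apv sg x s) 0 H) (APV sg x s)).
  { intros sg x Hsg Hx. apply imp_from0; [intros; apply rcont_apv; lra|apply APV_ok; assumption]. }
  pose proof (tends_identity _ _ _ _ _ _ _ _ _ (APprim d s - APprim c s - g (RtoC (INR n)))%C Ci (- Ci)%C (- Ci)%C Ci
    (T 1 d ltac:(auto) ltac:(lra)) (T (-1) d ltac:(auto) ltac:(lra)) (T 1 c ltac:(auto) ltac:(lra)) (T (-1) c ltac:(auto) ltac:(lra))
    (horizontal_tails s c d ltac:(lra) ltac:(unfold c, d; lra))) as Lim.
  apply (f_equal (fun X => X + g (RtoC (INR n)))%C) in Lim.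
  - change (Cpw (RtoC (INR n)) s) with (g (RtoC (INR n))). rewrite <- (Cplus_0_l (g _)), <- Lim. unfold APW. ring.
  - intros H HH.
    pose proof (residue_integer n g H Hn HH) as R1. fold c in R1. fold d in R1. rewrite <- R1; [|intros z [Z1 Z2]; apply Gh; lra].
    change (fun z => (g z / (Eper z - 1))%C) with (fdn s).
    assert (R2 : RI g c d 0 H = 0%C) by (apply goursat; [assumption|lra|]; intros z [Z1 Z2]; apply Gh; lra).
    assert (Cf : forall x, x = c \/ x = d -> rc_on (fun t => fdn s (x, t)) (- H) H).
    { intros x Hx. apply rc_v. intros t _. apply hol_ccont, hol_fdn; [apply slit_Re; destruct Hx; subst; simpl; lra|apply NEv, Hx]. }
    assert (Vert : forall x, x = c \/ x = d -> (forall t, fup s (x, t) = apv 1 x s t) ->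
       (CI (fun t => fdn s (x, t)) 0 H + CI (fun t => g (x, t)) 0 H = CI (apv 1 x s) 0 H)%C).
    { intros x Hx U. rewrite <- CI_plus; [|lra|intros t Ht; apply Cf; [exact Hx|lra]|].
      - apply CI_ext; [lra|]. intros t _. rewrite <- U. symmetry. apply fup_fdn, NEv, Hx.
      - apply rc_v. intros t _. apply hol_ccont, Gh. destruct Hx; subst; simpl; lra. }
    pose proof (Vert d (or_intror eq_refl) Ud) as Vd. pose proof (Vert c (or_introl eq_refl) Uc) as Vc.
    assert (Hb : CI (fun t => g (t, 0)) c d = (APprim d s - APprim c s)%C).
    { apply (hline_int (fun z => Cpw z (s - 1) / (1 - s))%C g 0); [assumption| |].
      - intros t Ht. apply cder_Cpw_prim; [apply slit_Re; simpl; lra|assumption].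
      - intros t Ht. apply hol_ccont, Gh. simpl; lra. }
    assert (Ht : CI (fun t => fup s (t, H)) c d = (CI (fun t => fdn s (t, H)) c d + CI (fun t => g (t, H)) c d)%C).
    { rewrite <- CI_plus; [apply CI_ext; [exact Hcd|intros; apply fup_fdn, Eper_off_axis; lra]|exact Hcd| |].
      - apply rc_h. intros t Ht. apply hol_ccont, hol_fdn; [apply slit_Re; simpl; lra|apply Eper_off_axis; lra].
      - apply rc_h. intros t Ht. apply hol_ccont, Gh. simpl; lra. }
    rewrite Ht, <- Hb, <- Vd, <- Vc. unfold RI in R2 |- *.
    rewrite <- (CI_chasles (fun t => fdn s (d, t)) (- H) 0 H), <- (CI_chasles (fun t => fdn s (c, t)) (- H) 0 H) by (try lra; auto).
    rewrite Ld, Lc by exact HH. rewrite <- R2. ring.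
Qed.

Fixpoint Dsum (s : C) (N : nat) : C := match N with O => RtoC 0 | S m => (Dsum s m + Cpw (RtoC (INR (S m))) s)%C end.

Lemma abel_plana_sum (s : C) N : s <> 1%C -> Dsum s N = (APW (INR N + / 2) s - APW (/ 2) s)%C.
Proof.
  intros Hs. induction N as [|N IH].
  - simpl. rewrite Rplus_0_l. ring.
  - change (Dsum s (S N)) with (Dsum s N + Cpw (RtoC (INR (S N))) s)%C.
    rewrite IH, (abel_plana_step (S N) s) by (try assumption; lia).
    replace (INR (S N) - / 2) with (INR N + / 2) by (rewrite S_INR; lra). ring.
Qed.

Lemma Carg_RtoC x : Carg (RtoC x) = 0.
Proof. unfold Carg. simpl. unfold Rdiv. rewrite Rmult_0_l, atan_0. ring. Qed.

Lemma Cmod_Cpw_real x s : 0 < x -> Cmod (Cpw (RtoC x) s) = exp (- fst s * ln x).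
Proof. intros H. rewrite Cmod_Cpw, Carg_RtoC, Cmod_RtoC_pos by lra. f_equal. ring. Qed.

Lemma pcont_apv sg c s : 0 < c -> pcont (apv sg c s).
Proof.
  intros Hc t _. unfold apv. apply rcont_mult; [apply rcont_apw|].
  apply (hol_rcont Cexp (fun t => - s * Clog (c, (sg * t)%R))%C); [apply hol_Cexp|].
  apply rcont_mult; [apply rcont_const|apply rcont_clog_line, Hc].
Qed.

Lemma APV_le sg c s M : 0 < c -> 
  (forall t, 0 < t -> - fst s * ln (Cmod (c, sg * t)) + snd s * Carg (c, sg * t) <= M + t) ->
  Cmod (APV sg c s) <= exp M.
Proof.
  intros Hc H. replace (exp M) with (exp M / 1) by field.
  apply (Imp_bound (apv sg c s) (exp M) 1); [apply pcont_apv, Hc|lra|]. intros t Ht. unfold apv. rewrite Cmod_mult.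
  change (Cexp (- s * Clog (c, (sg * t)%R))) with (Cpw (c, sg * t) s). rewrite Cmod_Cpw.
  step_le; [apply Rmult_le_compat; [apply Cmod_ge_0|left; apply exp_pos|apply apw_le|apply exp_le, H, Ht]|].
  rewrite <- !exp_plus. apply exp_le. pose proof PI_gt_3. nra.
Qed.

Lemma exp_ln_decay k e : 0 < k -> 0 < e -> exists N0, (1 <= N0)%nat /\ forall N, (N0 <= N)%nat -> exp (- k * ln (INR N + / 2)) <= e.
Proof.
  intros Hk He. destruct (INR_unbounded (exp (/ (k * e)))) as [N0 HN0]. exists (S N0). split; [lia|]. intros N HN.
  assert (HN1 : INR N0 <= INR N) by (apply le_INR; lia). assert (Hke : 0 < k * e) by (mul_pos; assumption).
  assert (Hl : / (k * e) <= ln (INR N + / 2)).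
  { rewrite <- (ln_exp (/ (k * e))). left. apply ln_increasing; [apply exp_pos|lra]. }
  assert (H1 : / e <= k * ln (INR N + / 2)).
  { apply Rle_trans with (k * / (k * e)); [right; field; lra|mono_l; lra]. }
  replace (- k * ln (INR N + / 2)) with (- (k * ln (INR N + / 2))) by ring. rewrite exp_Ropp.
  replace e with (/ / e) by (field; lra). apply Rinv_le_contravar; [apply Rinv_0_lt_compat, He|].
  pose proof (exp_ineq1_le (k * ln (INR N + / 2))). lra.
Qed.

(** The primitive decays like [c ^ (1 - Re s)], the two integrals like [c ^ (- Re s)]. *)
Lemma APW_decay (s : C) : 1 < fst s -> forall e, 0 < e -> exists N0, forall N, (N0 <= N)%nat ->
  Cmod (APW (INR N + / 2) s) <= e.
Proof.
  intros Hs e He. set (m := Cmod (1 - s)). assert (Hm : 0 < m).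
  { apply Cmod_pos_neq. intros E. apply (f_equal fst) in E. simpl in E. lra. }
  set (Q := exp (Rabs (snd s) * PI)). assert (HQ : 0 < Q) by apply exp_pos.
  destruct (exp_ln_decay (fst s - 1) (e * m / 3)) as (N1 & _ & H1); [lra| |].
  { div_pos; [mul_pos; assumption|lra]. } destruct (exp_ln_decay (fst s) (e / (3 * Q))) as (N2 & Hn2 & H2); [lra| |].
  { div_pos; lra. } exists (N1 + N2)%nat. intros N HN. specialize (H1 N ltac:(lia)). specialize (H2 N ltac:(lia)).
  assert (HN1 : 1 <= INR N) by (apply (le_INR 1); lia). set (c := INR N + / 2) in *.
  assert (Hc : 1 <= c) by (unfold c; lra). assert (HV : forall sg, Cmod (APV sg c s) <= e / 3).
  { intros sg. apply Rle_trans with (exp (- fst s * ln c + Rabs (snd s) * PI)).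
    - apply APV_le; [lra|]. intros t Ht.
      assert (Hz : c <= Cmod (c, sg * t)) by (apply (proj1 (Cmod_half c (sg * t) ltac:(lra)))).
      assert (ln c <= ln (Cmod (c, sg * t))) by (destruct Hz as [Hz|Hz]; [left; apply ln_increasing; lra|right; congruence]).
      assert (snd s * Carg (c, sg * t) <= Rabs (snd s) * PI).
      { step_le; [apply Rle_abs|]. rewrite Rabs_mult. mono_l; [apply Rabs_pos|apply Carg_bound]. } nra.
    - rewrite exp_plus. fold Q. apply Rle_trans with (e / (3 * Q) * Q); [mono_r; lra|right; field; lra]. }
  unfold APW, APprim. step_le; [apply Cmod_triangle|]. rewrite Cmod_mult, Cmod_Ci, Rmult_1_l.
  assert (P : Cmod (Cpw c (s - 1) / (1 - s)) <= e / 3).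
  { rewrite Cmod_div by (apply Cmod_neq_0; exact Hm). rewrite Cmod_Cpw_real by lra. fold m.
    simpl. replace (- (fst s + - (1)) * ln c) with (- (fst s - 1) * ln c) by ring.
    apply Rmult_le_reg_r with m; [assumption|]. unfold Rdiv at 1. rewrite Rmult_assoc, Rinv_l, Rmult_1_r by lra.
    replace (e / 3 * m) with (e * m / 3) by field. exact H1. }
  pose proof (Cmod_triangle_minus (APV 1 c s) (APV (-1) c s)). pose proof (HV 1). pose proof (HV (-1)). lra.
Qed.

Lemma Dsum_sum_n s N : @sum_n C_AbelianMonoid (fun n => ninv_pow (S n) s) N = Dsum s (S N).
Proof.
  induction N as [|N IH].
  - unfold sum_n. rewrite sum_n_n. rewrite ninv_pow_Cpw by lia. simpl. ring.
  - rewrite sum_n_S, IH, ninv_pow_Cpw by lia. reflexivity.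
Qed.

Lemma zeta_abel_plana_right zeta (s : C) : is_riemann_zeta zeta -> 1 < fst s -> zeta s = (- APW (/ 2) s)%C.
Proof.
  intros [Hz _] Hs. specialize (Hz s Hs). assert (Hs1 : s <> 1%C) by (intros ->; simpl in Hs; lra).
  enough (E : (zeta s + APW (/ 2) s)%C = 0%C).
  { replace (zeta s) with ((zeta s + APW (/ 2) s) - APW (/ 2) s)%C by ring. rewrite E. ring. }
  apply Cmod_0_contra. intros Hpos. set (e := Cmod (zeta s + APW (/ 2) s)) in *.
  destruct (is_series_Cmod_lim _ _ Hz (e / 3)) as [N1 H1]; [lra|].
  destruct (APW_decay s Hs (e / 3)) as [N2 H2]; [lra|].
  specialize (H1 (N1 + N2)%nat ltac:(lia)). specialize (H2 (S (N1 + N2)) ltac:(lia)).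
  rewrite Dsum_sum_n, abel_plana_sum in H1 by assumption. set (X := APW (INR (S (N1 + N2)) + / 2) s) in *.
  assert (e <= Cmod (X - APW (/ 2) s - zeta s) + Cmod X); [|lra].
  unfold e. replace (zeta s + APW (/ 2) s)%C with (X - (X - APW (/ 2) s - zeta s))%C by ring.
  step_le; [apply Cmod_triangle_minus|]. lra.
Qed.

Lemma hol_APW c (s : C) : / 2 <= c -> s <> 1%C -> hol (APW c) s.
Proof.
  intros Hc Hs. unfold APW. apply hol_plus.
  - unfold APprim. apply hol_div.
    + apply (hol_comp (fun s => s - 1)%C (fun s => Cpw c s)); [apply hol_minus_const|apply hol_Cpw_exp].
    + apply hol_minus; [apply hol_const|apply hol_id].
    + intros E. apply Hs. apply C_eq; [apply (f_equal fst) in E|apply (f_equal snd) in E]; simpl in *; lra.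
  - apply hol_mult; [apply hol_const|]. apply (hol_minus (APV 1 c) (APV (-1) c)); apply APV_ok; auto.
Qed.

Lemma zeta_hol zeta (s : C) : is_riemann_zeta zeta -> s <> 1%C -> hol zeta s.
Proof. intros [_ H] Hs. apply analytic_hol, H, Hs. Qed.

Lemma Im_pos_neq_1 (s : C) : 0 < snd s -> s <> 1%C.
Proof. intros H ->. simpl in H. lra. Qed.

(** Both sides are holomorphic off 1, so the identity extends from [2 + i t] along a horizontal
    segment, which stays in the upper half-plane and avoids the pole. *)
Theorem zeta_abel_plana zeta (s : C) : is_riemann_zeta zeta -> 0 < snd s -> zeta s = (- APW (/ 2) s)%C.
Proof.
  intros Hz Hs. destruct s as [x t]; simpl in Hs. enough (E : (zeta (x, t) + APW (/ 2) (x, t))%C = 0%C).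
  { replace (zeta (x, t)) with ((zeta (x, t) + APW (/ 2) (x, t)) - APW (/ 2) (x, t))%C by ring. rewrite E. ring. }
  apply (identity_segment (fun s => zeta s + APW (/ 2) s)%C (2, t) (x, t) (/ 2) t); try lra.
  - intros u w Hu Hw. assert (Hw1 : 0 < snd w).
    { pose proof (Cmod_snd (w - ((2, t)%R + RtoC u * ((x, t)%R - (2, t)%R)))%C) as F.
      simpl in F. apply Rabs_le_between in F. lra. }
    apply hol_plus; [apply zeta_hol; [assumption|]|apply hol_APW; [lra|]]; apply Im_pos_neq_1, Hw1.
  - intros w Hw. rewrite (zeta_abel_plana_right zeta w Hz); [ring|].
    pose proof (Cmod_fst (w - (2, t)%R)%C) as F. simpl in F. apply Rabs_le_between in F. lra.
Qed.

Lemma Dsum_bound s N L : 0 <= L -> - L <= fst s -> Cmod (Dsum s N) <= INR N * exp (L * ln (INR N + 1)).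
Proof.
  intros HL Hs.  assert (K : forall n, (n <= N)%nat -> Cmod (Dsum s n) <= INR n * exp (L * ln (INR N + 1))).
  { induction n as [|n IH]; intros Hn.
    - simpl. rewrite Cmod_0. lra.
    - change (Dsum s (S n)) with (Dsum s n + Cpw (RtoC (INR (S n))) s)%C. step_le; [apply Cmod_triangle|].
      assert (H1 : 1 <= INR (S n)) by (apply (le_INR 1); lia).
      assert (H2 : INR (S n) <= INR N) by (apply le_INR; lia). rewrite Cmod_Cpw_real by lra.
      assert (exp (- fst s * ln (INR (S n))) <= exp (L * ln (INR N + 1))).
      { apply exp_le.
        assert (0 <= ln (INR (S n))) by (rewrite <- ln_1; destruct H1 as [H1|H1]; [left; apply ln_increasing; lra|rewrite <- H1; lra]).
        assert (ln (INR (S n)) < ln (INR N + 1)) by (apply ln_increasing; lra). nra. }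
      specialize (IH ltac:(lia)). rewrite S_INR at 2. lra. } apply K, le_n.
Qed.

(** The sum is cut at an [N] just above [t]: some [t] terms of size about [t ^ L] at most give
    [t ^ (1 + L)], and [t <= c] keeps the factor [exp (t * Carg)] of the remainder under control.
    The excess of the exponent over [L] does not grow with [L], and this is all that the later
    choice of a large [L] requires. *)
Theorem zeta_growth zeta L : is_riemann_zeta zeta -> 0 <= L -> exists K, 0 < K /\
  forall s : C, 1 <= snd s -> - L <= fst s -> Cmod (zeta s) <= K * exp ((1 + L) * ln (snd s)).
Proof.
  intros Hz HL. destruct (ln_growth L 1) as (B & HB & Hln); [lra|assumption|].
  exists ((2 + 2 * exp (B + 1)) * exp ((1 + L) * ln 4)).
  split; [mul_pos; [pose proof (exp_pos (B + 1)); lra|apply exp_pos]|]. intros s Ht Hs. set (t := snd s) in *.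
  assert (Hs1 : s <> 1%C) by (apply Im_pos_neq_1; fold t; lra).
  destruct (nfloor_ex t) as [n Hn]; [lra|]. set (N := S n).
  assert (HN : t <= INR N <= t + 1) by (unfold N; rewrite S_INR; lra). set (c := INR N + / 2).
  assert (E : zeta s = (Dsum s N - APW c s)%C).
  { rewrite zeta_abel_plana by (try assumption; fold t; lra). rewrite abel_plana_sum by assumption. unfold c. ring. }
  set (Q := exp (L * ln (4 * t))). assert (Hln4 : ln (INR N + 1) <= ln (4 * t)).
  { destruct (Rle_lt_or_eq_dec (INR N + 1) (4 * t)) as [H|H]; [lra|left; apply ln_increasing; lra|rewrite H; lra]. }
  assert (Hlc : 0 <= ln c /\ ln c <= ln (INR N + 1)).
  { split; [rewrite <- ln_1|]; left; apply ln_increasing; unfold c; lra. } assert (HQ1 : 1 <= Q).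
  { unfold Q. rewrite <- exp_0. apply exp_le. apply Rmult_le_pos; [assumption|lra]. }
  assert (HQ : exp ((1 + L) * ln 4) * exp ((1 + L) * ln t) = 4 * t * Q).
  { unfold Q. rewrite <- exp_plus. replace ((1 + L) * ln 4 + (1 + L) * ln t) with (ln (4 * t) + L * ln (4 * t)).
    - rewrite exp_plus, exp_ln by lra. reflexivity.
    - rewrite (ln_mult 4 t) by lra. ring. } rewrite Rmult_assoc, HQ. assert (B1 : Cmod (Dsum s N) <= (2 * t) * Q).
  { step_le; [apply (Dsum_bound s N L HL Hs)|].
    apply Rmult_le_compat; [apply pos_INR|left; apply exp_pos|lra|]. apply exp_le. mono_l; lra. }
  assert (Hm : 1 <= Cmod (1 - s)).
  { step_le; [|apply Cmod_snd]. simpl. fold t. rewrite Rabs_left; lra. } assert (B2 : Cmod (APprim c s) <= 4 * t * Q).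
  { unfold APprim. rewrite Cmod_div by (apply Cmod_neq_0; lra). rewrite Cmod_Cpw_real by (unfold c; lra). simpl.
    apply Rle_trans with (exp (- (fst s + - (1)) * ln c) / 1).
    - mono_l; [left; apply exp_pos|]. apply Rinv_le_contravar; lra.
    - rewrite Rdiv_1_r. rewrite <- (exp_ln (4 * t)) by lra. unfold Q. rewrite <- exp_plus. apply exp_le. nra. }
  assert (B3 : forall sg, sg = 1 \/ sg = -1 -> Cmod (APV sg c s) <= exp (B + 1) * Q).
  { intros sg Hsg. unfold Q. rewrite <- exp_plus. apply Rle_trans with (exp (B + 1 + L * ln c)).
    2:{ apply exp_le. nra. }
    (* the weight [exp(-2 pi y)] absorbs both [(1 + y)^L] and [exp(t y / c) <= exp y] *)
    replace (exp (B + 1 + L * ln c)) with (exp (B + 1 + L * ln c) / 1) by field.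
    apply (Imp_bound (apv sg c s) (exp (B + 1 + L * ln c)) 1); [apply pcont_apv; unfold c; lra|lra|].
    intros y Hy. unfold apv. rewrite Cmod_mult.
    change (Cexp (- s * Clog (c, (sg * y)%R))) with (Cpw (c, sg * y) s). rewrite Cmod_Cpw. fold t.
    assert (Hc1 : 1 <= c) by (unfold c; lra). assert (Hsa : Rabs (sg * y) = y).
    { destruct Hsg as [-> | ->]; [rewrite Rabs_pos_eq; lra|rewrite Rabs_left; lra]. }
    pose proof (Cmod_half c (sg * y) ltac:(lra)) as Hzm. rewrite Hsa in Hzm. assert (Ha : t * Carg (c, sg * y) <= y).
    { destruct Hsg as [-> | ->].
      - assert (Carg (c, 1 * y) <= (1 * y) / c) by (apply (Carg_le (c, 1 * y)); simpl; lra).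
        apply Rle_trans with (t * ((1 * y) / c)); [mono_l; lra|].
        apply Rmult_le_reg_r with c; [lra|]. replace (t * (1 * y / c) * c) with (t * y) by (field; lra).
        assert (t <= c) by (unfold c; lra). nra.
      - assert (Carg (c, -1 * y) <= 0) by (apply (Carg_nonpos (c, -1 * y)); simpl; lra). nra. }
    assert (Hlz : 0 <= ln (Cmod (c, sg * y)) <= ln c + ln (1 + y)).
    { split.
      - rewrite <- ln_1. destruct (Rle_lt_or_eq_dec 1 (Cmod (c, sg * y))) as [H|H]; [lra|left; apply ln_increasing; lra|rewrite <- H; lra].
      - rewrite <- ln_mult by lra. 
        destruct (Rle_lt_or_eq_dec (Cmod (c, sg * y)) (c * (1 + y))) as [H|H]; [nra|left; apply ln_increasing; lra|rewrite H; lra]. }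
    specialize (Hln (1 + y) ltac:(lra)). pose proof (Rle_abs (ln (1 + y))).
    assert (L * ln (1 + y) <= L * Rabs (ln (1 + y))) by (mono_l; assumption).
    step_le; [apply Rmult_le_compat; [apply Cmod_ge_0|left; apply exp_pos|apply apw_le|apply Rle_refl]|].
    rewrite <- !exp_plus. apply exp_le.  assert (- fst s * ln (Cmod (c, sg * y)) <= L * (ln c + ln (1 + y))) by nra.
    pose proof PI_gt_3. nra. } rewrite E. unfold APW. step_le; [apply Cmod_triangle_minus|].
  step_le; [apply Rplus_le_compat_l, Cmod_triangle|]. rewrite Cmod_mult, Cmod_Ci, Rmult_1_l.
  pose proof (Cmod_triangle_minus (APV 1 c s) (APV (-1) c s)).
  pose proof (B3 1 (or_introl eq_refl)). pose proof (B3 (-1) (or_intror eq_refl)). pose proof (exp_pos (B + 1)) as Hp.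
  assert (0 <= exp (B + 1) * Q * (4 * t - 1)) by (repeat apply Rmult_le_pos; lra). nra.
Qed.

Lemma imp_scale f l k : 0 < k -> pcont f -> imp f l -> imp (fun t => f (k * t)) (RtoC (/ k) * l).
Proof.
  intros Hk F Hi e He. destruct (Hi (e * k)) as (a0 & b0 & Ha0 & Hab & K); [mul_pos; assumption|].
  exists (a0 / k), (b0 / k). assert (Hik : 0 < / k) by (apply Rinv_0_lt_compat, Hk).
  split; [mul_pos; assumption|]. split; [mono_r; lra|]. intros a b Ha Hb. assert (A1 : k * a <= a0).
  { apply Rmult_le_reg_r with (/ k); [assumption|]. replace (k * a * / k) with a by (field; lra). lra. }
  assert (B1 : b0 <= k * b).
  { apply Rmult_le_reg_r with (/ k); [assumption|]. replace (k * b * / k) with b by (field; lra). lra. }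
  assert (A2 : 0 < k * a) by (mul_pos; lra). specialize (K (k * a) (k * b) ltac:(lra) ltac:(lra)).
  assert (Hab' : k * a <= k * b) by lra.
  assert (E : CI (fun t => f (k * t)) a b = (RtoC (/ k) * CI f (k * a) (k * b))%C).
  { assert (Eg : forall g : R -> R, ex_RInt g (k * a) (k * b) ->
      RInt (fun t => g (k * t)) a b = / k * RInt g (k * a) (k * b)).
    { intros g Hg. pose proof (RInt_comp_lin (V := RC) g k 0 a b) as Q. rewrite !Rplus_0_r in Q. rewrite <- (Q Hg).
      rewrite <- (RInt_scal (V := RC)).
      - apply RInt_ext. intros t _. change (g (k * t) = / k * (k * g (k * t + 0))). rewrite Rplus_0_r. field. lra.
      - apply (ex_RInt_comp_lin (V := RN) g k 0 a b). rewrite !Rplus_0_r. exact Hg. }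
    unfold CI. rewrite (Eg (fun t => fst (f t))), (Eg (fun t => snd (f t))).
    - ceq; ring.
    - apply rc_ex2; [assumption|apply pcont_on; assumption].
    - apply rc_ex1; [assumption|apply pcont_on; assumption]. }
  rewrite E. replace (RtoC (/ k) * CI f (k * a) (k * b) - RtoC (/ k) * l)%C with (RtoC (/ k) * (CI f (k * a) (k * b) - l))%C by ring.
  rewrite Cmod_mult, Cmod_R, Rabs_pos_eq by lra.
  apply Rmult_le_reg_l with k; [assumption|]. rewrite <- Rmult_assoc, Rinv_r, Rmult_1_l by lra. lra.
Qed.

(** * The functional equation *)

(** [exp (- u) * u ^ b], written in the form [A t * Cexp (- s * L t)] that [imp_param]
    differentiates, with [L = - ln]. *)
Definition gam_f (b : C) (u : R) : C := (RtoC (exp (- u)) * Cexp (- b * RtoC (- ln u)))%C.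
(** [Gam1 b = Gamma (b + 1)] for [Re b > 0]; the shift keeps the integrand bounded near 0. *)
Definition Gam1 (b : C) : C := Imp (gam_f b).

Lemma continuous_ln t : 0 < t -> continuous ln t.
Proof.
  intros H. apply (ex_derive_continuous (V := RN)). exists (/ t). apply is_derive_Reals, derivable_pt_lim_ln, H.
Qed.

Lemma pcont_nln : pcont (fun u => RtoC (- ln u)).
Proof. intros t Ht. apply rcont_RtoC, (continuous_opp ln), continuous_ln, Ht. Qed.

Lemma rcont_exp_lin k t : rcont (fun u => RtoC (exp (- (k * u)))) t.
Proof. apply rcont_RtoC, (ex_derive_continuous (V := RN)). auto_derive. auto. Qed.

Lemma pcont_Cexp_ln b : pcont (fun u => Cexp (- b * RtoC (- ln u))).
Proof.
  intros t Ht. apply (hol_rcont Cexp (fun t => - b * RtoC (- ln t))%C); [apply hol_Cexp|].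
  apply rcont_mult; [apply rcont_const|apply pcont_nln, Ht].
Qed.

Lemma pcont_gam b : pcont (gam_f b).
Proof.
  intros t Ht. apply rcont_mult; [|apply pcont_Cexp_ln, Ht].
  apply (rcont_ext (fun u => RtoC (exp (- (1 * u))))); [intros; rewrite Rmult_1_l; reflexivity|apply rcont_exp_lin].
Qed.

Lemma Gam1_ok b : 0 < fst b -> imp (gam_f b) (Gam1 b) /\ hol Gam1 b.
Proof.
  intros Hb. set (be := fst b) in *. destruct (ln_growth (4 * be) 1) as (B & HB & Hln); [lra|lra|].
  destruct (imp_param (fun u => RtoC (exp (- u))) (fun u => RtoC (- ln u)) b (be / 2)
    (exp (B / 2 + / 2)) (/ 2)) as [P1 P2]; try lra.
  - intros t Ht. apply (rcont_ext (fun u => RtoC (exp (- (1 * u))))); [intros; rewrite Rmult_1_l; reflexivity|apply rcont_exp_lin].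
  - apply pcont_nln.
  - intros t Ht. rewrite Cmod_Cexp, !Cmod_R, (Rabs_pos_eq (exp (- t))) by (left; apply exp_pos).
    rewrite <- !exp_plus. apply exp_le. simpl. fold be. rewrite Rabs_Ropp.
    replace (- be * - ln t - - snd b * 0) with (be * ln t) by ring. destruct (Rle_lt_dec t 1) as [H1|H1].
    + assert (ln t <= 0) by (rewrite <- ln_1; destruct H1 as [H1|H1]; [left; apply ln_increasing; lra|right; congruence]).
      rewrite Rabs_left1 by assumption. replace (2 * (be / 2) * - ln t) with (- (be * ln t)) by field. lra.
    + specialize (Hln t ltac:(lra)). pose proof (Rle_abs (ln t)).
      assert (0 < ln t) by (rewrite <- ln_1; apply ln_increasing; lra). rewrite Rabs_pos_eq in * by lra. nra.
  - split; [|exact P2]. apply (P1 b). replace (b - b)%C with (RtoC 0) by ring. rewrite Cmod_0. lra.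
Qed.

Lemma rder_upow (b : C) u : 0 < u -> rder (fun u => - gam_f (b + 1) u)%C u (gam_f (b + 1) u - (b + 1) * gam_f b u)%C.
Proof.
  intros Hu. unfold gam_f, Cexp, Re, Im. destruct b as [x y]. assert (E : exp ((x + 1) * ln u) = u * exp (x * ln u)).
  { rewrite Rmult_plus_distr_r, exp_plus, Rmult_1_l, exp_ln by assumption. ring. } split; simpl.
  - auto_derive; [repeat split; assumption|].
    replace (- (x + 1) * - ln u + - (- (y + 0) * 0)) with ((x + 1) * ln u) by ring.
    replace (- (x + 1) * - ln u - - (y + 0) * 0) with ((x + 1) * ln u) by ring.
    replace (- x * - ln u - - y * 0) with (x * ln u) by ring.
    replace (- (x + 1) * 0 + - (y + 0) * - ln u) with (y * ln u) by ring.
    replace (- x * 0 + - y * - ln u) with (y * ln u) by ring. rewrite E. field. lra.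
  - auto_derive; [repeat split; assumption|].
    replace (- (x + 1) * - ln u + - (- (y + 0) * 0)) with ((x + 1) * ln u) by ring.
    replace (- (x + 1) * - ln u - - (y + 0) * 0) with ((x + 1) * ln u) by ring.
    replace (- x * - ln u - - y * 0) with (x * ln u) by ring.
    replace (- (x + 1) * 0 + - (y + 0) * - ln u) with (y * ln u) by ring.
    replace (- x * 0 + - y * - ln u) with (y * ln u) by ring. rewrite E. field. lra.
Qed.

Lemma gam_small b e : 0 < fst b -> 0 < e -> exists a0 b0, 0 < a0 /\ forall u, (0 < u <= a0 \/ b0 <= u /\ 0 < u) -> Cmod (gam_f b u) <= e.
Proof.
  intros Hb He. set (be := fst b) in *. destruct (ln_growth (2 * be) 1) as (B & HB & Hln); [lra|lra|].
  assert (E : forall u, 0 < u -> Cmod (gam_f b u) = exp (- u + be * ln u)).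
  { intros u Hu. unfold gam_f. rewrite Cmod_mult, Cmod_Cexp, Cmod_R, Rabs_pos_eq by (left; apply exp_pos).
    rewrite <- exp_plus. f_equal. simpl. fold be. ring. }
  exists (exp (ln e / be)), (Rmax 1 (B - 2 * ln e)). split; [apply exp_pos|]. intros u [Hu|[Hu Hu0]].
  - rewrite E by lra. rewrite <- (exp_ln e He). apply exp_le. assert (ln u <= ln e / be).
    { rewrite <- (ln_exp (ln e / be)). destruct (proj2 Hu) as [H|H]; [left; apply ln_increasing; lra|right; congruence]. }
    assert (be * ln u <= be * (ln e / be)) by (mono_l; lra).
    replace (be * (ln e / be)) with (ln e) in * by (field; lra). lra.
  - rewrite E by lra. pose proof (Rmax_l 1 (B - 2 * ln e)). pose proof (Rmax_r 1 (B - 2 * ln e)).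
    specialize (Hln u ltac:(lra)). pose proof (Rle_abs (ln u)). rewrite <- (exp_ln e He). apply exp_le.
    assert (2 * be * ln u <= 2 * be * Rabs (ln u)) by (mono_l; lra). lra.
Qed.

(** Integration by parts; the boundary terms [exp (- u) * u ^ (b + 1)] vanish at both ends. *)
Lemma Gam1_rec b : 0 < fst b -> Gam1 (b + 1) = ((b + 1) * Gam1 b)%C.
Proof.
  intros Hb. assert (Hb1 : 0 < fst (b + 1)%C) by (simpl; lra).
  destruct (Gam1_ok b Hb) as [I0 _]. destruct (Gam1_ok (b + 1)%C Hb1) as [I1 _].
  assert (I2 : imp (fun u => gam_f (b + 1) u - (b + 1) * gam_f b u)%C (Gam1 (b + 1) - (b + 1) * Gam1 b)%C).
  { apply imp_minus; [apply pcont_gam|apply pcont_scal, pcont_gam|exact I1|apply imp_scal; [apply pcont_gam|exact I0]]. }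
  assert (I3 : imp (fun u => gam_f (b + 1) u - (b + 1) * gam_f b u)%C 0%C).
  { intros e He. destruct (gam_small (b + 1)%C (e / 2) Hb1) as (a0 & b0 & Ha0 & H); [lra|].
    exists (Rmin a0 1), (Rmax 1 b0). split; [apply Rmin_pos; lra|].
    pose proof (Rmin_l a0 1). pose proof (Rmin_r a0 1). pose proof (Rmax_l 1 b0). pose proof (Rmax_r 1 b0).
    split; [lra|]. intros x y Hx Hy. rewrite (CI_antider (fun u => - gam_f (b + 1) u)%C).
    - replace (- gam_f (b + 1) y - - gam_f (b + 1) x - 0)%C with (gam_f (b + 1) x - gam_f (b + 1) y)%C by ring.
      step_le; [apply Cmod_triangle_minus|]. pose proof (H x ltac:(lra)). pose proof (H y ltac:(lra)). lra.
    - lra.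
    - intros t Ht. apply rcont_minus; [apply pcont_gam; lra|apply pcont_scal; [apply pcont_gam|lra]].
    - intros t Ht. apply rder_upow. lra. } pose proof (imp_unique _ _ _ I2 I3) as E.
  replace (Gam1 (b + 1)) with ((Gam1 (b + 1) - (b + 1) * Gam1 b) + (b + 1) * Gam1 b)%C by ring. rewrite E. ring.
Qed.

(** The product of [k - s] over [1 <= k <= m]; dividing [Gam1 (m - s)] by it continues
    [Gamma (1 - s)] to [Re s < m]. *)
Fixpoint poch (m : nat) (s : C) : C := match m with O => RtoC 1 | S k => (poch k s * (RtoC (INR (S k)) - s))%C end.

Lemma Gam1_shift m (s : C) : fst s < 0 -> Gam1 (RtoC (INR m) - s) = (poch m s * Gam1 (- s))%C.
Proof.
  intros Hs. induction m as [|m IH].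
  - simpl. replace (0 - s)%C with (- s)%C by ring. ring.
  - change (poch (S m) s) with (poch m s * (RtoC (INR (S m)) - s))%C.
    replace (RtoC (INR (S m)) - s)%C with (RtoC (INR m) - s + 1)%C by (rewrite S_INR, RtoC_plus; ring).
    rewrite Gam1_rec, IH; [ring|]. simpl. pose proof (pos_INR m). lra.
Qed.

Lemma poch_neq_0 m (s : C) : 0 < snd s -> poch m s <> 0%C.
Proof.
  intros Hs. induction m as [|m IH].
  - apply Cmod_neq_0. simpl. rewrite Cmod_1. lra.
  - apply Cmult_neq_0; [exact IH|]. intros E. apply (f_equal snd) in E. simpl in E. lra.
Qed.

Lemma hol_poch m (s : C) : hol (poch m) s.
Proof.
  induction m as [|m IH]; [apply hol_const|].
  apply (hol_mult (poch m) (fun s => RtoC (INR (S m)) - s)%C); [exact IH|].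
  apply hol_minus; [apply hol_const|apply hol_id].
Qed.

(** The substitution [u = k * t] in the integral for [Gamma (1 - s)]. *)
Lemma gam_scaled (s : C) k : 0 < k -> fst s < 0 ->
  imp (fun t => RtoC (exp (- (k * t))) * Cexp (- s * RtoC (ln t)))%C (Cexp ((s - 1) * RtoC (ln k)) * Gam1 (- s))%C.
Proof.
  intros Hk Hs. destruct (Gam1_ok (- s)%C) as [I _]; [simpl; lra|].
  pose proof (imp_scale _ _ k Hk (pcont_gam (- s)%C) I) as I2. assert (Pk : pcont (fun t => gam_f (- s)%C (k * t))).
  { intros t Ht.  assert (Hkt : 0 < k * t) by (mul_pos; assumption).
    destruct (pcont_gam (- s)%C (k * t) Hkt) as [C1 C2]. assert (Ck : continuous (fun t => k * t) t) by (cont_derive).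
    split.
    - apply (continuous_comp (fun t => k * t) (fun u => fst (gam_f (- s)%C u))); assumption.
    - apply (continuous_comp (fun t => k * t) (fun u => snd (gam_f (- s)%C u))); assumption. }
  apply (imp_scal (Cexp (s * RtoC (ln k)))) in I2; [|exact Pk].
  replace (Cexp ((s - 1) * ln k) * Gam1 (- s))%C with (Cexp (s * ln k) * (RtoC (/ k) * Gam1 (- s)))%C.
  2:{ replace ((s - 1) * ln k)%C with (s * ln k + RtoC (- ln k))%C by (rewrite RtoC_opp; ring).
      rewrite Cexp_plus, Cexp_RtoC, exp_Ropp, exp_ln by assumption. ring. } eapply imp_ext; [|exact I2].
  intros t Ht. cbv beta. unfold gam_f. rewrite ln_mult by assumption.
  replace (- - s * RtoC (- (ln k + ln t)))%C with (- (s * ln k) + - s * ln t)%C by (rewrite RtoC_opp, RtoC_plus; ring).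
  rewrite Cexp_plus, Cexp_opp. field. apply Cexp_neq_0.
Qed.

Definition jker (s : C) (t : R) : C := (RtoC (/ (exp (2 * PI * t) - 1)) * Cexp (- s * RtoC (ln t)))%C.

Lemma exp_gap t : 0 < t -> PI * t * exp (PI * t) <= exp (2 * PI * t) - 1 /\ 0 < PI * t.
Proof.
  intros Ht. pose proof PI_RGT_0. assert (Hx : 0 < PI * t) by (mul_pos; lra).
  split; [|exact Hx]. replace (2 * PI * t) with (PI * t + PI * t) by ring. rewrite exp_plus.
  pose proof (exp_ineq1_le (PI * t)). set (x := PI * t) in *. nra.
Qed.

Lemma pcont_Cexp_ln' s : pcont (fun t => Cexp (- s * RtoC (ln t))).
Proof.
  intros t Ht. apply (hol_rcont Cexp (fun t => - s * RtoC (ln t))%C); [apply hol_Cexp|].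
  apply rcont_mult; [apply rcont_const|apply rcont_RtoC, continuous_ln, Ht].
Qed.

Lemma pcont_jker s : pcont (jker s).
Proof.
  intros t Ht. apply rcont_mult; [|apply pcont_Cexp_ln', Ht].
  apply rcont_RtoC, (ex_derive_continuous (V := RN)). auto_derive.
  destruct (exp_gap t Ht). pose proof (exp_pos (PI * t)). nra.
Qed.

Lemma Cmod_tpow (s : C) t : Cmod (Cexp (- s * RtoC (ln t))) = exp (- fst s * ln t).
Proof. rewrite Cmod_Cexp. f_equal. simpl. ring. Qed.

(** The product is the remainder after [N] terms of the geometric series of
    [/ (exp (2 * PI * t) - 1)]. One power of [t] pays for the singularity at 0, another gives [/ N]
    through [t * exp (- (PI * N * t)) <= / N]; hence [Re s < -2]. *)
Lemma jker_tail (s : C) : fst s < -2 -> exists B, 0 <= B /\ forall N t, (1 <= N)%nat -> 0 < t ->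
   Cmod (jker s t * RtoC (exp (- (2 * PI * INR N * t)))) <= (exp B / INR N) * exp (- (1 * t)).
Proof.
  intros Hs. set (k := - fst s - 2). destruct (ln_growth k 1) as (B & HB & Hln); [lra|unfold k; lra|].
  exists B. split; [assumption|]. intros N t HN Ht. assert (HN1 : 1 <= INR N) by (apply (le_INR 1); assumption).
  unfold jker. rewrite !Cmod_mult, Cmod_tpow, !Cmod_R. destruct (exp_gap t Ht) as [G1 G2]. pose proof PI_gt_3 as HPI.
  assert (G3 : PI * t <= exp (2 * PI * t) - 1).
  { pose proof (exp_ineq1_le (PI * t)). step_le; [|exact G1]. nra. }
  rewrite Rabs_pos_eq by (left; apply Rinv_0_lt_compat; lra). rewrite Rabs_pos_eq by (left; apply exp_pos).
  assert (E : exp (- fst s * ln t) = t * (t * exp (k * ln t))).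
  { replace (- fst s * ln t) with (ln t + (ln t + k * ln t)) by (unfold k; ring).
    rewrite !exp_plus, exp_ln by assumption. reflexivity. } rewrite E.
  assert (Hk : exp (k * ln t) * exp (- (PI * t)) <= exp B * exp (- (1 * t))).
  { rewrite <- !exp_plus. apply exp_le. destruct (Rle_lt_dec t 1) as [H1|H1].
    - assert (ln t <= 0) by (rewrite <- ln_1; destruct H1 as [H1|H1]; [left; apply ln_increasing; lra|right; congruence]).
      assert (0 <= k) by (unfold k; lra). nra.
    - specialize (Hln t ltac:(lra)). pose proof (Rle_abs (ln t)). assert (0 <= k) by (unfold k; lra). nra. }
  assert (Hn : t * exp (- (PI * INR N * t)) <= / INR N).
  { rewrite exp_Ropp. pose proof (exp_ineq1_le (PI * INR N * t)) as He. pose proof (exp_pos (PI * INR N * t)).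
    apply Rmult_le_reg_r with (exp (PI * INR N * t)); [assumption|]. rewrite Rmult_assoc, Rinv_l, Rmult_1_r by lra.
    apply Rmult_le_reg_l with (INR N); [lra|]. rewrite <- Rmult_assoc, Rinv_r, Rmult_1_l by lra.
    assert (0 < INR N * t) by (mul_pos; lra). nra. }
  assert (H2 : exp (- (2 * PI * INR N * t)) = exp (- (PI * INR N * t)) * exp (- (PI * INR N * t))).
  { rewrite <- exp_plus. f_equal. ring. } assert (H3 : exp (- (PI * INR N * t)) <= exp (- (PI * t))).
  { apply exp_le. nra. } rewrite H2. set (a := exp (- (PI * INR N * t))) in *. set (b := exp (k * ln t)) in *.
  assert (Ha : 0 < a) by apply exp_pos. assert (Hb : 0 < b) by apply exp_pos.
  replace (/ (exp (2 * PI * t) - 1) * (t * (t * b)) * (a * a))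
    with ((/ (exp (2 * PI * t) - 1) * t) * ((t * a) * (b * a))) by ring.
  assert (A1 : / (exp (2 * PI * t) - 1) * t <= 1).
  { apply Rmult_le_reg_l with (exp (2 * PI * t) - 1); [lra|]. rewrite <- Rmult_assoc, Rinv_r by lra. nra. }
  assert (A2 : b * a <= exp B * exp (- (1 * t))).
  { step_le; [|exact Hk]. mono_l; lra. } assert (A3 : (t * a) * (b * a) <= / INR N * (exp B * exp (- (1 * t)))).
  { apply Rmult_le_compat; [nra|nra|assumption|assumption]. } assert (A4 : 0 <= / (exp (2 * PI * t) - 1) * t).
  { apply Rmult_le_pos; [left; apply Rinv_0_lt_compat; lra|lra]. }
  assert (A5 : 0 <= (t * a) * (b * a)) by (repeat apply Rmult_le_pos; lra).
  replace (exp B / INR N * exp (- (1 * t))) with (/ INR N * (exp B * exp (- (1 * t)))) by (unfold Rdiv; ring). nra.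
Qed.

Lemma jker_imp (s : C) : fst s < -2 -> imp (jker s) (Imp (jker s)).
Proof.
  intros Hs. set (k := - fst s - 1). destruct (ln_growth k 1) as (B & HB & Hln); [lra|unfold k; lra|].
  apply (Imp_bound (jker s) (exp B) 1); [apply pcont_jker|lra|].
  intros t Ht. unfold jker. rewrite Cmod_mult, Cmod_tpow, Cmod_R.
  destruct (exp_gap t Ht) as [G1 G2]. pose proof PI_gt_3 as HPI. pose proof (exp_pos (PI * t)) as Hp.
  assert (G3 : 0 < PI * t * exp (PI * t)) by (mul_pos; assumption).
  rewrite Rabs_pos_eq by (left; apply Rinv_0_lt_compat; lra).
  apply Rle_trans with (/ (PI * t * exp (PI * t)) * exp (- fst s * ln t)).
  { mono_r; [left; apply exp_pos|]. apply Rinv_le_contravar; assumption. }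
  replace (- fst s * ln t) with (ln t + k * ln t) by (unfold k; ring). rewrite exp_plus, exp_ln by assumption.
  apply Rle_trans with (exp (- (PI * t)) * exp (k * ln t)).
  - rewrite exp_Ropp. replace (/ (PI * t * exp (PI * t)) * (t * exp (k * ln t))) with (/ PI * (/ exp (PI * t) * exp (k * ln t))) by (field; lra).
    assert (0 < / PI <= 1) by (split; [apply Rinv_0_lt_compat; lra|rewrite <- Rinv_1; apply Rinv_le_contravar; lra]).
    assert (0 < / exp (PI * t) * exp (k * ln t)) by (mul_pos; [apply Rinv_0_lt_compat, Hp|apply exp_pos]). nra.
  - rewrite <- !exp_plus. apply exp_le. assert (0 <= k) by (unfold k; lra). destruct (Rle_lt_dec t 1) as [H1|H1].
    + assert (ln t <= 0) by (rewrite <- ln_1; destruct H1 as [H1|H1]; [left; apply ln_increasing; lra|right; congruence]). nra.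
    + specialize (Hln t ltac:(lra)). pose proof (Rle_abs (ln t)). nra.
Qed.

(** Termwise integration of the geometric series of [/ (exp (2 * PI * t) - 1)]: each term is a
    scaled Gamma integral, and the powers [n ^ (s - 1)] add up to [zeta (1 - s)]. *)
Lemma jker_zeta zeta (s : C) : is_riemann_zeta zeta -> fst s < -2 ->
  Imp (jker s) = (Cexp ((s - 1) * RtoC (ln (2 * PI))) * Gam1 (- s) * zeta (1 - s))%C.
Proof.
  intros [Hz _] Hs. pose proof PI_RGT_0 as HPI. set (Kc := (Cexp ((s - 1) * RtoC (ln (2 * PI))) * Gam1 (- s))%C).
  assert (Ex : pcont (fun t => RtoC (exp (- (2 * PI * t))))).
  { intros t _. apply (rcont_exp_lin (2 * PI)). }
  assert (HI : forall N, imp (fun t => jker s t * RtoC (exp (- (2 * PI * INR N * t))))%C (Imp (jker s) - Kc * Dsum (1 - s) N)%C).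
  { induction N as [|N IH].
    - simpl. replace (Imp (jker s) - Kc * 0)%C with (Imp (jker s)) by ring.
      eapply imp_ext; [|apply jker_imp, Hs]. intros t _. cbv beta.
      replace (- (2 * PI * 0 * t)) with 0 by ring. rewrite exp_0. ring.
    - change (Dsum (1 - s) (S N)) with (Dsum (1 - s) N + Cpw (RtoC (INR (S N))) (1 - s))%C.
      assert (Hk : 0 < 2 * PI * INR (S N)) by (mul_pos; [lra|apply lt_0_INR; lia]).
      pose proof (gam_scaled s (2 * PI * INR (S N)) Hk ltac:(lra)) as G.
      replace (Cexp ((s - 1) * ln (2 * PI * INR (S N))) * Gam1 (- s))%C with (Kc * Cpw (RtoC (INR (S N))) (1 - s))%C in G.
      2:{ unfold Kc, Cpw. rewrite (ln_mult (2 * PI)), Clog_RtoC by (try apply lt_0_INR; try lia; lra).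
          replace ((s - 1) * RtoC (ln (2 * PI) + ln (INR (S N))))%C
            with ((s - 1) * RtoC (ln (2 * PI)) + - (1 - s) * RtoC (ln (INR (S N))))%C by (rewrite RtoC_plus; ring).
          rewrite Cexp_plus. ring. } replace (Imp (jker s) - Kc * (Dsum (1 - s) N + Cpw (RtoC (INR (S N))) (1 - s)))%C
        with ((Imp (jker s) - Kc * Dsum (1 - s) N) - Kc * Cpw (RtoC (INR (S N))) (1 - s))%C by ring.
      eapply imp_ext; [|apply imp_minus; [| |exact IH|exact G]].
      + intros t Ht. cbv beta. unfold jker. destruct (exp_gap t Ht) as [G1 G2]. pose proof (exp_pos (PI * t)) as Hp.
        assert (G3 : 0 < PI * t * exp (PI * t)) by (mul_pos; assumption).
        assert (G4 : exp (2 * PI * t) - 1 <> 0) by lra. set (X := Cexp _).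
        replace (RtoC (exp (- (2 * PI * INR (S N) * t)))) with (RtoC (exp (- (2 * PI * INR N * t)) * / exp (2 * PI * t))).
        2:{ rewrite <- exp_Ropp, <- exp_plus. do 2 f_equal. rewrite S_INR. ring. }
        set (q := exp (2 * PI * t)) in *. set (y := exp (- (2 * PI * INR N * t))) in *.
        assert (Hq : q <> 0) by (apply Rgt_not_eq, exp_pos).
        transitivity (RtoC (/ (q - 1) * y - y * / q) * X)%C; [rewrite RtoC_minus, !RtoC_mult; ring|].
        replace (/ (q - 1) * y - y * / q) with (/ (q - 1) * (y * / q)) by (field; split; assumption).
        rewrite !RtoC_mult. ring.
      + intros t Ht. apply rcont_mult; [apply pcont_jker, Ht|apply (rcont_exp_lin (2 * PI * INR N))].
      + intros t Ht. apply rcont_mult; [apply (rcont_exp_lin (2 * PI * INR (S N)))|apply pcont_Cexp_ln', Ht]. }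
  destruct (jker_tail s Hs) as (B & HB & Htail). enough (E : (Imp (jker s) - Kc * zeta (1 - s)%C)%C = 0%C).
  { replace (Imp (jker s)) with ((Imp (jker s) - Kc * zeta (1 - s)%C) + Kc * zeta (1 - s)%C)%C by ring. rewrite E. ring. }
  apply Cmod_0_contra. intros Hpos. set (e := Cmod (Imp (jker s) - Kc * zeta (1 - s)%C)) in *.
  pose proof (Cmod_ge_0 Kc) as HK.
  destruct (is_series_Cmod_lim _ _ (Hz (1 - s)%C ltac:(simpl; lra)) (e / (3 * (1 + Cmod Kc)))) as [N1 H1].
  { div_pos; lra. } destruct (INR_unbounded (3 * exp B / e)) as [N2 HN2]. set (N := (N1 + N2)%nat).
  specialize (H1 N ltac:(unfold N; lia)). rewrite Dsum_sum_n in H1.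
  assert (HN3 : INR N2 <= INR (S N)) by (apply le_INR; unfold N; lia).
  assert (H2 : Cmod (Imp (jker s) - Kc * Dsum (1 - s) (S N)) <= exp B / INR (S N)).
  { specialize (HI (S N)). rewrite <- (Imp_eq _ _ HI). replace (exp B / INR (S N)) with (exp B / INR (S N) / 1) by apply Rdiv_1_r.
    apply (Imp_bound _ (exp B / INR (S N)) 1).
    - intros t Ht. apply rcont_mult; [apply pcont_jker, Ht|apply (rcont_exp_lin (2 * PI * INR (S N)))].
    - lra.
    - intros t Ht. apply Htail; [lia|assumption]. } assert (H3 : exp B / INR (S N) <= e / 3).
  { assert (Hp : 0 < INR (S N)) by (apply lt_0_INR; lia).
    apply Rmult_le_reg_r with (INR (S N)); [assumption|]. unfold Rdiv at 1. rewrite Rmult_assoc, Rinv_l, Rmult_1_r by lra.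
    apply Rle_trans with (e / 3 * (3 * exp B / e)); [right; field; lra|]. mono_l; lra. }
  assert (H4 : Cmod Kc * Cmod (Dsum (1 - s) (S N) - zeta (1 - s)%C) <= e / 3).
  { apply Rle_trans with ((1 + Cmod Kc) * (e / (3 * (1 + Cmod Kc)))).
    - apply Rmult_le_compat; [assumption|apply Cmod_ge_0|lra|lra].
    - right. field. lra. }
  assert (e <= exp B / INR (S N) + Cmod Kc * Cmod (Dsum (1 - s) (S N) - zeta (1 - s)%C)); [|lra].
  unfold e. rewrite <- Cmod_mult. replace (Imp (jker s) - Kc * zeta (1 - s)%C)%C
    with ((Imp (jker s) - Kc * Dsum (1 - s) (S N)) + Kc * (Dsum (1 - s) (S N) - zeta (1 - s)%C))%C by ring.
  step_le; [apply Cmod_triangle|]. lra.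
Qed.

Lemma Eper_gap_0 : exists r, 0 < r /\ forall z, 0 < Cmod z < r -> (Eper z - 1)%C <> 0%C /\ Cmod z <= Cmod (Eper z - 1).
Proof.
  destruct (exp_quotient_limit 1 Rlt_0_1) as (r & Hr & H). assert (Ht : Cmod twopii = 2 * PI).
  { unfold twopii, Cmod; simpl. replace (0 * (0 * 1) + 2 * PI * (2 * PI * 1)) with (Rsqr (2 * PI)) by (unfold Rsqr; ring).
    apply sqrt_Rsqr. pose proof PI_RGT_0. lra. } pose proof PI_gt_3.
  exists (r / (2 * PI)). split; [div_pos; lra|]. intros z [Z0 Z]. destruct (H (twopii * z)%C) as (_ & H1 & H2).
  { rewrite Cmod_mult, Ht. split; [mul_pos; lra|].
    apply (Rmult_lt_compat_l (2 * PI)) in Z; [|lra]. replace (2 * PI * (r / (2 * PI))) with r in Z by (field; lra). exact Z. }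
  split; [exact H1|]. fold (Eper z) in H2. rewrite Cmod_mult, Ht in H2. nra.
Qed.

Lemma Eper_0 : Eper 0 = 1%C.
Proof. unfold Eper. rewrite Cmult_0_r. apply Cexp_0. Qed.

(** With this default value the kernels [fup] and [fdn] are 0 at the origin, which is also their
    limit there when [Re s < -1]. *)
Lemma Cinv_0 : (/ 0 = 0)%C.
Proof. apply C_eq; simpl; unfold Rdiv; ring. Qed.

Lemma ccont_0_of_bound (f : C -> C) m K r : 0 < m -> 0 < K -> 0 < r -> f 0%C = 0%C ->
  (forall z, 0 < Cmod z < r -> Cmod (f z) <= K * exp (m * ln (Cmod z))) -> ccont f 0.
Proof.
  intros Hm HK Hr H0 H e He. set (q := exp (ln (e / (2 * K)) / m)). assert (Hek : 0 < e / (2 * K)) by (div_pos; lra).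
  exists (Rmin r q). split; [apply Rmin_pos; [assumption|apply exp_pos]|]. intros w Hw.
  rewrite H0. replace (f w - 0)%C with (f w) by ring. replace (w - 0)%C with w in Hw by ring.
  destruct (Cmod_ge_0 w) as [Hp|Hz].
  - destruct (Rmin_Rgt_l _ _ _ Hw) as [W1 W2]. eapply Rle_lt_trans; [apply H; lra|].
    assert (L : ln (Cmod w) <= ln (e / (2 * K)) / m).
    { rewrite <- (ln_exp (ln (e / (2 * K)) / m)). left. apply ln_increasing; assumption. }
    assert (L2 : m * ln (Cmod w) <= ln (e / (2 * K))).
    { apply Rle_trans with (m * (ln (e / (2 * K)) / m)); [mono_l; lra|right; field; lra]. }
    apply exp_le in L2. rewrite exp_ln in L2 by assumption.
    apply Rle_lt_trans with (K * (e / (2 * K))); [mono_l; lra|].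
    replace (K * (e / (2 * K))) with (e / 2) by (field; lra). lra.
  - symmetry in Hz. apply Cmod_eq_0 in Hz. subst w. rewrite H0, Cmod_0. exact He.
Qed.

(** [Re s < -1] tames the pole of [1/(e(z)-1)] at the corner. *)
Lemma kernels_cont_0 (s : C) : fst s < -1 -> ccont (fup s) 0 /\ ccont (fdn s) 0.
Proof.
  intros Hs. destruct Eper_gap_0 as (r & Hr & Hgap).
  set (Q := exp (Rabs (snd s) * PI)). assert (HQ : 0 < Q) by apply exp_pos.
  assert (Hb : forall z, 0 < Cmod z < r -> Cmod (fdn s z) <= Q * exp ((- fst s - 1) * ln (Cmod z))).
  { intros z Hz. destruct (Hgap z Hz) as [G1 G2]. unfold fdn. rewrite Cmod_mult, Cmod_inv by assumption.
    rewrite Cmod_Cpw. assert (E0 : exp ((- fst s - 1) * ln (Cmod z)) = exp (- fst s * ln (Cmod z)) * / Cmod z).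
    { replace ((- fst s - 1) * ln (Cmod z)) with (- fst s * ln (Cmod z) + - ln (Cmod z)) by ring.
      rewrite exp_plus, (exp_Ropp (ln (Cmod z))), exp_ln by lra. reflexivity. } rewrite E0, exp_plus.
    assert (E1 : exp (snd s * Carg z) <= Q).
    { apply exp_le. step_le; [apply Rle_abs|]. rewrite Rabs_mult. mono_l; [apply Rabs_pos|apply Carg_bound]. }
    assert (E2 : / Cmod (Eper z - 1) <= / Cmod z) by (apply Rinv_le_contravar; lra).
    assert (E3 : 0 < / Cmod (Eper z - 1)) by (apply Rinv_0_lt_compat; lra).
    pose proof (exp_pos (- fst s * ln (Cmod z))) as E4. pose proof (exp_pos (snd s * Carg z)) as E5.
    set (a := exp (- fst s * ln (Cmod z))) in *. replace (Q * (a * / Cmod z)) with ((a * Q) * / Cmod z) by ring.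
    apply Rmult_le_compat; [nra|lra|nra|assumption]. } split.
  - apply (ccont_0_of_bound _ (- fst s - 1) (Q * exp (2 * PI)) (Rmin 1 r)).
    + lra.
    + mul_pos; [assumption|apply exp_pos].
    + apply Rmin_pos; lra.
    + unfold fup. rewrite Eper_0. replace (1 - 1)%C with (RtoC 0) by ring. rewrite Cinv_0. ring.
    + intros z [Z0 Z]. destruct (Rmin_Rgt_l _ _ _ Z) as [Z1 Z2].
      replace (fup s z) with (Eper z * fdn s z)%C by (unfold fup, fdn; ring).
      rewrite Cmod_mult, (Rmult_comm Q), Rmult_assoc. apply Rmult_le_compat; try apply Cmod_ge_0; [|apply Hb; lra].
      rewrite Cmod_Eper. apply exp_le. pose proof (Cmod_snd z) as F. apply Rabs_le_between in F. pose proof PI_gt_3. nra.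
  - apply (ccont_0_of_bound _ (- fst s - 1) Q r); try assumption; try lra.
    unfold fdn. rewrite Eper_0. replace (1 - 1)%C with (RtoC 0) by ring. rewrite Cinv_0. ring.
Qed.

(** [(sg * i) ^ (- s)], the factor that relates [z ^ (- s)] on the imaginary axis to [t ^ (- s)]. *)
Definition quarter (sg : R) (s : C) : C := Cexp (- s * (0, sg * (PI / 2))%R).

Lemma Cpw_imag sg (s : C) t : sg = 1 \/ sg = -1 -> 0 < t ->
  Cpw (0, sg * t) s = (quarter sg s * Cexp (- s * RtoC (ln t)))%C.
Proof.
  intros Hsg Ht. unfold Cpw, quarter. rewrite <- Cexp_plus. f_equal.
  assert (E : Clog (0, sg * t) = (ln t, sg * (PI / 2))).
  { assert (Em : Cmod (0, sg * t) = t).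
    { unfold Cmod; simpl. replace (0 * (0 * 1) + sg * t * (sg * t * 1)) with (Rsqr t).
      - apply sqrt_Rsqr. lra.
      - unfold Rsqr. destruct Hsg as [-> | ->]; ring. }
    unfold Clog, Carg. rewrite Em. f_equal. simpl. rewrite Rplus_0_r. replace (sg * t / t) with sg by (field; lra).
    destruct Hsg as [-> | ->].
    - rewrite atan_1. field.
    - replace (-1) with (- (1)) by ring. rewrite atan_opp, atan_1. field. } rewrite E. ceq; ring.
Qed.

(** Away from 0 the difference of the kernels is [Cpw], whose primitive tends to 0 at the origin;
    the piece next to 0 is small by continuity of the kernels. *)
Lemma kernel_bottom (s : C) : fst s < -2 -> CI (fun t => fup s (t, 0) - fdn s (t, 0))%C 0 (/ 2) = APprim (/ 2) s.
Proof.
  intros Hs. set (k := fun t => (fup s (t, 0) - fdn s (t, 0))%C). destruct (kernels_cont_0 s) as [K1 K2]; [lra|].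
  assert (NE : forall t, 0 < t <= / 2 -> (Eper (t, 0) - 1)%C <> 0%C).
  { intros t Ht. apply (Eper_neq_1 0); [simpl; apply Rabs_le; lra|].
    intros E. apply (f_equal fst) in E. simpl in E. lra. }
  assert (Ek : forall t, 0 < t <= / 2 -> k t = Cpw (RtoC t) s).
  { intros t Ht. unfold k, fup, fdn. specialize (NE t Ht). change (RtoC t) with (t, 0). field. exact NE. }
  assert (Rk : rc_on k 0 (/ 2)).
  { intros t Ht. apply rcont_minus.
    - apply (ccont_rcont (fup s) (fun t => (t, 0))); [|apply rcont_hline].
      destruct (Req_dec t 0) as [->|Hn]; [exact K1|]. apply hol_ccont.
      apply hol_mult; [apply hol_Cpw_base, slit_Re; simpl; lra|].
      apply hol_mult; [apply hol_Eper|apply hol_inv; [apply hol_minus; [apply hol_Eper|apply hol_const]|apply NE; lra]].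
    - apply (ccont_rcont (fdn s) (fun t => (t, 0))); [|apply rcont_hline].
      destruct (Req_dec t 0) as [->|Hn]; [exact K2|]. apply hol_ccont.
      apply hol_mult; [apply hol_Cpw_base, slit_Re; simpl; lra|].
      apply hol_inv; [apply hol_minus; [apply hol_Eper|apply hol_const]|apply NE; lra]. }
  destruct (rc_bounded k 0 (/ 2)) as [M HM]; [lra|exact Rk|].
  assert (HM0 : 0 <= M) by (step_le; [apply Cmod_ge_0|apply (HM 0); lra]).
  assert (Hs1 : s <> 1%C) by (intros ->; simpl in Hs; lra). enough (E : (CI k 0 (/ 2) - APprim (/ 2) s)%C = 0%C).
  { replace (CI k 0 (/ 2)) with ((CI k 0 (/ 2) - APprim (/ 2) s) + APprim (/ 2) s)%C by ring. rewrite E. ring. }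
  apply Cmod_0_contra. intros Hpos. set (e := Cmod (CI k 0 (/ 2) - APprim (/ 2) s)) in *.
  set (a := Rmin (/ 2) (e / (2 * (M + 1)))). assert (Ha : 0 < a) by (apply Rmin_pos; [lra|div_pos; lra]).
  assert (Ha1 : a <= / 2) by apply Rmin_l. assert (Ha2 : (M + 1) * a <= e / 2).
  { apply Rle_trans with ((M + 1) * (e / (2 * (M + 1)))); [mono_l; [lra|apply Rmin_r]|right; field; lra]. }
  assert (E1 : CI k a (/ 2) = (APprim (/ 2) s - APprim a s)%C).
  { rewrite (CI_ext k (fun t => Cpw (t, 0) s)) by (try lra; intros; apply Ek; lra).
    apply (hline_int (fun z => Cpw z (s - 1) / (1 - s))%C (fun z => Cpw z s) 0); [assumption| |].
    - intros t Ht. apply cder_Cpw_prim; [apply slit_Re; simpl; lra|assumption].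
    - intros t Ht. apply hol_ccont, hol_Cpw_base, slit_Re. simpl; lra. } assert (B1 : Cmod (CI k 0 a) <= M * (a - 0)).
  { apply CI_bound; [lra|intros t Ht; apply Rk; lra|intros t Ht; apply HM; lra]. }
  assert (B2 : Cmod (APprim a s) <= a).
  { assert (Hm : 1 <= Cmod (1 - s)).
    { step_le; [|apply Cmod_fst]. simpl. rewrite Rabs_pos_eq; lra. }
    unfold APprim. rewrite Cmod_div by (apply Cmod_neq_0; lra). rewrite Cmod_Cpw_real by assumption.
    assert (Hln : ln a <= 0) by (rewrite <- ln_1; left; apply ln_increasing; lra).
    assert (Hexp : exp (- fst (s - 1)%C * ln a) <= a).
    { rewrite <- (exp_ln a) at 2 by assumption. apply exp_le. simpl. nra. }
    apply Rle_trans with (exp (- fst (s - 1)%C * ln a) / 1).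
    - mono_l; [left; apply exp_pos|]. apply Rinv_le_contravar; lra.
    - rewrite Rdiv_1_r. exact Hexp. } assert (e <= Cmod (CI k 0 a) + Cmod (APprim a s)); [|lra].
  unfold e. rewrite <- (CI_chasles k 0 a (/ 2)) by (try lra; exact Rk). rewrite E1.
  replace (CI k 0 a + (APprim (/ 2) s - APprim a s) - APprim (/ 2) s)%C with (CI k 0 a - APprim a s)%C by ring.
  apply Cmod_triangle_minus.
Qed.

(** The line [Re z = / 2] is moved to the imaginary axis: for such [s] the zero of [z ^ (- s)] at
    the origin outweighs the pole of the kernels. On the axis both kernels are multiples of
    [jker]. *)
Lemma abel_plana_left (s : C) : fst s < -2 -> APW (/ 2) s = (Ci * (quarter (-1) s - quarter 1 s) * Imp (jker s))%C.
Proof.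
  intros Hs. destruct (kernels_cont_0 s) as [K1 K2]; [lra|].
  assert (NE : forall z : C, 0 <= fst z <= / 2 -> z <> 0%C -> slit z /\ (Eper z - 1)%C <> 0%C).
  { intros z Hz Hn. split; [|apply (Eper_neq_1 0); [simpl; apply Rabs_le; lra|exact Hn]].
    destruct (Req_dec (snd z) 0) as [H|H]; [|apply slit_Im, H].
    apply slit_Re. destruct (proj1 Hz) as [H0|H0]; [exact H0|]. exfalso. apply Hn. apply C_eq; simpl; lra. }
  assert (Hup : forall z : C, 0 <= fst z <= / 2 -> z <> 0%C -> hol (fup s) z) by (intros; apply hol_fup; apply NE; assumption).
  assert (Hdn : forall z : C, 0 <= fst z <= / 2 -> z <> 0%C -> hol (fdn s) z) by (intros; apply hol_fdn; apply NE; assumption).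
  assert (Cup : forall z : C, 0 <= fst z <= / 2 -> ccont (fup s) z).
  { intros z Hz. destruct (classic (z = 0%C)) as [->|Hn]; [exact K1|apply hol_ccont, Hup; assumption]. }
  assert (Cdn : forall z : C, 0 <= fst z <= / 2 -> ccont (fdn s) z).
  { intros z Hz. destruct (classic (z = 0%C)) as [->|Hn]; [exact K2|apply hol_ccont, Hdn; assumption]. }
  set (u0 := fun t => fup s (0, t)). set (d0 := fun t => fdn s (0, - t)).
  assert (U0 : forall t, 0 < t -> u0 t = (- quarter 1 s * jker s t)%C /\ d0 t = (quarter (-1) s * jker s t)%C).
  { intros t Ht. unfold u0, d0, fup, fdn, jker. rewrite !Eper_int0.
    replace (0, t) with (0, 1 * t) by (f_equal; ring). replace (0, - t) with (0, -1 * t) by (f_equal; ring). rewrite !Cpw_imag by auto.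
    destruct (exp_gap t Ht) as [G1 G2]. pose proof (exp_pos (PI * t)).
    assert (G3 : 0 < PI * t * exp (PI * t)) by (mul_pos; assumption).
    replace (- (2 * PI * - t)) with (2 * PI * t) by ring. rewrite exp_Ropp. set (q := exp (2 * PI * t)) in *.
    assert (Hq : 0 < q) by apply exp_pos. assert (Hq1 : / q - 1 <> 0).
    { intros E. assert (E0 : q * (/ q - 1) = 0) by (rewrite E; ring). rewrite Rmult_minus_distr_l, Rinv_r in E0; lra. }
    rewrite <- !RtoC_minus, <- !RtoC_inv by lra. split; [|ring]. rewrite <- RtoC_mult.
    replace (/ q * / (/ q - 1)) with (- / (q - 1)) by (field; repeat split; lra). rewrite RtoC_opp. ring. }
  assert (Ru : forall t, 0 <= t -> rcont u0 t).
  { intros t Ht. apply (ccont_rcont (fup s) (fun t => (0, t))); [apply Cup; simpl; lra|apply rcont_vline]. }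
  assert (Rd : forall t, 0 <= t -> rcont d0 t).
  { intros t Ht. apply (ccont_rcont (fdn s) (fun t => (0, - t))); [apply Cdn; simpl; lra|].
    split; [apply continuous_const|]. cont_derive. } pose proof (jker_imp s Hs) as IJ. set (J := Imp (jker s)) in *.
  assert (IU : imp u0 (- quarter 1 s * J)%C).
  { eapply imp_ext; [|apply imp_scal; [apply pcont_jker|exact IJ]]. intros t Ht. symmetry. apply U0, Ht. }
  assert (ID : imp d0 (quarter (-1) s * J)%C).
  { eapply imp_ext; [|apply imp_scal; [apply pcont_jker|exact IJ]]. intros t Ht. symmetry. apply U0, Ht. }
  destruct (kernel_half (/ 2) s ltac:(lra)) as [Vu Vd].
  { intros t. replace (/ 2) with (INR 0 + / 2) by (simpl; lra). apply Eper_half. }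
  assert (T : forall sg, sg = 1 \/ sg = -1 -> tends (fun H => CI (apv sg (/ 2) s) 0 H) (APV sg (/ 2) s)).
  { intros sg Hsg. apply imp_from0; [intros; apply rcont_apv; lra|apply APV_ok; [exact Hsg|lra]]. }
  pose proof (tends_identity _ _ _ _ _ _ _ _ _ (APprim (/ 2) s) Ci (- Ci)%C (- Ci)%C (- Ci)%C
    (T 1 ltac:(auto)) (T (-1) ltac:(auto)) (imp_from0 u0 _ Ru IU) (imp_from0 d0 _ Rd ID)
    (horizontal_tails s 0 (/ 2) ltac:(lra) ltac:(lra))) as Lim.
  transitivity (0 + Ci * (quarter (-1) s - quarter 1 s) * J)%C; [|ring]. rewrite <- Lim; [unfold APW; ring|].
  intros H HH. assert (R1 : RI (fup s) 0 (/ 2) 0 H = 0%C).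
  { apply (RI_removable _ _ _ _ _ 0%C); try lra; [intros z [Z1 Z2]; apply Cup; lra|intros z [Z1 Z2] Hn; apply Hup; [lra|exact Hn]]. }
  assert (R2 : RI (fdn s) 0 (/ 2) (- H) 0 = 0%C).
  { apply (RI_removable _ _ _ _ _ 0%C); try lra; [intros z [Z1 Z2]; apply Cdn; lra|intros z [Z1 Z2] Hn; apply Hdn; [lra|exact Hn]]. }
  assert (F0 : CI (fun t => fdn s (0, t)) (- H) 0 = CI d0 0 H).
  { replace (CI (fun t => fdn s (0, t)) (- H) 0) with (CI (fun t => fdn s (0, t)) (- H) (- 0)) by (f_equal; ring).
    apply (CI_reflect (fun t => fdn s (0, t)) 0 H); [lra|]. apply rc_v. intros t _. apply Cdn. simpl. lra. }
  unfold RI in R1, R2. rewrite F0, Vd in R2 by exact HH.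
  rewrite (CI_ext (fun t => fup s (/ 2, t)) (apv 1 (/ 2) s)) in R1 by (try lra; intros; apply Vu). fold u0 in R1.
  rewrite <- (kernel_bottom s Hs), CI_minus; [|lra|apply rc_h; intros; apply Cup; simpl; lra|apply rc_h; intros; apply Cdn; simpl; lra].
  transitivity (0 + 0)%C; [|ring]. rewrite <- R1 at 1. rewrite <- R2. ring.
Qed.

Lemma Dsum_conj (s : C) N : Dsum (Cconj s) N = Cconj (Dsum s N).
Proof.
  induction N as [|N IH].
  - simpl. ceq; ring.
  - change (Dsum (Cconj s) (S N)) with (Dsum (Cconj s) N + Cpw (RtoC (INR (S N))) (Cconj s))%C.
    change (Dsum s (S N)) with (Dsum s N + Cpw (RtoC (INR (S N))) s)%C. rewrite IH.
    replace (Cpw (RtoC (INR (S N))) (Cconj s)) with (Cconj (Cpw (RtoC (INR (S N))) s)); [ceq; ring|].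
    unfold Cpw. rewrite <- Cexp_conj, Clog_RtoC by (apply lt_0_INR; lia). f_equal. ceq; ring.
Qed.

Lemma zeta_conj_right zeta (s : C) : is_riemann_zeta zeta -> 1 < fst s -> zeta (Cconj s) = Cconj (zeta s).
Proof.
  intros [Hz _] Hs. enough (E : (zeta (Cconj s) - Cconj (zeta s))%C = 0%C).
  { replace (zeta (Cconj s)) with ((zeta (Cconj s) - Cconj (zeta s)) + Cconj (zeta s))%C by ring. rewrite E. ring. }
  apply Cmod_0_contra. intros Hpos. set (e := Cmod (zeta (Cconj s) - Cconj (zeta s))) in *.
  destruct (is_series_Cmod_lim _ _ (Hz s Hs) (e / 3)) as [N1 H1]; [lra|].
  destruct (is_series_Cmod_lim _ _ (Hz (Cconj s) ltac:(simpl; lra)) (e / 3)) as [N2 H2]; [lra|].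
  specialize (H1 (N1 + N2)%nat ltac:(lia)). specialize (H2 (N1 + N2)%nat ltac:(lia)).
  rewrite Dsum_sum_n in H1, H2. rewrite Dsum_conj in H2. set (X := Dsum s (S (N1 + N2))) in *.
  assert (e <= Cmod (X - zeta s) + Cmod (Cconj X - zeta (Cconj s))); [|lra]. rewrite <- (Cmod_conj (X - zeta s)).
  unfold e. replace (zeta (Cconj s) - Cconj (zeta s))%C
    with (Cconj (X - zeta s) - (Cconj X - zeta (Cconj s)))%C by (ceq; ring). apply Cmod_triangle_minus.
Qed.

Lemma hol_conj (f : C -> C) (z : C) : hol f (Cconj z) -> hol (fun w => Cconj (f (Cconj w))) z.
Proof.
  intros [d Hd]. exists (Cconj d). intros e He. destruct (Hd e He) as (r & Hr & H).
  exists r. split; [assumption|]. intros w Hw. assert (E : Cmod (Cconj w - Cconj z) = Cmod (w - z)).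
  { rewrite <- (Cmod_conj (w - z)). f_equal. ceq; ring. }
  specialize (H (Cconj w) ltac:(rewrite E; exact Hw)). rewrite E in H. rewrite <- Cmod_conj.
  replace (Cconj (Cconj (f (Cconj w)) - Cconj (f (Cconj z)) - Cconj d * (w - z)))%C
    with (f (Cconj w) - f (Cconj z) - d * (Cconj w - Cconj z))%C by (ceq; ring). exact H.
Qed.

(** [zeta_star s = conj (zeta (1 - conj s))]: the point [1 - conj s] has the same ordinate as [s]. *)
Definition zeta_star (zeta : C -> C) (s : C) : C := Cconj (zeta (1 - Cconj s)%C).

(** [Ci * (quarter 1 s - quarter (-1) s)] is [2 sin (pi s / 2)], so this is the usual factor [2 (2
    pi)^(s-1) sin (pi s / 2) Gamma (1 - s)], with [Gamma (1 - s)] continued to [Re s < m]. *)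
Definition chi_factor (m : nat) (s : C) : C :=
  (Ci * (quarter 1 s - quarter (-1) s) * Cexp ((s - 1) * RtoC (ln (2 * PI))) * Gam1 (RtoC (INR m) - s) / poch m s)%C.

Lemma functional_equation_left zeta m (s : C) : is_riemann_zeta zeta -> fst s < -2 -> 0 < snd s ->
  zeta s = (chi_factor m s * zeta_star zeta s)%C.
Proof.
  intros Hz Hs Ht. rewrite zeta_abel_plana, abel_plana_left, (jker_zeta zeta) by assumption.
  unfold chi_factor, zeta_star. rewrite Gam1_shift by lra.
  replace (1 - s)%C with (Cconj (1 - Cconj s))%C by (ceq; ring).
  rewrite zeta_conj_right by (try assumption; simpl; lra). field. apply poch_neq_0, Ht.
Qed.

Lemma hol_chi m (s : C) : fst s < INR m -> 0 < snd s -> hol (chi_factor m) s.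
Proof.
  intros Hs Ht. unfold chi_factor. apply hol_div; [|apply hol_poch|apply poch_neq_0, Ht].
  assert (Q : forall sg, hol (quarter sg) s).
  { intros sg. apply hol_Cexp_comp, hol_mult; [apply hol_opp, hol_id|apply hol_const]. }
  apply hol_mult; [apply hol_mult; [apply hol_mult; [apply hol_const|apply hol_minus; apply Q]|]|].
  - apply hol_Cexp_comp, hol_mult; [apply hol_minus_const|apply hol_const].
  - apply (hol_comp (fun s => RtoC (INR m) - s)%C Gam1); [apply hol_minus; [apply hol_const|apply hol_id]|].
    apply Gam1_ok. simpl. lra.
Qed.

(** Continuation along a horizontal segment from [-4 + i t], around which [functional_equation_left]
    applies. *)
Theorem functional_equation zeta m (s : C) : is_riemann_zeta zeta -> fst s < INR m -> 0 < snd s ->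
  zeta s = (chi_factor m s * zeta_star zeta s)%C.
Proof.
  intros Hz Hs Ht. destruct s as [x t]; simpl in Hs, Ht.
  set (D := fun s => (zeta s - chi_factor m s * zeta_star zeta s)%C). enough (E : D (x, t) = 0%C).
  { unfold D in E. replace (zeta (x, t)) with ((zeta (x, t) - chi_factor m (x, t) * zeta_star zeta (x, t)) + chi_factor m (x, t) * zeta_star zeta (x, t))%C by ring.
    rewrite E. ring. } pose proof (pos_INR m) as Hm. assert (Hr : 0 < Rmin t (INR m - Rmax x (-4))).
  { apply Rmin_pos; [assumption|]. apply Rmax_case_strong; lra. }
  apply (identity_segment D (-4, t) (x, t) (Rmin 1 t) (Rmin t (INR m - Rmax x (-4)))); [apply Rmin_pos; lra|exact Hr| |].
  - intros u w Hu Hw.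
    assert (Hw1 : Cmod (w - ((-4, t)%R + RtoC u * ((x, t)%R - (-4, t)%R))) < t) by (eapply Rlt_le_trans; [exact Hw|apply Rmin_l]).
    assert (Hw2 : Cmod (w - ((-4, t)%R + RtoC u * ((x, t)%R - (-4, t)%R))) < INR m - Rmax x (-4)) by (eapply Rlt_le_trans; [exact Hw|apply Rmin_r]).
    pose proof (Cmod_snd (w - ((-4, t)%R + RtoC u * ((x, t)%R - (-4, t)%R)))%C) as F2.
    pose proof (Cmod_fst (w - ((-4, t)%R + RtoC u * ((x, t)%R - (-4, t)%R)))%C) as F1.
    simpl in F1, F2. apply Rabs_le_between in F1. apply Rabs_le_between in F2. assert (W2 : 0 < snd w) by lra.
    assert (W1 : fst w < INR m).
    { pose proof (Rmax_l x (-4)). pose proof (Rmax_r x (-4)). set (M := Rmax x (-4)) in *.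
      assert (-4 + (u * (x + - -4) - 0 * (t + - t)) <= M) by nra. lra. }
    unfold D. apply hol_minus; [apply zeta_hol; [assumption|apply Im_pos_neq_1, W2]|].
    apply hol_mult; [apply hol_chi; assumption|]. unfold zeta_star.
    apply (hol_conj (fun v => zeta (1 - v)%C)), (hol_comp (fun v => 1 - v)%C zeta); [apply hol_minus; [apply hol_const|apply hol_id]|].
    apply zeta_hol; [assumption|]. apply Im_pos_neq_1. simpl. lra.
  - intros w Hw. unfold D. destruct (Rmin_Rgt_l _ _ _ Hw) as [H1 H2].
    pose proof (Cmod_fst (w - (-4, t)%R)%C) as F1. pose proof (Cmod_snd (w - (-4, t)%R)%C) as F2.
    simpl in F1, F2. apply Rabs_le_between in F1. apply Rabs_le_between in F2.
    rewrite <- (functional_equation_left zeta m w Hz) by lra. ring.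
Qed.

(** At [1 - beta + i gamma] the factor [zeta_star] is the conjugate of [zeta rho]. *)
Corollary zeta_zero_reflect zeta (rho : C) : is_riemann_zeta zeta -> 0 < snd rho -> zeta rho = 0%C ->
  zeta (1 - fst rho, snd rho) = 0%C.
Proof.
  intros Hz Ht H0. destruct (INR_unbounded (1 - fst rho)) as [m Hm].
  rewrite (functional_equation zeta m) by (try assumption; simpl; lra).
  unfold zeta_star. replace (1 - Cconj (1 - fst rho, snd rho)%R)%C with rho by (ceq; destruct rho; simpl; ring).
  rewrite H0. ceq; ring.
Qed.

(** For [sigma >= 3], [(n + 1) ^ (- sigma) <= 2 ^ (- sigma) * (2 / (n + 1)) ^ 3], and the cubes are
    dominated by the telescoping differences [4 * (/ n - / (n + 1))]. *)
Lemma Dsum_right (s : C) N : 3 <= fst s -> (1 <= N)%nat ->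
  Cmod (Dsum s N - 1) <= 4 * exp (- fst s * ln 2) * (1 - / INR N).
Proof.
  intros Hs HN. induction N as [|N IH]; [lia|]. change (Dsum s (S N)) with (Dsum s N + Cpw (RtoC (INR (S N))) s)%C.
  destruct N as [|N].
  - simpl. replace (0 + Cpw 1 s - 1)%C with (RtoC 0).
    + rewrite Cmod_0, Rinv_1. lra.
    + unfold Cpw. rewrite Clog_RtoC, ln_1 by lra. replace (- s * 0)%C with (RtoC 0) by ring. rewrite Cexp_0. ring.
  - specialize (IH ltac:(lia)). set (n := S N) in *. assert (Hn1 : 1 <= INR n) by (apply (le_INR 1); unfold n; lia).
    replace (Dsum s n + Cpw (RtoC (INR (S n))) s - 1)%C with ((Dsum s n - 1) + Cpw (RtoC (INR (S n))) s)%C by ring.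
    step_le; [apply Cmod_triangle|]. rewrite Cmod_Cpw_real, S_INR by (apply lt_0_INR; lia). set (x := INR n) in *.
    assert (Hb : exp (- fst s * ln (x + 1)) <= 4 * exp (- fst s * ln 2) * (/ x - / (x + 1))).
    { replace (x + 1) with (2 * ((x + 1) / 2)) at 1 by field. rewrite ln_mult by lra.
      rewrite Rmult_plus_distr_l, exp_plus. assert (Hl : 0 <= ln ((x + 1) / 2)).
      { rewrite <- ln_1. destruct (Rle_lt_or_eq_dec 1 ((x + 1) / 2)) as [H|H]; [lra|left; apply ln_increasing; lra|rewrite <- H; lra]. }
      assert (Hc : exp (- fst s * ln ((x + 1) / 2)) <= 8 / (x + 1) ^ 3).
      { apply Rle_trans with (exp (- (3 * ln ((x + 1) / 2)))); [apply exp_le; nra|].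
        replace (3 * ln ((x + 1) / 2)) with (ln ((x + 1) / 2) + (ln ((x + 1) / 2) + ln ((x + 1) / 2))) by ring.
        rewrite exp_Ropp, !exp_plus, exp_ln by lra. right. field. lra. } pose proof (exp_pos (- fst s * ln 2)) as Hp.
      replace (4 * exp (- fst s * ln 2) * (/ x - / (x + 1))) with (exp (- fst s * ln 2) * (4 / (x * (x + 1)))) by (field; lra).
      mono_l; [lra|]. step_le; [exact Hc|].
      apply Rmult_le_reg_r with (x * (x + 1) ^ 3); [mul_pos; [lra|apply pow_lt; lra]|].
      replace (8 / (x + 1) ^ 3 * (x * (x + 1) ^ 3)) with (8 * x) by (field; lra).
      replace (4 / (x * (x + 1)) * (x * (x + 1) ^ 3)) with (4 * (x + 1) ^ 2) by (field; lra). nra. } lra.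
Qed.

Lemma zeta_right zeta (s : C) : is_riemann_zeta zeta -> 3 <= fst s -> Cmod (zeta s - 1) <= 4 * exp (- fst s * ln 2).
Proof.
  intros [Hz _] Hs. apply Rnot_lt_le. intros Hlt. set (e := Cmod (zeta s - 1) - 4 * exp (- fst s * ln 2)) in *.
  assert (Hs1 : 1 < Re s) by (unfold Re; lra).
  destruct (is_series_Cmod_lim _ _ (Hz s Hs1) e) as [N H1]; [unfold e; lra|].
  specialize (H1 N (le_n N)). rewrite Dsum_sum_n in H1. pose proof (Dsum_right s (S N) Hs ltac:(lia)) as H2.
  assert (H3 : 0 < / INR (S N)) by (apply Rinv_0_lt_compat, lt_0_INR; lia). pose proof (exp_pos (- fst s * ln 2)).
  assert (Cmod (zeta s - 1) <= Cmod (Dsum s (S N) - 1) + Cmod (Dsum s (S N) - zeta s)).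
  { replace (zeta s - 1)%C with ((Dsum s (S N) - 1) - (Dsum s (S N) - zeta s))%C by ring. apply Cmod_triangle_minus. }
  unfold e in H1. nra.
Qed.

(** From [Re s = 3] on, the bound of [zeta_right] is at most [4 / 8 < 1]. This is why a zero lies
    within [5 / 2] of the critical line. *)
Lemma zeta_nonzero_right zeta (s : C) : is_riemann_zeta zeta -> 3 <= fst s -> zeta s <> 0%C.
Proof.
  intros Hz Hs E. pose proof (zeta_right zeta s Hz Hs) as H. rewrite E in H.
  replace (0 - 1)%C with (- (1))%C in H by ring. rewrite Cmod_opp, Cmod_1 in H.
  assert (exp (- fst s * ln 2) <= / 8); [|lra]. replace (/ 8) with (exp (- (3 * ln 2))).
  - apply exp_le. assert (0 < ln 2) by (rewrite <- ln_1; apply ln_increasing; lra). nra.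
  - rewrite exp_Ropp. f_equal. replace (3 * ln 2) with (ln 2 + (ln 2 + ln 2)) by ring. rewrite !exp_plus, exp_ln by lra. ring.
Qed.

(** * Montgomery and Vaughan's Hilbert inequality *)

Fixpoint rs (f : nat -> R) (n : nat) : R := match n with O => 0 | S m => rs f m + f m end.

Lemma rs_ext f g n : (forall i, (i < n)%nat -> f i = g i) -> rs f n = rs g n.
Proof.
  induction n as [|n IH]; intros H; simpl; [reflexivity|].
  rewrite IH, H by (try lia; intros; apply H; lia). reflexivity.
Qed.
Lemma rs_plus f g n : rs (fun i => f i + g i) n = rs f n + rs g n.
Proof. induction n as [|n IH]; simpl; [ring|rewrite IH; ring]. Qed.
Lemma rs_minus f g n : rs (fun i => f i - g i) n = rs f n - rs g n.
Proof. induction n as [|n IH]; simpl; [ring|rewrite IH; ring]. Qed.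
Lemma rs_scal c f n : rs (fun i => c * f i) n = c * rs f n.
Proof. induction n as [|n IH]; simpl; [ring|rewrite IH; ring]. Qed.
Lemma rs_scal_r c f n : rs (fun i => f i * c) n = rs f n * c.
Proof. induction n as [|n IH]; simpl; [ring|rewrite IH; ring]. Qed.
Lemma rs_0 n : rs (fun _ => 0) n = 0.
Proof. induction n as [|n IH]; simpl; [ring|rewrite IH; ring]. Qed.
Lemma rs_const c n : rs (fun _ => c) n = INR n * c.
Proof. induction n as [|n IH]; [simpl; ring|]. rewrite S_INR. simpl rs. rewrite IH. ring. Qed.
Lemma rs_le f g n : (forall i, (i < n)%nat -> f i <= g i) -> rs f n <= rs g n.
Proof.
  induction n as [|n IH]; intros H; simpl; [lra|].
  pose proof (H n ltac:(lia)). pose proof (IH ltac:(intros; apply H; lia)). lra.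
Qed.
Lemma rs_nonneg f n : (forall i, (i < n)%nat -> 0 <= f i) -> 0 <= rs f n.
Proof. intros H. rewrite <- (rs_0 n). apply rs_le, H. Qed.
Lemma rs_swap f n m : rs (fun i => rs (fun j => f i j) m) n = rs (fun j => rs (fun i => f i j) n) m.
Proof.
  induction n as [|n IH]; simpl; [rewrite rs_0; reflexivity|]. rewrite IH, <- rs_plus. reflexivity.
Qed.
Lemma rs_delta f n k : (k < n)%nat -> rs (fun i => if Nat.eqb k i then f i else 0) n = f k.
Proof.
  intros Hk. induction n as [|n IH]; [lia|]. simpl. destruct (Nat.eqb_spec k n) as [->|Hn].
  - rewrite (rs_ext _ (fun _ => 0)); [rewrite rs_0; ring|]. intros i Hi.
    destruct (Nat.eqb_spec n i); [lia|reflexivity].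
  - rewrite IH by lia. ring.
Qed.
Lemma rs_mult f g n m : rs f n * rs g m = rs (fun i => rs (fun j => f i * g j) m) n.
Proof. rewrite <- rs_scal_r. apply rs_ext. intros. rewrite <- rs_scal. reflexivity. Qed.
(** Lagrange's identity: the difference of the two sides is half the double sum of
    [(f i * g j - f j * g i) ^ 2]. *)
Lemma rs_cauchy_schwarz f g n : rs (fun i => f i * g i) n ^ 2 <= rs (fun i => f i ^ 2) n * rs (fun i => g i ^ 2) n.
Proof.
  assert (H : 0 <= rs (fun i => rs (fun j => (f i * g j - f j * g i) ^ 2) n) n).
  { apply rs_nonneg. intros. apply rs_nonneg. intros. apply pow2_ge_0. }
  rewrite (rs_ext _ (fun i => f i ^ 2 * rs (fun j => g j ^ 2) n + g i ^ 2 * rs (fun j => f j ^ 2) n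
     - 2 * (f i * g i) * rs (fun j => f j * g j) n)) in H.
  - rewrite rs_minus, rs_plus, !rs_scal_r, rs_scal in H. nra.
  - intros i _. rewrite <- !rs_scal, <- rs_plus, <- rs_minus. apply rs_ext. intros. ring.
Qed.

(** Matsuoka's evaluation of [sum 1/k^2]: integrating [cos^(2n)] by parts twice makes the ratios [WJ n / WI n] telescope. *)
Definition WI (n : nat) : R := RInt (fun x => cos x ^ (2 * n)) 0 (PI / 2).
Definition WJ (n : nat) : R := RInt (fun x => x ^ 2 * cos x ^ (2 * n)) 0 (PI / 2).

Lemma WI_ex n : ex_RInt (fun x => cos x ^ n) 0 (PI / 2).
Proof.
  apply (ex_RInt_continuous (V := RC)). intros z _. cont_derive.
Qed.
Lemma WJ_ex n : ex_RInt (fun x => x ^ 2 * cos x ^ n) 0 (PI / 2).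
Proof.
  apply (ex_RInt_continuous (V := RC)). intros z _. cont_derive.
Qed.

Lemma WI_pos n : 0 < WI n.
Proof.
  pose proof PI_RGT_0. apply RInt_gt_0; [lra| |].
  - intros x Hx. apply pow_lt, cos_gt_0; lra.
  - intros x _. cont_derive.
Qed.
Lemma WJ_nonneg n : 0 <= WJ n.
Proof.
  pose proof PI_RGT_0. apply RInt_ge_0; [lra|apply WJ_ex|].
  intros x Hx. apply Rmult_le_pos; [apply pow2_ge_0|apply pow_le, cos_ge_0; lra].
Qed.

Lemma RInt_lin2 (a b : R) (f g : R -> R) x y : ex_RInt f x y -> ex_RInt g x y ->
  RInt (fun t => a * f t + b * g t) x y = a * RInt f x y + b * RInt g x y.
Proof.
  intros Hf Hg. apply is_RInt_unique. apply (is_RInt_plus (V := RN) (fun t => a * f t) (fun t => b * g t));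
    apply (is_RInt_scal (V := RN)); apply (RInt_correct (V := RC)); assumption.
Qed.

Lemma WI_rec n : (2 * INR n + 2) * WI (S n) = (2 * INR n + 1) * WI n.
Proof.
  pose proof PI_RGT_0 as HPI.
  assert (E : RInt (fun x => (2 * INR n + 2) * cos x ^ (2 * S n) + - (2 * INR n + 1) * cos x ^ (2 * n)) 0 (PI / 2) = 0).
  { apply is_RInt_unique.
    replace 0 with (sin (PI / 2) * cos (PI / 2) ^ (2 * n + 1) - sin 0 * cos 0 ^ (2 * n + 1)) at 2.
    2:{ rewrite cos_PI2, sin_0, pow_add. simpl. ring. }
    apply (is_RInt_derive (V := RC) (fun x => sin x * cos x ^ (2 * n + 1))).
    - intros x _. auto_derive; [auto|]. replace (2 * S n)%nat with (2 * n + 2)%nat by lia.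
      replace (Init.Nat.pred (n + (n + 0) + 1)) with (2 * n)%nat by lia.
      replace (n + (n + 0) + 1)%nat with (2 * n + 1)%nat by lia.
      rewrite !pow_add. replace (INR (2 * n + 1)) with (2 * INR n + 1) by (rewrite plus_INR, mult_INR; simpl; ring).
      pose proof (sin2_cos2 x) as S. unfold Rsqr in S.
      set (c := cos x) in *. set (s := sin x) in *. set (q := c ^ (2 * n)) in *.
      assert (S2 : s * s = 1 - c * c) by lra. simpl (_ ^ 1). simpl (_ ^ 2).
      match goal with |- ?l = ?r => assert (D : l - r = q * (2 * INR n + 1) * (1 - c * c - s * s)) by ring end.
      rewrite S2 in D. assert (D2 : q * (2 * INR n + 1) * (1 - c * c - (1 - c * c)) = 0) by ring. lra.
    - intros x _. cont_derive. } rewrite RInt_lin2 in E by apply WI_ex. unfold WI. lra.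
Qed.

Lemma WJ_rec n : WI (S n) = (INR n + 1) * (2 * INR n + 1) * WJ n - 2 * (INR n + 1) ^ 2 * WJ (S n).
Proof.
  pose proof PI_RGT_0 as HPI. set (k := INR n + 1).
  assert (E : RInt (fun x => 1 * cos x ^ (2 * S n) + 1 * (2 * k ^ 2 * (x ^ 2 * cos x ^ (2 * S n)) + - (k * (2 * INR n + 1)) * (x ^ 2 * cos x ^ (2 * n)))) 0 (PI / 2) = 0).
  { replace (2 * S n)%nat with (2 * n + 2)%nat by lia.
    assert (Hp : INR (2 * n) = 2 * INR n) by (rewrite mult_INR; reflexivity).
    set (p := (2 * n)%nat) in *. clearbody p. apply is_RInt_unique.
    set (F := fun x => x * cos x ^ (p + 2) + k * (x ^ 2 * (sin x * cos x ^ (p + 1)))).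
    replace 0 with (F (PI / 2) - F 0) at 2.
    2:{ unfold F. rewrite cos_PI2, sin_0, !pow_add. simpl. ring. } apply (is_RInt_derive (V := RC) F).
    - intros x _. unfold F. auto_derive; [auto|]. replace (Init.Nat.pred (p + 2)) with (p + 1)%nat by lia.
      replace (Init.Nat.pred (p + 1)) with p by lia. rewrite !pow_add, !plus_INR, Hp.
      replace (INR 2) with 2 by reflexivity. replace (INR 1) with 1 by reflexivity.
      pose proof (sin2_cos2 x) as S. unfold Rsqr in S.
      set (c := cos x) in *. set (s := sin x) in *. set (q := c ^ p) in *. assert (S2 : s * s = 1 - c * c) by lra.
      match goal with |- ?l = ?r => assert (D : l - r = q * (k * (x * x)) * (2 * k - 1) * (1 - c * c - s * s)) by (unfold k; ring) end.
      rewrite S2 in D. assert (D2 : q * (k * (x * x)) * (2 * k - 1) * (1 - c * c - (1 - c * c)) = 0) by ring. lra.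
    - intros x _. cont_derive. } rewrite RInt_lin2 in E.
  - rewrite RInt_lin2 in E by apply WJ_ex. unfold WI, WJ. lra.
  - apply WI_ex.
  - apply (ex_RInt_plus (V := RN) (fun x => 2 * k ^ 2 * (x ^ 2 * cos x ^ (2 * S n))) (fun x => - (k * (2 * INR n + 1)) * (x ^ 2 * cos x ^ (2 * n))));
    apply (ex_RInt_scal (V := RN)), WJ_ex.
Qed.

Definition zsum (n : nat) : R := rs (fun k => / (INR k + 1) ^ 2) n.

(** The sum telescopes to [2 * (WJ 0 / WI 0 - WJ n / WI n)]; the last ratio is nonnegative, and
    [WJ 0 / WI 0 = PI ^ 2 / 12]. *)
Lemma zsum_bound n : zsum n <= PI ^ 2 / 6.
Proof.
  pose proof PI_RGT_0 as HPI. assert (E : zsum n = 2 * (WJ 0 / WI 0 - WJ n / WI n)).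
  { induction n as [|n IH].
    - unfold zsum; simpl. ring.
    - unfold zsum in *. cbn [rs]. rewrite IH.
      pose proof (WI_rec n) as R1. pose proof (WJ_rec n) as R2. pose proof (WI_pos n) as P1. pose proof (WI_pos (S n)) as P2.
      pose proof (pos_INR n) as Hn. set (k := INR n) in *. assert (E1 : WI n = (2 * k + 2) / (2 * k + 1) * WI (S n)).
      { apply Rmult_eq_reg_l with (2 * k + 1); [|lra]. rewrite <- R1. field. lra. }
      assert (E2 : WJ n = (WI (S n) + 2 * (k + 1) ^ 2 * WJ (S n)) / ((k + 1) * (2 * k + 1))).
      { rewrite R2. field. lra. } rewrite E1, E2. field. repeat split; try lra. apply Rgt_not_eq, WI_pos. }
  assert (I0 : WI 0 = PI / 2).
  { unfold WI. simpl. int_const. ring. } assert (J0 : WJ 0 = PI ^ 3 / 24).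
  { unfold WJ. apply is_RInt_unique. replace (PI ^ 3 / 24) with ((PI / 2) ^ 3 / 3 - 0 ^ 3 / 3) by field.
    apply (is_RInt_derive (V := RC) (fun x => x ^ 3 / 3)).
    - intros x _. auto_derive; [auto|]. simpl. field.
    - intros x _. cont_derive. } rewrite E, I0, J0. assert (0 <= WJ n / WI n).
  { apply Rmult_le_pos; [apply WJ_nonneg|left; apply Rinv_0_lt_compat, WI_pos]. }
  replace (PI ^ 3 / 24 / (PI / 2)) with (PI ^ 2 / 12) by (field; lra). lra.
Qed.

(** Montgomery and Vaughan's argument: with [A = (1/(la i - la j))] and [D] the diagonal matrix of row sums,
    [-A^2 = E - (D A - A D)] with [E] entrywise nonnegative; the commutator drops out of [tr ((-A^2)^m)],
    so the traces grow at most like the [m]th power of the norm of [E]. *)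
Definition mm (n : nat) (A B : nat -> nat -> R) (i j : nat) : R := rs (fun k => A i k * B k j) n.
Definition idm (i j : nat) : R := if Nat.eqb i j then 1 else 0.
Fixpoint mpw (n : nat) (A : nat -> nat -> R) (m : nat) : nat -> nat -> R :=
  match m with O => idm | S k => mm n A (mpw n A k) end.

Lemma mm_assoc n A B C i j : mm n A (mm n B C) i j = mm n (mm n A B) C i j.
Proof.
  unfold mm. rewrite (rs_ext _ (fun k => rs (fun l => A i k * B k l * C l j) n)).
  2:{ intros k _. rewrite <- rs_scal. apply rs_ext. intros; ring. }
  rewrite rs_swap. apply rs_ext. intros l _. rewrite <- rs_scal_r. reflexivity.
Qed.
Lemma mm_ext_r n A B B' i j : (forall k, (k < n)%nat -> B k j = B' k j) -> mm n A B i j = mm n A B' i j.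
Proof. intros H. apply rs_ext. intros k Hk. rewrite H by assumption. reflexivity. Qed.
Lemma mm_ext_l n A A' B i j : (forall k, (k < n)%nat -> A i k = A' i k) -> mm n A B i j = mm n A' B i j.
Proof. intros H. apply rs_ext. intros k Hk. rewrite H by assumption. reflexivity. Qed.
Lemma mm_id_r n A i j : (j < n)%nat -> mm n A idm i j = A i j.
Proof.
  intros Hj. unfold mm, idm. rewrite (rs_ext _ (fun k => if Nat.eqb j k then A i k else 0)).
  - apply (rs_delta (fun k => A i k)), Hj.
  - intros k _. rewrite Nat.eqb_sym. destruct (Nat.eqb j k); ring.
Qed.
Lemma mm_id_l n A i j : (i < n)%nat -> mm n idm A i j = A i j.
Proof.
  intros Hi. unfold mm, idm. rewrite (rs_ext _ (fun k => if Nat.eqb i k then A k j else 0)).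
  - apply (rs_delta (fun k => A k j)), Hi.
  - intros k _. destruct (Nat.eqb i k); ring.
Qed.
Lemma mpw_comm n A m : forall i j, (i < n)%nat -> (j < n)%nat -> mm n A (mpw n A m) i j = mm n (mpw n A m) A i j.
Proof.
  induction m as [|m IH]; intros i j Hi Hj; simpl.
  - rewrite mm_id_r, mm_id_l by assumption. reflexivity.
  - rewrite <- mm_assoc. apply mm_ext_r. intros k Hk. apply IH; assumption.
Qed.
Lemma mpw_anti n A m : (forall i j, A i j = - A j i) -> forall i j, (i < n)%nat -> (j < n)%nat ->
  mpw n A m j i = (-1) ^ m * mpw n A m i j.
Proof.
  intros HA. induction m as [|m IH]; intros i j Hi Hj.
  - simpl. unfold idm. rewrite Nat.eqb_sym. ring.
  - cbn [mpw]. rewrite (mpw_comm n A m i j Hi Hj). simpl ((-1) ^ S m). unfold mm.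
    rewrite <- rs_scal. apply rs_ext. intros k Hk. rewrite (HA j k), (IH i k Hi Hk). ring.
Qed.

Section Hilbert.
Variables (n : nat) (la : nat -> R) (e : R).
Hypothesis Hla : forall i j, (i < n)%nat -> (j < n)%nat -> i <> j -> la i <> la j.

Definition ha (i j : nat) : R := if Nat.eqb i j then 0 else / (la i - la j).

Lemma ha_anti i j : ha i j = - ha j i.
Proof.
  unfold ha. rewrite Nat.eqb_sym. destruct (Nat.eqb j i); [ring|]. rewrite <- Rinv_opp. f_equal. ring.
Qed.
Lemma ha_diag i : ha i i = 0.
Proof. unfold ha. rewrite Nat.eqb_refl. reflexivity. Qed.

Definition hd (i : nat) : R := rs (fun s => ha i s) n.
Definition hr (i : nat) : R := rs (fun s => ha i s ^ 2) n.

Lemma rs_two_deltas f i j : (i < n)%nat -> (j < n)%nat -> i <> j ->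
  rs f n = rs (fun s => if (Nat.eqb i s || Nat.eqb j s)%bool then 0 else f s) n + f i + f j.
Proof.
  intros Hi Hj Hij. rewrite <- (rs_delta f n i Hi), <- (rs_delta f n j Hj), <- !rs_plus.
  apply rs_ext. intros s _. destruct (Nat.eqb_spec i s), (Nat.eqb_spec j s); simpl; subst; try ring. lia.
Qed.

(** Partial fractions: [ha i s * ha s j = ha i j * (ha i s - ha j s)] for [s] different from [i] and
    [j]. Completing the sums to [hd i] and [hd j] costs [2 * ha i j ^ 2]. *)
Lemma ha_sq i j : (i < n)%nat -> (j < n)%nat -> i <> j ->
  mm n ha ha i j = hd i * ha i j - ha i j * hd j - 2 * ha i j ^ 2.
Proof.
  intros Hi Hj Hij. unfold mm. rewrite (rs_two_deltas (fun k => ha i k * ha k j) i j), ha_diag, ha_diag by assumption.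
  rewrite (rs_ext _ (fun s => ha i j * (if (Nat.eqb i s || Nat.eqb j s)%bool then 0 else ha i s)
      - ha i j * (if (Nat.eqb i s || Nat.eqb j s)%bool then 0 else ha j s))).
  - rewrite rs_minus, !rs_scal. unfold hd.
    rewrite (rs_two_deltas (fun s => ha i s) i j), (rs_two_deltas (fun s => ha j s) i j) by assumption.
    rewrite !ha_diag, (ha_anti j i). ring.
  - intros s Hs. destruct (Nat.eqb_spec i s) as [E|E], (Nat.eqb_spec j s) as [F|F]; simpl; try ring.
    rewrite (ha_anti s j). unfold ha. destruct (Nat.eqb_spec i s), (Nat.eqb_spec j s), (Nat.eqb_spec i j); try lia.
    pose proof (Hla i s Hi Hs ltac:(lia)). pose proof (Hla j s Hj Hs ltac:(lia)). pose proof (Hla i j Hi Hj ltac:(lia)).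
    field. repeat split; lra.
Qed.

Lemma ha_sq_diag i : mm n ha ha i i = - hr i.
Proof.
  unfold mm, hr. rewrite (rs_ext _ (fun s => -1 * ha i s ^ 2)); [rewrite rs_scal; ring|].
  intros s _. rewrite (ha_anti s i). ring.
Qed.

Hypothesis Hrow : forall i, (i < n)%nat -> 3 * hr i <= e.

Definition qE (x : nat -> R) : R :=
  rs (fun k => rs (fun l => (2 * ha k l ^ 2) * (x k * x l)) n) n + rs (fun k => hr k * x k ^ 2) n.

(** By [2 * (x k * x l) <= x k ^ 2 + x l ^ 2] the entries [2 * ha k l ^ 2] contribute twice the row
    sums, and the diagonal adds them once more: hence the factor 3 in [Hrow]. *)
Lemma qE_le x : qE x <= e * rs (fun k => x k ^ 2) n.
Proof.
  unfold qE.
  assert (H1 : rs (fun k => rs (fun l => (2 * ha k l ^ 2) * (x k * x l)) n) n <= rs (fun k => 2 * hr k * x k ^ 2) n).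
  { apply Rle_trans with (rs (fun k => rs (fun l => ha k l ^ 2 * x k ^ 2 + ha k l ^ 2 * x l ^ 2) n) n).
    - apply rs_le. intros k _. apply rs_le. intros l _. pose proof (pow2_ge_0 (ha k l)). 
      assert (2 * (x k * x l) <= x k ^ 2 + x l ^ 2) by (pose proof (pow2_ge_0 (x k - x l)); nra). nra.
    - right. rewrite (rs_ext _ (fun k => hr k * x k ^ 2 + rs (fun l => ha k l ^ 2 * x l ^ 2) n)).
      2:{ intros k _. rewrite rs_plus, rs_scal_r. reflexivity. } rewrite rs_plus, rs_swap.
      rewrite (rs_ext (fun j => rs (fun i => ha i j ^ 2 * x j ^ 2) n) (fun k => hr k * x k ^ 2)).
      2:{ intros k _. rewrite rs_scal_r. f_equal. apply rs_ext. intros i _. rewrite (ha_anti k i). ring. }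
      rewrite <- rs_plus. apply rs_ext. intros; ring. } apply Rle_trans with (rs (fun k => 3 * hr k * x k ^ 2) n).
  - rewrite (rs_ext (fun k => 3 * hr k * x k ^ 2) (fun k => 2 * hr k * x k ^ 2 + hr k * x k ^ 2)) by (intros; ring).
    rewrite rs_plus. lra.
  - rewrite <- rs_scal. apply rs_le. intros k Hk. mono_r; [apply pow2_ge_0|apply Hrow, Hk].
Qed.

Definition tr2 (m : nat) : R := rs (fun i => rs (fun j => mpw n ha m i j ^ 2) n) n.

Lemma col_step (B : nat -> nat -> R) j : rs (fun i => mm n ha B i j ^ 2) n =
  qE (fun k => B k j) - rs (fun k => rs (fun l => (hd k * ha k l - ha k l * hd l) * (B k j * B l j)) n) n.
Proof.
  transitivity (rs (fun k => rs (fun l => - mm n ha ha k l * (B k j * B l j)) n) n).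
  - rewrite (rs_ext _ (fun i => rs (fun k => rs (fun l => ha i k * B k j * (ha i l * B l j)) n) n)).
    2:{ intros i _. unfold mm. simpl (_ ^ 2). rewrite Rmult_1_r, rs_mult. reflexivity. }
    rewrite rs_swap. apply rs_ext. intros k _. rewrite rs_swap. apply rs_ext. intros l _.
    unfold mm. rewrite (rs_ext _ (fun i => ha k i * ha i l * (-1 * (B k j * B l j)))).
    + rewrite rs_scal_r. ring.
    + intros i _. rewrite (ha_anti i k). ring.
  - unfold qE. rewrite <- rs_plus, <- rs_minus. apply rs_ext. intros k Hk.
    rewrite <- (rs_delta (fun l => hr l * B l j ^ 2) n k Hk), <- rs_plus, <- rs_minus.
    apply rs_ext. intros l Hl. destruct (Nat.eqb_spec k l) as [<-|H].
    + rewrite ha_sq_diag, ha_diag. ring.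
    + rewrite ha_sq by assumption. ring.
Qed.

Lemma tr2_step m : tr2 (S m) <= e * tr2 m.
Proof.
  unfold tr2. cbn [mpw]. set (B := mpw n ha m). rewrite rs_swap.
  rewrite (rs_ext _ (fun j => qE (fun k => B k j) - rs (fun k => rs (fun l => (hd k * ha k l - ha k l * hd l) * (B k j * B l j)) n) n))
    by (intros; apply col_step). rewrite rs_minus.
  (* This sum is the trace of the commutator of the diagonal matrix [hd] and [ha], times [G], the
     product of [B] and its transpose. As a power of an antisymmetric matrix [B] is symmetric up to
     sign, so [G] is [B * B] up to sign and commutes with [ha]; the trace is 0. *)
  assert (Z : rs (fun j => rs (fun k => rs (fun l => (hd k * ha k l - ha k l * hd l) * (B k j * B l j)) n) n) n = 0).
  { set (G := fun k l => rs (fun j => B k j * B l j) n).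
    transitivity (rs (fun k => rs (fun l => (hd k * ha k l - ha k l * hd l) * G k l) n) n).
    { rewrite rs_swap. apply rs_ext. intros k _. rewrite rs_swap. apply rs_ext. intros l _. unfold G. rewrite rs_scal. reflexivity. }
    assert (GB : forall k l, (k < n)%nat -> (l < n)%nat -> G k l = (-1) ^ m * mm n B B k l).
    { intros k l Hk Hl. unfold G, mm. rewrite <- rs_scal. apply rs_ext. intros j Hj.
      unfold B. rewrite (mpw_anti n ha m ha_anti j l Hj Hl). ring. }
    assert (GS : forall k l, G k l = G l k) by (intros; unfold G; apply rs_ext; intros; ring).
    assert (GC : forall k, (k < n)%nat -> mm n ha G k k = mm n G ha k k).
    { intros k Hk. rewrite (mm_ext_r n ha G (fun a b => (-1) ^ m * mm n B B a b)) by (intros; apply GB; assumption).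
      rewrite (mm_ext_l n G (fun a b => (-1) ^ m * mm n B B a b) ha) by (intros; apply GB; assumption).
      transitivity ((-1) ^ m * mm n ha (mm n B B) k k); [unfold mm at 1 3; rewrite <- rs_scal; apply rs_ext; intros; ring|].
      transitivity ((-1) ^ m * mm n (mm n B B) ha k k); [|unfold mm at 1 3; rewrite <- rs_scal; apply rs_ext; intros; ring].
      f_equal. rewrite mm_assoc.
      rewrite (mm_ext_l n (mm n ha B) (mm n B ha) B) by (intros; apply mpw_comm; assumption). rewrite <- mm_assoc.
      rewrite (mm_ext_r n B (mm n ha B) (mm n B ha)) by (intros; apply mpw_comm; assumption).
      rewrite mm_assoc. reflexivity. }
    transitivity (rs (fun k => hd k * mm n ha G k k) n - rs (fun k => hd k * mm n G ha k k) n).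
    - rewrite (rs_ext _ (fun k => hd k * mm n ha G k k - rs (fun l => G k l * ha k l * hd l) n)).
      + rewrite rs_minus. f_equal. rewrite rs_swap. apply rs_ext. intros l _.
        rewrite rs_scal_r. unfold mm. rewrite Rmult_comm. f_equal. apply rs_ext. intros k _. rewrite (GS k l). reflexivity.
      + intros k _. unfold mm. rewrite <- rs_scal, <- rs_minus. apply rs_ext. intros l _. rewrite (GS l k). ring.
    - rewrite <- rs_minus. rewrite (rs_ext _ (fun _ => 0)); [apply rs_0|].
      intros k Hk. rewrite GC by assumption. ring. } rewrite Z, Rminus_0_r.
  apply Rle_trans with (rs (fun j => e * rs (fun k => B k j ^ 2) n) n).
  - apply rs_le. intros j _. apply (qE_le (fun k => B k j)).
  - rewrite rs_scal, rs_swap. lra.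
Qed.

Hypothesis He : 0 < e.

Lemma tr2_bound m : tr2 m <= e ^ m * INR n.
Proof.
  induction m as [|m IH].
  - unfold tr2; simpl. rewrite Rmult_1_l. rewrite <- (Rmult_1_r (INR n)), <- rs_const. right.
    apply rs_ext. intros i Hi. unfold idm. rewrite (rs_ext _ (fun j => if Nat.eqb i j then 1 else 0)).
    + apply (rs_delta (fun _ => 1)), Hi.
    + intros j _. destruct (Nat.eqb i j); ring.
  - step_le; [apply tr2_step|]. simpl. rewrite Rmult_assoc. mono_l; lra.
Qed.

Fixpoint vpw (x : nat -> R) (m : nat) (i : nat) : R :=
  match m with O => x i | S k => rs (fun j => ha i j * vpw x k j) n end.
Definition vn (x : nat -> R) (m : nat) : R := rs (fun i => vpw x m i ^ 2) n.

Lemma vpw_mpw x m : forall i, (i < n)%nat -> vpw x m i = rs (fun j => mpw n ha m i j * x j) n.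
Proof.
  induction m as [|m IH]; intros i Hi; simpl.
  - unfold idm. rewrite (rs_ext _ (fun j => if Nat.eqb i j then x j else 0)).
    + symmetry. apply rs_delta, Hi.
    + intros j _. destruct (Nat.eqb i j); ring.
  - rewrite (rs_ext _ (fun j => rs (fun k => ha i j * mpw n ha m j k * x k) n)).
    + rewrite rs_swap. apply rs_ext. intros k _. unfold mm. rewrite <- rs_scal_r. reflexivity.
    + intros j Hj. rewrite IH, <- rs_scal by assumption. apply rs_ext. intros; ring.
Qed.

Lemma vn_bound x m : vn x m <= e ^ m * INR n * vn x 0.
Proof.
  apply Rle_trans with (tr2 m * vn x 0).
  - unfold vn at 1, tr2. rewrite <- rs_scal_r. apply rs_le. intros i Hi. rewrite vpw_mpw by assumption.
    apply (rs_cauchy_schwarz (fun j => mpw n ha m i j) x).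
  - mono_r; [apply rs_nonneg; intros; apply pow2_ge_0|apply tr2_bound].
Qed.

(** Antisymmetry moves one factor [ha] across the inner product, and Cauchy-Schwarz finishes. *)
Lemma vn_logconvex x m : vn x (S m) ^ 2 <= vn x m * vn x (S (S m)).
Proof.
  assert (E : vn x (S m) = - rs (fun j => vpw x m j * vpw x (S (S m)) j) n).
  { unfold vn. rewrite (rs_ext _ (fun i => rs (fun j => ha i j * vpw x m j * vpw x (S m) i) n)).
    - rewrite rs_swap. rewrite <- (Rmult_1_l (rs (fun j => vpw x m j * _) n)), Ropp_mult_distr_l, <- rs_scal.
      apply rs_ext. intros j _. change (vpw x (S (S m)) j) with (rs (fun i => ha j i * vpw x (S m) i) n).
      rewrite <- !rs_scal. apply rs_ext. intros i _. rewrite (ha_anti i j). ring.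
    - intros i _. rewrite rs_scal_r. change (vpw x (S m) i) with (rs (fun j => ha i j * vpw x m j) n). ring. }
  rewrite E. replace ((- rs (fun j => vpw x m j * vpw x (S (S m)) j) n) ^ 2)
    with (rs (fun j => vpw x m j * vpw x (S (S m)) j) n ^ 2) by ring. apply rs_cauchy_schwarz.
Qed.

Lemma vn_nonneg x m : 0 <= vn x m.
Proof. apply rs_nonneg. intros; apply pow2_ge_0. Qed.

(** Log-convexity removes the factor [n] of [vn_bound]: an initial ratio [r > e] would persist and
    force growth like [r ^ m], against the bound [e ^ m * n]. *)
Lemma ha_norm x : vn x 1 <= e * vn x 0.
Proof.
  apply Rnot_lt_le. intros Hlt. pose proof (vn_nonneg x 0) as H0. assert (Hp : 0 < vn x 0).
  { destruct H0 as [H|H]; [exact H|]. pose proof (vn_bound x 1) as B. rewrite <- H in *. lra. }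
  set (r := vn x 1 / vn x 0). assert (Er : vn x 1 = r * vn x 0) by (unfold r; field; lra). assert (Hr : e < r) by nra.
  assert (Step : forall m, 0 < vn x m /\ r * vn x m <= vn x (S m)).
  { induction m as [|m [IH1 IH2]]; [split; lra|]. assert (Hp1 : 0 < vn x (S m)) by nra.
    split; [exact Hp1|]. pose proof (vn_logconvex x m). apply Rmult_le_reg_l with (vn x m); [assumption|]. nra. }
  assert (Low : forall m, r ^ m * vn x 0 <= vn x m).
  { induction m as [|m IH]; [simpl; lra|]. destruct (Step m) as [S1 S2]. simpl.
    step_le; [|exact S2]. rewrite Rmult_assoc. mono_l; lra. } set (q := r / e). assert (Hq : 0 < q - 1).
  { unfold q. apply Rmult_lt_reg_r with e; [assumption|]. replace ((r / e - 1) * e) with (r - e) by (field; lra). lra. }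
  destruct (INR_unbounded (INR n / (q - 1))) as [m Hm]. assert (Hb : 1 + INR m * (q - 1) <= q ^ m).
  { replace (q ^ m) with ((1 + (q - 1)) ^ m) by (f_equal; ring). apply poly. exact Hq. } assert (Hc : q ^ m <= INR n).
  { pose proof (Low m) as L. pose proof (vn_bound x m) as U. assert (Hem : 0 < e ^ m) by (apply pow_lt; assumption).
    assert (L2 : r ^ m <= e ^ m * INR n) by (apply Rmult_le_reg_r with (vn x 0); lra).
    unfold q, Rdiv. rewrite Rpow_mult_distr, pow_inv.
    apply Rmult_le_reg_l with (e ^ m); [assumption|]. replace (e ^ m * (r ^ m * / e ^ m)) with (r ^ m) by (field; lra). exact L2. }
  apply (Rmult_lt_compat_r (q - 1)) in Hm; [|assumption].
  replace (INR n / (q - 1) * (q - 1)) with (INR n) in Hm by (field; lra). lra.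
Qed.

Lemma ha_bilinear x y s : 0 < s -> e = s ^ 2 ->
  rs (fun i => rs (fun j => x i * y j * ha i j) n) n <= s / 2 * (rs (fun i => x i ^ 2) n + rs (fun i => y i ^ 2) n).
Proof.
  intros Hs Es. pose proof (ha_norm y) as H. unfold vn in H. cbn [vpw] in H.
  set (z := fun i => rs (fun j => ha i j * y j) n) in *.
  assert (E : rs (fun i => rs (fun j => x i * y j * ha i j) n) n = rs (fun i => x i * z i) n).
  { apply rs_ext. intros i _. unfold z. rewrite <- rs_scal. apply rs_ext. intros; ring. } rewrite E.
  apply Rle_trans with (rs (fun i => s / 2 * x i ^ 2 + / (2 * s) * z i ^ 2) n).
  - apply rs_le. intros i _. apply Rmult_le_reg_l with (2 * s); [lra|].
    replace (2 * s * (s / 2 * x i ^ 2 + / (2 * s) * z i ^ 2)) with ((s * x i) ^ 2 + z i ^ 2) by (field; lra).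
    pose proof (pow2_ge_0 (s * x i - z i)). nra.
  - rewrite rs_plus, !rs_scal.
    assert (/ (2 * s) * rs (fun i => z i ^ 2) n <= s / 2 * rs (fun i => y i ^ 2) n); [|lra].
    apply Rmult_le_reg_l with (2 * s); [lra|].
    replace (2 * s * (/ (2 * s) * rs (fun i => z i ^ 2) n)) with (rs (fun i => z i ^ 2) n) by (field; lra).
    rewrite Es in H. replace (2 * s * (s / 2 * rs (fun i => y i ^ 2) n)) with (s ^ 2 * rs (fun i => y i ^ 2) n) by field. exact H.
Qed.
End Hilbert.

Lemma row_sum_shift k : forall n, rs (fun s => if Nat.eqb k s then 0 else / (INR k - INR s) ^ 2) n <= 2 * (PI ^ 2 / 6).
Proof.
  set (f := fun s => if Nat.eqb k s then 0 else / (INR k - INR s) ^ 2).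
  assert (H1 : forall n, (n <= k)%nat -> rs f n + zsum (k - n) = zsum k).
  { induction n as [|n IH]; intros Hn.
    - simpl. rewrite Nat.sub_0_r. ring.
    - rewrite <- IH by lia. replace (k - n)%nat with (S (k - S n)) by lia. unfold zsum; cbn [rs].
      unfold f at 2. destruct (Nat.eqb_spec k n); [lia|].
      replace (INR (k - S n) + 1) with (INR k - INR n) by (rewrite minus_INR, S_INR by lia; ring). ring. }
  assert (H2 : forall m, rs f (S k + m) = rs f k + zsum m).
  { induction m as [|m IH].
    - rewrite Nat.add_0_r. unfold zsum; cbn [rs]. unfold f at 2. rewrite Nat.eqb_refl. ring.
    - rewrite Nat.add_succ_r. cbn [rs]. rewrite IH. unfold zsum; cbn [rs].
      unfold f at 2. destruct (Nat.eqb_spec k (S k + m)); [lia|].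
      replace ((INR k - INR (S k + m)) ^ 2) with ((INR m + 1) ^ 2) by (rewrite plus_INR, S_INR; ring). ring. }
  intros n. pose proof (zsum_bound k) as Zk. assert (Zp : forall m, 0 <= zsum m).
  { intros m. apply rs_nonneg. intros i _. left. apply Rinv_0_lt_compat, pow_lt. pose proof (pos_INR i). lra. }
  assert (P : 0 <= PI ^ 2 / 6) by (pose proof (pow2_ge_0 PI); lra). destruct (Nat.le_gt_cases n k) as [H|H].
  - pose proof (H1 n H). pose proof (Zp (k - n)%nat). lra.
  - replace n with (S k + (n - S k))%nat by lia. rewrite H2.
    pose proof (H1 k (le_n k)) as Hk. rewrite Nat.sub_diag in Hk. unfold zsum at 1 in Hk; simpl in Hk.
    pose proof (zsum_bound (n - S k)). lra.
Qed.

(** [la] is listed so that the gaps are at least [de] per index step, in either direction. *)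
Theorem hilbert_inequality n (la x y : nat -> R) de : 0 < de ->
  (forall i j, (i < n)%nat -> (j < n)%nat -> de * Rabs (INR i - INR j) <= Rabs (la i - la j)) ->
  rs (fun i => rs (fun j => x i * y j * ha la i j) n) n
    <= PI / de / 2 * (rs (fun i => x i ^ 2) n + rs (fun i => y i ^ 2) n).
Proof.
  intros Hde Hsep. pose proof PI_RGT_0 as HPI. assert (Hs : 0 < PI / de) by (div_pos; lra).
  apply (ha_bilinear n la ((PI / de) ^ 2)); [| |apply pow_lt, Hs|exact Hs|reflexivity].
  - intros i j Hi Hj Hij E. specialize (Hsep i j Hi Hj). rewrite E, Rminus_diag, Rabs_R0 in Hsep.
    assert (0 < Rabs (INR i - INR j)) by (apply Rabs_pos_lt; intros E2; apply Hij, INR_eq; lra). nra.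
  (* [3 * 2 * (PI ^ 2 / 6) = PI ^ 2]: the row sums produce exactly the constant [PI / de]. *)
  - intros i Hi. unfold hr. apply Rle_trans with (3 * (/ de ^ 2 * (2 * (PI ^ 2 / 6)))); [|right; field; lra].
    mono_l; [lra|].
    apply Rle_trans with (/ de ^ 2 * rs (fun s => if Nat.eqb i s then 0 else / (INR i - INR s) ^ 2) n).
    2:{ mono_l; [left; apply Rinv_0_lt_compat, pow_lt, Hde|apply row_sum_shift]. }
    rewrite <- rs_scal. apply rs_le. intros s Hs'. unfold ha. destruct (Nat.eqb_spec i s) as [E|E]; [simpl; lra|].
    specialize (Hsep i s Hi Hs').
    assert (Hd : 0 < Rabs (INR i - INR s)) by (apply Rabs_pos_lt; intros E2; apply E, INR_eq; lra).
    rewrite pow_inv, <- Rinv_mult. apply Rinv_le_contravar.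
    + rewrite <- (pow2_abs (INR i - INR s)). mul_pos; apply pow_lt; assumption.
    + rewrite <- (pow2_abs (INR i - INR s)), <- (pow2_abs (la i - la s)), <- Rpow_mult_distr.
      apply pow_incr. split; [apply Rmult_le_pos; lra|exact Hsep].
Qed.

(** * The dual large sieve *)

Lemma rcont_Cconj f t : rcont f t -> rcont (fun t => Cconj (f t)) t.
Proof. intros [F1 F2]. split; simpl; [exact F1|apply (continuous_opp (fun t => snd (f t))), F2]. Qed.

Lemma ex_Cmod2 f a b : a <= b -> rc_on f a b -> ex_RInt (fun t => Cmod (f t) ^ 2) a b.
Proof. intros H F. apply ex_RInt_cont; [exact H|]. intros. apply rcont_Cmod2, F. assumption. Qed.

(** Pythagoras after removing the component of [f] along the conjugate of [e]; the coefficients are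
    taken against [e] itself, without conjugation. *)
Lemma bessel_step f e a b : a < b -> rc_on f a b -> rc_on e a b -> (forall t, Cmod (e t) = 1) ->
  let c := CI (fun t => f t * e t)%C a b in RInt (fun t => Cmod (f t - c / RtoC (b - a) * Cconj (e t))%C ^ 2) a b
    = RInt (fun t => Cmod (f t) ^ 2) a b - Cmod c ^ 2 / (b - a).
Proof.
  intros Hab Hf He H1 c. set (P := b - a). assert (HP : 0 < P) by (unfold P; lra).
  assert (Hfe : rc_on (fun t => f t * e t)%C a b) by (intros t Ht; apply rcont_mult; [apply Hf|apply He]; exact Ht).
  assert (Hl : a <= b) by lra.
  pose proof (rc_ex1 _ _ _ Hl Hfe) as E1. pose proof (rc_ex2 _ _ _ Hl Hfe) as E2. pose proof (ex_Cmod2 f a b Hl Hf) as E0.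
  pose proof (ex_RInt_const (V := RN) a b (Cmod c ^ 2 / P ^ 2)) as E3.
  rewrite (RInt_ext _ (fun t => 1 * Cmod (f t) ^ 2 + 1 * (1 * (Cmod c ^ 2 / P ^ 2) +
     (-2 / P) * (fst c * fst (f t * e t)%C + snd c * snd (f t * e t)%C)))).
  2:{ intros t _. assert (Ec : (c / RtoC P)%C = (fst c / P, snd c / P)).
      { unfold Cdiv. rewrite <- RtoC_inv by lra. destruct c; ceq; unfold Rdiv; ring. }
      rewrite Ec. specialize (H1 t). assert (H2 : Cmod (e t) ^ 2 = 1) by (rewrite H1; ring).
      rewrite Cmod_sqr in H2. rewrite !Cmod_sqr. destruct (f t) as [f1 f2], (e t) as [e1 e2], c as [c1 c2]; csimp.
      assert (H3 : e1 * e1 + e2 * e2 = 1) by lra. apply Rminus_diag_uniq.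
      transitivity ((c1 * c1 + c2 * c2) / P ^ 2 * (e1 * e1 + e2 * e2 - 1)); [field; lra|rewrite H3; ring]. }
  assert (E12 : ex_RInt (fun t => fst c * fst (f t * e t)%C + snd c * snd (f t * e t)%C) a b).
  { apply (ex_RInt_plus (V := RN) (fun t => fst c * fst (f t * e t)%C) (fun t => snd c * snd (f t * e t)%C));
      apply (ex_RInt_scal (V := RN)); assumption. } assert (E4 : ex_RInt (fun t => 1 * (Cmod c ^ 2 / P ^ 2) +
     (-2 / P) * (fst c * fst (f t * e t)%C + snd c * snd (f t * e t)%C)) a b).
  { apply (ex_RInt_plus (V := RN) (fun t => 1 * (Cmod c ^ 2 / P ^ 2))
      (fun t => (-2 / P) * (fst c * fst (f t * e t)%C + snd c * snd (f t * e t)%C)));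
      apply (ex_RInt_scal (V := RN)); assumption. }
  rewrite (RInt_lin2 1 1 (fun t => Cmod (f t) ^ 2) (fun t => 1 * (Cmod c ^ 2 / P ^ 2) +
     (-2 / P) * (fst c * fst (f t * e t)%C + snd c * snd (f t * e t)%C)) a b E0 E4).
  rewrite (RInt_lin2 1 (-2 / P) (fun _ => Cmod c ^ 2 / P ^ 2)) by assumption.
  rewrite (RInt_lin2 (fst c) (snd c) (fun t => fst (f t * e t)%C)) by assumption. int_const.
  change (RInt (fun t => fst (f t * e t)%C) a b) with (fst c).
  change (RInt (fun t => snd (f t * e t)%C) a b) with (snd c).
  fold P. pose proof (Cmod_sqr c) as Q. simpl in Q. rewrite Q. field. lra.
Qed.

(** Induction on the number of functions: by orthogonality, removing the component along the
    conjugate of [e n] leaves the earlier coefficients unchanged. *)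
Lemma bessel (e : nat -> R -> C) a b : a < b -> (forall m, rc_on (e m) a b) -> (forall m t, Cmod (e m t) = 1) ->
  (forall m k, m <> k -> CI (fun t => Cconj (e k t) * e m t)%C a b = 0%C) -> forall n f, rc_on f a b ->
  rs (fun m => Cmod (CI (fun t => f t * e m t)%C a b) ^ 2) n <= (b - a) * RInt (fun t => Cmod (f t) ^ 2) a b.
Proof.
  intros Hab He H1 Ho. assert (Hl : a <= b) by lra. induction n as [|n IH]; intros f Hf.
  - simpl rs. apply Rmult_le_pos; [lra|]. apply RInt_ge_0; [exact Hl|apply ex_Cmod2; assumption|].
    intros. apply pow2_ge_0.
  - cbn [rs]. set (c := CI (fun t => f t * e n t)%C a b).
    set (f' := fun t => (f t - c / RtoC (b - a) * Cconj (e n t))%C). assert (Hf' : rc_on f' a b).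
    { intros t Ht. apply rcont_minus; [apply Hf, Ht|]. apply rcont_mult; [apply rcont_const|].
      apply rcont_Cconj, He, Ht. }
    specialize (IH f' Hf'). pose proof (bessel_step f (e n) a b Hab Hf (He n) (H1 n)) as S. cbv zeta in S.
    fold c in S. fold f' in S. unfold f' in IH at 2. rewrite S in IH.
    rewrite (rs_ext _ (fun m => Cmod (CI (fun t => f t * e m t)%C a b) ^ 2)) in IH.
    + replace ((b - a) * (RInt (fun t => Cmod (f t) ^ 2) a b - Cmod c ^ 2 / (b - a)))
        with ((b - a) * RInt (fun t => Cmod (f t) ^ 2) a b - Cmod c ^ 2) in IH by (field; lra). lra.
    + intros m Hm. f_equal. f_equal.
      rewrite (CI_ext _ (fun t => f t * e m t - c / RtoC (b - a) * (Cconj (e n t) * e m t))%C);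
        [|exact Hl|intros; unfold f'; ring].
      assert (R1 : rc_on (fun t => f t * e m t)%C a b) by (intros t Ht; apply rcont_mult; [apply Hf|apply He]; exact Ht).
      assert (R2 : rc_on (fun t => Cconj (e n t) * e m t)%C a b)
        by (intros t Ht; apply rcont_mult; [apply rcont_Cconj, He|apply He]; exact Ht).
      rewrite CI_minus; [|exact Hl|exact R1|apply rc_on_scal, R2]. rewrite (CI_scal _ (fun t => Cconj (e n t) * e m t)%C); [|exact Hl|exact R2].
      rewrite Ho by lia. ring.
Qed.

Definition ei (x : R) : C := (cos x, sin x).
Lemma Cmod_ei x : Cmod (ei x) = 1.
Proof.
  pose proof (Cmod_sqr (ei x)) as H. pose proof (Cmod_ge_0 (ei x)). unfold ei in *. simpl in H.
  pose proof (sin2_cos2 x) as S. unfold Rsqr in S. simpl in *. nra.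
Qed.
Lemma ei_plus x y : ei (x + y) = (ei x * ei y)%C.
Proof. unfold ei. ceq; rewrite ?cos_plus, ?sin_plus; ring. Qed.
Lemma Cconj_ei x : Cconj (ei x) = ei (- x).
Proof. unfold ei, Cconj; simpl. rewrite cos_neg, sin_neg. reflexivity. Qed.
Lemma rc_ei d c a b : rc_on (fun t => ei (t * d + c)) a b.
Proof.
  intros t _. split; simpl; cont_derive.
Qed.
Lemma CI_ei d a b : a <= b -> d <> 0 ->
  CI (fun t => ei (t * d)) a b = ((sin (b * d) - sin (a * d)) / d, (cos (a * d) - cos (b * d)) / d).
Proof.
  intros Hab Hd. unfold CI. f_equal; simpl; apply is_RInt_unique.
  - replace ((sin (b * d) - sin (a * d)) / d) with (sin (b * d) / d - sin (a * d) / d) by (field; exact Hd).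
    apply (is_RInt_derive (V := RC) (fun t => sin (t * d) / d)).
    + intros t _. auto_derive; auto. field. exact Hd.
    + intros t _. cont_derive.
  - replace ((cos (a * d) - cos (b * d)) / d) with (- cos (b * d) / d - - cos (a * d) / d) by (field; exact Hd).
    apply (is_RInt_derive (V := RC) (fun t => - cos (t * d) / d)).
    + intros t _. auto_derive; auto. field. exact Hd.
    + intros t _. cont_derive.
Qed.

Lemma CI_ei_period a b (m k : nat) : a < b -> m <> k ->
  CI (fun t => ei (t * (2 * PI / (b - a) * (INR m - INR k)))) a b = 0%C.
Proof.
  intros Hab Hmk. pose proof PI_RGT_0 as HPI. set (d := 2 * PI / (b - a) * (INR m - INR k)). assert (Hd : d <> 0).
  { unfold d. apply Rmult_integral_contrapositive. split.
    - apply Rgt_not_eq, Rdiv_lt_0_compat; lra.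
    - intros E. apply Hmk, INR_eq. lra. } rewrite CI_ei by (try assumption; lra).
  assert (E : b * d + 2 * INR k * PI = a * d + 2 * INR m * PI) by (unfold d; field; lra).
  rewrite <- (sin_period (b * d) k), <- (sin_period (a * d) m), <- (cos_period (b * d) k), <- (cos_period (a * d) m), E.
  ceq; unfold Rdiv; ring.
Qed.

Definition csum (f : nat -> C) (n : nat) : C := (rs (fun i => fst (f i)) n, rs (fun i => snd (f i)) n).
Lemma csum_S f n : csum f (S n) = (csum f n + f n)%C.
Proof. reflexivity. Qed.
Lemma csum_ext f g n : (forall i, (i < n)%nat -> f i = g i) -> csum f n = csum g n.
Proof. intros H. unfold csum. f_equal; apply rs_ext; intros; rewrite H by assumption; reflexivity. Qed.
Lemma csum_scal c f n : csum (fun i => c * f i)%C n = (c * csum f n)%C.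
Proof. induction n as [|n IH]; [ceq; ring|]. rewrite !csum_S, IH. ring. Qed.
Lemma csum_rc (f : nat -> R -> C) n t : (forall i, (i < n)%nat -> rcont (f i) t) -> rcont (fun t => csum (fun i => f i t) n) t.
Proof.
  intros H. induction n as [|n IH]; [apply rcont_const|].
  apply (rcont_plus (fun t => csum (fun i => f i t) n) (f n)); [apply IH; intros; apply H; lia|apply H; lia].
Qed.
Lemma CI_csum (f : nat -> R -> C) n a b : a <= b -> (forall i, (i < n)%nat -> rc_on (f i) a b) ->
  CI (fun t => csum (fun i => f i t) n) a b = csum (fun i => CI (f i) a b) n.
Proof.
  intros Hab H. induction n as [|n IH].
  - unfold csum; simpl. unfold CI; simpl. f_equal; rewrite (RInt_const (V := RC));
      unfold scal; simpl; unfold mult; simpl; ring.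
  - rewrite csum_S. change (fun t => csum (fun i => f i t) (S n)) with (fun t => (csum (fun i => f i t) n + f n t)%C).
    rewrite CI_plus, IH; try assumption; [reflexivity|intros; apply H; lia| |apply H; lia].
    intros t Ht. apply csum_rc. intros i Hi. apply H; [lia|exact Ht].
Qed.
Lemma RInt_rs (f : nat -> R -> R) n a b : (forall i, (i < n)%nat -> ex_RInt (f i) a b) ->
  ex_RInt (fun t => rs (fun i => f i t) n) a b /\
  RInt (fun t => rs (fun i => f i t) n) a b = rs (fun i => RInt (f i) a b) n.
Proof.
  intros H. induction n as [|n IH].
  - simpl. split; [apply (ex_RInt_const (V := RN))|]. int_const. ring.
  - destruct IH as [I1 I2]; [intros; apply H; lia|]. simpl. split.
    + apply (ex_RInt_plus (V := RN)); [exact I1|apply H; lia].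
    + rewrite (RInt_plus (V := RC)); [|exact I1|apply H; lia]. rewrite I2. reflexivity.
Qed.

Section Sieve.
Variables (n : nat) (la c : nat -> R) (de a b : R).
Hypothesis Hde : 0 < de.
Hypothesis Hab : a < b.
Hypothesis Hsep : forall i j, (i < n)%nat -> (j < n)%nat -> de * Rabs (INR i - INR j) <= Rabs (la i - la j).

Definition Phi (xi : R) : C := csum (fun j => RtoC (c j) * ei (xi * (- la j)))%C n.

Lemma rc_Phi u v : rc_on Phi u v.
Proof.
  intros t Ht. apply csum_rc. intros i Hi. apply rcont_mult; [apply rcont_const|].
  eapply rcont_ext; [|apply (rc_ei (- la i) 0 u v t Ht)]. intros; simpl. rewrite Rplus_0_r. reflexivity.
Qed.

(** The addition formula splits the sine into two bilinear forms, equal by antisymmetry. Hilbert's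
    inequality bounds them, and [sin^2 + cos^2 = 1] recombines the norms. *)
Lemma sieve_sin x : rs (fun i => rs (fun j => c i * c j * (sin (x * (la i - la j)) * ha la i j)) n) n
   <= PI / de * rs (fun i => c i ^ 2) n.
Proof.
  set (X := fun i => c i * sin (x * la i)). set (Z := fun i => c i * cos (x * la i)).
  assert (E : rs (fun i => rs (fun j => c i * c j * (sin (x * (la i - la j)) * ha la i j)) n) n
     = 2 * rs (fun i => rs (fun j => X i * Z j * ha la i j) n) n).
  { rewrite (rs_ext _ (fun i => rs (fun j => X i * Z j * ha la i j) n + rs (fun j => X j * Z i * ha la j i) n)).
    - rewrite rs_plus, (rs_swap (fun i j => X j * Z i * ha la j i)). ring.
    - intros i Hi. rewrite <- rs_plus. apply rs_ext. intros j Hj.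
      rewrite (ha_anti la j i). unfold X, Z. rewrite Rmult_minus_distr_l, sin_minus. ring. }
  rewrite E. pose proof (hilbert_inequality n la X Z de Hde Hsep) as H.
  assert (E2 : rs (fun i => X i ^ 2) n + rs (fun i => Z i ^ 2) n = rs (fun i => c i ^ 2) n).
  { rewrite <- rs_plus. apply rs_ext. intros i Hi. unfold X, Z. pose proof (sin2_cos2 (x * la i)) as S. unfold Rsqr in S.
    replace ((c i * sin (x * la i)) ^ 2 + (c i * cos (x * la i)) ^ 2)
      with (c i ^ 2 * (sin (x * la i) * sin (x * la i) + cos (x * la i) * cos (x * la i))) by ring. rewrite S. ring. }
  rewrite E2 in H. lra.
Qed.

(** After squaring out, the diagonal gives [b - a]; the other terms are sines at the two endpoints
    over [la i - la j], and each endpoint costs [PI / de]. *)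
Lemma Phi_norm : RInt (fun t => Cmod (Phi t) ^ 2) a b <= (b - a + 2 * PI / de) * rs (fun i => c i ^ 2) n.
Proof.
  rewrite (RInt_ext _ (fun t => rs (fun i => rs (fun j => c i * c j * cos (t * (la i - la j))) n) n)).
  2:{ intros t _. rewrite Cmod_sqr. unfold Phi, csum; simpl fst; simpl snd.
      rewrite <- !Rsqr_pow2. unfold Rsqr. rewrite !rs_mult, <- rs_plus. apply rs_ext. intros i Hi. rewrite <- rs_plus.
      apply rs_ext. intros j Hj. replace (t * (la i - la j)) with (t * la i - t * la j) by ring. rewrite cos_minus.
      unfold ei; csimp. rewrite !Ropp_mult_distr_r_reverse, !cos_neg, !sin_neg. ring. }
  assert (EX : forall d k, ex_RInt (fun t => k * cos (t * d)) a b).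
  { intros d k. apply ex_RInt_cont; [lra|]. intros t _. cont_derive. }
  assert (EX1 : forall i, ex_RInt (fun t => rs (fun j => c i * c j * cos (t * (la i - la j))) n) a b).
  { intros i. apply (RInt_rs (fun j t => c i * c j * cos (t * (la i - la j)))). intros. apply EX. }
  rewrite (proj2 (RInt_rs (fun i t => rs (fun j => c i * c j * cos (t * (la i - la j))) n) n a b (fun i _ => EX1 i))).
  rewrite (rs_ext _ (fun i => (b - a) * c i ^ 2 + (rs (fun j => c i * c j * (sin (b * (la i - la j)) * ha la i j)) n
     - rs (fun j => c i * c j * (sin (a * (la i - la j)) * ha la i j)) n))).
  - rewrite rs_plus, rs_minus, rs_scal. pose proof (sieve_sin b) as S1. pose proof (sieve_sin (- a)) as S2.
    rewrite (rs_ext _ (fun i => -1 * rs (fun j => c i * c j * (sin (a * (la i - la j)) * ha la i j)) n)) in S2.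
    2:{ intros i Hi. rewrite <- rs_scal. apply rs_ext. intros j Hj. rewrite Ropp_mult_distr_l_reverse, sin_neg. ring. }
    rewrite rs_scal in S2. replace (2 * PI / de) with (PI / de + PI / de) by (field; lra). lra.
  - intros i Hi. rewrite (proj2 (RInt_rs (fun j t => c i * c j * cos (t * (la i - la j))) n a b (fun j _ => EX _ _))).
    rewrite <- rs_minus.
    rewrite <- (rs_delta (fun j => (b - a) * c j ^ 2) n i Hi), <- rs_plus. apply rs_ext. intros j Hj.
    assert (F : RInt (fun t => c i * c j * cos (t * (la i - la j))) a b = c i * c j * RInt (fun t => cos (t * (la i - la j))) a b).
    { apply is_RInt_unique, (is_RInt_scal (V := RN)), (RInt_correct (V := RC)).
      eapply ex_RInt_ext; [|apply (EX (la i - la j) 1)]. intros; simpl; ring. }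
    rewrite F. unfold ha. destruct (Nat.eqb_spec i j) as [<-|Hij].
    + rewrite (RInt_ext _ (fun _ => 1)) by (intros; rewrite Rminus_diag, Rmult_0_r, cos_0; reflexivity).
      int_const. ring.
    + assert (Hd : la i - la j <> 0).
      { intros E. specialize (Hsep i j Hi Hj). rewrite E, Rabs_R0 in Hsep.
        assert (0 < Rabs (INR i - INR j)) by (apply Rabs_pos_lt; intros E2; apply Hij, INR_eq; lra). nra. }
      pose proof (CI_ei (la i - la j) a b ltac:(lra) Hd) as Q. apply (f_equal fst) in Q. simpl in Q. rewrite Q.
      field. exact Hd.
Qed.

(** [2 pi] times the kernel with Fourier transform the indicator of [[a, b]], on the real line. *)
Definition KR (u : R) : C := CI (fun xi => ei (xi * u)) a b.

Lemma Phi_KR x : CI (fun xi => Phi xi * ei (xi * x))%C a b = csum (fun j => RtoC (c j) * KR (x - la j))%C n.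
Proof.
  assert (R1 : forall d, rc_on (fun xi => ei (xi * d)) a b).
  { intros d t Ht. eapply rcont_ext; [|apply (rc_ei d 0 a b t Ht)]. intros; simpl. rewrite Rplus_0_r. reflexivity. }
  rewrite (CI_ext _ (fun xi => csum (fun j => RtoC (c j) * ei (xi * (x - la j)))%C n)); [|lra|].
  - rewrite (CI_csum (fun j xi => RtoC (c j) * ei (xi * (x - la j)))%C); [|lra|intros; apply rc_on_scal, R1].
    apply csum_ext. intros j Hj. apply CI_scal; [lra|apply R1].
  - intros xi _. unfold Phi. rewrite Cmult_comm, <- csum_scal. apply csum_ext. intros j Hj.
    replace (xi * (x - la j)) with (xi * x + xi * - la j) by ring. rewrite ei_plus. ring.
Qed.

(** At spacing [2 * PI / (b - a)] the exponentials are orthogonal on [[a, b]], so the sampled values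
    of the kernel sum are Fourier coefficients of [Phi] and Bessel's inequality applies. *)
Lemma sieve_points x0 N :
  rs (fun m => Cmod (csum (fun j => RtoC (c j) * KR (x0 + INR m * (2 * PI / (b - a)) - la j))%C n) ^ 2) N
   <= (b - a) * ((b - a + 2 * PI / de) * rs (fun i => c i ^ 2) n).
Proof.
  set (h := 2 * PI / (b - a)). assert (R1 : forall d, rc_on (fun xi => ei (xi * d)) a b).
  { intros d t Ht. eapply rcont_ext; [|apply (rc_ei d 0 a b t Ht)]. intros; simpl. rewrite Rplus_0_r. reflexivity. }
  pose proof (bessel (fun m xi => ei (xi * (x0 + INR m * h))) a b Hab (fun m => R1 _) (fun m t => Cmod_ei _)) as B.
  assert (O : forall m k, m <> k -> CI (fun t => Cconj (ei (t * (x0 + INR k * h))) * ei (t * (x0 + INR m * h)))%C a b = 0%C).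
  { intros m k Hmk. rewrite <- (CI_ei_period a b m k Hab Hmk). apply CI_ext; [lra|]. intros t _.
    rewrite Cconj_ei, <- ei_plus. f_equal. fold h. ring. } specialize (B O N Phi (rc_Phi a b)).
  rewrite (rs_ext _ (fun m => Cmod (CI (fun t => Phi t * ei (t * (x0 + INR m * h)))%C a b) ^ 2)).
  - step_le; [exact B|]. mono_l; [lra|apply Phi_norm].
  - intros m Hm. rewrite Phi_KR. reflexivity.
Qed.
End Sieve.

Lemma RInt_blocks (g : R -> R) x0 h N : 0 <= h -> (forall t, continuous g t) ->
  RInt g x0 (x0 + INR N * h) = RInt (fun x => rs (fun m => g (x + INR m * h)) N) x0 (x0 + h).
Proof.
  intros Hh Hg. assert (EX : forall u v, ex_RInt g u v) by (intros; apply (ex_RInt_continuous (V := RC)); auto).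
  assert (EX2 : forall m, ex_RInt (fun x => g (x + INR m * h)) x0 (x0 + h)).
  { intros m. apply (ex_RInt_continuous (V := RC)). intros z _.
    apply (continuous_comp (fun x => x + INR m * h) g); [|apply Hg]. cont_derive. }
  rewrite (proj2 (RInt_rs (fun m x => g (x + INR m * h)) N x0 (x0 + h) (fun m _ => EX2 m))). induction N as [|N IH].
  - simpl. rewrite Rmult_0_l, Rplus_0_r. apply (RInt_point (V := RC)).
  - rewrite S_INR. simpl rs. rewrite <- IH. rewrite <- (RInt_Chasles (V := RC) g x0 (x0 + INR N * h)) by apply EX.
    unfold plus; simpl. f_equal. pose proof (RInt_comp_lin (V := RC) g 1 (INR N * h) x0 (x0 + h)) as K.
    transitivity (RInt g (1 * x0 + INR N * h) (1 * (x0 + h) + INR N * h)); [f_equal; ring|].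
    rewrite <- K by apply EX. apply RInt_ext. intros; unfold scal; simpl; unfold mult; simpl. rewrite !Rmult_1_l. reflexivity.
Qed.

Lemma RInt_mono_dom (g : R -> R) x y z : x <= y -> y <= z -> (forall t, continuous g t) -> (forall t, 0 <= g t) ->
  RInt g x y <= RInt g x z.
Proof.
  intros H1 H2 Hg Hp. assert (EX : forall u v, ex_RInt g u v) by (intros; apply (ex_RInt_continuous (V := RC)); auto).
  rewrite <- (RInt_Chasles (V := RC) g x y z) by apply EX. unfold plus; simpl.
  assert (0 <= RInt g y z) by (apply RInt_ge_0; [exact H2|apply EX|intros; apply Hp]). lra.
Qed.

(** Integrating [sieve_points] over one period of the sampling lattice takes the place of
    Plancherel's theorem for [Phi] cut off to [[a, b]]. The period times [b - a] is the factor
    [2 * PI]. *)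
Theorem dual_large_sieve n (la c : nat -> R) de a b X : 0 < de -> a < b -> 0 <= X ->
  (forall i j, (i < n)%nat -> (j < n)%nat -> de * Rabs (INR i - INR j) <= Rabs (la i - la j)) ->
  (forall t, rcont (KR a b) t) ->
  RInt (fun x => Cmod (csum (fun j => RtoC (c j) * KR a b (x - la j))%C n) ^ 2) (- X) X
    <= 2 * PI * ((b - a + 2 * PI / de) * rs (fun i => c i ^ 2) n).
Proof.
  intros Hde Hab HX Hsep HK. pose proof PI_RGT_0 as HPI.
  set (g := fun x => Cmod (csum (fun j => RtoC (c j) * KR a b (x - la j))%C n) ^ 2).
  assert (Hg : forall t, continuous g t).
  { intros t. apply rcont_Cmod2, csum_rc. intros i Hi. apply rcont_mult; [apply rcont_const|].
    destruct (HK (t - la i)) as [K1 K2]. assert (Hl : continuous (fun x => x - la i) t) by (cont_derive).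
    split; [apply (continuous_comp (fun x => x - la i) (fun x => fst (KR a b x)))|
            apply (continuous_comp (fun x => x - la i) (fun x => snd (KR a b x)))]; assumption. }
  set (h := 2 * PI / (b - a)). assert (Hh : 0 < h) by (div_pos; lra). destruct (INR_unbounded (2 * X / h)) as [N HN].
  assert (HN2 : X <= - X + INR N * h).
  { apply (Rmult_gt_compat_r h) in HN; [|exact Hh]. unfold Rdiv in HN. rewrite Rmult_assoc, Rinv_l in HN; lra. }
  step_le; [apply (RInt_mono_dom g (- X) X (- X + INR N * h)); [lra|exact HN2|exact Hg|intros; apply pow2_ge_0]|].
  rewrite RInt_blocks by (try assumption; lra).
  assert (EX2 : forall m, ex_RInt (fun x => g (x + INR m * h)) (- X) (- X + h)).
  { intros m. apply (ex_RInt_continuous (V := RC)). intros z _.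
    apply (continuous_comp (fun x => x + INR m * h) g); [|apply Hg]. cont_derive. }
  apply Rle_trans with (RInt (fun _ => (b - a) * ((b - a + 2 * PI / de) * rs (fun i => c i ^ 2) n)) (- X) (- X + h)).
  - apply RInt_le; [lra|apply (RInt_rs (fun m x => g (x + INR m * h))); intros; apply EX2|apply (ex_RInt_const (V := RN))|].
    intros x _. exact (sieve_points n la c de a b Hde Hab Hsep x N).
  - int_const. right. unfold h. field. lra.
Qed.

(** * Exponential quotients, the strip map and the entire kernel *)

Lemma Cexp_expand (c p : C) : exists K, 0 <= K /\ forall s, Cmod (s - p) < 1 ->
  Cmod (Cexp (c * s) - Cexp (c * p) - c * Cexp (c * p) * (s - p) - c * c / 2 * Cexp (c * p) * (s - p) * (s - p))
    <= K * Cmod (s - p) ^ 3.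
Proof.
  pose proof (Cmod_ge_0 c) as Hc. pose proof (Cmod_ge_0 (Cexp (c * p))) as He.
  exists (Cmod (Cexp (c * p)) * (Cmod c ^ 3 * exp (Cmod c))).
  assert (H3 : 0 <= Cmod c ^ 3) by (apply pow_le, Hc). pose proof (exp_pos (Cmod c)) as Hx.
  split; [apply Rmult_le_pos; [exact He|apply Rmult_le_pos; lra]|]. intros s Hs. pose proof (Cmod_ge_0 (s - p)) as Hn.
  assert (E : Cexp (c * s) = (Cexp (c * p) * Cexp (c * (s - p)))%C).
  { rewrite <- Cexp_plus. f_equal. ring. } set (u := (c * (s - p))%C) in *.
  assert (Eu : (Cexp (c * s) - Cexp (c * p) - c * Cexp (c * p) * (s - p) - c * c / 2 * Cexp (c * p) * (s - p) * (s - p))%C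
     = (Cexp (c * p) * (Cexp (RtoC 1 * u) - 1 - RtoC 1 * u - RtoC (1 * 1 / 2) * u * u))%C).
  { rewrite E, !Cmult_1_l. replace (RtoC (1 * 1 / 2)) with (/ 2)%C by (rewrite <- RtoC_inv by lra; f_equal; field).
    unfold u. field. } rewrite Eu, Cmod_mult, !Rmult_assoc. mono_l; [exact He|].
  step_le; [apply (Cexp_bound3 u 1); lra|]. unfold u. rewrite Cmod_mult.
  assert (Hle : exp (Cmod c * Cmod (s - p)) <= exp (Cmod c)) by (apply exp_le; nra).
  replace (Cmod c * Cmod (s - p) * (Cmod c * Cmod (s - p) * (Cmod c * Cmod (s - p) * exp (Cmod c * Cmod (s - p)))))
    with ((Cmod c ^ 3 * Cmod (s - p) ^ 3) * exp (Cmod c * Cmod (s - p))) by ring.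
  replace (Cmod c ^ 3 * (exp (Cmod c) * Cmod (s - p) ^ 3)) with ((Cmod c ^ 3 * Cmod (s - p) ^ 3) * exp (Cmod c)) by ring.
  mono_l; [apply Rmult_le_pos; [exact H3|apply pow_le, Hn]|exact Hle].
Qed.

Lemma hol_Cexp_lin (c z : C) : hol (fun s => Cexp (c * s)) z.
Proof. apply hol_Cexp_comp, hol_mult; [apply hol_const|apply hol_id]. Qed.

(** Covers both entire quotients in use: [phi a z - phi a p] over [z - p], and the kernel [KC]. *)
Lemma hol_exp_quotient (A B C0 c d p : C) : (A * Cexp (c * p) + B * Cexp (d * p) + C0 = 0)%C ->
  forall z, hol (Cquot (fun s => A * Cexp (c * s) + B * Cexp (d * s) + C0)%C p
     (A * (c * Cexp (c * p)) + B * (d * Cexp (d * p)))) z.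
Proof.
  intros H0 z. destruct (classic (z = p)) as [->|Hz].
  - destruct (Cexp_expand c p) as (K1 & HK1 & H1). destruct (Cexp_expand d p) as (K2 & HK2 & H2).
    pose proof (Cmod_ge_0 A) as HA. pose proof (Cmod_ge_0 B) as HB.
    apply (expansion_divide _ p _ (A * (c * c / 2 * Cexp (c * p)) + B * (d * d / 2 * Cexp (d * p)))
      (Cmod A * K1 + Cmod B * K2) 1); [nra|lra|exact H0|]. intros s Hs. specialize (H1 s Hs). specialize (H2 s Hs).
    set (X := (Cexp (c * s) - Cexp (c * p) - c * Cexp (c * p) * (s - p) - c * c / 2 * Cexp (c * p) * (s - p) * (s - p))%C) in *.
    set (Y := (Cexp (d * s) - Cexp (d * p) - d * Cexp (d * p) * (s - p) - d * d / 2 * Cexp (d * p) * (s - p) * (s - p))%C) in *.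
    match goal with |- Cmod ?e <= _ => replace e with (A * X + B * Y)%C by (unfold X, Y; ring) end.
    step_le; [apply Cmod_triangle|]. rewrite !Cmod_mult.
    apply (Rmult_le_compat_l _ _ _ HA) in H1. apply (Rmult_le_compat_l _ _ _ HB) in H2. lra.
  - apply hol_Cquot_off; [exact Hz|].
    apply hol_plus; [apply hol_plus; (apply hol_mult; [apply hol_const|apply hol_Cexp_lin])|apply hol_const].
Qed.

(** [e^(a z)] maps the strip [|Im z| < pi / a] conformally onto the slit plane. *)
Definition phi (a : R) (z : C) : C := Cexp (RtoC a * z).

Lemma phi_fst a z : fst (phi a z) = exp (a * fst z) * cos (a * snd z).
Proof. unfold phi, Cexp. destruct z; csimp. f_equal; f_equal; ring. Qed.
Lemma phi_snd a z : snd (phi a z) = exp (a * fst z) * sin (a * snd z).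
Proof. unfold phi, Cexp. destruct z; csimp. f_equal; f_equal; ring. Qed.
Lemma phi_mod a z : Cmod (phi a z) = exp (a * fst z).
Proof. unfold phi. rewrite Cmod_Cexp. f_equal. destruct z; csimp; ring. Qed.
Lemma hol_phi a z : hol (phi a) z.
Proof. apply hol_Cexp_lin. Qed.
Lemma cos_eq_1 x : - (2 * PI) < x < 2 * PI -> cos x = 1 -> x = 0.
Proof.
  intros Hx E. assert (S : sin (x / 2) = 0).
  { pose proof (cos_2a_sin (x / 2)) as H. replace (2 * (x / 2)) with x in H by field. rewrite E in H. nra. }
  assert (P := PI_RGT_0). destruct (Rtotal_order (x / 2) 0) as [H|[H|H]]; [|lra|].
  - pose proof (sin_lt_0_var (x / 2)). lra.
  - pose proof (sin_gt_0 (x / 2)). lra.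
Qed.

Lemma phi_inj a (z p : C) : 0 < a -> Rabs (snd z - snd p) * a < 2 * PI -> phi a z = phi a p -> z = p.
Proof.
  intros Ha Hs E. assert (E1 : fst z = fst p).
  { apply (f_equal Cmod) in E. rewrite !phi_mod in E. apply exp_inv in E. nra. }
  pose proof (f_equal fst E) as Ef. pose proof (f_equal snd E) as Es. rewrite !phi_fst in Ef. rewrite !phi_snd in Es. rewrite E1 in *.
  pose proof (exp_pos (a * fst p)) as Hp. apply Rmult_eq_reg_l in Ef; [|lra]. apply Rmult_eq_reg_l in Es; [|lra].
  assert (H1 : cos (a * snd z - a * snd p) = 1).
  { rewrite cos_minus, Ef, Es. pose proof (sin2_cos2 (a * snd p)) as S. unfold Rsqr in S. lra. } apply cos_eq_1 in H1.
  - apply C_eq; [exact E1|]. nra.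
  - assert (Hq : Rabs (a * snd z - a * snd p) < 2 * PI); [|apply Rabs_def2 in Hq; lra]. rewrite <- Rmult_minus_distr_l, Rabs_mult, (Rabs_pos_eq a) by lra. lra.
Qed.

(** [phi a - phi a p] has a simple zero at [p] and no other within one period, so it can stand in
    for the linear factor [z - p]. *)
Lemma phi_quotient a (p : C) : 0 < a -> exists g : C -> C,
  (forall z, hol g z) /\ (forall z, (phi a z - phi a p)%C = ((z - p) * g z)%C) /\
  (forall z : C, Rabs (snd z - snd p) * a < 2 * PI -> g z <> 0%C).
Proof.
  intros Ha. set (f := fun s => (1 * Cexp (RtoC a * s) + 0 * Cexp (0 * s) + - phi a p)%C).
  set (d := (1 * (RtoC a * Cexp (RtoC a * p)) + 0 * (0 * Cexp (0 * p)))%C). exists (Cquot f p d).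
  assert (Ef : forall z, f z = (phi a z - phi a p)%C) by (intros z; unfold f, phi; ring). split; [|split].
  - intros z. apply (hol_exp_quotient 1 0 (- phi a p) (RtoC a) 0 p). unfold phi. ring.
  - intros z. destruct (classic (z = p)) as [->|Hz]; [ring|].
    rewrite Cquot_off, Ef by exact Hz. field. intros E. apply Hz. replace z with ((z - p) + p)%C by ring. rewrite E. ring.
  - intros z Hs. destruct (classic (z = p)) as [->|Hz].
    + rewrite Cquot_at. unfold d. intros E. apply (Cexp_neq_0 (RtoC a * p)).
      replace (Cexp (RtoC a * p)) with (/ RtoC a * (1 * (RtoC a * Cexp (RtoC a * p)) + 0 * (0 * Cexp (0 * p))))%C.
      * rewrite E. ring.
      * field. intros E2. apply (f_equal fst) in E2. simpl in E2. lra.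
    + rewrite Cquot_off, Ef by exact Hz. intros E. apply Hz, (phi_inj a z p Ha Hs).
      assert (Hn : (z - p)%C <> 0%C) by (intros E2; apply Hz; replace z with ((z - p) + p)%C by ring; rewrite E2; ring).
      replace (phi a z) with ((phi a z - phi a p) / (z - p) * (z - p) + phi a p)%C by (field; exact Hn).
      rewrite E. ring.
Qed.

(** The entire extension of [KR]: [(exp (i b u) - exp (i a u)) / (i u)], with its value at 0 filled
    in. *)
Definition KC (a b : R) (u : C) : C :=
  (/ Ci * Cquot (fun s => 1 * Cexp (Ci * RtoC b * s) + RtoC (-1) * Cexp (Ci * RtoC a * s) + 0) 0
    (1 * (Ci * RtoC b * Cexp (Ci * RtoC b * 0)) + RtoC (-1) * (Ci * RtoC a * Cexp (Ci * RtoC a * 0))) u)%C.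

Lemma Ci_neq_0 : Ci <> 0%C.
Proof. intros E. apply (f_equal snd) in E. simpl in E. lra. Qed.

Lemma hol_KC a b u : hol (KC a b) u.
Proof.
  apply hol_mult; [apply hol_const|]. apply hol_exp_quotient. rewrite !Cmult_0_r, !Cexp_0. ceq; ring.
Qed.
Lemma KC_off a b (u : C) : u <> 0%C -> KC a b u = ((Cexp (Ci * RtoC b * u) - Cexp (Ci * RtoC a * u)) / (Ci * u))%C.
Proof.
  intros Hu. unfold KC. rewrite Cquot_off by exact Hu. replace (u - 0)%C with u by ring.
  replace (RtoC (-1)) with (- (1))%C by (ceq; ring). field. split; [exact Hu|exact Ci_neq_0].
Qed.
Lemma Cexp_Ci (b x : R) : Cexp (Ci * RtoC b * RtoC x)%C = ei (b * x).
Proof.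
  unfold Cexp, ei, Re, Im. csimp. replace ((0 * b - 1 * 0) * x - (0 * 0 + 1 * b) * 0) with 0 by ring.
  replace ((0 * b - 1 * 0) * 0 + (0 * 0 + 1 * b) * x) with (b * x) by ring. rewrite exp_0. f_equal; ring.
Qed.
Lemma Cmult_reg_l (c x y : C) : (c * x = c * y)%C -> c <> 0%C -> x = y.
Proof.
  intros E Hc. transitivity (/ c * (c * x))%C; [field; exact Hc|]. rewrite E. field. exact Hc.
Qed.

Lemma KC_KR a b x : a <= b -> KC a b (RtoC x) = KR a b x.
Proof.
  intros Hab. destruct (Req_dec x 0) as [->|Hx].
  - unfold KC. rewrite Cquot_at, !Cmult_0_r, !Cexp_0. unfold KR. rewrite (CI_ext _ (fun _ => RtoC 1)); [|exact Hab|].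
    + unfold CI. simpl. rewrite !RInt_const. unfold scal; simpl; unfold mult; simpl.
      transitivity (RtoC b - RtoC a)%C; [|ceq; ring].
      replace (RtoC (-1)) with (- (1))%C by (ceq; ring). field. exact Ci_neq_0.
    + intros. unfold ei. rewrite Rmult_0_r, cos_0, sin_0. reflexivity.
  - assert (Hx' : RtoC x <> 0%C) by (intros E; apply (f_equal fst) in E; simpl in E; lra).
    rewrite KC_off by exact Hx'. rewrite !Cexp_Ci. unfold KR. rewrite CI_ei by assumption.
    apply (Cmult_reg_l (Ci * RtoC x)%C).
    + transitivity (ei (b * x) - ei (a * x))%C; [field; split; [exact Hx'|exact Ci_neq_0]|].
      unfold ei. ceq; field; exact Hx.
    + apply Cmult_neq_0; [exact Ci_neq_0|exact Hx'].
Qed.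
Lemma rcont_KR a b t : a <= b -> rcont (KR a b) t.
Proof.
  intros Hab. apply (rcont_ext (fun t => KC a b (RtoC t))); [intros; apply KC_KR, Hab|].
  apply (hol_rcont (KC a b) (fun t => RtoC t)); [apply hol_KC|apply rcont_RtoC, continuous_id].
Qed.

(** * Finite products and dividing out zeros *)

Fixpoint cprod (f : nat -> C) (n : nat) : C := match n with O => 1%C | S m => (cprod f m * f m)%C end.

Lemma cprod_neq_0 (f : nat -> C) n : (forall i, (i < n)%nat -> f i <> 0%C) -> cprod f n <> 0%C.
Proof.
  induction n as [|n IH]; intros H; simpl.
  - intros E. apply (f_equal fst) in E. simpl in E. lra.
  - apply Cmult_neq_0; [apply IH; intros; apply H; lia|apply H; lia].
Qed.
Lemma cprod_0 (f : nat -> C) n i : (i < n)%nat -> f i = 0%C -> cprod f n = 0%C.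
Proof.
  induction n as [|n IH]; intros Hi H; [lia|]. simpl. destruct (Nat.eq_dec i n) as [->|].
  - rewrite H. ring.
  - rewrite IH by (try assumption; lia). ring.
Qed.
Lemma cprod_le f g n : (forall i, (i < n)%nat -> Cmod (f i) <= Cmod (g i)) -> Cmod (cprod f n) <= Cmod (cprod g n).
Proof.
  induction n as [|n IH]; intros H; simpl; [lra|]. rewrite !Cmod_mult.
  apply Rmult_le_compat; try apply Cmod_ge_0; [apply IH; intros; apply H; lia|apply H; lia].
Qed.
Lemma cprod_le_exp f g t n : (forall i, (i < n)%nat -> Cmod (f i) <= exp (t i) * Cmod (g i)) ->
  Cmod (cprod f n) <= exp (rs t n) * Cmod (cprod g n).
Proof.
  induction n as [|n IH]; intros H; simpl; [rewrite exp_0; lra|]. rewrite !Cmod_mult, exp_plus.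
  pose proof (IH ltac:(intros; apply H; lia)) as I. pose proof (H n ltac:(lia)) as J.
  replace (exp (rs t n) * exp (t n) * (Cmod (cprod g n) * Cmod (g n)))
    with ((exp (rs t n) * Cmod (cprod g n)) * (exp (t n) * Cmod (g n))) by ring.
  apply Rmult_le_compat; try apply Cmod_ge_0; assumption.
Qed.
Lemma hol_cprod (f : nat -> C -> C) n z : (forall i, (i < n)%nat -> hol (f i) z) -> hol (fun z => cprod (fun i => f i z) n) z.
Proof.
  intros H. induction n as [|n IH]; [exact (hol_const 1%C z)|].
  apply (hol_mult (fun z => cprod (fun i => f i z) n) (f n)); [apply IH; intros; apply H; lia|apply H; lia].
Qed.

Lemma ccont_nonzero f (z : C) : ccont f z -> f z <> 0%C -> exists r, 0 < r /\ forall w, Cmod (w - z) < r -> f w <> 0%C.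
Proof.
  intros Hc Hz. destruct (Hc (Cmod (f z)) (Cmod_pos_neq _ Hz)) as (r & Hr & H). exists r. split; [exact Hr|].
  intros w Hw E. specialize (H w Hw). rewrite E in H. replace (0 - f z)%C with (- f z)%C in H by ring.
  rewrite Cmod_opp in H. lra.
Qed.

(** One factor at a time: the previous quotient satisfies [F * P = v n * g], where the product [P]
    of the earlier factors does not vanish at [zz n]; so [g / P] fills in [F / v n] there. *)
Lemma divide_out (D : C -> Prop) (v : nat -> C -> C) (zz : nat -> C) (f : C -> C) n :
  (forall z, D z -> exists r, 0 < r /\ forall w, Cmod (w - z) < r -> D w) -> (forall z, D z -> hol f z) ->
  (forall i, (i < n)%nat -> D (zz i) /\ exists g, hol g (zz i) /\ forall z, D z -> f z = (v i z * g z)%C) ->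
  (forall i z, (i < n)%nat -> D z -> hol (v i) z /\ (v i z = 0%C -> z = zz i)) ->
  (forall i j, (i < n)%nat -> (j < n)%nat -> i <> j -> zz i <> zz j) ->
  exists F, (forall z, D z -> hol F z) /\ forall z, D z -> f z = (F z * cprod (fun i => v i z) n)%C.
Proof.
  intros HD Hf. induction n as [|n IH]; intros Hz Hv Hd.
  - exists f. split; [exact Hf|]. intros; simpl; ring.
  - destruct IH as (F & HF & EF); [intros; apply Hz; lia|intros; apply Hv; [lia|assumption]|intros; apply Hd; lia|].
    destruct (Hz n ltac:(lia)) as (Dp & g & Hg & Eg). set (p := zz n) in *.
    set (P := fun z => cprod (fun i => v i z) n). assert (HP : P p <> 0%C).
    { apply cprod_neq_0. intros i Hi E. apply (Hd i n); [lia|lia|lia|]. symmetry. apply (Hv i p ltac:(lia) Dp), E. }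
    assert (HPh : hol P p) by (apply hol_cprod; intros; apply Hv; [lia|exact Dp]).
    set (F' := fun z => if Req_EM_T (Cmod (z - p)) 0 then (g p / P p)%C else (F z / v n z)%C).
    assert (Eat : F' p = (g p / P p)%C).
    { unfold F'. destruct Req_EM_T as [E|E]; [reflexivity|]. exfalso. apply E.
      replace (p - p)%C with (RtoC 0) by ring. apply Cmod_0. }
    assert (Eoff : forall z, z <> p -> F' z = (F z / v n z)%C).
    { intros z Hzp. unfold F'. destruct Req_EM_T as [E|E]; [|reflexivity]. exfalso. apply Hzp, Cmod_sub_0, E. }
    assert (Hvn : forall z, D z -> z <> p -> v n z <> 0%C).
    { intros z Dz Hzp E. apply Hzp, (Hv n z ltac:(lia) Dz), E. } exists F'. split.
    + intros z Dz. destruct (classic (z = p)) as [->|Hzp].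
      * destruct (ccont_nonzero P p (hol_ccont _ _ HPh) HP) as (r1 & Hr1 & H1). destruct (HD p Dp) as (r2 & Hr2 & H2).
        apply (hol_local (fun z => g z / P z)%C F' p (Rmin r1 r2)); [apply Rmin_pos; assumption| |apply hol_div; assumption].
        intros w Hw. assert (W1 : P w <> 0%C) by (apply H1; eapply Rlt_le_trans; [exact Hw|apply Rmin_l]).
        assert (W2 : D w) by (apply H2; eapply Rlt_le_trans; [exact Hw|apply Rmin_r]).
        destruct (classic (w = p)) as [->|Hwp]; [symmetry; exact Eat|]. rewrite Eoff by exact Hwp.
        pose proof (Hvn w W2 Hwp) as W3. pose proof (EF w W2) as E1. rewrite (Eg w W2) in E1. fold (P w) in E1.
        apply (Cmult_reg_l (v n w * P w)%C); [|apply Cmult_neq_0; assumption].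
        transitivity (v n w * g w)%C; [field; exact W1|]. rewrite E1. field. exact W3.
      * assert (Hn : 0 < Cmod (z - p)).
        { apply Cmod_pos_neq. intros E. apply Hzp. replace z with ((z - p) + p)%C by ring. rewrite E. ring. }
        apply (hol_local (fun z => F z / v n z)%C F' z (Cmod (z - p))); [exact Hn| |].
        -- intros w Hw. symmetry. apply Eoff. intros ->. rewrite Cmod_minus_sym in Hw. lra.
        -- apply hol_div; [apply HF, Dz|apply Hv; [lia|exact Dz]|apply Hvn; assumption].
    + intros z Dz. simpl. fold (P z). destruct (classic (z = p)) as [->|Hzp].
      * rewrite Eat, (Eg p Dp). field. exact HP.
      * rewrite (Eoff z Hzp), (EF z Dz). fold (P z). field. apply Hvn; assumption.
Qed.

(** * Moving zeros to the real axis *)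

Lemma exp_ge_1x x : 1 + x <= exp x.
Proof. destruct (Req_dec x 0) as [->|H]; [rewrite exp_0; lra|left; apply exp_ineq1, H]. Qed.
Lemma cos_ge_half x : 0 <= x <= 1 -> / 2 <= cos x.
Proof.
  intros Hx. pose proof PI_gt_3. replace (/ 2) with (cos (PI / 3)) by (rewrite cos_PI3; field). apply cos_decr_1; lra.
Qed.
Lemma sin_le_id x : 0 <= x -> sin x <= x.
Proof. intros [H|<-]; [left; apply sin_lt_x, H|rewrite sin_0; lra]. Qed.

Section Local.
Variables (a Y X L iota : R) (n : nat) (la al : nat -> R) (G : C -> C).
Hypothesis Ha : 0 < a.
Hypothesis HaY : a * Y = PI / 2.
Hypothesis HaX : 4 <= a * X.
Hypothesis HL : 0 < L.
Hypothesis HY : L + 4 <= Y.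
Hypothesis Hio : 0 < iota < PI / 2.
Hypothesis Hal : forall i, (i < n)%nat -> 0 <= al i <= 5 / 2 /\ a * al i <= 1.
Hypothesis Hla : forall i, (i < n)%nat -> Rabs (la i) <= X / 2.
Hypothesis Hdist : forall i j, (i < n)%nat -> (j < n)%nat -> i <> j -> la i <> la j.
Hypothesis Him : forall i, (i < n)%nat -> exp (a * la i) * sin (a * al i) <= 2 * sin iota.

Definition Dom (z : C) : Prop := - X - 1 < fst z < X + 1 /\ - L - 1 < snd z < 2 * Y + 1.
Hypothesis HG : forall z, Dom z -> hol G z.
Hypothesis Hdiv : forall i, (i < n)%nat ->
  exists g, hol g (la i, al i) /\ forall z, Dom z -> G z = ((z - (la i, al i)) * g z)%C.

(** Its image under [phi] is [exp (i (PI - iota))], on the unit circle just above [-1]. *)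
Definition zw : C := (0, (PI - iota) / a).
(** On these lines [phi] is huge, tiny or purely imaginary, so its distance from each [p i] is at
    least proportional to [Cmod (p i)]. *)
Definition far (z : C) : Prop := fst z = X \/ fst z = - X \/ snd z = Y.

Let p i : C := phi a (la i, al i).
(** Replacing the factor [v i] by [u i] lets [phi] take the real part of [p i] instead of [p i],
    which moves the zero to the real axis. *)
Let u i (z : C) : C := (phi a z - RtoC (fst (p i)))%C.
Let v i (z : C) : C := (phi a z - p i)%C.

Lemma X_pos : 0 < X.
Proof. nra. Qed.
Lemma Dom_open z : Dom z -> exists r, 0 < r /\ forall w, Cmod (w - z) < r -> Dom w.
Proof.
  intros [[H1 H2] [H3 H4]].
  set (r := Rmin (Rmin (fst z + X + 1) (X + 1 - fst z)) (Rmin (snd z + L + 1) (2 * Y + 1 - snd z))).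
  assert (R1 : r <= fst z + X + 1) by (unfold r; step_le; [apply Rmin_l|apply Rmin_l]).
  assert (R2 : r <= X + 1 - fst z) by (unfold r; step_le; [apply Rmin_l|apply Rmin_r]).
  assert (R3 : r <= snd z + L + 1) by (unfold r; step_le; [apply Rmin_r|apply Rmin_l]).
  assert (R4 : r <= 2 * Y + 1 - snd z) by (unfold r; step_le; [apply Rmin_r|apply Rmin_r]).
  exists r. split; [unfold r; repeat apply Rmin_pos; lra|].
  intros w Hw. pose proof (Cmod_fst (w - z)) as A. pose proof (Cmod_snd (w - z)) as B.
  change (fst (w - z)%C) with (fst w + - fst z) in A. change (snd (w - z)%C) with (snd w + - snd z) in B.
  apply Rabs_le_between in A. apply Rabs_le_between in B. split; split; lra.
Qed.

Lemma p_im_nonneg i : (i < n)%nat -> 0 <= snd (p i).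
Proof.
  intros Hi. unfold p. rewrite phi_snd. simpl. destruct (Hal i Hi) as [A B]. pose proof PI_gt_3.
  apply Rmult_le_pos; [left; apply exp_pos|apply sin_ge_0; nra].
Qed.
Lemma u_sq i z : Cmod (u i z) ^ 2 = (fst (phi a z) - fst (p i)) ^ 2 + snd (phi a z) ^ 2.
Proof. rewrite Cmod_sqr. unfold u. csimp. ring. Qed.
Lemma v_sq i z : Cmod (v i z) ^ 2 = (fst (phi a z) - fst (p i)) ^ 2 + (snd (phi a z) - snd (p i)) ^ 2.
Proof. rewrite Cmod_sqr. unfold v. csimp. ring. Qed.
Lemma sq_le_Cmod (x y : C) : Cmod x ^ 2 <= Cmod y ^ 2 -> Cmod x <= Cmod y.
Proof. intros H. pose proof (Cmod_ge_0 x). pose proof (Cmod_ge_0 y). simpl in H. nra. Qed.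
(** A point of the closed lower half-plane is at least as near to the real part of [p i] as to
    [p i], which lies above the axis. *)
Lemma u_le_v i z : (i < n)%nat -> snd (phi a z) <= 0 -> Cmod (u i z) <= Cmod (v i z).
Proof.
  intros Hi H. apply sq_le_Cmod. rewrite u_sq, v_sq. pose proof (p_im_nonneg i Hi). nra.
Qed.
Lemma phi_zw : phi a zw = (- cos iota, sin iota).
Proof.
  apply C_eq; rewrite ?phi_fst, ?phi_snd; simpl; rewrite Rmult_0_r, exp_0; replace (a * ((PI - iota) / a)) with (PI - iota) by (field; lra).
  - rewrite Rtrigo_facts.cos_pi_minus. ring.
  - rewrite Rtrigo_facts.sin_pi_minus. ring.
Qed.
Lemma sin_iota_pos : 0 < sin iota.
Proof. apply sin_gt_0; lra. Qed.
(** The comparison is reversed at [zw]: by [Him] the height of [p i] is at most twice that of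
    [phi a zw], so [p i] is no farther from [phi a zw] than its projection to the real axis is. *)
Lemma v_le_u_zw i : (i < n)%nat -> Cmod (v i zw) <= Cmod (u i zw).
Proof.
  intros Hi. apply sq_le_Cmod. rewrite u_sq, v_sq, phi_zw. pose proof (p_im_nonneg i Hi). pose proof (Him i Hi) as A.
  assert (E : snd (p i) = exp (a * la i) * sin (a * al i)) by (unfold p; rewrite phi_snd; reflexivity).
  rewrite <- E in A. cbn [fst snd]. nra.
Qed.
Lemma far_v i z : (i < n)%nat -> far z -> exp (a * la i) <= 2 * Cmod (v i z).
Proof.
  intros Hi Hf. pose proof (Hla i Hi) as A. apply Rabs_le_between in A. pose proof X_pos as HX.
  assert (E0 : 2 <= exp 2) by (pose proof (exp_ge_1x 2); lra).
  assert (Hm : Cmod (p i) = exp (a * la i)) by (unfold p; apply phi_mod). destruct Hf as [Hf|[Hf|Hf]].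
  - pose proof (Cmod_rev_triangle (phi a z) (p i)) as T. rewrite phi_mod, Hf, Hm in T. fold (v i z) in T.
    assert (H1 : exp (a * la i) * exp 2 <= exp (a * X)) by (rewrite <- exp_plus; apply exp_le; nra).
    pose proof (exp_pos (a * la i)). nra.
  - pose proof (Cmod_rev_triangle (p i) (phi a z)) as T. rewrite Cmod_minus_sym in T. rewrite phi_mod, Hf, Hm in T. fold (v i z) in T.
    assert (H1 : exp (a * - X) * exp 2 <= exp (a * la i)) by (rewrite <- exp_plus; apply exp_le; nra).
    pose proof (exp_pos (a * la i)). pose proof (exp_pos (a * - X)). nra.
  - pose proof (Cmod_fst (v i z)) as T. unfold v in T. change (fst (phi a z - p i)%C) with (fst (phi a z) + - fst (p i)) in T.
    rewrite phi_fst, Hf, HaY, cos_PI2, Rmult_0_r, Rplus_0_l, Rabs_Ropp in T. fold (v i z) in T.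
    unfold p in T. rewrite phi_fst in T. cbn [fst snd] in T. destruct (Hal i Hi) as [B1 B2].
    assert (C0 : / 2 <= cos (a * al i)) by (apply cos_ge_half; split; [nra|exact B2]).
    pose proof (exp_pos (a * la i)). rewrite Rabs_pos_eq in T by nra. nra.
Qed.
(** [u i] and [v i] differ by the height of [p i], at most [a * al i] times [Cmod (p i)], while
    [Cmod (v i z)] is at least half of [Cmod (p i)]. *)
Lemma u_far i z : (i < n)%nat -> far z -> Cmod (u i z) <= exp (2 * (a * al i)) * Cmod (v i z).
Proof.
  intros Hi Hf. pose proof (far_v i z Hi Hf) as A. destruct (Hal i Hi) as [B1 B2].
  assert (E : u i z = (v i z + (0, snd (p i)))%C) by (unfold u, v; ceq; ring).
  pose proof (Cmod_triangle (v i z) (0, snd (p i))) as T. rewrite <- E in T.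
  assert (M : Cmod (0, snd (p i)) = snd (p i)).
  { pose proof (Cmod_le_abs (0, snd (p i))) as Q. pose proof (Cmod_snd (0, snd (p i))) as Q2. cbn [fst snd] in Q, Q2.
    pose proof (Rabs_pos_eq _ (p_im_nonneg i Hi)) as Q3. rewrite Rabs_R0, Q3 in Q. rewrite Q3 in Q2. lra. }
  rewrite M in T. unfold p in T. rewrite phi_snd in T. cbn [fst snd] in T.
  assert (S0 : sin (a * al i) <= a * al i) by (apply sin_le_id; nra).
  pose proof (exp_ge_1x (2 * (a * al i))) as X1. pose proof (exp_pos (a * la i)). pose proof (Cmod_ge_0 (v i z)).
  assert (exp (a * la i) * sin (a * al i) <= 2 * Cmod (v i z) * (a * al i)).
  { apply Rle_trans with (exp (a * la i) * (a * al i)); [mono_l; lra|mono_r; [nra|lra]]. }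
  apply Rle_trans with ((1 + 2 * (a * al i)) * Cmod (v i z)); [lra|mono_r; lra].
Qed.

(** The real point where [phi] equals the real part of [p i]: [exp (a * lash i) = exp (a * la i) *
    cos (a * al i)]. *)
Definition lash (i : nat) : R := la i + ln (cos (a * al i)) / a.
Lemma phi_lash i : (i < n)%nat -> phi a (RtoC (lash i)) = RtoC (fst (p i)).
Proof.
  intros Hi. destruct (Hal i Hi) as [B1 B2].
  assert (C0 : / 2 <= cos (a * al i)) by (apply cos_ge_half; split; [nra|exact B2]).
  unfold phi. rewrite <- RtoC_mult, Cexp_RtoC. f_equal. unfold p, lash. rewrite phi_fst. simpl.
  rewrite Rmult_plus_distr_l. replace (a * (ln (cos (a * al i)) / a)) with (ln (cos (a * al i))) by (field; lra).
  rewrite exp_plus, exp_ln by lra. reflexivity.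
Qed.
Lemma Dom_in z : - X <= fst z <= X -> - L <= snd z <= 2 * Y -> Dom z.
Proof. intros. split; lra. Qed.
Lemma zw_y : 0 < (PI - iota) / a < 2 * Y.
Proof.
  assert (E : 2 * Y = PI / a) by (apply (Rmult_eq_reg_l a); [|lra]; field_simplify; [lra|lra]).
  rewrite E. split; [div_pos; lra|]. apply Rmult_lt_compat_r; [apply Rinv_0_lt_compat, Ha|lra].
Qed.
Lemma Dom_zw : Dom zw.
Proof. pose proof X_pos. pose proof zw_y. apply Dom_in; simpl; lra. Qed.

Lemma phi_zero_real (i : nat) z : (i < n)%nat -> Dom z -> v i z = 0%C -> z = (la i, al i).
Proof.
  intros Hi Dz E. apply (phi_inj a); [exact Ha| |].
  - destruct Dz as [D1 D2]. destruct (Hal i Hi) as [B1 B2]. simpl.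
    assert (Rabs (snd z - al i) <= 4 * Y - 1 / 2) by (apply Rabs_le_between'; lra). nra.
  - fold (p i). replace (phi a z) with (v i z + p i)%C by (unfold v; ring). rewrite E. ring.
Qed.

(** Each zero is moved along a level curve of [Re phi] down to the real axis. The factor [u/v] this costs
    has modulus at most 1 where [Im phi <= 0] and at least 1 at [zw]. *)
Lemma move_zeros : exists Gh : C -> C, (forall z, Dom z -> hol Gh z) /\ Gh zw = G zw /\
  (forall z, Dom z -> snd (phi a z) <= 0 -> Cmod (Gh z) <= Cmod (G z)) /\
  (forall z, Dom z -> far z -> Cmod (Gh z) <= exp (2 * rs (fun i => a * al i) n) * Cmod (G z)) /\
  (forall i, (i < n)%nat -> Gh (RtoC (lash i)) = 0%C).
Proof.
  pose proof X_pos as HX. destruct (divide_out Dom v (fun i => (la i, al i)) G n Dom_open HG) as (F & HF & EF).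
  - intros i Hi. destruct (Hal i Hi) as [B1 B2]. pose proof (Hla i Hi) as A. apply Rabs_le_between in A.
    split; [apply Dom_in; simpl; lra|].
    destruct (Hdiv i Hi) as (g & Hg & Eg). destruct (phi_quotient a (la i, al i) Ha) as (q & Hq & Eq & Nq).
    (* [q] does not vanish on [Dom]; the branch for [q z = 0] only makes the function total. *)
    exists (fun z => if excluded_middle_informative (q z = 0%C) then (G z / v i z)%C else (g z / q z)%C). split.
    + assert (N0 : q (la i, al i) <> 0%C) by (apply Nq; rewrite Rminus_diag, Rabs_R0; pose proof PI_RGT_0; lra).
      destruct (ccont_nonzero q _ (hol_ccont _ _ (Hq _)) N0) as (r & Hr & Hw).
      apply (hol_local (fun z => g z / q z)%C _ _ r Hr); [|apply hol_div; auto].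
      intros w Hd. destruct excluded_middle_informative as [E|E]; [exfalso; apply (Hw w Hd), E|reflexivity].
    + intros z Dz. destruct excluded_middle_informative as [E|E].
      * exfalso. revert E. apply Nq. destruct Dz as [D1 D2]. simpl.
        assert (Rabs (snd z - al i) <= 4 * Y - 1 / 2) by (apply Rabs_le_between'; lra). nra.
      * rewrite Eg by exact Dz. unfold v, p. rewrite Eq. field. exact E.
  - intros i z Hi Dz. split; [apply hol_minus; [apply hol_phi|apply hol_const]|]. apply phi_zero_real; assumption.
  - intros i j Hi Hj Hij E. injection E. intros _. apply Hdist; assumption.
  (* The constant that makes [Gh] agree with [G] at [zw]. By [v_le_u_zw] its modulus is at most 1,
     so it preserves every upper bound. *)
  - set (hw := (cprod (fun i => v i zw) n / cprod (fun i => u i zw) n)%C).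
    assert (Nu : cprod (fun i => u i zw) n <> 0%C).
    { apply cprod_neq_0. intros i Hi E. apply (f_equal snd) in E. unfold u in E. rewrite phi_zw in E. simpl in E.
      pose proof sin_iota_pos. lra. } assert (Hhw : Cmod hw <= 1).
    { unfold hw. rewrite Cmod_div by exact Nu. apply (Rmult_le_reg_r (Cmod (cprod (fun i => u i zw) n))); [apply Cmod_pos_neq, Nu|].
      unfold Rdiv. rewrite Rmult_assoc, Rinv_l, Rmult_1_r, Rmult_1_l by (apply Rgt_not_eq, Cmod_pos_neq, Nu).
      apply cprod_le. intros; apply v_le_u_zw; assumption. } pose proof (Cmod_ge_0 hw) as Hhw0.
    exists (fun z => F z * cprod (fun i => u i z) n * hw)%C. split; [|split; [|split; [|split]]].
    + intros z Dz. apply hol_mult; [apply hol_mult; [apply HF, Dz|]|apply hol_const].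
      apply (hol_cprod u). intros i Hi. apply hol_minus; [apply hol_phi|apply hol_const].
    + rewrite (EF zw Dom_zw). unfold hw. field. exact Nu.
    + intros z Dz Hz. rewrite (EF z Dz), !Cmod_mult. pose proof (Cmod_ge_0 (F z)).
      assert (A : Cmod (cprod (fun i => u i z) n) <= Cmod (cprod (fun i => v i z) n))
        by (apply cprod_le; intros; apply u_le_v; assumption). pose proof (Cmod_ge_0 (cprod (fun i => u i z) n)).
      assert (0 <= Cmod (F z) * Cmod (cprod (fun i => u i z) n)) by (apply Rmult_le_pos; assumption).
      apply Rle_trans with (Cmod (F z) * Cmod (cprod (fun i => u i z) n)); [nra|mono_l; assumption].
    + intros z Dz Hz. rewrite (EF z Dz), !Cmod_mult. pose proof (Cmod_ge_0 (F z)).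
      assert (A : Cmod (cprod (fun i => u i z) n) <= exp (2 * rs (fun i => a * al i) n) * Cmod (cprod (fun i => v i z) n)).
      { rewrite <- rs_scal. apply cprod_le_exp. intros; apply u_far; assumption. }
      pose proof (Cmod_ge_0 (cprod (fun i => u i z) n)).
      assert (0 <= Cmod (F z) * Cmod (cprod (fun i => u i z) n)) by (apply Rmult_le_pos; assumption).
      apply Rle_trans with (Cmod (F z) * Cmod (cprod (fun i => u i z) n)); [nra|].
      step_le; [mono_l; [assumption|exact A]|]. right; ring.
    + intros i Hi. rewrite (cprod_0 (fun i => u i (RtoC (lash i))) n i) || rewrite (cprod_0 _ n i Hi); [ring|].
      unfold u. rewrite phi_lash by exact Hi. ring.
Qed.
End Local.

(** * Weights on the strip and the comparison of mean squares *)

Definition wq (a x : R) : R := 4 * exp (a * x) / (1 + exp (a * x)) ^ 2.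
(** [wk a k x = 1 / (cosh (a x) + k)] and [wq a x = 2 / (cosh (a x) + 1)]: [2 * wk] tends to [wq] as
    [k] tends to 1. The upper edge of the strip receives the weight with [- k], which is bounded
    only by [/ (1 - k)]. *)
Definition wk (a k x : R) : R := 2 * exp (a * x) / (exp (a * x) ^ 2 + 2 * k * exp (a * x) + 1).

Lemma wk_den e k : 0 < e -> -1 < k < 1 -> 0 < e ^ 2 + 2 * k * e + 1.
Proof. intros He Hk. pose proof (pow2_ge_0 (e + k)). assert (0 < (1 - k) * (1 + k)) by (mul_pos; lra). lra. Qed.
Lemma wk_pos a k x : -1 < k < 1 -> 0 < wk a k x.
Proof.
  intros Hk. pose proof (exp_pos (a * x)) as He. div_pos; [lra|apply wk_den; assumption].
Qed.
Lemma wk_le a k x : -1 < k < 1 -> wk a k x <= / (1 + k).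
Proof.
  intros Hk. unfold wk. set (e := exp (a * x)). assert (He : 0 < e) by apply exp_pos. pose proof (wk_den e k He Hk).
  apply (Rmult_le_reg_r ((e ^ 2 + 2 * k * e + 1) * (1 + k))); [nra|].
  replace (2 * e / (e ^ 2 + 2 * k * e + 1) * ((e ^ 2 + 2 * k * e + 1) * (1 + k))) with (2 * e * (1 + k)) by (field; lra).
  replace (/ (1 + k) * ((e ^ 2 + 2 * k * e + 1) * (1 + k))) with (e ^ 2 + 2 * k * e + 1) by (field; lra). pose proof (pow2_ge_0 (e - 1)). lra.
Qed.
Lemma wq_pos a x : 0 < wq a x.
Proof. pose proof (exp_pos (a * x)) as He. div_pos; [lra|apply pow_lt; lra]. Qed.
Lemma wq_le_wk a k x : -1 < k < 1 -> wq a x <= 2 * wk a k x.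
Proof.
  intros Hk. unfold wq, wk. set (e := exp (a * x)). assert (He : 0 < e) by apply exp_pos. pose proof (wk_den e k He Hk).
  replace (2 * (2 * e / (e ^ 2 + 2 * k * e + 1))) with (4 * e * / (e ^ 2 + 2 * k * e + 1)) by (field; lra).
  mono_l; [lra|]. apply Rinv_le_contravar; [assumption|]. assert (k * e <= 1 * e) by (mono_r; lra). lra.
Qed.
Lemma wk_le_wq a k x : -1 < k < 1 -> 2 * wk a k x <= 2 / (1 + k) * wq a x.
Proof.
  intros Hk. unfold wq, wk. set (e := exp (a * x)). assert (He : 0 < e) by apply exp_pos. pose proof (wk_den e k He Hk).
  assert (0 < (1 + e) ^ 2) by (apply pow_lt; lra).
  apply (Rmult_le_reg_r ((e ^ 2 + 2 * k * e + 1) * (1 + k) * (1 + e) ^ 2)); [mul_pos; [nra|assumption]|].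
  replace (2 * (2 * e / (e ^ 2 + 2 * k * e + 1)) * ((e ^ 2 + 2 * k * e + 1) * (1 + k) * (1 + e) ^ 2))
    with (4 * e * ((1 + k) * (1 + e) ^ 2)) by (field; lra).
  replace (2 / (1 + k) * (4 * e / (1 + e) ^ 2) * ((e ^ 2 + 2 * k * e + 1) * (1 + k) * (1 + e) ^ 2))
    with (4 * e * (2 * (e ^ 2 + 2 * k * e + 1))) by (field; lra).
  mono_l; [lra|]. assert (0 <= (1 - k) * (1 - e) ^ 2) by (apply Rmult_le_pos; [lra|apply pow2_ge_0]). lra.
Qed.
Lemma cont_wq a t : continuous (wq a) t.
Proof.
  apply (ex_derive_continuous (V := RN)). unfold wq. auto_derive. pose proof (exp_pos (a * t)). apply Rgt_not_eq. nra.
Qed.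
Lemma cont_wk a k t : -1 < k < 1 -> continuous (wk a k) t.
Proof.
  intros Hk. apply (ex_derive_continuous (V := RN)). unfold wk. auto_derive.
  pose proof (wk_den (exp (a * t)) k (exp_pos _) Hk). lra.
Qed.

Lemma RInt_abs_split (f g h : R -> R) x y c : x <= y ->
  (forall t, x <= t <= y -> continuous f t) -> (forall t, x <= t <= y -> continuous g t) ->
  (forall t, x <= t <= y -> continuous h t) -> (forall t, x <= t <= y -> f t <= c * g t + 2 * h t) ->
  RInt f x y <= c * RInt g x y + 2 * RInt h x y.
Proof.
  intros Hxy Hf Hg Hh H. rewrite <- (RInt_lin2 c 2 g h) by (apply ex_RInt_cont; assumption).
  apply RInt_le; [exact Hxy|apply ex_RInt_cont; assumption| |intros t Ht; apply H; lra].
  apply (ex_RInt_plus (V := RN) (fun t => c * g t) (fun t => 2 * h t));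
    apply (ex_RInt_scal (V := RN)), ex_RInt_cont; assumption.
Qed.

Section Compare.
Variables (a Y X L iota H E2 : R) (G Gh : C -> C).
Hypothesis Ha : 0 < a.
Hypothesis HaY : a * Y = PI / 2.
Hypothesis HaX : 4 <= a * X.
Hypothesis HL : 0 < L.
Hypothesis HY : L + 4 <= Y.
Hypothesis Hio : 0 < iota < PI / 2.
Hypothesis HG : forall z, Dom Y X L z -> hol G z.
Hypothesis HGh : forall z, Dom Y X L z -> hol Gh z.
Hypothesis Hw : Gh (zw a iota) = G (zw a iota).
Hypothesis Hlow : forall z, Dom Y X L z -> snd (phi a z) <= 0 -> Cmod (Gh z) <= Cmod (G z).
Hypothesis HE2 : 1 <= E2.
Hypothesis Hfar : forall z, Dom Y X L z -> far Y X z -> Cmod (Gh z) <= E2 * Cmod (G z).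
Hypothesis HH : forall z, - X <= fst z <= X -> - L <= snd z <= 2 * Y -> Cmod (G z) <= H.

Let w := zw a iota.
Let k0 := cos iota.

Lemma cos_iota : 0 < k0 < 1.
Proof.
  split; [apply cos_gt_0; lra|]. unfold k0. rewrite <- cos_0. apply cos_decreasing_1; lra.
Qed.
Lemma X_pos' : 0 < X.
Proof. nra. Qed.
Lemma H_pos : 0 <= H.
Proof. step_le; [apply (Cmod_ge_0 (G 0))|]. pose proof X_pos'. apply HH; simpl; lra. Qed.
Lemma Dm z : - X <= fst z <= X -> - L <= snd z <= 2 * Y -> Dom Y X L z.
Proof. apply Dom_in; lra. Qed.

(** A kernel of Poisson type: it is real on both edges of the strip, where [phi] is real, and
    between them its only pole is [w], because [Cconj (phi a w)] lies in the lower half-plane. *)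
Definition kz (z : C) : C := (2 * phi a z / ((phi a z - phi a w) * (phi a z - Cconj (phi a w))))%C.
Definition Nz (z : C) : C := ((G z - Gh z) * kz z)%C.

Lemma phi_w : phi a w = (- k0, sin iota).
Proof. apply phi_zw; assumption. Qed.

Lemma strip_im z : 0 <= snd z <= 2 * Y -> 0 <= snd (phi a z).
Proof.
  intros Hz. rewrite phi_snd. apply Rmult_le_pos; [left; apply exp_pos|apply sin_ge_0; nra].
Qed.
Lemma conj_nz z : 0 <= snd z <= 2 * Y -> (phi a z - Cconj (phi a w))%C <> 0%C.
Proof.
  intros Hz E. pose proof (strip_im z Hz) as A. apply (f_equal snd) in E. rewrite phi_w in E.
  destruct (phi a z) as [x y]. simpl in *. pose proof (sin_gt_0 iota). lra.
Qed.
Lemma w_y : 0 < snd w < 2 * Y.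
Proof. apply zw_y; assumption. Qed.

(** The simple pole of [kz] at [w] contributes a multiple of [G w - Gh w], which is 0. *)
Lemma contour_zero : RI Nz (- X) X 0 (2 * Y) = 0%C.
Proof.
  pose proof X_pos' as HX. pose proof w_y as Hwy. destruct (phi_quotient a w Ha) as (q & Hq & Eq & Nq).
  assert (Nq' : forall z, 0 <= snd z <= 2 * Y -> q z <> 0%C).
  { intros z Hz. apply Nq. assert (Rabs (snd z - snd w) <= 2 * Y) by (apply Rabs_le_between'; lra). pose proof PI_RGT_0. nra. }
  set (uu := fun z => ((G z - Gh z) * (2 * phi a z) / (q z * (phi a z - Cconj (phi a w))))%C).
  rewrite (RI_ext_bd _ (fun z => uu z / (z - w))%C); [|lra|lra|].
  - rewrite residue_quotient.
    + unfold uu at 1. unfold w at 1 2. rewrite Hw. fold w. unfold Cdiv. ring_simplify. ring.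
    + simpl; lra.
    + exact Hwy.
    + intros z [Z1 Z2]. assert (Dz : Dom Y X L z) by (apply Dm; lra).
      apply hol_div; [apply hol_mult; [apply hol_minus; [apply HG|apply HGh]; exact Dz|
         apply hol_mult; [apply hol_const|apply hol_phi]]|apply hol_mult; [apply Hq|apply hol_minus; [apply hol_phi|apply hol_const]]|].
      apply Cmult_neq_0; [apply Nq', Z2|apply conj_nz, Z2].
  - intros z [[Z1 Z2] Hb]. assert (Hz : (z - w)%C <> 0%C).
    { intros E. assert (z = w) by (replace z with ((z - w) + w)%C by ring; rewrite E; ring). subst z.
      assert (W0 : fst w = 0) by reflexivity. rewrite W0 in Hb. lra. }
    unfold Nz, kz, uu. rewrite Eq. field. repeat split; first [exact Hz|apply conj_nz, Z2|apply Nq', Z2].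
Qed.

Lemma kz_bottom x : kz (x, 0) = RtoC (wk a k0 x).
Proof.
  pose proof cos_iota as Hk. unfold kz. rewrite phi_w. set (e := exp (a * x)). assert (He : 0 < e) by apply exp_pos.
  assert (E : phi a (x, 0) = RtoC e).
  { apply C_eq; rewrite ?phi_fst, ?phi_snd; simpl; rewrite Rmult_0_r, ?cos_0, ?sin_0; unfold e; ring. }
  rewrite E. pose proof (wk_den e k0 He ltac:(lra)) as Hd.
  assert (Q : ((RtoC e - (- k0, sin iota)%R) * (RtoC e - Cconj (- k0, sin iota)%R))%C = RtoC (e ^ 2 + 2 * k0 * e + 1)).
  { pose proof (sin2_cos2 iota) as S. unfold Rsqr in S. fold k0 in S. ceq; nra. }
  rewrite Q. unfold Cdiv. rewrite <- RtoC_inv by lra. unfold wk. fold e. ceq; unfold Rdiv; ring.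
Qed.
(** The minus sign cancels the reversed orientation of the upper edge, so both edges enter
    [contour_re] with positive weights. *)
Lemma kz_top x : kz (x, 2 * Y) = RtoC (- wk a (- k0) x).
Proof.
  pose proof cos_iota as Hk. unfold kz. rewrite phi_w. set (e := exp (a * x)). assert (He : 0 < e) by apply exp_pos.
  assert (E : phi a (x, 2 * Y) = RtoC (- e)).
  { apply C_eq; rewrite ?phi_fst, ?phi_snd; simpl; replace (a * (2 * Y)) with PI by lra; rewrite ?cos_PI, ?sin_PI; unfold e; ring. }
  rewrite E. pose proof (wk_den e (- k0) He ltac:(lra)) as Hd.
  assert (Q : ((RtoC (- e) - (- k0, sin iota)%R) * (RtoC (- e) - Cconj (- k0, sin iota)%R))%C = RtoC (e ^ 2 + 2 * - k0 * e + 1)).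
  { pose proof (sin2_cos2 iota) as S. unfold Rsqr in S. fold k0 in S. ceq; nra. }
  rewrite Q. unfold Cdiv. rewrite <- RtoC_inv by lra. unfold wk. fold e. ceq; unfold Rdiv; ring.
Qed.

Lemma Cmod_conj' (z : C) : Cmod (Cconj z) = Cmod z.
Proof. unfold Cmod, Cconj. simpl. f_equal. ring. Qed.
Lemma Cmod_phi_w : Cmod (phi a w) = 1.
Proof. rewrite phi_mod. unfold w, zw. simpl. rewrite Rmult_0_r. apply exp_0. Qed.

Lemma kz_den z e : 0 <= snd z <= 2 * Y -> 0 <= e -> (e <= Cmod (phi a z) - 1 \/ e <= 1 - Cmod (phi a z)) ->
   e * e <= Cmod ((phi a z - phi a w) * (phi a z - Cconj (phi a w)))%C.
Proof.
  intros Hz He Hd. rewrite Cmod_mult.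
  pose proof (Cmod_rev_triangle (phi a z) (phi a w)) as T1. pose proof (Cmod_rev_triangle (phi a w) (phi a z)) as T2.
  pose proof (Cmod_rev_triangle (phi a z) (Cconj (phi a w))) as T3. pose proof (Cmod_rev_triangle (Cconj (phi a w)) (phi a z)) as T4.
  rewrite (Cmod_minus_sym (phi a w)) in T2. rewrite (Cmod_minus_sym (Cconj (phi a w))) in T4.
  rewrite Cmod_conj' in T3, T4. rewrite Cmod_phi_w in *. apply Rmult_le_compat; lra.
Qed.
Lemma kz_side z : 0 <= snd z <= 2 * Y -> fst z = X \/ fst z = - X -> Cmod (kz z) <= 8 * exp (- (a * X)).
Proof.
  intros Hz Hx. set (E := exp (a * X)). assert (HE : 2 <= E) by (unfold E; pose proof (exp_ge_1x (a * X)); lra).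
  assert (HEi : exp (- (a * X)) = / E) by (unfold E; rewrite exp_Ropp; reflexivity).
  assert (Hn : ((phi a z - phi a w) * (phi a z - Cconj (phi a w)))%C <> 0%C -> Cmod (kz z) =
    2 * Cmod (phi a z) / Cmod ((phi a z - phi a w) * (phi a z - Cconj (phi a w)))%C).
  { intros N. unfold kz. rewrite Cmod_div, Cmod_mult by exact N. rewrite Cmod_RtoC_pos by lra. reflexivity. }
  assert (HiE : 0 < / E) by (apply Rinv_0_lt_compat; lra).
  assert (HiE2 : / E <= / 2) by (apply Rinv_le_contravar; lra). rewrite HEi. destruct Hx as [Hx|Hx].
  - assert (M : Cmod (phi a z) = E) by (rewrite phi_mod, Hx; reflexivity).
    pose proof (kz_den z (E / 2) Hz ltac:(lra) ltac:(rewrite M; left; lra)) as D. assert (0 < E / 2 * (E / 2)) by nra.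
    rewrite Hn by (apply Cmod_neq_0; lra). rewrite M.
    apply Rle_trans with (2 * E * / (E / 2 * (E / 2))); [mono_l; [lra|apply Rinv_le_contravar; assumption]|].
    right. field. lra.
  - assert (M : Cmod (phi a z) = / E) by (rewrite phi_mod, Hx, Ropp_mult_distr_r_reverse, HEi; reflexivity).
    pose proof (kz_den z (1 / 2) Hz ltac:(lra) ltac:(rewrite M; right; lra)) as D.
    rewrite Hn by (apply Cmod_neq_0; lra). rewrite M.
    apply Rle_trans with (2 * / E * / (1 / 2 * (1 / 2))); [mono_l; [lra|apply Rinv_le_contravar; [lra|exact D]]|].
    right. field. lra.
Qed.

Lemma Nz_side z : 0 <= snd z <= 2 * Y -> fst z = X \/ fst z = - X -> Cmod (Nz z) <= 16 * H * E2 * exp (- (a * X)).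
Proof.
  intros Hz Hx. pose proof X_pos' as HX. pose proof H_pos as H0. unfold Nz. rewrite Cmod_mult.
  assert (Dz : Dom Y X L z) by (apply Dm; lra). assert (B : Cmod (G z) <= H) by (apply HH; lra).
  pose proof (Hfar z Dz ltac:(unfold far; tauto)) as F. pose proof (Cmod_ge_0 (G z)).
  pose proof (Cmod_triangle_minus (G z) (Gh z)) as T.
  pose proof (kz_side z Hz Hx) as K. pose proof (Cmod_ge_0 (kz z)). assert (Cmod (G z - Gh z) <= 2 * H * E2).
  { assert (E2 * Cmod (G z) <= E2 * H) by (mono_l; lra). assert (1 * H <= E2 * H) by (mono_r; lra). lra. }
  apply Rle_trans with ((2 * H * E2) * (8 * exp (- (a * X)))); [|right; ring].
  apply Rmult_le_compat; try apply Cmod_ge_0; assumption.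
Qed.

(** [|1 - g|^2 = 1 - 2 Re g + |g|^2]: once the moduli are dominated, only the real parts remain to
    be compared, and the contour integral controls those. *)
Lemma sq_diff (g gh : C) : Cmod gh <= Cmod g -> Cmod (1 - gh) ^ 2 <= Cmod (1 - g) ^ 2 + 2 * fst (g - gh)%C.
Proof.
  intros Hg. pose proof (Cmod_ge_0 gh). assert (Cmod gh ^ 2 <= Cmod g ^ 2) by (apply pow_incr; lra).
  rewrite !Cmod_sqr in *. csimp. lra.
Qed.
Lemma phi_real_im x : snd (phi a (x, 0)) <= 0.
Proof. rewrite phi_snd; simpl. rewrite Rmult_0_r, sin_0. lra. Qed.
Lemma phi_top_im x : snd (phi a (x, 2 * Y)) <= 0.
Proof. rewrite phi_snd; simpl. replace (a * (2 * Y)) with PI by lra. rewrite sin_PI. lra. Qed.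

Lemma cont_G y f : (forall z, Dom Y X L z -> hol f z) -> - L <= y <= 2 * Y -> rc_on (fun x => f (x, y)) (- X) X.
Proof. intros Hf Hy t Ht. apply (hol_rcont f (fun t => (t, y))); [apply Hf, Dm; simpl; lra|apply rcont_hline]. Qed.

Lemma cont_sq y f (k : R -> R) : (forall z, Dom Y X L z -> hol f z) -> - L <= y <= 2 * Y -> (forall t, continuous k t) ->
   forall t, - X <= t <= X -> continuous (fun t => Cmod (1 - f (t, y))%C ^ 2 * k t) t.
Proof.
  intros Hf Hy Hk t Ht. apply (continuous_mult (K := R_AbsRing)); [|apply Hk].
  apply rcont_Cmod2, rcont_minus; [apply rcont_const|apply (cont_G y f Hf Hy t Ht)].
Qed.
Lemma cont_re y (k : R -> R) : - L <= y <= 2 * Y -> (forall t, continuous k t) ->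
   forall t, - X <= t <= X -> continuous (fun t => fst (G (t, y) - Gh (t, y))%C * k t) t.
Proof.
  intros Hy Hk t Ht. apply (continuous_mult (K := R_AbsRing)); [|apply Hk].
  apply (rcont_minus (fun t => G (t, y)) (fun t => Gh (t, y))); [apply (cont_G y G HG Hy t Ht)|apply (cont_G y Gh HGh Hy t Ht)].
Qed.

Lemma contour_re : RInt (fun x => fst (G (x, 0) - Gh (x, 0))%C * wk a k0 x) (- X) X
   + RInt (fun x => fst (G (x, 2 * Y)%R - Gh (x, 2 * Y)%R)%C * wk a (- k0) x) (- X) X <= 64 * Y * H * E2 * exp (- (a * X)).
Proof.
  pose proof X_pos' as HX. pose proof cos_iota as Hk. pose proof contour_zero as Z. unfold RI in Z.
  set (Ms := 16 * H * E2 * exp (- (a * X))) in *.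
  assert (Hn : forall z, 0 <= snd z <= 2 * Y -> fst z = X \/ fst z = - X -> ccont Nz z).
  { intros z Hz Hx. apply hol_ccont. apply hol_mult; [apply hol_minus; [apply HG|apply HGh]; apply Dm; lra|].
    apply hol_div; [apply hol_mult; [apply hol_const|apply hol_phi]|
      apply hol_mult; (apply hol_minus; [apply hol_phi|apply hol_const])|].
    apply Cmult_neq_0; [|apply conj_nz, Hz]. intros E.
    assert (E' : phi a z = phi a w) by (replace (phi a z) with ((phi a z - phi a w) + phi a w)%C by ring; rewrite E; ring).
    apply (f_equal Cmod) in E'. rewrite !phi_mod in E'. apply exp_inv in E'. unfold w, zw in E'. simpl in E'. nra. }
  assert (S1 : Cmod (CI (fun t => Nz (X, t)) 0 (2 * Y)) <= Ms * (2 * Y - 0)).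
  { apply CI_bound; [lra|apply rc_v; intros; apply Hn; simpl; [lra|tauto]|]. intros; apply Nz_side; simpl; [lra|tauto]. }
  assert (S2 : Cmod (CI (fun t => Nz (- X, t)) 0 (2 * Y)) <= Ms * (2 * Y - 0)).
  { apply CI_bound; [lra|apply rc_v; intros; apply Hn; simpl; [lra|tauto]|]. intros; apply Nz_side; simpl; [lra|tauto]. }
  pose proof (Cmod_snd (CI (fun t => Nz (X, t)) 0 (2 * Y))) as A1. pose proof (Cmod_snd (CI (fun t => Nz (- X, t)) 0 (2 * Y))) as A2.
  apply (f_equal fst) in Z.
  assert (B1 : fst (CI (fun t => Nz (t, 0)) (- X) X) = RInt (fun x => fst (G (x, 0) - Gh (x, 0))%C * wk a k0 x) (- X) X).
  { unfold CI. cbn [fst]. apply RInt_ext. intros x _. unfold Nz. rewrite kz_bottom. csimp. ring. }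
  assert (B2 : fst (CI (fun t => Nz (t, 2 * Y)) (- X) X) = - RInt (fun x => fst (G (x, 2 * Y)%R - Gh (x, 2 * Y)%R)%C * wk a (- k0) x) (- X) X).
  { unfold CI. cbn [fst]. rewrite <- (RInt_opp (V := RC)).
    - apply RInt_ext. intros x _. unfold Nz. rewrite kz_top. csimp. unfold opp; simpl. ring.
    - apply ex_RInt_cont; [lra|]. apply cont_re; [lra|]. intros; apply cont_wk; lra. }
  rewrite <- B1. apply (f_equal Ropp) in B2. rewrite Ropp_involutive in B2. rewrite <- B2.
  apply Rabs_le_between in A1. apply Rabs_le_between in A2.
  set (c1 := CI (fun t => Nz (t, 0)) (- X) X) in *. set (c2 := CI (fun t => Nz (X, t)) 0 (2 * Y)) in *.
  set (c3 := CI (fun t => Nz (t, 2 * Y)) (- X) X) in *. set (c4 := CI (fun t => Nz (- X, t)) 0 (2 * Y)) in *.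
  clearbody c1 c2 c3 c4. clear - Z A1 A2 S1 S2. replace (64 * Y * H * E2 * exp (- (a * X))) with (Ms * (4 * Y)) by (unfold Ms; ring).
  simpl in Z. lra.
Qed.

(** [sq_diff] on both edges, added through [contour_re]. On the upper edge the mean square of
    [1 - Gh] is dropped by positivity and that of [1 - G] is controlled by [et]. Passing between
    [2 * wk] and [wq] costs the factor [2 / (1 + k0)]. *)
Lemma compare et : (forall x, - X <= x <= X -> Cmod (1 - G (x, 2 * Y)%R) <= et) ->
  RInt (fun x => Cmod (1 - Gh (x, 0))%C ^ 2 * wq a x) (- X) X <=
    2 / (1 + k0) * RInt (fun x => Cmod (1 - G (x, 0))%C ^ 2 * wq a x) (- X) X
    + (4 * X * et ^ 2 / (1 - k0) + 256 * Y * H * E2 * exp (- (a * X))).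
Proof.
  intros Het. pose proof X_pos' as HX. pose proof cos_iota as Hk. pose proof contour_re as HC.
  assert (Lx : - X <= X) by lra. assert (Ck : forall t, continuous (wk a k0) t) by (intros; apply cont_wk; lra).
  assert (Ck' : forall t, continuous (wk a (- k0)) t) by (intros; apply cont_wk; lra).
  assert (Y1 : - L <= 0 <= 2 * Y) by lra. assert (Y2 : - L <= 2 * Y <= 2 * Y) by lra.
  pose proof (RInt_abs_split (fun x => Cmod (1 - Gh (x, 0))%C ^ 2 * wk a k0 x) (fun x => Cmod (1 - G (x, 0))%C ^ 2 * wk a k0 x)
     (fun x => fst (G (x, 0) - Gh (x, 0))%C * wk a k0 x) (- X) X 1 Lx
     (cont_sq 0 Gh _ HGh Y1 Ck) (cont_sq 0 G _ HG Y1 Ck) (cont_re 0 _ Y1 Ck)) as I1.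
  pose proof (RInt_abs_split (fun x => Cmod (1 - Gh (x, 2 * Y)%R)%C ^ 2 * wk a (- k0) x)
     (fun x => Cmod (1 - G (x, 2 * Y)%R)%C ^ 2 * wk a (- k0) x)
     (fun x => fst (G (x, 2 * Y)%R - Gh (x, 2 * Y)%R)%C * wk a (- k0) x) (- X) X 1 Lx
     (cont_sq (2 * Y) Gh _ HGh Y2 Ck') (cont_sq (2 * Y) G _ HG Y2 Ck') (cont_re (2 * Y) _ Y2 Ck')) as I2.
  assert (J1 : forall t, - X <= t <= X -> Cmod (1 - Gh (t, 0))%C ^ 2 * wk a k0 t <=
     1 * (Cmod (1 - G (t, 0))%C ^ 2 * wk a k0 t) + 2 * (fst (G (t, 0) - Gh (t, 0))%C * wk a k0 t)).
  { intros t Ht. pose proof (sq_diff (G (t, 0)) (Gh (t, 0)) (Hlow (t, 0) ltac:(apply Dm; simpl; lra) (phi_real_im t))) as S.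
    apply (Rmult_le_compat_r (wk a k0 t)) in S; [lra|left; apply wk_pos; lra]. }
  assert (J2 : forall t, - X <= t <= X -> Cmod (1 - Gh (t, 2 * Y)%R)%C ^ 2 * wk a (- k0) t <=
     1 * (Cmod (1 - G (t, 2 * Y)%R)%C ^ 2 * wk a (- k0) t) + 2 * (fst (G (t, 2 * Y)%R - Gh (t, 2 * Y)%R)%C * wk a (- k0) t)).
  { intros t Ht. pose proof (sq_diff (G (t, 2 * Y)%R) (Gh (t, 2 * Y)%R) (Hlow (t, 2 * Y)%R ltac:(apply Dm; simpl; lra) (phi_top_im t))) as S.
    apply (Rmult_le_compat_r (wk a (- k0) t)) in S; [lra|left; apply wk_pos; lra]. }
  specialize (I1 J1). specialize (I2 J2).
  assert (P2 : 0 <= RInt (fun x => Cmod (1 - Gh (x, 2 * Y)%R)%C ^ 2 * wk a (- k0) x) (- X) X).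
  { apply RInt_ge_0; [lra|apply ex_RInt_cont; [lra|apply cont_sq; assumption]|]. intros x _.
    apply Rmult_le_pos; [apply pow2_ge_0|left; apply wk_pos; lra]. }
  assert (T2 : RInt (fun x => Cmod (1 - G (x, 2 * Y)%R)%C ^ 2 * wk a (- k0) x) (- X) X <= 2 * X * (et ^ 2 / (1 - k0))).
  { apply Rle_trans with (RInt (fun _ => et ^ 2 / (1 - k0)) (- X) X).
    - apply RInt_le; [lra|apply ex_RInt_cont; [lra|apply cont_sq; assumption]|apply (ex_RInt_const (V := RN))|].
      intros x Hx. apply Rmult_le_compat; [apply pow2_ge_0|left; apply wk_pos; lra| |apply wk_le; lra].
      apply pow_incr. split; [apply Cmod_ge_0|apply Het; lra].
    - int_const. right. ring. } assert (Q1 : RInt (fun x => Cmod (1 - Gh (x, 0))%C ^ 2 * wq a x) (- X) X <=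
     2 * RInt (fun x => Cmod (1 - Gh (x, 0))%C ^ 2 * wk a k0 x) (- X) X + 2 * RInt (fun _ => 0) (- X) X).
  { apply (RInt_abs_split _ _ (fun _ => 0)); [lra|apply cont_sq; [assumption|assumption|apply cont_wq]|apply cont_sq; assumption|
      intros; apply continuous_const|]. intros t _. pose proof (wq_le_wk a k0 t ltac:(lra)) as W.
    apply (Rmult_le_compat_l (Cmod (1 - Gh (t, 0))%C ^ 2)) in W; [lra|apply pow2_ge_0]. }
  assert (Q2 : RInt (fun x => Cmod (1 - G (x, 0))%C ^ 2 * wk a k0 x) (- X) X <=
     1 / (1 + k0) * RInt (fun x => Cmod (1 - G (x, 0))%C ^ 2 * wq a x) (- X) X + 2 * RInt (fun _ => 0) (- X) X).
  { apply (RInt_abs_split _ _ (fun _ => 0)); [lra|apply cont_sq; assumption|apply cont_sq; [assumption|assumption|apply cont_wq]|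
      intros; apply continuous_const|]. intros t _. pose proof (wk_le_wq a k0 t ltac:(lra)) as W.
    apply (Rmult_le_compat_l (Cmod (1 - G (t, 0))%C ^ 2)) in W; [|apply pow2_ge_0]. unfold Rdiv in *. lra. }
  rewrite RInt_const in Q1, Q2. unfold scal in Q1, Q2; simpl in Q1, Q2; unfold mult in Q1, Q2; simpl in Q1, Q2.
  replace (4 * X * et ^ 2 / (1 - k0)) with (2 * (2 * X * (et ^ 2 / (1 - k0)))) by (field; lra).
  replace (2 / (1 + k0) * RInt (fun x => Cmod (1 - G (x, 0))%C ^ 2 * wq a x) (- X) X)
    with (2 * (1 / (1 + k0) * RInt (fun x => Cmod (1 - G (x, 0))%C ^ 2 * wq a x) (- X) X)) by (field; lra).
  simpl (_ ^ 2) in *. lra.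
Qed.
End Compare.

(** * Sampling at the moved zeros *)

(** [sech (a z / 2)], an analytic square root of the weight [wq], so that the weighted mean square
    of a function is the plain one of its product with [om]. *)
Definition om (a : R) (z : C) : C := (2 * Cexp (RtoC (a / 2) * z) / (1 + phi a z))%C.
Definition omr (a x : R) : R := 2 * exp (a / 2 * x) / (1 + exp (a * x)).

Lemma omr_bounds a x : 0 < omr a x <= 1.
Proof.
  unfold omr. pose proof (exp_pos (a * x)). assert (E : exp (a * x) = exp (a / 2 * x) ^ 2).
  { simpl. rewrite Rmult_1_r, <- exp_plus. f_equal. field. }
  pose proof (exp_pos (a / 2 * x)) as P. split; [div_pos; lra|].
  apply (Rmult_le_reg_r (1 + exp (a * x))); [lra|]. unfold Rdiv. rewrite Rmult_assoc, Rinv_l by lra. rewrite E in *.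
  pose proof (pow2_ge_0 (exp (a / 2 * x) - 1)). lra.
Qed.
Lemma omr_sq a x : omr a x ^ 2 = wq a x.
Proof.
  unfold omr, wq. assert (E : exp (a * x) = exp (a / 2 * x) ^ 2).
  { simpl. rewrite Rmult_1_r, <- exp_plus. f_equal. field. } pose proof (exp_pos (a * x)). rewrite E in *. field. lra.
Qed.
Lemma om_real a x : om a (RtoC x) = RtoC (omr a x).
Proof.
  unfold om, omr, phi. rewrite <- !RtoC_mult, !Cexp_RtoC. pose proof (exp_pos (a * x)).
  rewrite <- RtoC_plus. unfold Cdiv. rewrite <- RtoC_inv by lra. rewrite <- !RtoC_mult. reflexivity.
Qed.

Lemma Cmod_csum_le f n : Cmod (csum f n) <= rs (fun i => Cmod (f i)) n.
Proof.
  induction n as [|n IH]; [unfold csum; simpl; change (0, 0) with (RtoC 0); rewrite Cmod_0; lra|].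
  rewrite csum_S. simpl. step_le; [apply Cmod_triangle|]. lra.
Qed.
Lemma Cmod_exp_Ci (c : R) (u : C) : Cmod (Cexp (Ci * RtoC c * u)) = exp (- (c * snd u)).
Proof. rewrite Cmod_Cexp. f_equal. destruct u. csimp. ring. Qed.

Section Reproduce.
Variables (a Y X L B1 eta B : R) (Gh : C -> C).
Hypothesis Ha : 0 < a.
Hypothesis HaY : a * Y = PI / 2.
Hypothesis HX : 2 <= X.
Hypothesis HL : 1 <= L.
Hypothesis HY : L + 4 <= Y.
Hypothesis HB1 : 0 < B1.
Hypothesis Heta : 0 < eta.
Hypothesis HGh : forall z, Dom Y X L z -> hol Gh z.
Hypothesis HB : forall z, - X <= fst z <= X -> - L <= snd z <= Y -> snd z <= 0 \/ far Y X z -> 1 + Cmod (Gh z) <= B.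

Definition Fz (z : C) : C := ((1 - Gh z) * om a z)%C.

Lemma phi_re z : - L <= snd z <= Y -> 0 <= fst (phi a z).
Proof.
  intros Hz. rewrite phi_fst. apply Rmult_le_pos; [left; apply exp_pos|apply cos_ge_0; nra].
Qed.
Lemma one_phi z : - L <= snd z <= Y -> 1 <= Cmod (1 + phi a z) /\ exp (a * fst z) <= Cmod (1 + phi a z).
Proof.
  intros Hz. pose proof (phi_re z Hz) as P. pose proof (Cmod_ge_0 (1 + phi a z)) as P2.
  assert (E : Cmod (1 + phi a z) ^ 2 = 1 + 2 * fst (phi a z) + Cmod (phi a z) ^ 2) by (rewrite !Cmod_sqr; csimp; ring).
  rewrite phi_mod in E. pose proof (exp_pos (a * fst z)). split; nra.
Qed.
Lemma om_le z : - L <= snd z <= Y -> Cmod (om a z) <= 2 * exp (a / 2 * fst z) /\ Cmod (om a z) <= 2 * exp (- (a / 2 * fst z)).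
Proof.
  intros Hz. destruct (one_phi z Hz) as [O1 O2]. unfold om. rewrite Cmod_div by (apply Cmod_neq_0; lra).
  rewrite Cmod_mult, Cmod_Cexp, Cmod_RtoC_pos by lra.
  replace (fst (RtoC (a / 2) * z)%C) with (a / 2 * fst z) by (destruct z; csimp; ring).
  set (e := exp (a / 2 * fst z)). assert (He : 0 < e) by apply exp_pos.
  assert (E : exp (a * fst z) = e * e) by (unfold e; rewrite <- exp_plus; f_equal; field).
  rewrite exp_Ropp. fold e. rewrite E in O2.
  set (m := Cmod (1 + phi a z)) in *. assert (Hi : 0 < / m) by (apply Rinv_0_lt_compat; lra).
  split; apply (Rmult_le_reg_r m); try lra; unfold Rdiv; rewrite Rmult_assoc, Rinv_l by lra.
  - nra.
  - apply Rle_trans with (2 * / e * (e * e)); [right; field; lra|]. mono_l; [|exact O2].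
    apply Rlt_le, Rmult_lt_0_compat; [lra|apply Rinv_0_lt_compat, He].
Qed.
Lemma om_le2 z : - L <= snd z <= Y -> Cmod (om a z) <= 2.
Proof.
  intros Hz. destruct (om_le z Hz) as [O1 O2]. destruct (Rle_dec (fst z) 0) as [H|H].
  - assert (exp (a / 2 * fst z) <= exp 0) by (apply exp_le; nra). rewrite exp_0 in *. lra.
  - assert (exp (- (a / 2 * fst z)) <= exp 0) by (apply exp_le; nra). rewrite exp_0 in *. lra.
Qed.
Lemma om_side z : - L <= snd z <= Y -> fst z = X \/ fst z = - X -> Cmod (om a z) <= 2 * exp (- (a * X / 2)).
Proof.
  intros Hz Hx. destruct (om_le z Hz) as [O1 O2]. destruct Hx as [Hx|Hx]; rewrite Hx in *.
  - replace (- (a * X / 2)) with (- (a / 2 * X)) by field. exact O2.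
  - replace (- (a * X / 2)) with (a / 2 * - X) by field. exact O1.
Qed.
Lemma hol_Fz z : - X <= fst z <= X -> - L <= snd z <= Y -> hol Fz z.
Proof.
  intros H1 H2. apply hol_mult; [apply hol_minus; [apply hol_const|apply HGh, Dom_in; lra]|].
  apply hol_div; [apply hol_mult; [apply hol_const|apply hol_Cexp_lin]|apply hol_plus; [apply hol_const|apply hol_phi]|].
  apply Cmod_neq_0. destruct (one_phi z H2). lra.
Qed.
Lemma Fz_bd z m : - X <= fst z <= X -> - L <= snd z <= Y -> snd z <= 0 \/ far Y X z -> Cmod (om a z) <= m ->
  Cmod (Fz z) <= B * m.
Proof.
  intros H1 H2 H3 Hm. unfold Fz. rewrite Cmod_mult. apply Rmult_le_compat; try apply Cmod_ge_0; [|exact Hm].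
  step_le; [apply Cmod_triangle_minus|]. rewrite Cmod_1. apply HB; assumption.
Qed.
Lemma B_pos : 1 <= B.
Proof. pose proof (Cmod_ge_0 (Gh (RtoC 0))). pose proof (HB (RtoC 0) ltac:(simpl; lra) ltac:(simpl; lra) ltac:(simpl; lra)). lra. Qed.

(** In order: the vertical sides, the line [Im z = - L] where the frequency [- B1] decays, and the
    line [Im z = Y] where the frequency [eta] decays. *)
Definition Err : R := B * (16 * Y * exp (- (a * X / 2) + eta * L) + 4 * X * (exp (- (B1 * L)) + exp (- (eta * Y)))).

Section At.
Variable lam : R.
Hypothesis Hlam : Rabs lam <= X / 2.

Let c : C := RtoC lam.
(** [f1] carries the whole kernel, [f3] only its exponential of frequency [eta], which decays
    upwards; their difference carries the frequency [- B1] and decays downwards. *)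
Let f1 (z : C) : C := (Fz z * KC (- B1) eta (z - c))%C.
Let uu (z : C) : C := (Fz z * Cexp (Ci * RtoC eta * (z - c)) / Ci)%C.
Let f3 (z : C) : C := (uu z / (z - c))%C.

Lemma zc_snd (z : C) : snd (z - c)%C = snd z.
Proof. unfold c. csimp. ring. Qed.
Lemma zc_side z : fst z = X \/ fst z = - X -> 1 <= Cmod (z - c).
Proof.
  intros Hx. pose proof (Cmod_fst (z - c)) as A. apply Rabs_le_between in Hlam.
  change (fst (z - c)%C) with (fst z + - lam) in A.
  step_le; [|exact A]. destruct Hx as [Hx|Hx]; rewrite Hx; [rewrite Rabs_pos_eq by lra|rewrite Rabs_left1 by lra]; lra.
Qed.
Lemma zc_vert (z : C) : Rabs (snd z) <= Cmod (z - c).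
Proof. rewrite <- zc_snd. apply Cmod_snd. Qed.
Lemma quot_le (x y : C) m : Cmod x <= m -> 1 <= Cmod y -> Cmod (x / y) <= m.
Proof.
  intros Hx Hy. rewrite Cmod_div by (apply Cmod_neq_0; lra). pose proof (Cmod_ge_0 x).
  apply (Rmult_le_reg_r (Cmod y)); [lra|]. unfold Rdiv. rewrite Rmult_assoc, Rinv_l by lra. nra.
Qed.
Lemma Cmod_Ci : Cmod Ci = 1.
Proof. rewrite <- (Cmod_ei (PI / 2)). unfold ei. rewrite cos_PI2, sin_PI2. reflexivity. Qed.

Lemma uu_bd z m : Cmod (Fz z) <= m -> Cmod (uu z) <= m * exp (- (eta * snd z)).
Proof.
  intros Hm. unfold uu. rewrite Cmod_div, Cmod_Ci, Cmod_mult, Cmod_exp_Ci, zc_snd by exact Ci_neq_0.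
  unfold Rdiv. rewrite Rinv_1, Rmult_1_r. mono_r; [left; apply exp_pos|exact Hm].
Qed.
Lemma hol_uu z : - X <= fst z <= X -> - L <= snd z <= Y -> hol uu z.
Proof.
  intros H1 H2. apply hol_mult; [apply hol_mult; [apply hol_Fz; assumption|]|apply hol_const].
  apply hol_Cexp_comp, hol_mult; [apply hol_const|apply hol_minus_const].
Qed.
Lemma hol_f1 z : - X <= fst z <= X -> - L <= snd z <= Y -> hol f1 z.
Proof.
  intros H1 H2. apply hol_mult; [apply hol_Fz; assumption|].
  apply (hol_comp (fun z => z - c)%C (KC (- B1) eta)); [apply hol_minus_const|apply hol_KC].
Qed.
Lemma hol_f3 z : - X <= fst z <= X -> - L <= snd z <= Y -> (z - c)%C <> 0%C -> hol f3 z.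
Proof.
  intros H1 H2 H3. apply hol_div; [apply hol_uu; assumption|apply hol_minus_const|exact H3].
Qed.

Let S0 : R := exp (- (a * X / 2) + eta * L).

Lemma eL_ge : 1 <= exp (eta * L).
Proof. rewrite <- exp_0. apply exp_le. nra. Qed.

Lemma f1_side z : - L <= snd z <= 0 -> fst z = X \/ fst z = - X -> Cmod (f1 z) <= 4 * B * S0.
Proof.
  intros Hz Hx. pose proof (zc_side z Hx) as H1. pose proof B_pos. pose proof eL_ge.
  unfold f1. rewrite Cmod_mult. rewrite KC_off by (apply Cmod_neq_0; lra).
  assert (A : Cmod (Fz z) <= B * (2 * exp (- (a * X / 2)))).
  { apply Fz_bd; [lra|lra|left; lra|apply om_side; [lra|exact Hx]]. }
  assert (K : Cmod ((Cexp (Ci * RtoC eta * (z - c)) - Cexp (Ci * RtoC (- B1) * (z - c))) / (Ci * (z - c))) <= 2 * exp (eta * L)).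
  { apply quot_le; [|rewrite Cmod_mult, Cmod_Ci; lra].
    step_le; [apply Cmod_triangle_minus|]. rewrite !Cmod_exp_Ci, zc_snd.
    assert (exp (- (eta * snd z)) <= exp (eta * L)) by (apply exp_le; nra).
    assert (exp (- (- B1 * snd z)) <= exp 0) by (apply exp_le; nra). rewrite exp_0 in *. lra. }
  apply Rle_trans with ((B * (2 * exp (- (a * X / 2)))) * (2 * exp (eta * L))).
  - apply Rmult_le_compat; try apply Cmod_ge_0; assumption.
  - right. unfold S0. rewrite exp_plus. ring.
Qed.
Lemma f3_side z : - L <= snd z <= Y -> fst z = X \/ fst z = - X -> Cmod (f3 z) <= 2 * B * S0.
Proof.
  intros Hz Hx. apply quot_le; [|apply zc_side, Hx]. pose proof B_pos.
  assert (A : Cmod (Fz z) <= B * (2 * exp (- (a * X / 2)))).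
  { apply Fz_bd; [lra|lra|right; unfold far; tauto|apply om_side; [lra|exact Hx]]. }
  step_le; [apply uu_bd, A|]. unfold S0. rewrite exp_plus.
  assert (exp (- (eta * snd z)) <= exp (eta * L)) by (apply exp_le; nra).
  apply Rle_trans with (B * (2 * exp (- (a * X / 2))) * exp (eta * L)); [|right; ring].
  mono_l; [pose proof (exp_pos (- (a * X / 2))); nra|assumption].
Qed.
Lemma f3_top z : - X <= fst z <= X -> snd z = Y -> Cmod (f3 z) <= 2 * B * exp (- (eta * Y)).
Proof.
  intros Hx Hz. apply quot_le; [|step_le; [|apply zc_vert]; rewrite Hz, Rabs_pos_eq; lra].
  assert (A : Cmod (Fz z) <= B * 2).
  { apply Fz_bd; [lra|lra|right; unfold far; tauto|apply om_le2; lra]. }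
  step_le; [apply uu_bd, A|]. rewrite Hz. right; ring.
Qed.
Lemma f13_bottom z : - X <= fst z <= X -> snd z = - L -> Cmod (f1 z - f3 z) <= 2 * B * exp (- (B1 * L)).
Proof.
  intros Hx Hz. assert (N : 1 <= Cmod (z - c)).
  { step_le; [|apply zc_vert]. rewrite Hz, Rabs_left1; lra. }
  assert (N0 : (z - c)%C <> 0%C) by (apply Cmod_neq_0; lra).
  assert (E : (f1 z - f3 z)%C = (- (Fz z * Cexp (Ci * RtoC (- B1) * (z - c))) / (Ci * (z - c)))%C).
  { unfold f1, f3, uu. rewrite KC_off by exact N0. field. split; [exact N0|exact Ci_neq_0]. }
  rewrite E. apply quot_le; [|rewrite Cmod_mult, Cmod_Ci; lra].
  rewrite Cmod_opp, Cmod_mult, Cmod_exp_Ci, zc_snd, Hz. replace (- (- B1 * - L)) with (- (B1 * L)) by ring.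
  mono_r; [left; apply exp_pos|]. rewrite (Rmult_comm 2). apply Fz_bd; [lra|lra|left; lra|apply om_le2; lra].
Qed.

(** The integral of [f1] is moved from the real axis down to [Im z = - L], crossing no pole. There
    the part of frequency [- B1] is negligible, and the rest, [f3], is moved up to [Im z = Y] past
    its pole at [c], which yields the value [Fz c]. *)
Lemma reproduce : Cmod (CI (fun x => Fz (RtoC x) * RtoC 1 * KR (- B1) eta (x - lam))%C (- X) X - RtoC (2 * PI) * Fz c) <= Err.
Proof.
  pose proof B_pos as HB0. assert (Hl : Rabs lam <= X / 2) by exact Hlam. apply Rabs_le_between in Hl.
  pose proof (goursat f1 (- X) X (- L) 0 ltac:(lra) ltac:(lra)) as G1.
  specialize (G1 ltac:(intros z [Z1 Z2]; apply hol_f1; lra)).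
  pose proof (residue_quotient uu (- X) X (- L) Y c) as G3. cbn [c fst snd RtoC] in G3.
  specialize (G3 ltac:(simpl; lra) ltac:(simpl; lra) ltac:(intros z [Z1 Z2]; apply hol_uu; lra)). unfold RI in G1, G3.
  change (fun t : R => (uu (t, - L)%R / ((t, - L)%R - c))%C) with (fun t : R => f3 (t, - L)) in G3.
  change (fun t : R => (uu (t, Y) / ((t, Y) - c))%C) with (fun t : R => f3 (t, Y)) in G3.
  change (fun t : R => (uu (X, t) / ((X, t) - c))%C) with (fun t : R => f3 (X, t)) in G3.
  change (fun t : R => (uu (- X, t)%R / ((- X, t)%R - c))%C) with (fun t : R => f3 (- X, t)) in G3.
  assert (Eu : ((0, 2 * PI)%R * uu c)%C = (RtoC (2 * PI) * Fz c)%C).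
  { unfold uu. replace (c - c)%C with (RtoC 0) by ring. rewrite Cmult_0_r, Cexp_0.
    replace (0, 2 * PI) with (RtoC (2 * PI) * Ci)%C by (ceq; ring). field. exact Ci_neq_0. } rewrite Eu in G3.
  assert (N3 : forall z, - X <= fst z <= X -> - L <= snd z <= Y -> (fst z = X \/ fst z = - X \/ snd z = Y \/ snd z = - L) -> (z - c)%C <> 0%C).
  { intros z Z1 Z2 [Hz|[Hz|[Hz|Hz]]]; apply Cmod_neq_0;
      [pose proof (zc_side z (or_introl Hz)); lra|pose proof (zc_side z (or_intror Hz)); lra| |];
      pose proof (zc_vert z) as V; rewrite Hz in V; [rewrite Rabs_pos_eq in V by lra|rewrite Rabs_left1 in V by lra]; lra. }
  assert (R1 : rc_on (fun t => f1 (t, - L)) (- X) X) by (apply rc_h; intros; apply hol_ccont, hol_f1; simpl; lra).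
  assert (R2 : rc_on (fun t => f3 (t, - L)) (- X) X) by (apply rc_h; intros; apply hol_ccont, hol_f3; [simpl; lra|simpl; lra|apply N3; simpl; lra]).
  assert (A1 : Cmod (CI (fun t => f1 (X, t)) (- L) 0) <= (4 * B * S0) * (0 - - L)).
  { apply CI_bound; [lra|apply rc_v; intros; apply hol_ccont, hol_f1; simpl; lra|]. intros; apply f1_side; simpl; [lra|tauto]. }
  assert (A2 : Cmod (CI (fun t => f1 (- X, t)) (- L) 0) <= (4 * B * S0) * (0 - - L)).
  { apply CI_bound; [lra|apply rc_v; intros; apply hol_ccont, hol_f1; simpl; lra|]. intros; apply f1_side; simpl; [lra|tauto]. }
  assert (A3 : Cmod (CI (fun t => f3 (X, t)) (- L) Y) <= (2 * B * S0) * (Y - - L)).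
  { apply CI_bound; [lra|apply rc_v; intros; apply hol_ccont, hol_f3; [simpl; lra|simpl; lra|apply N3; simpl; lra]|].
    intros; apply f3_side; simpl; [lra|tauto]. }
  assert (A4 : Cmod (CI (fun t => f3 (- X, t)) (- L) Y) <= (2 * B * S0) * (Y - - L)).
  { apply CI_bound; [lra|apply rc_v; intros; apply hol_ccont, hol_f3; [simpl; lra|simpl; lra|apply N3; simpl; lra]|].
    intros; apply f3_side; simpl; [lra|tauto]. }
  assert (A5 : Cmod (CI (fun t => f3 (t, Y)) (- X) X) <= (2 * B * exp (- (eta * Y))) * (X - - X)).
  { apply CI_bound; [lra|apply rc_h; intros; apply hol_ccont, hol_f3; [simpl; lra|simpl; lra|apply N3; simpl; lra]|].
    intros; apply f3_top; simpl; [lra|reflexivity]. }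
  assert (A6 : Cmod (CI (fun t => f1 (t, - L)) (- X) X - CI (fun t => f3 (t, - L)) (- X) X) <= (2 * B * exp (- (B1 * L))) * (X - - X)).
  { rewrite <- CI_minus by (try assumption; lra). apply CI_bound; [lra|intros t Ht; apply rcont_minus; [apply R1, Ht|apply R2, Ht]|].
    intros; apply f13_bottom; simpl; [lra|reflexivity]. }
  assert (E0 : CI (fun x => Fz (RtoC x) * RtoC 1 * KR (- B1) eta (x - lam))%C (- X) X = CI (fun t => f1 (t, 0)) (- X) X).
  { apply CI_ext; [lra|]. intros t _. unfold f1. change (t, 0) with (RtoC t). unfold c.
    rewrite <- RtoC_minus, KC_KR by lra. ring. } rewrite E0.
  set (d1 := CI (fun t => f1 (t, - L)) (- X) X) in *. set (d2 := CI (fun t => f1 (X, t)) (- L) 0) in *.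
  set (d3 := CI (fun t => f1 (t, 0)) (- X) X) in *. set (d4 := CI (fun t => f1 (- X, t)) (- L) 0) in *.
  set (e1 := CI (fun t => f3 (t, - L)) (- X) X) in *. set (e2 := CI (fun t => f3 (X, t)) (- L) Y) in *.
  set (e3 := CI (fun t => f3 (t, Y)) (- X) X) in *. set (e4 := CI (fun t => f3 (- X, t)) (- L) Y) in *.
  assert (Q : (d3 - RtoC (2 * PI) * Fz c)%C = ((d1 - e1) + Ci * (d2 - d4) + e3 + Ci * (e4 - e2))%C).
  { rewrite <- G3. replace d3 with (d1 + Ci * d2 - Ci * d4 - (d1 + Ci * d2 - d3 - Ci * d4))%C by ring. rewrite G1. ring. }
  rewrite Q. step_le; [apply Cmod_triangle|]. step_le; [apply Rplus_le_compat_r, Cmod_triangle|].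
  step_le; [apply Rplus_le_compat_r, Rplus_le_compat_r, Cmod_triangle|]. rewrite !Cmod_mult, Cmod_Ci, !Rmult_1_l.
  pose proof (Cmod_triangle_minus d2 d4) as T1. pose proof (Cmod_triangle_minus e4 e2) as T2.
  assert (HS : 0 < S0) by apply exp_pos. unfold Err. fold S0.
  assert (HLY : (12 * L + 4 * Y) * (B * S0) <= (16 * Y) * (B * S0)) by (mono_r; [nra|lra]). lra.
Qed.
End At.

Variables (n : nat) (mu : nat -> R) (de : R).
Hypothesis Hde : 0 < de.
Hypothesis Hmu : forall i, (i < n)%nat -> Rabs (mu i) <= X / 2 /\ Gh (RtoC (mu i)) = 0%C.
Hypothesis Hsep : forall i j, (i < n)%nat -> (j < n)%nat -> de * Rabs (INR i - INR j) <= Rabs (mu i - mu j).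

(** Duality: as [1 - Gh = 1] at the points [mu i], the sum of the weights is, up to [Err], an
    integral of [F] against the kernel sum [g]. The large sieve bounds the norm of [g] by the same
    sum of weights, so half of the left side is absorbed. *)
Lemma local_sieve : 2 * PI * rs (fun i => wq a (mu i)) n <=
  (B1 + eta + 2 * PI / de) * RInt (fun x => Cmod (1 - Gh (x, 0))%C ^ 2 * wq a x) (- X) X + 2 * INR n * Err.
Proof.
  pose proof PI_RGT_0 as HPI. set (W := B1 + eta + 2 * PI / de).
  assert (HW : 0 < W) by (unfold W; assert (0 < 2 * PI / de) by (div_pos; lra); lra).
  set (S := rs (fun i => wq a (mu i)) n). set (cc := fun i => omr a (mu i)).
  set (g := fun x => csum (fun j => RtoC (cc j) * KR (- B1) eta (x - mu j))%C n). set (F := fun x : R => Fz (RtoC x)).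
  assert (HF : rc_on F (- X) X).
  { intros t Ht. apply (hol_rcont Fz (fun t => RtoC t)); [apply hol_Fz; simpl; lra|apply rcont_RtoC, continuous_id]. }
  assert (HK : forall d, rc_on (fun x => KR (- B1) eta (x - d)) (- X) X).
  { intros d t _. apply (rcont_ext (fun t => KC (- B1) eta (RtoC (t - d)))); [intros; apply KC_KR; lra|].
    apply (hol_rcont (KC (- B1) eta) (fun t => RtoC (t - d))); [apply hol_KC|apply rcont_RtoC]. cont_derive. }
  assert (Hg : rc_on g (- X) X).
  { intros t Ht. apply csum_rc. intros i Hi. apply rcont_mult; [apply rcont_const|apply HK, Ht]. }
  assert (ES : csum (fun i => RtoC (cc i) * (RtoC (2 * PI) * Fz (RtoC (mu i))))%C n = RtoC (2 * PI * S)).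
  { unfold S. rewrite (csum_ext _ (fun i => RtoC (2 * PI * wq a (mu i)))).
    - unfold csum. cbn [fst snd RtoC]. rewrite rs_0. unfold RtoC. rewrite rs_scal. reflexivity.
    - intros i Hi. unfold Fz. rewrite (proj2 (Hmu i Hi)), om_real, <- omr_sq. unfold cc. ceq; ring. }
  assert (EI : CI (fun x => F x * g x)%C (- X) X =
     csum (fun i => RtoC (cc i) * CI (fun x => Fz (RtoC x) * RtoC 1 * KR (- B1) eta (x - mu i))%C (- X) X)%C n).
  { assert (R1 : forall i, rc_on (fun x => Fz (RtoC x) * RtoC 1 * KR (- B1) eta (x - mu i))%C (- X) X).
    { intros i t Ht. apply rcont_mult; [apply rcont_mult; [apply HF, Ht|apply rcont_const]|apply HK, Ht]. }
    rewrite (CI_ext _ (fun x => csum (fun i => RtoC (cc i) * (Fz (RtoC x) * RtoC 1 * KR (- B1) eta (x - mu i)))%C n)); [|lra|].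
    - rewrite (CI_csum (fun i x => RtoC (cc i) * (Fz (RtoC x) * RtoC 1 * KR (- B1) eta (x - mu i)))%C);
        [|lra|intros; apply rc_on_scal, R1]. apply csum_ext. intros i Hi. apply CI_scal; [lra|apply R1].
    - intros x _. unfold g. rewrite <- csum_scal. apply csum_ext. intros; unfold F; ring. }
  assert (HS : 2 * PI * S <= Cmod (CI (fun x => F x * g x)%C (- X) X) + INR n * Err).
  { assert (S0 : 0 <= S) by (apply rs_nonneg; intros; left; apply wq_pos).
    rewrite <- (Cmod_RtoC_pos (2 * PI * S)) at 1 by (apply Rmult_le_pos; lra). rewrite <- ES, EI.
    set (I := fun i => CI (fun x => Fz (RtoC x) * RtoC 1 * KR (- B1) eta (x - mu i))%C (- X) X).
    set (J := fun i => (RtoC (2 * PI) * Fz (RtoC (mu i)))%C).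
    change (Cmod (csum (fun i => RtoC (cc i) * J i)%C n) <= Cmod (csum (fun i => RtoC (cc i) * I i)%C n) + INR n * Err).
    assert (D : Cmod (csum (fun i => RtoC (cc i) * J i)%C n - csum (fun i => RtoC (cc i) * I i)%C n) <= INR n * Err).
    { assert (D0 : (csum (fun i => RtoC (cc i) * J i)%C n - csum (fun i => RtoC (cc i) * I i)%C n)%C
         = csum (fun i => RtoC (cc i) * (J i - I i))%C n).
      { clear. induction n as [|m IH]; [ceq; ring|]. rewrite !csum_S, <- IH. ring. }
      rewrite D0. step_le; [apply Cmod_csum_le|]. rewrite <- rs_const. apply rs_le. intros i Hi.
      rewrite Cmod_mult. destruct (omr_bounds a (mu i)) as [O1 O2]. unfold cc. rewrite Cmod_RtoC_pos by lra.
      pose proof (reproduce (mu i) (proj1 (Hmu i Hi))) as Rp. rewrite Cmod_minus_sym in Rp.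
      pose proof (Cmod_ge_0 (J i - I i)). unfold J, I in *. nra. }
    pose proof (Cmod_rev_triangle (csum (fun i => RtoC (cc i) * J i)%C n) (csum (fun i => RtoC (cc i) * I i)%C n)). lra. }
  assert (HN : Cmod (CI (fun x => F x * g x)%C (- X) X) <=
     W / 2 * RInt (fun x => Cmod (F x) ^ 2) (- X) X + / (2 * W) * RInt (fun x => Cmod (g x) ^ 2) (- X) X).
  { assert (CF : forall t, - X <= t <= X -> continuous (fun x => Cmod (F x) ^ 2) t) by (intros; apply rcont_Cmod2, HF; lra).
    assert (Cg : forall t, - X <= t <= X -> continuous (fun x => Cmod (g x) ^ 2) t) by (intros; apply rcont_Cmod2, Hg; lra).
    rewrite <- RInt_lin2 by (apply ex_RInt_cont; [lra|assumption]).
    apply CI_bound_g; [lra|intros t Ht; apply rcont_mult; [apply HF, Ht|apply Hg, Ht]| |].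
    - intros t Ht. apply (continuous_plus (fun x => W / 2 * Cmod (F x) ^ 2) (fun x => / (2 * W) * Cmod (g x) ^ 2));
        apply (continuous_mult (K := R_AbsRing)); try apply continuous_const; [apply CF, Ht|apply Cg, Ht].
    - intros t _. rewrite Cmod_mult. set (x := Cmod (F t)). set (y := Cmod (g t)).
      apply (Rmult_le_reg_l (2 * W)); [lra|].
      replace (2 * W * (W / 2 * x ^ 2 + / (2 * W) * y ^ 2)) with ((W * x) ^ 2 + y ^ 2) by (field; lra).
      pose proof (pow2_ge_0 (W * x - y)). lra. }
  assert (HGs : RInt (fun x => Cmod (g x) ^ 2) (- X) X <= 2 * PI * (W * S)).
  { pose proof (dual_large_sieve n mu cc de (- B1) eta X Hde ltac:(lra) ltac:(lra) Hsep (fun t => rcont_KR (- B1) eta t ltac:(lra))) as D.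
    replace (eta - - B1 + 2 * PI / de) with W in D by (unfold W; ring).
    rewrite (rs_ext (fun i => cc i ^ 2) (fun i => wq a (mu i))) in D by (intros; apply omr_sq). exact D. }
  assert (EF : RInt (fun x => Cmod (F x) ^ 2) (- X) X = RInt (fun x => Cmod (1 - Gh (x, 0))%C ^ 2 * wq a x) (- X) X).
  { apply RInt_ext. intros x _. unfold F, Fz. rewrite om_real, Cmod_mult, Rpow_mult_distr.
    destruct (omr_bounds a x). rewrite Cmod_RtoC_pos, omr_sq by lra. reflexivity. } rewrite EF in HN.
  assert (Hi : / (2 * W) * RInt (fun x => Cmod (g x) ^ 2) (- X) X <= PI * S).
  { apply (Rmult_le_reg_l (2 * W)); [lra|]. rewrite <- Rmult_assoc, Rinv_r, Rmult_1_l by lra. lra. } lra.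
Qed.
End Reproduce.

(** * The mollified zeta-function *)

Lemma sum_n_m_csum (u : nat -> C) N : @sum_n_m C_AbelianMonoid u 1 N = csum (fun i => u (S i)) N.
Proof.
  induction N as [|N IH].
  - apply (sum_n_m_zero (G := C_AbelianMonoid)). lia.
  - rewrite (sum_n_Sm (G := C_AbelianMonoid)) by lia. rewrite IH. reflexivity.
Qed.
Lemma Cmod_ninv_pow n s : Cmod (ninv_pow n s) = exp (- fst s * ln (INR n)).
Proof. unfold ninv_pow. rewrite Cmod_Cexp. f_equal. destruct s; csimp; ring. Qed.
Lemma hol_ninv_pow n s : hol (ninv_pow n) s.
Proof. apply hol_Cexp_comp, hol_mult; [apply hol_opp, hol_id|apply hol_const]. Qed.
Lemma hol_csum (f : nat -> C -> C) n z : (forall i, (i < n)%nat -> hol (f i) z) -> hol (fun z => csum (fun i => f i z) n) z.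
Proof.
  intros H. induction n as [|n IH]; [exact (hol_const 0%C z)|].
  apply (hol_plus (fun z => csum (fun i => f i z) n) (f n)); [apply IH; intros; apply H; lia|apply H; lia].
Qed.
Lemma hol_dirichlet_poly a x s : hol (dirichlet_poly a x) s.
Proof.
  apply (hol_ext (fun s => csum (fun i => a (S i) * ninv_pow (S i) s)%C (Z.to_nat (Int_part x)))).
  - intros w. symmetry. apply sum_n_m_csum.
  - apply hol_csum. intros i _. apply hol_mult; [apply hol_const|apply hol_ninv_pow].
Qed.

Lemma floor_nat x : 1 <= x -> INR (Z.to_nat (Int_part x)) <= x /\ (1 <= Z.to_nat (Int_part x))%nat.
Proof.
  intros Hx. destruct (base_Int_part x) as [H1 H2]. assert (P : (1 <= Int_part x)%Z).
  { destruct (Z.lt_ge_cases (Int_part x) 1) as [H|H]; [|exact H]. assert (H0 : (Int_part x <= 0)%Z) by lia. apply IZR_le in H0. lra. }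
  split; [|lia]. rewrite INR_IZR_INZ, Z2Nat.id by lia. exact H1.
Qed.

Section DP.
Variables (a : nat -> C) (K1 x : R).
Hypothesis Hx : 1 <= x.
Hypothesis HK : 0 <= K1.
Hypothesis Hco : forall n, (1 <= n)%nat -> Cmod (a n) <= K1 * INR n.

(** A termwise estimate; what is lost against [x ^ L] is a power of [x] independent of [L]. *)
Lemma dirichlet_poly_bound s L : 0 <= L -> - L <= fst s ->
  Cmod (dirichlet_poly a x s) <= K1 * (x * exp ((1 + L) * ln x)).
Proof.
  intros HL Hs. unfold dirichlet_poly. rewrite sum_n_m_csum. set (N := Z.to_nat (Int_part x)).
  destruct (floor_nat x Hx) as [F1 F2]. fold N in F1, F2. step_le; [apply Cmod_csum_le|].
  apply Rle_trans with (rs (fun _ => K1 * exp ((1 + L) * ln x)) N).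
  - apply rs_le. intros i Hi. rewrite Cmod_mult, Cmod_ninv_pow.
    assert (I1 : 1 <= INR (S i)) by (rewrite S_INR; pose proof (pos_INR i); lra).
    assert (I2 : INR (S i) <= x) by (step_le; [apply le_INR; exact Hi|exact F1]).
    assert (L1 : 0 <= ln (INR (S i))) by (rewrite <- ln_1; apply ln_le; lra).
    assert (L2 : ln (INR (S i)) <= ln x) by (apply ln_le; lra). pose proof (Hco (S i) ltac:(lia)) as C1.
    apply Rle_trans with ((K1 * INR (S i)) * exp (L * ln (INR (S i)))).
    + apply Rmult_le_compat; [apply Cmod_ge_0|left; apply exp_pos|exact C1|apply exp_le; nra].
    + rewrite Rmult_assoc. mono_l; [exact HK|].
      rewrite <- (exp_ln (INR (S i))) at 1 by lra. rewrite <- exp_plus. apply exp_le. nra.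
  - rewrite rs_const. pose proof (exp_pos ((1 + L) * ln x)).
    apply Rle_trans with (x * (K1 * exp ((1 + L) * ln x))); [mono_r; [nra|exact F1]|right; ring].
Qed.

(** The term [n = 1] is 1, and every other one is at most [K1 * n ^ (1 - sigma) <= K1 * 2 ^ (1 -
    sigma)]. *)
Lemma dirichlet_poly_near_1 s : a 1%nat = RtoC 1 -> 1 <= fst s ->
  Cmod (dirichlet_poly a x s - 1) <= K1 * (x * exp ((1 - fst s) * ln 2)).
Proof.
  intros Ha1 Hs. unfold dirichlet_poly. rewrite sum_n_m_csum. set (N := Z.to_nat (Int_part x)).
  destruct (floor_nat x Hx) as [F1 F2]. fold N in F1, F2. set (E := K1 * exp ((1 - fst s) * ln 2)).
  assert (HE : 0 <= E) by (apply Rmult_le_pos; [exact HK|left; apply exp_pos]).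
  assert (G : forall m, (S m <= N)%nat -> Cmod (csum (fun i => a (S i) * ninv_pow (S i) s)%C (S m) - 1) <= INR m * E).
  { induction m as [|m IH]; intros Hm.
    - unfold csum. cbn [rs]. rewrite Ha1. unfold ninv_pow. simpl INR. rewrite ln_1, Cmult_0_r, Cexp_0.
      match goal with |- Cmod ?e <= _ => replace e with (RtoC 0) by (ceq; ring) end. rewrite Cmod_0. simpl. lra.
    - rewrite csum_S. specialize (IH ltac:(lia)). rewrite S_INR.
      match goal with |- Cmod (Cminus (Cplus ?A ?B) ?D) <= _ => replace (Cminus (Cplus A B) D) with (Cplus (Cminus A D) B) by ring end.
      step_le; [apply Cmod_triangle|]. enough (Cmod (a (S (S m)) * ninv_pow (S (S m)) s) <= E) by lra.
      rewrite Cmod_mult, Cmod_ninv_pow. pose proof (Hco (S (S m)) ltac:(lia)) as C1.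
      assert (I1 : 2 <= INR (S (S m))) by (rewrite !S_INR; pose proof (pos_INR m); lra).
      assert (L2 : ln 2 <= ln (INR (S (S m)))) by (apply ln_le; lra).
      apply Rle_trans with ((K1 * INR (S (S m))) * exp (- fst s * ln (INR (S (S m))))).
      + mono_r; [left; apply exp_pos|exact C1].
      + unfold E. rewrite Rmult_assoc. mono_l; [exact HK|].
        rewrite <- (exp_ln (INR (S (S m)))) at 1 by lra. rewrite <- exp_plus. apply exp_le. nra. }
  destruct N as [|N0]; [lia|]. step_le; [apply G; lia|]. unfold E.
  rewrite S_INR in F1. replace (K1 * (x * exp ((1 - fst s) * ln 2))) with (x * E) by (unfold E; ring).
  fold E. mono_r; lra.
Qed.
End DP.

Lemma zero_divides (zeta : C -> C) (rho : C) : analytic_at zeta rho -> zeta rho = 0%C ->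
  exists g, hol g rho /\ forall s, zeta s = ((s - rho) * g s)%C.
Proof.
  intros Ha H0. destruct (analytic_expansion zeta rho Ha) as (c1 & c2 & K & r & HK & Hr & H).
  exists (Cquot zeta rho c1). split; [apply (expansion_divide zeta rho c1 c2 K r); assumption|].
  intros s. destruct (classic (s = rho)) as [->|Hs]; [rewrite H0; ring|].
  rewrite Cquot_off by exact Hs. field. intros E. apply Hs. replace s with ((s - rho) + rho)%C by ring. rewrite E. ring.
Qed.

Section Zeta.
Variables (zeta : C -> C) (t : R) (M : C -> C).
Hypothesis Hz : is_riemann_zeta zeta.
Hypothesis HM : forall s, hol M s.

Definition spt (z : C) : C := ((1 / 2 + snd z)%R, (t - fst z)%R).
Definition Gz (z : C) : C := (zeta (spt z) * M (spt z))%C.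

Lemma spt_lin z : spt z = ((1 / 2, t)%R - Ci * z)%C.
Proof. unfold spt. destruct z. ceq; ring. Qed.
Lemma hol_spt z : hol spt z.
Proof.
  apply (hol_ext (fun z => (1 / 2, t)%R - Ci * z)%C); [intros; symmetry; apply spt_lin|].
  apply hol_minus; [apply hol_const|apply hol_mult; [apply hol_const|apply hol_id]].
Qed.
Lemma hol_Gz z : fst z < t -> hol Gz z.
Proof.
  intros H. apply hol_mult; [|apply (hol_comp spt M); [apply hol_spt|apply HM]].
  apply (hol_comp spt zeta); [apply hol_spt|]. apply zeta_hol; [exact Hz|].
  apply Im_pos_neq_1. unfold spt. simpl. lra.
Qed.

Definition alpha (rho : C) : R := Rabs (fst rho - 1 / 2).
Lemma zero_reflected rho : zeta rho = 0%C -> 0 < snd rho -> zeta (1 / 2 + alpha rho, snd rho) = RtoC 0.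
Proof.
  intros H0 Hp. unfold alpha. destruct (Rle_dec (1 / 2) (fst rho)) as [H|H].
  - rewrite Rabs_pos_eq by lra. rewrite <- H0. f_equal. destruct rho; simpl. f_equal. ring.
  - rewrite Rabs_left by lra. rewrite <- (zeta_zero_reflect zeta rho Hz Hp H0). f_equal. f_equal. field.
Qed.
Lemma alpha_bound rho : zeta rho = 0%C -> 0 < snd rho -> 0 <= alpha rho <= 5 / 2.
Proof.
  intros H0 Hp. split; [apply Rabs_pos|]. destruct (Rle_dec (alpha rho) (5 / 2)) as [H|H]; [exact H|]. exfalso.
  apply (zeta_nonzero_right zeta (1 / 2 + alpha rho, snd rho) Hz); [simpl; lra|apply zero_reflected; assumption].
Qed.
Lemma Gz_divides rho : zeta rho = 0%C -> 0 < snd rho ->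
  exists g, hol g (t - snd rho, alpha rho) /\ forall z, Gz z = ((z - (t - snd rho, alpha rho)%R) * g z)%C.
Proof.
  intros H0 Hp. set (r' := (1 / 2 + alpha rho, snd rho)).
  assert (Hr : zeta r' = 0%C) by (apply zero_reflected; assumption).
  destruct (zero_divides zeta r') as (g & Hg & Eg); [apply (proj2 Hz)| exact Hr|].
  - intros E. apply (f_equal snd) in E. simpl in E. lra.
  - exists (fun z => - Ci * g (spt z) * M (spt z))%C. split.
    + apply hol_mult; [apply hol_mult; [apply hol_const|]|apply (hol_comp spt M); [apply hol_spt|apply HM]].
      apply (hol_comp spt g); [apply hol_spt|].
      replace (spt (t - snd rho, alpha rho)) with r'; [exact Hg|]. unfold spt, r'. simpl. f_equal. ring.
    + intros z. unfold Gz. rewrite Eg.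
      replace (spt z - r')%C with (- Ci * (z - (t - snd rho, alpha rho)%R))%C; [ring|].
      unfold spt, r'. destruct z. ceq; ring.
Qed.
End Zeta.

(** The logarithmic derivative of [wq a] is at most [a] in absolute value. *)
Lemma wq_shift a x d : 0 < a -> exp (- (a * Rabs d)) * wq a x <= wq a (x + d).
Proof.
  intros Ha. unfold wq. rewrite Rmult_plus_distr_l, exp_plus. set (e := exp (a * x)).
  assert (He : 0 < e) by apply exp_pos. destruct (Rle_dec 0 d) as [Hd|Hd].
  - rewrite Rabs_pos_eq by exact Hd. rewrite exp_Ropp. set (k := exp (a * d)).
    assert (Hk : 1 <= k) by (unfold k; rewrite <- exp_0; apply exp_le; nra).
    assert (Hq : 0 < (1 + e) ^ 2) by (apply pow_lt; lra). assert (Hp : 0 < (1 + e * k) ^ 2) by (apply pow_lt; nra).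
    apply Rle_trans with (4 * (e * k) * / (k * (1 + e)) ^ 2); [right; field; lra|].
    mono_l; [nra|]. apply Rinv_le_contravar; [exact Hp|]. apply pow_incr. nra.
  - rewrite Rabs_left by lra. replace (- (a * - d)) with (a * d) by ring. set (k := exp (a * d)).
    assert (Hk0 : 0 < k) by apply exp_pos. assert (Hk : k <= 1) by (unfold k; rewrite <- exp_0; apply exp_le; nra).
    assert (Hp : 0 < (1 + e * k) ^ 2) by (apply pow_lt; nra).
    apply Rle_trans with (4 * (e * k) * / (1 + e) ^ 2); [right; field; lra|].
    mono_l; [nra|]. apply Rinv_le_contravar; [exact Hp|]. apply pow_incr. nra.
Qed.

Lemma cos_ge_quad x : 0 <= x -> 1 - x ^ 2 / 2 <= cos x.
Proof.
  intros Hx. replace (cos x) with (1 - 2 * sin (x / 2) ^ 2).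
  - assert (Rabs (sin (x / 2)) <= x / 2).
    { destruct (Req_dec x 0) as [->|H]; [unfold Rdiv; rewrite Rmult_0_l, sin_0, Rabs_R0; lra|].
      apply Rabs_le_between. split; [|left; apply sin_lt_x; lra].
      assert (- sin (x / 2) <= x / 2); [|lra]. rewrite <- sin_neg.  destruct (Rle_dec (x / 2) 1) as [H1|H1].
      - pose proof PI_gt_3. pose proof (sin_ge_0 (x / 2) ltac:(lra) ltac:(lra)). rewrite sin_neg. lra.
      - pose proof (SIN_bound (- (x / 2))). lra. }
    rewrite <- (pow2_abs (sin (x / 2))). pose proof (Rabs_pos (sin (x / 2))). nra.
  - replace (cos x) with (cos (2 * (x / 2))) by (f_equal; field). rewrite cos_2a_sin. ring.
Qed.

(** [- ln (cos th) <= th ^ 2] for [th = a * al i <= 1]; division by [a] leaves [a * al i ^ 2], and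
    [(5 / 2) ^ 2 = 25 / 4]. *)
Lemma lash_shift a la al i : 0 < a -> 0 <= al i <= 5 / 2 -> a * al i <= 1 -> Rabs (lash a la al i - la i) <= a * (25 / 4).
Proof.
  intros Ha H1 H2. unfold lash. replace (la i + ln (cos (a * al i)) / a - la i) with (ln (cos (a * al i)) / a) by ring.
  set (th := a * al i). assert (Hth : 0 <= th) by (unfold th; nra).
  pose proof (cos_ge_quad th Hth) as C. assert (C0 : / 2 <= cos th) by (apply cos_ge_half; split; [exact Hth|exact H2]).
  assert (C1 : cos th <= 1) by apply COS_bound. assert (A : ln (cos th) <= 0) by (rewrite <- ln_1; apply ln_le; lra).
  assert (B : - (th ^ 2) <= ln (cos th)).
  { pose proof (exp_ge_1x (th ^ 2)) as E. assert (E2 : 0 < exp (th ^ 2)) by apply exp_pos.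
    rewrite <- (ln_exp (- th ^ 2)). apply ln_le; [apply exp_pos|]. rewrite exp_Ropp.
    apply (Rmult_le_reg_r (exp (th ^ 2))); [exact E2|]. rewrite Rinv_l by lra.
    assert (T : th ^ 2 <= 1) by (assert (th <= 1) by exact H2; nra). pose proof (pow2_ge_0 th). nra. }
  rewrite Rabs_left1.
  - apply (Rmult_le_reg_r a); [exact Ha|]. replace (- (ln (cos th) / a) * a) with (- ln (cos th)) by (field; lra).
    apply Rle_trans with (th ^ 2); [lra|]. unfold th.
    assert (al i ^ 2 <= 25 / 4) by nra. replace ((a * al i) ^ 2) with (a * a * al i ^ 2) by ring.
    replace (a * (25 / 4) * a) with (a * a * (25 / 4)) by ring. mono_l; nra.
  - apply (Rmult_le_reg_r a); [exact Ha|]. unfold Rdiv. rewrite Rmult_assoc, Rinv_l by lra. lra.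
Qed.

(** [move_zeros], [compare] and [local_sieve] combined. Each zero moves by at most [a * (25 / 4)],
    so the separation is assumed larger by twice that amount and the weights lose the factor
    [exp (- (a * (a * (25 / 4))))]. *)
Theorem local_bound a Y X L iota B1 eta H et de n (la al : nat -> R) (G : C -> C) :
  0 < a -> a * Y = PI / 2 -> 4 <= a * X -> 2 <= X -> 1 <= L -> L + 4 <= Y -> 0 < iota < PI / 2 ->
  0 < B1 -> 0 < eta -> 0 < de -> a * (5 / 2) <= 1 -> a * (25 / 4) <= X / 4 ->
  (forall i, (i < n)%nat -> 0 <= al i <= 5 / 2) -> (forall i, (i < n)%nat -> Rabs (la i) <= X / 4) ->
  (forall i, (i < n)%nat -> exp (a * la i) * sin (a * al i) <= 2 * sin iota) ->
  (forall i j, (i < n)%nat -> (j < n)%nat -> (de + 2 * (a * (25 / 4))) * Rabs (INR i - INR j) <= Rabs (la i - la j)) ->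
  (forall z, Dom Y X L z -> hol G z) ->
  (forall i, (i < n)%nat -> exists g, hol g (la i, al i) /\ forall z, Dom Y X L z -> G z = ((z - (la i, al i)) * g z)%C) ->
  (forall z, - X <= fst z <= X -> - L <= snd z <= 2 * Y -> Cmod (G z) <= H) ->
  (forall x, - X <= x <= X -> Cmod (1 - G (x, 2 * Y)%R) <= et) ->
  2 * PI * (exp (- (a * (a * (25 / 4)))) * rs (fun i => wq a (la i)) n) <=
   (B1 + eta + 2 * PI / de) * (2 / (1 + cos iota) * RInt (fun x => Cmod (1 - G (x, 0))%C ^ 2 * wq a x) (- X) X
     + (4 * X * et ^ 2 / (1 - cos iota) + 256 * Y * H * exp (2 * rs (fun i => a * al i) n) * exp (- (a * X))))
   + 2 * INR n * Err a Y X L B1 eta (1 + exp (2 * rs (fun i => a * al i) n) * H).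
Proof.
  intros Ha HaY HaX HX HL HY Hio HB1 Heta Hde Ha1 Ha2 Hal Hla Him Hsep HG Hdiv HH Het.
  assert (Hal' : forall i, (i < n)%nat -> 0 <= al i <= 5 / 2 /\ a * al i <= 1).
  { intros i Hi. destruct (Hal i Hi). split; [lra|]. nra. }
  assert (Hla' : forall i, (i < n)%nat -> Rabs (la i) <= X / 2) by (intros i Hi; specialize (Hla i Hi); lra).
  assert (Hd : forall i j, (i < n)%nat -> (j < n)%nat -> i <> j -> la i <> la j).
  { intros i j Hi Hj Hij E. specialize (Hsep i j Hi Hj). rewrite E, Rminus_diag, Rabs_R0 in Hsep.
    assert (0 < Rabs (INR i - INR j)) by (apply Rabs_pos_lt; intros E2; apply Hij, INR_eq; lra). nra. }
  assert (HL0 : 0 < L) by lra.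
  destruct (move_zeros a Y X L iota n la al G Ha HaY HaX HL0 HY Hio Hal' Hla' Hd Him HG Hdiv) as (Gh & M1 & M2 & M3 & M4 & M5).
  set (E2 := exp (2 * rs (fun i => a * al i) n)) in *. assert (HE2 : 1 <= E2).
  { unfold E2. rewrite <- exp_0. apply exp_le. apply Rmult_le_pos; [lra|]. apply rs_nonneg. intros i Hi. destruct (Hal i Hi). nra. }
  pose proof (compare a Y X L iota H E2 G Gh Ha HaY HaX HL0 HY Hio HG M1 M2 M3 HE2 M4 HH et Het) as C1.
  assert (H0 : 0 <= H) by (step_le; [apply (Cmod_ge_0 (G (RtoC 0)))|apply HH; simpl; lra]).
  assert (HB : forall z : C, - X <= fst z <= X -> - L <= snd z <= Y -> snd z <= 0 \/ far Y X z -> 1 + Cmod (Gh z) <= 1 + E2 * H).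
  { intros z Z1 Z2 Z3. assert (Dz : Dom Y X L z) by (apply Dom_in; lra).
    pose proof (HH z Z1 ltac:(lra)) as B. pose proof (Cmod_ge_0 (G z)). apply Rplus_le_compat_l.
    destruct Z3 as [Z3|Z3].
    - step_le; [apply M3; [exact Dz|]|nra]. rewrite phi_snd.
      assert (sin (a * snd z) <= 0); [|pose proof (exp_pos (a * fst z)); nra].
      replace (a * snd z) with (- (a * - snd z)) by ring. rewrite sin_neg.
      assert (0 <= sin (a * - snd z)); [|lra]. apply sin_ge_0; nra.
    - step_le; [apply M4; assumption|]. mono_l; lra. }
  assert (Hsh : forall i, (i < n)%nat -> Rabs (lash a la al i - la i) <= a * (25 / 4)).
  { intros i Hi. destruct (Hal' i Hi). apply lash_shift; assumption. }
  assert (Hmu : forall i, (i < n)%nat -> Rabs (lash a la al i) <= X / 2 /\ Gh (RtoC (lash a la al i)) = 0%C).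
  { intros i Hi. split; [|apply M5, Hi]. specialize (Hsh i Hi). specialize (Hla i Hi).
    apply Rabs_le_between in Hsh. apply Rabs_le_between in Hla. apply Rabs_le_between. lra. }
  assert (Hse : forall i j, (i < n)%nat -> (j < n)%nat -> de * Rabs (INR i - INR j) <= Rabs (lash a la al i - lash a la al j)).
  { intros i j Hi Hj. pose proof (Hsh i Hi) as A1. pose proof (Hsh j Hj) as A2. specialize (Hsep i j Hi Hj).
    destruct (Nat.eq_dec i j) as [<-|Hij]; [rewrite !Rminus_diag, Rabs_R0; lra|].
    assert (D : 1 <= Rabs (INR i - INR j)).
    { destruct (Nat.lt_ge_cases i j) as [Q|Q].
      - apply le_INR in Q. rewrite S_INR in Q. rewrite Rabs_left1; lra.
      - assert (Q2 : (S j <= i)%nat) by lia. apply le_INR in Q2. rewrite S_INR in Q2. rewrite Rabs_pos_eq; lra. }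
    pose proof (Rabs_triang (lash a la al i - lash a la al j) ((la i - lash a la al i) + (lash a la al j - la j))) as T.
    pose proof (Rabs_triang (la i - lash a la al i) (lash a la al j - la j)) as T2.
    rewrite (Rabs_minus_sym (la i)) in T2.
    replace (lash a la al i - lash a la al j + (la i - lash a la al i + (lash a la al j - la j))) with (la i - la j) in T by ring.
    nra. }
  pose proof (local_sieve a Y X L B1 eta (1 + E2 * H) Gh Ha HaY HX HL HY HB1 Heta M1 HB n (lash a la al) de Hde Hmu Hse) as S1.
  assert (S2 : exp (- (a * (a * (25 / 4)))) * rs (fun i => wq a (la i)) n <= rs (fun i => wq a (lash a la al i)) n).
  { rewrite <- rs_scal. apply rs_le. intros i Hi.
    replace (lash a la al i) with (la i + (lash a la al i - la i)) by ring.
    step_le; [|apply wq_shift, Ha]. mono_r; [left; apply wq_pos|]. apply exp_le. specialize (Hsh i Hi). nra. }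
  pose proof PI_RGT_0 as HPI.
  assert (HW : 0 < B1 + eta + 2 * PI / de) by (assert (0 < 2 * PI / de) by (div_pos; lra); lra).
  apply (Rmult_le_compat_l (2 * PI)) in S2; [|lra]. apply (Rmult_le_compat_l (B1 + eta + 2 * PI / de)) in C1; [|lra]. lra.
Qed.

(** * The bound at a fixed height *)

Fixpoint lsum (f : C -> R) (l : list C) : R := match l with nil => 0 | x :: q => f x + lsum f q end.

Lemma lsum_perm f l l' : Permutation l l' -> lsum f l = lsum f l'.
Proof. induction 1; simpl; lra. Qed.
Lemma lsum_nth f l d : lsum f l = rs (fun i => f (nth i l d)) (length l).
Proof.
  assert (G : forall g n, rs g (S n) = g 0%nat + rs (fun i => g (S i)) n).
  { intros g n. induction n as [|n IH]; [simpl; ring|]. change (rs g (S (S n))) with (rs g (S n) + g (S n)). rewrite IH. simpl. ring. }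
  induction l as [|x l IH]; [reflexivity|]. change (length (x :: l)) with (S (length l)). rewrite G. simpl. rewrite IH. reflexivity.
Qed.
Lemma lsum_filter (p : C -> bool) f l : lsum (fun x => if p x then f x else 0) l = lsum f (filter p l).
Proof. induction l as [|x l IH]; [reflexivity|]. simpl. destruct (p x); simpl; rewrite IH; ring. Qed.
Lemma lsum_le f g l : (forall x, In x l -> f x <= g x) -> lsum f l <= lsum g l.
Proof.
  induction l as [|x l IH]; intros H; simpl; [lra|].
  pose proof (H x (or_introl eq_refl)). pose proof (IH (fun y Hy => H y (or_intror Hy))). lra.
Qed.
Lemma lsum_ext f g l : (forall x, In x l -> f x = g x) -> lsum f l = lsum g l.
Proof. intros H. apply Rle_antisym; apply lsum_le; intros; rewrite H by assumption; lra. Qed.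
Lemma lsum_rs_swap (f : nat -> C -> R) n l : rs (fun k => lsum (f k) l) n = lsum (fun x => rs (fun k => f k x) n) l.
Proof.
  induction l as [|x l IH]; simpl; [apply rs_0|]. rewrite <- IH. apply rs_plus.
Qed.
Lemma lsum_const c l : lsum (fun _ => c) l = INR (length l) * c.
Proof. induction l as [|x l IH]; [simpl; ring|]. change (length (x :: l)) with (S (length l)). rewrite S_INR. simpl. rewrite IH. ring. Qed.

Lemma list_min (l : list C) : l <> nil -> exists x, In x l /\ forall y, In y l -> snd x <= snd y.
Proof.
  induction l as [|x l IH]; intros H; [congruence|]. destruct l as [|y l].
  - exists x. split; [left; reflexivity|]. intros z [<-|[]]. lra.
  - destruct IH as (m & Hm & Hle); [discriminate|]. destruct (Rle_dec (snd x) (snd m)) as [Q|Q].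
    + exists x. split; [left; reflexivity|]. intros z [<-|Hz]; [lra|]. specialize (Hle z Hz). lra.
    + exists m. split; [right; exact Hm|]. intros z [<-|Hz]; [lra|apply Hle, Hz].
Qed.

(** The lowest ordinate is taken out repeatedly. In this order the gaps add up, which turns the
    pairwise spacing into the one proportional to index differences that [hilbert_inequality]
    requires. *)
Lemma sort_spaced d (n : nat) : 0 < d -> forall l : list C, length l = n -> NoDup l -> well_spaced d l ->
  exists l', Permutation l l' /\ forall i j, (i < j)%nat -> (j < n)%nat ->
    d * (INR j - INR i) <= snd (nth j l' 0%C) - snd (nth i l' 0%C).
Proof.
  intros Hd. induction n as [|n IH]; intros l Hl Hn Hw.
  - exists nil. destruct l; [|discriminate]. split; [constructor|]. intros; lia.
  - destruct (list_min l) as (x & Hx & Hmin); [intros ->; discriminate|].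
    destruct (in_split x l Hx) as (l1 & l2 & E). subst l.
    assert (P : Permutation (l1 ++ x :: l2) (x :: l1 ++ l2)) by (symmetry; apply Permutation_middle).
    assert (Hn2 : NoDup (x :: l1 ++ l2)) by (eapply Permutation_NoDup; [exact P|exact Hn]).
    inversion Hn2 as [|? ? Hx2 Hn3]; subst. assert (Hsub : forall y, In y (l1 ++ l2) -> In y (l1 ++ x :: l2)).
    { intros y Hy. eapply Permutation_in; [symmetry; exact P|]. right. exact Hy. }
    destruct (IH (l1 ++ l2)) as (l' & P' & S').
    + pose proof (Permutation_length P) as Q. simpl in Q. lia.
    + exact Hn3.
    + intros r r' H1 H2. apply Hw; apply Hsub; assumption.
    + exists (x :: l'). split; [rewrite P; constructor; exact P'|]. assert (Hlen : length l' = n).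
      { rewrite <- (Permutation_length P'). pose proof (Permutation_length P) as Q. simpl in Q. lia. }
      assert (Hfirst : forall k, (k < n)%nat -> d <= snd (nth k l' 0%C) - snd x).
      { intros k Hk. set (y := nth k l' 0%C). assert (Hy : In y (l1 ++ l2)).
        { eapply Permutation_in; [symmetry; exact P'|]. apply nth_In. lia. }
        assert (x <> y) by (intros <-; contradiction).
        pose proof (Hw x y Hx (Hsub y Hy) H) as W. pose proof (Hmin y (Hsub y Hy)) as Mn. unfold Im in W.
        rewrite Rabs_left1 in W by lra. lra. }
      intros i j Hij Hj. destruct j as [|j]; [lia|]. destruct i as [|i]; simpl nth.
      * pose proof (Hfirst 0%nat ltac:(lia)) as F0. rewrite S_INR. simpl INR.
        destruct j as [|j]; [simpl INR in *; lra|]. pose proof (S' 0%nat (S j) ltac:(lia) ltac:(lia)) as F1. simpl (INR 0) in F1. lra.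
      * rewrite !S_INR. pose proof (S' i j ltac:(lia) ltac:(lia)). lra.
Qed.

Lemma count_spaced d (l : list C) u M : 0 < d -> 0 <= M -> NoDup l -> well_spaced d l ->
  (forall x, In x l -> u <= snd x <= u + M) -> INR (length l) <= M / d + 1.
Proof.
  intros Hd HM Hn Hw H. destruct (sort_spaced d (length l) Hd l eq_refl Hn Hw) as (l' & P & S').
  assert (HMd : 0 <= M / d) by (apply Rmult_le_pos; [exact HM|left; apply Rinv_0_lt_compat, Hd]).
  destruct (length l) as [|[|m]] eqn:E; [simpl; lra|simpl; lra|].
  assert (Hlen : length l' = S (S m)) by (rewrite <- (Permutation_length P); exact E).
  specialize (S' 0%nat (S m) ltac:(lia) ltac:(lia)).
  assert (I : forall k, (k < S (S m))%nat -> u <= snd (nth k l' 0%C) <= u + M).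
  { intros k Hk. apply H. eapply Permutation_in; [symmetry; exact P|]. apply nth_In. lia. }
  pose proof (I 0%nat ltac:(lia)). pose proof (I (S m) ltac:(lia)). rewrite (S_INR (S m)). simpl (INR 0) in S'.
  apply Rplus_le_compat_r. apply (Rmult_le_reg_r d); [exact Hd|]. unfold Rdiv. rewrite Rmult_assoc, Rinv_l by lra. lra.
Qed.

Lemma well_spaced_filter d (p : C -> bool) l : well_spaced d l -> well_spaced d (filter p l).
Proof. intros H r r' Hr Hr'. apply filter_In in Hr. apply filter_In in Hr'. apply H; tauto. Qed.

Definition ev (P : R -> Prop) : Prop := exists l0, forall l, l0 <= l -> P l.
Lemma ev_and P Q : ev P -> ev Q -> ev (fun l => P l /\ Q l).
Proof.
  intros [a HP] [b HQ]. exists (Rmax a b). intros l Hl.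
  split; [apply HP; step_le; [apply Rmax_l|exact Hl]|apply HQ; step_le; [apply Rmax_r|exact Hl]].
Qed.
Lemma ev_ge c : ev (fun l => c <= l).
Proof. exists c. auto. Qed.

Lemma pow_le_exp k c l : (1 <= k)%nat -> 0 < c -> 0 <= l -> l ^ k <= (INR k / c) ^ k * exp (c * l).
Proof.
  intros Hk Hc Hl. assert (P : 0 < INR k) by (apply lt_0_INR; lia).
  assert (E : forall m x, exp x ^ m = exp (INR m * x)).
  { intros m x. induction m as [|m IH]; [simpl; rewrite Rmult_0_l, exp_0; reflexivity|].
    rewrite S_INR. simpl. rewrite IH, <- exp_plus. f_equal. ring. }
  replace (c * l) with (INR k * (c * l / INR k)) by (field; lra). rewrite <- E, <- Rpow_mult_distr.
  apply pow_incr. split; [exact Hl|]. pose proof (exp_ge_1x (c * l / INR k)).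
  apply Rle_trans with (INR k / c * (c * l / INR k)); [right; field; lra|].
  mono_l; [apply Rlt_le, Rdiv_lt_0_compat; lra|lra].
Qed.

Definition clog (A theta : R) : R := 1 + theta + 1 / A.

Section Pointwise.
Variables (zeta : C -> C) (A e theta kappa : R).
Hypothesis Hz : is_riemann_zeta zeta.
Hypothesis HA : 0 < A.
Hypothesis He : 0 < e <= 1 / 2.
Hypothesis Hth : 0 < theta.
Hypothesis Hka : 1 <= kappa.

(** [cE * l] bounds the exponent of the cost of moving the zeros of a window; [h * l] is the
    exponent in the bound for [G] down to [Im z = - L]. [L] is fixed by
    [e * L = 10 + 2 * theta + cE], the surplus needed on that line. *)
Let cE := 3 * kappa / A + 1.
Let L := (10 + 2 * theta + cE) / e.
Let h := (1 + theta) * L + 2 + 2 * theta.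
Let D := clog A theta.

Lemma cE_pos : 1 <= cE.
Proof. unfold cE. assert (0 < 3 * kappa / A) by (div_pos; lra). lra. Qed.
Lemma L_ge : 10 + 2 * theta + cE <= L /\ e * L = 10 + 2 * theta + cE.
Proof.
  pose proof cE_pos. assert (E : e * L = 10 + 2 * theta + cE) by (unfold L; field; lra). split; [|exact E].
  assert (0 < L) by (unfold L; div_pos; lra). nra.
Qed.
Lemma D_gt : 1 < D.
Proof. unfold D, clog. assert (0 < 1 / A) by (div_pos; lra). lra. Qed.

(** Every requirement that [T] be large, collected in terms of [l = ln T]. The coefficient constant
    [K1] is absent, so the threshold is uniform in the coefficients; [K1] only multiplies the
    errors. *)
Definition big (Kz l : R) : Prop :=
  20 <= l /\ 1100000 <= l /\ L + 4 <= l /\ 4 * kappa <= l /\ exp (kappa * (PI / 2)) * (PI * 5 / 4) / (2 * sin e) <= l /\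
  25 / (8 * (e * A)) <= l /\ 25 / e <= l /\ Kz * exp (1 + L) <= l /\ 9 + 2 * theta + h + cE + (8 + h + cE) / e <= l /\
  2 * (9 + h + cE + e * L) <= l /\ 210000 / (1 - cos e) <= l /\ 3 * D <= l /\ 6 * (kappa / (PI * A)) + 1 <= l.

Lemma big_ev Kz : ev (big Kz).
Proof. repeat apply ev_and; apply ev_ge. Qed.

Lemma exp_const c l : c <= l -> c <= exp l.
Proof. intros H. pose proof (exp_ge_1x l). lra. Qed.

(** Each error term is a product of four factors bounded by [c * exp y]; one [exp l] pays for the
    product of the constants. *)
Lemma prod4 x1 x2 x3 x4 c1 c2 c3 c4 y1 y2 y3 y4 K c y l :
  0 <= x1 <= c1 * exp y1 -> 0 <= x2 <= c2 * exp y2 -> 0 <= x3 <= c3 * exp y3 -> 0 <= x4 <= c4 * exp y4 ->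
  c1 * c2 * c3 * c4 = K * c -> 0 <= K -> c <= l -> y1 + y2 + y3 + y4 <= y -> y + l <= - (4 * l) ->
  x1 * x2 * x3 * x4 <= K * exp (- (4 * l)).
Proof.
  intros H1 H2 H3 H4 Hc HK Hl Hy Hyl.
  apply Rle_trans with ((c1 * exp y1) * (c2 * exp y2) * (c3 * exp y3) * (c4 * exp y4)).
  - assert (M : forall p q r s, 0 <= p <= q -> 0 <= r <= s -> 0 <= p * r <= q * s).
    { intros p q r s P Q. split; [apply Rmult_le_pos; lra|apply Rmult_le_compat; lra]. }
    apply (M _ _ _ _ (M _ _ _ _ (M _ _ _ _ H1 H2) H3) H4).
  - replace ((c1 * exp y1) * (c2 * exp y2) * (c3 * exp y3) * (c4 * exp y4)) with (K * (c * exp (y1 + y2 + y3 + y4)))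
      by (rewrite !exp_plus, <- Rmult_assoc, <- Hc; ring). mono_l; [exact HK|]. pose proof (exp_const c l Hl) as E.
    apply Rle_trans with (exp l * exp (y1 + y2 + y3 + y4)).
    + mono_r; [left; apply exp_pos|exact E].
    + rewrite <- exp_plus. apply exp_le. lra.
Qed.

(** Every error carries a decay of at least [exp (- (c * l ^ 2))], beyond any power of [T], except
    the one from [Im z = - L]: there the decay is itself a power of [T], and the choice of [L]
    decides. *)
Lemma errors_small Kz l K1 n s W : big Kz l -> 1 <= K1 -> INR n <= kappa / (PI * A) * l ^ 3 + 1 -> 0 <= s -> 2 * s <= cE * l ->
  0 <= W <= 3 * l * D -> let a := PI / (2 * l ^ 2) in let X := l ^ 4 in let H := K1 * exp (h * l) in
  W * (4 * X * (14 * K1 * exp (theta * l - l ^ 2)) ^ 2 / (1 - cos e) + 256 * l ^ 2 * H * exp (2 * s) * exp (- (a * X)))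
   + 2 * INR n * Err a (l ^ 2) X L ((1 + theta) * (1 + e) * l) (e * l) (1 + exp (2 * s) * H) <= K1 ^ 2 * exp (- (3 * l)).
Proof.
  intros (B0 & B1 & B2 & B3 & B4 & B5 & B6 & B7 & B8 & B9 & B10 & B11 & B12) HK Hn Hs0 Hs HW a X H.
  pose proof PI_gt_3 as HPI. destruct L_ge as [L1 L2]. pose proof cE_pos as HcE. pose proof D_gt as HD.
  assert (Hh : 0 < h) by (unfold h; assert (0 < (1 + theta) * L) by (mul_pos; lra); lra).
  assert (Hl0 : 0 <= l) by lra.
  pose proof (pow_le_exp 4 1 l ltac:(lia) ltac:(lra) Hl0) as X4. pose proof (pow_le_exp 2 1 l ltac:(lia) ltac:(lra) Hl0) as X2.
  rewrite Rmult_1_l in X4, X2. replace ((INR 4 / 1) ^ 4) with 256 in X4 by (simpl; field). replace ((INR 2 / 1) ^ 2) with 4 in X2 by (simpl; field).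
  fold X in X4. assert (HX0 : 0 <= X) by (apply pow_le, Hl0). assert (HY0 : 0 <= l ^ 2) by (apply pow_le, Hl0).
  assert (Hn4 : INR n <= 256 * exp l).
  { apply Rle_trans with X; [|exact X4]. step_le; [exact Hn|]. unfold X.
    assert (1 <= l ^ 3) by (apply pow_R1_Rle; lra). assert (0 <= kappa / (PI * A)) by (apply Rlt_le, Rdiv_lt_0_compat; [lra|mul_pos; lra]).
    replace (l ^ 4) with (l * l ^ 3) by ring. apply Rle_trans with ((kappa / (PI * A) + 1) * l ^ 3); [lra|].
    mono_r; lra. } assert (HWe : 0 <= W <= 1 * exp (2 * l)).
  { split; [apply HW|]. pose proof (exp_const l l (Rle_refl l)). replace (2 * l) with (l + l) by ring. rewrite exp_plus. nra. }
  assert (HE2 : exp (2 * s) <= exp (cE * l)) by (apply exp_le; lra).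
  assert (Ha : a * X = PI / 2 * l ^ 2) by (unfold a, X; field; lra).
  assert (HaX : l ^ 2 <= a * X) by (rewrite Ha; nra). assert (Hll : l ^ 2 = l * l) by ring.
  assert (HK1 : K1 <= K1 ^ 2) by nra. assert (Hcos : cos e < 1) by (rewrite <- cos_0; apply cos_decreasing_1; lra).
  assert (Hb9 : 9 + 2 * theta + h + cE <= l) by (assert (0 < (8 + h + cE) / e) by (div_pos; lra); lra).
  set (B := 1 + exp (2 * s) * H). assert (HB : 0 <= B <= (2 * K1) * exp ((cE + h) * l)).
  { assert (E1 : 1 <= exp ((cE + h) * l)) by (rewrite <- exp_0; apply exp_le; nra).
    assert (P : 0 < exp (2 * s) * H) by (mul_pos; [apply exp_pos|mul_pos; [lra|apply exp_pos]]).
    unfold B. split; [lra|]. assert (Q : exp (2 * s) * H <= K1 * exp ((cE + h) * l)); [|pose proof (Rmult_le_compat 1 K1 1 _ ltac:(lra) ltac:(lra) HK E1); lra].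
    unfold H. replace ((cE + h) * l) with (cE * l + h * l) by ring. rewrite exp_plus.
    replace (K1 * (exp (cE * l) * exp (h * l))) with (exp (cE * l) * (K1 * exp (h * l))) by ring.
    mono_r; [apply Rmult_le_pos; [lra|left; apply exp_pos]|exact HE2]. }
  assert (Hbig : forall k, k <= 9 + 2 * theta + h + cE -> k * l <= l ^ 2) by (intros k Hk; rewrite Hll; nra).
  pose proof (Hbig (9 + 2 * theta + h + cE) (Rle_refl _)) as Hq.
  assert (N2 : 0 <= 2 * INR n <= 512 * exp l) by (pose proof (pos_INR n); lra).
  assert (X16 : 0 <= 16 * l ^ 2 <= 64 * exp l) by lra. assert (X4' : 0 <= 4 * X <= 1024 * exp l) by lra.
  assert (PE : forall y, 0 <= exp y <= 1 * exp y) by (intros y; pose proof (exp_pos y); lra).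
  assert (Hc1 : 0 < 784 / (1 - cos e)) by (div_pos; lra). assert (Hc2 : 200704 / (1 - cos e) <= l).
  { step_le; [|exact B10]. mono_r; [left; apply Rinv_0_lt_compat|]; lra. }
  (* [TA] and [TB] are the upper edge and the vertical sides of [compare]; [TC], [TD] and [TE] are
     the three parts of [Err]. *)
  assert (TA : W * X * exp (2 * (theta * l - l ^ 2)) * (784 / (1 - cos e)) <= 1 * exp (- (4 * l))).
  { apply (prod4 _ _ _ _ 1 256 1 (784 / (1 - cos e)) (2 * l) l (2 * (theta * l - l ^ 2)) 0 1 (200704 / (1 - cos e))
      (3 * l + 2 * (theta * l - l ^ 2)) l);
      [exact HWe|lra|apply PE|rewrite exp_0; lra|field; lra|lra|exact Hc2|lra|]. nra. }
  assert (TB : W * l ^ 2 * (256 * (H * exp (2 * s))) * exp (- (a * X)) <= K1 * exp (- (4 * l))).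
  { apply (prod4 _ _ _ _ 1 4 (256 * K1) 1 (2 * l) l ((h + cE) * l) (- l ^ 2) K1 1024 (3 * l + (h + cE) * l - l ^ 2) l);
      [exact HWe|lra| | |ring|lra|lra|lra|pose proof (Hbig (8 + h + cE) ltac:(lra)); lra].
    - assert (Q : 0 <= H * exp (2 * s) <= K1 * exp ((h + cE) * l)); [|lra]. unfold H. split.
      + repeat apply Rmult_le_pos; try (left; apply exp_pos); lra.
      + rewrite Rmult_plus_distr_r, exp_plus, Rmult_assoc. mono_l; [lra|]. mono_l; [left; apply exp_pos|exact HE2].
    - rewrite Rmult_1_l. split; [left; apply exp_pos|apply exp_le; lra]. }
  assert (TC : (2 * INR n) * B * (16 * l ^ 2) * exp (- (a * X / 2) + e * l * L) <= K1 * exp (- (4 * l))).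
  { apply (prod4 _ _ _ _ 512 (2 * K1) 64 1 l ((cE + h) * l) l (- (l ^ 2 / 2) + e * l * L) K1 65536
      (2 * l + (cE + h) * l - l ^ 2 / 2 + e * L * l) l); [exact N2|exact HB|exact X16| |ring|lra|lra|lra|].
    - rewrite Rmult_1_l. split; [left; apply exp_pos|apply exp_le; lra].
    - rewrite Hll. assert ((2 * (9 + h + cE + e * L)) * l <= l * l) by (mono_r; lra). lra. }
  assert (TD : (2 * INR n) * B * (4 * X) * exp (- ((1 + theta) * (1 + e) * l * L)) <= K1 * exp (- (4 * l))).
  { apply (prod4 _ _ _ _ 512 (2 * K1) 1024 1 l ((cE + h) * l) l (- ((1 + theta) * (1 + e) * l * L)) K1 1048576
      (2 * l + (cE + h) * l - (1 + theta) * (1 + e) * l * L) l); [exact N2|exact HB|exact X4'|apply PE|ring|lra|lra|lra|].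
    (* [h] exceeds [(1 + theta) * L] by [2 + 2 * theta], and [e * L = 10 + 2 * theta + cE] brings
       the total down to [-5]. *)
    assert (Q : (3 + cE + h - (1 + theta) * (1 + e) * L) * l <= -5 * l); [|lra]. mono_r; [exact Hl0|].
    unfold h. assert (e * L <= (1 + theta) * (e * L)) by (rewrite L2; assert (0 <= theta * (10 + 2 * theta + cE)) by (apply Rmult_le_pos; lra); lra). lra. }
  assert (TE : (2 * INR n) * B * (4 * X) * exp (- (e * l * l ^ 2)) <= K1 * exp (- (4 * l))).
  { apply (prod4 _ _ _ _ 512 (2 * K1) 1024 1 l ((cE + h) * l) l (- (e * l * l ^ 2)) K1 1048576
      (2 * l + (cE + h) * l - e * l * l ^ 2) l); [exact N2|exact HB|exact X4'|apply PE|ring|lra|lra|lra|].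
    assert (Q : 8 + h + cE <= e * l).
    { assert (Q0 : (8 + h + cE) / e <= l) by lra. apply (Rmult_le_compat_l e) in Q0; [|lra].
      replace (e * ((8 + h + cE) / e)) with (8 + h + cE) in Q0 by (field; lra). exact Q0. }
    assert (Q2 : (8 + h + cE) * l <= (e * l) * l ^ 2); [|lra]. apply Rmult_le_compat; [lra|exact Hl0|exact Q|rewrite Hll; pose proof (Rmult_le_compat_r l 1 l); lra]. }
  unfold Err. rewrite (Rpow_mult_distr (14 * K1)).
  replace (exp (theta * l - l ^ 2) ^ 2) with (exp (2 * (theta * l - l ^ 2))) by (set (y := theta * l - l ^ 2); replace (2 * y) with (y + y) by ring; rewrite exp_plus; ring).
  fold B. apply Rle_trans with (K1 ^ 2 * (5 * exp (- (4 * l)))).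
  - match goal with |- ?lhs <= _ => replace lhs with
      (K1 ^ 2 * (W * X * exp (2 * (theta * l - l ^ 2)) * (784 / (1 - cos e))) + W * l ^ 2 * (256 * (H * exp (2 * s))) * exp (- (a * X))
       + (2 * INR n) * B * (16 * l ^ 2) * exp (- (a * X / 2) + e * l * L)
       + (2 * INR n) * B * (4 * X) * exp (- ((1 + theta) * (1 + e) * l * L)) + (2 * INR n) * B * (4 * X) * exp (- (e * l * l ^ 2))) end.
    2:{ field. lra. }
    pose proof (exp_pos (- (4 * l))) as P4. assert (K1 * exp (- (4 * l)) <= K1 ^ 2 * exp (- (4 * l))) by (mono_r; lra).
    apply (Rmult_le_compat_l (K1 ^ 2)) in TA; [|lra]. lra.
  - mono_l; [lra|]. replace (- (3 * l)) with (l + - (4 * l)) by ring. rewrite exp_plus.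
    mono_r; [left; apply exp_pos|apply exp_const; lra].
Qed.

Definition fm (M : C -> C) (u : R) : R := Cmod (1 - zeta (1 / 2, u)%R * M (1 / 2, u)%R)%C ^ 2.

Lemma cont_fm M u : (forall s, hol M s) -> 0 < u -> continuous (fm M) u.
Proof.
  intros HM Hu. apply (rcont_Cmod2 (fun u => 1 - zeta (1 / 2, u)%R * M (1 / 2, u)%R)%C).
  apply rcont_minus; [apply rcont_const|]. apply rcont_mult; [|apply (hol_rcont M (fun u => (1 / 2, u))); [apply HM|apply rcont_vline]].
  apply (hol_rcont zeta (fun u => (1 / 2, u))); [|apply rcont_vline]. apply zeta_hol; [exact Hz|apply Im_pos_neq_1, Hu].
Qed.
Lemma cont_fm_wq M av t u : (forall s, hol M s) -> 0 < u -> continuous (fun u => fm M u * wq av (t - u)) u.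
Proof.
  intros HM Hu. apply (continuous_mult (K := R_AbsRing)); [apply cont_fm; assumption|].
  apply (continuous_comp (fun u => t - u) (wq av)); [|apply cont_wq]. cont_derive.
Qed.
Lemma window_integral M av t X T : (forall s, hol M s) -> 0 < T -> 0 <= X -> T <= t - X -> t + X <= 2 * T ->
  RInt (fun x => Cmod (1 - Gz zeta t M (x, 0))%C ^ 2 * wq av x) (- X) X <= RInt (fun u => fm M u * wq av (t - u)) T (2 * T).
Proof.
  intros HM HT HX H1 H2. set (g := fun u => fm M u * wq av (t - u)).
  assert (Cg : forall u, 0 < u -> continuous g u) by (intros; apply cont_fm_wq; assumption).
  assert (EX : forall x y, T <= x -> x <= y -> ex_RInt g x y) by (intros; apply ex_RInt_cont; [lra|intros; apply Cg; lra]).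
  assert (P0 : forall x y, T <= x -> x <= y -> 0 <= RInt g x y).
  { intros. apply RInt_ge_0; [lra|apply EX; lra|]. intros u _. apply Rmult_le_pos; [apply pow2_ge_0|left; apply wq_pos]. }
  assert (E : RInt (fun x => Cmod (1 - Gz zeta t M (x, 0))%C ^ 2 * wq av x) (- X) X = RInt g (t - X) (t + X)).
  { pose proof (RInt_comp_lin (V := RC) g (-1) t (- X) X) as Q.
    replace (-1 * - X + t) with (t + X) in Q by ring. replace (-1 * X + t) with (t - X) in Q by ring.
    specialize (Q ltac:(apply ex_RInt_swap, EX; lra)). rewrite <- (opp_RInt_swap (V := RC) g) in Q by (apply EX; lra).
    apply (f_equal Ropp) in Q. etransitivity; [|etransitivity; [exact Q|apply Ropp_involutive]].
    assert (Eq : forall F : R -> R, ex_RInt F (- X) X -> RInt F (- X) X = - RInt (fun x => - F x) (- X) X).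
    { intros F HF. pose proof (RInt_opp (V := RC) F _ _ HF) as O. apply (f_equal Ropp) in O.
      etransitivity; [symmetry; apply Ropp_involutive|symmetry; exact O]. } rewrite Eq.
    - f_equal. apply RInt_ext. intros x _. unfold g, fm, Gz, spt, scal; simpl; unfold mult; simpl.
      rewrite Rplus_0_r. replace (t - (-1 * x + t)) with x by ring. replace (-1 * x + t) with (t - x) by ring. ring.
    - apply ex_RInt_cont; [lra|]. intros x Hx. apply (continuous_mult (K := R_AbsRing)); [|apply cont_wq].
      apply (rcont_Cmod2 (fun x => 1 - Gz zeta t M (x, 0))%C), rcont_minus; [apply rcont_const|].
      apply (hol_rcont (Gz zeta t M) (fun x => (x, 0))); [apply hol_Gz; [exact Hz|exact HM|simpl; lra]|apply rcont_hline]. }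
  rewrite E.
  rewrite <- (RInt_Chasles (V := RC) g T (t - X) (2 * T)), <- (RInt_Chasles (V := RC) g (t - X) (t + X) (2 * T))
    by (apply EX; lra). unfold plus; simpl.
  pose proof (P0 T (t - X) ltac:(lra) ltac:(lra)). pose proof (P0 (t + X) (2 * T) ltac:(lra) ltac:(lra)). lra.
Qed.

Definition winsum (av w t : R) (S : list C) : R :=
  lsum (fun rho => if Rle_dec (Rabs (t - snd rho)) w then wq av (t - snd rho) else 0) S.

(** [local_bound] around [1 / 2 + i t] with [Y = l ^ 2], [X = l ^ 4], [iota = e],
    [B1 = (1 + theta) * (1 + e) * l], [eta = e * l], and the fraction [1 - e] of the spacing. Only
    zeros with ordinates within [kappa * l ^ 2] of [t] are counted: this keeps [phi] bounded at
    them, so that they lie low enough under [w]. *)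
Lemma pointwise Kz T K1 a S t : let l := ln T in let av := PI / (2 * l ^ 2) in
  0 < T -> 0 < Kz -> (forall s : C, 1 <= snd s -> - L <= fst s -> Cmod (zeta s) <= Kz * exp ((1 + L) * ln (snd s))) ->
  big Kz l -> 1 <= K1 -> (forall n, (1 <= n)%nat -> Cmod (a n) <= K1 * INR n) -> a 1%nat = RtoC 1 ->
  zero_set zeta T S -> well_spaced (2 * PI * A / l) S -> T + l ^ 4 <= t <= 2 * T - l ^ 4 ->
  2 * PI * ((1 - e) * winsum av (kappa * l ^ 2) t S) <=
   (1 + 2 * e) * (l * D) * ((1 + e) * RInt (fun u => fm (dirichlet_poly a (Rpower T theta)) u * wq av (t - u)) T (2 * T))
   + K1 ^ 2 * exp (- (3 * l)).
Proof.
  intros l av HT HKz Hgrow Hbig HK1 Hco Ha1 [HND HS] Hws Ht.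
  pose proof Hbig as (B0 & B1 & B2 & B3 & B4 & B5 & B6 & B7 & B8 & B9 & B10 & B11 & B12).
  pose proof PI_gt_3 as HPI. pose proof PI_4 as HPI4. destruct L_ge as [L1 L2]. pose proof cE_pos as HcE. pose proof D_gt as HD.
  assert (HTl : T = exp l) by (unfold l; rewrite exp_ln by exact HT; reflexivity).
  assert (HT1 : 1 + l <= T) by (rewrite HTl; apply exp_ge_1x). set (X := l ^ 4) in *. set (Y := l ^ 2).
  assert (HXY : X = Y * Y) by (unfold X, Y; ring). assert (HYl : Y = l * l) by (unfold Y; ring).
  assert (HY : 20 * l <= Y) by (rewrite HYl; mono_r; lra). assert (HX : 20 * Y <= X) by (rewrite HXY; mono_r; lra).
  assert (Hav : av * Y = PI / 2) by (unfold av; fold Y; field; nra).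
  assert (Hav0 : 0 < av) by (unfold av; fold Y; div_pos; lra).
  assert (HaX : av * X = PI / 2 * Y) by (rewrite HXY, <- Rmult_assoc, Hav; ring).
  assert (Have : av * l <= 2 / 5 * e /\ av <= 1 / 100).
  { assert (Q : av * l * l = PI / 2) by (rewrite Rmult_assoc, <- HYl; exact Hav).
    assert (25 <= e * l) by (apply (Rmult_le_compat_l e) in B6; [replace (e * (25 / e)) with 25 in B6 by (field; lra); lra|lra]).
    assert (av * l <= 2 / 5 * e) by (apply (Rmult_le_reg_r l); [lra|]; rewrite Q; lra).
    split; [assumption|]. apply (Rmult_le_reg_r l); lra. }
  set (de0 := 2 * PI * A / l) in *. assert (Hde0 : 0 < de0) by (div_pos; [mul_pos|]; lra).
  set (p := fun rho : C => if Rle_dec (Rabs (t - snd rho)) (kappa * Y) then true else false).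
  assert (Hwin : winsum av (kappa * Y) t S = lsum (fun rho => wq av (t - snd rho)) (filter p S)).
  { rewrite <- lsum_filter. apply lsum_ext. intros rho _. unfold p. destruct Rle_dec; reflexivity. }
  rewrite Hwin. clear Hwin.
  assert (HF : forall rho, In rho (filter p S) -> zeta rho = RtoC 0 /\ 0 < snd rho /\ Rabs (t - snd rho) <= kappa * Y).
  { intros rho Hr. apply filter_In in Hr. destruct Hr as [R1 R2]. destruct (HS rho R1) as [Z1 Z2]. unfold Im in Z2.
    split; [exact Z1|split; [lra|]]. unfold p in R2. destruct Rle_dec as [Q|Q]; [exact Q|discriminate]. }
  destruct (sort_spaced de0 (length (filter p S)) Hde0 (filter p S) eq_refl (NoDup_filter _ HND) (well_spaced_filter _ p _ Hws)) as (l' & P & Hsort).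
  assert (Hcount : INR (length (filter p S)) <= kappa / (PI * A) * l ^ 3 + 1).
  { replace (kappa / (PI * A) * l ^ 3) with (2 * kappa * Y / de0) by (unfold de0; rewrite HYl; field; lra).
    apply (count_spaced de0 _ (t - kappa * Y)); [exact Hde0|apply Rmult_le_pos; lra|apply NoDup_filter, HND|apply well_spaced_filter, Hws|].
    intros rho Hr. destruct (HF rho Hr) as (_ & _ & Q). apply Rabs_le_between in Q. lra. }
  assert (Hlen : length l' = length (filter p S)) by (symmetry; apply Permutation_length, P).
  set (n := length (filter p S)) in *. rewrite (lsum_perm _ _ _ P), (lsum_nth _ l' 0%C), Hlen.
  assert (HFn : forall i, (i < n)%nat -> zeta (nth i l' 0%C) = RtoC 0 /\ 0 < snd (nth i l' 0%C) /\ Rabs (t - snd (nth i l' 0%C)) <= kappa * Y).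
  { intros i Hi. apply HF. eapply Permutation_in; [symmetry; exact P|]. apply nth_In. lia. }
  set (la := fun i => t - snd (nth i l' 0%C)). set (al := fun i => alpha (nth i l' 0%C)).
  set (M := dirichlet_poly a (Rpower T theta)). assert (HM : forall s, hol M s) by (intros; apply hol_dirichlet_poly).
  assert (Hal : forall i, (i < n)%nat -> 0 <= al i <= 5 / 2) by (intros i Hi; destruct (HFn i Hi) as (Z1 & Z2 & _); apply (alpha_bound zeta); assumption).
  assert (Hx : Rpower T theta = exp (theta * l)) by reflexivity.
  assert (Hx1 : 1 <= Rpower T theta) by (rewrite Hx, <- exp_0; apply exp_le, Rmult_le_pos; lra).
  assert (Hlx : ln (Rpower T theta) = theta * l) by (rewrite Hx; apply ln_exp). set (H := K1 * exp (h * l)).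
  assert (Hsin : 0 < sin e) by (apply sin_gt_0; lra). assert (HYL : L + 4 <= Y) by lra.
  assert (HkX : kappa * Y <= X / 4) by (rewrite HXY; assert (4 * kappa <= Y) by lra; nra).
  (* The shifts are of order [1 / l ^ 2] and the spacing of order [1 / l], so the fraction [e] of
     the spacing covers them. *)
  assert (Hsp : (1 - e) * de0 + 2 * (av * (25 / 4)) <= de0).
  { assert (Q : 25 / 8 / l <= e * A).
    { apply (Rmult_le_reg_r l); [lra|]. replace (25 / 8 / l * l) with (25 / 8) by (field; lra).
      apply (Rmult_le_compat_l (e * A)) in B5; [|apply Rmult_le_pos; lra]. replace (e * A * (25 / (8 * (e * A)))) with (25 / 8) in B5 by (field; lra). exact B5. }
    unfold av, de0. fold Y. rewrite HYl.
    assert (Q2 : PI * 2 / l * (25 / 8 / l) <= PI * 2 / l * (e * A)) by (mono_l; [apply Rlt_le, Rdiv_lt_0_compat; lra|exact Q]).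
    replace (2 * (PI / (2 * (l * l)) * (25 / 4))) with (PI * 2 / l * (25 / 8 / l)) by (field; lra).
    replace (2 * PI * A / l) with (PI * 2 / l * A) by (field; lra). lra. }
  assert (Hnn : forall i j, (i < n)%nat -> (j < n)%nat -> ((1 - e) * de0 + 2 * (av * (25 / 4))) * Rabs (INR i - INR j) <= Rabs (la i - la j)).
  { intros i j Hi Hj. step_le; [mono_r; [apply Rabs_pos|exact Hsp]|]. unfold la.
    destruct (Nat.lt_total i j) as [Q|[<-|Q]]; [|rewrite !Rminus_diag, Rabs_R0; lra|].
    - pose proof (Hsort i j Q Hj) as W. apply lt_INR in Q. rewrite Rabs_left1 by lra. rewrite Rabs_pos_eq by nra. lra.
    - pose proof (Hsort j i Q Hi) as W. apply lt_INR in Q. rewrite Rabs_pos_eq by lra. rewrite Rabs_left1 by nra. lra. }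
  (* [av * la i] is at most the constant [kappa * (PI / 2)], while [av * al i] is of order
     [1 / l ^ 2]. *)
  assert (Him : forall i, (i < n)%nat -> exp (av * la i) * sin (av * al i) <= 2 * sin e).
  { intros i Hi. destruct (Hal i Hi) as [Q1 Q2]. destruct (HFn i Hi) as (_ & _ & Q3). fold (la i) in Q3. apply Rabs_le_between in Q3.
    apply Rle_trans with (exp (kappa * (PI / 2)) * (av * (5 / 2))).
    - apply Rle_trans with (exp (av * la i) * (av * al i)).
      + mono_l; [left; apply exp_pos|apply sin_le_id, Rmult_le_pos; lra].
      + apply Rmult_le_compat; [left; apply exp_pos|apply Rmult_le_pos; lra| |mono_l; lra].
        apply exp_le. rewrite <- Hav. replace (kappa * (av * Y)) with (av * (kappa * Y)) by ring. mono_l; lra.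
    - apply Rle_trans with (exp (kappa * (PI / 2)) * (PI * 5 / 4) / l).
      + replace (av * (5 / 2)) with (PI * 5 / 4 / Y) by (unfold av; fold Y; field; lra). 
        apply Rle_trans with (exp (kappa * (PI / 2)) * (PI * 5 / 4) * / Y); [right; unfold Rdiv; ring|].
        mono_l; [apply Rmult_le_pos; [left; apply exp_pos|lra]|apply Rinv_le_contravar; lra].
      + apply (Rmult_le_reg_r l); [lra|]. apply (Rmult_le_compat_l (2 * sin e)) in B4; [|lra].
        unfold Rdiv in *. rewrite Rmult_assoc, Rinv_l by lra.
        replace (2 * sin e * (exp (kappa * (PI * / 2)) * (PI * 5 * / 4) * / (2 * sin e))) with (exp (kappa * (PI * / 2)) * (PI * 5 * / 4)) in B4 by (field; lra). lra. }
  (* The exponents [2 + L] from zeta, one unit of it paying for constants, and [theta * (2 + L)]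
     from the polynomial add up to [h]. *)
  assert (HH : forall z : C, - X <= fst z <= X -> - L <= snd z <= 2 * Y -> Cmod (Gz zeta t M z) <= H).
  { intros z Z1 Z2. unfold Gz. rewrite Cmod_mult. assert (E1 : Cmod (zeta (spt t z)) <= exp l * exp ((1 + L) * l)).
    { step_le; [apply Hgrow; unfold spt; simpl; lra|]. assert (Q : ln (snd (spt t z)) <= 1 + l).
      { apply Rle_trans with (ln (2 * T)); [apply ln_le; unfold spt; simpl; lra|]. rewrite ln_mult by lra. fold l.
        pose proof (exp_ge_1x 1). assert (ln 2 <= 1) by (rewrite <- (ln_exp 1); apply ln_le; lra). lra. }
      apply Rle_trans with (Kz * exp ((1 + L) * (1 + l))); [mono_l; [lra|apply exp_le, Rmult_le_compat_l; lra]|].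
      replace ((1 + L) * (1 + l)) with ((1 + L) + (1 + L) * l) by ring. rewrite exp_plus, <- Rmult_assoc.
      mono_r; [left; apply exp_pos|apply exp_const, B7]. }
    assert (E2 : Cmod (M (spt t z)) <= K1 * (exp (theta * l) * exp ((1 + L) * (theta * l)))).
    { rewrite <- Hx, <- Hlx. apply dirichlet_poly_bound; [exact Hx1|lra|exact Hco|lra|unfold spt; simpl; lra]. }
    apply Rle_trans with ((exp l * exp ((1 + L) * l)) * (K1 * (exp (theta * l) * exp ((1 + L) * (theta * l))))).
    - apply Rmult_le_compat; try apply Cmod_ge_0; assumption.
    - right. unfold H. replace (h * l) with (l + (1 + L) * l + (theta * l + (1 + L) * (theta * l))) by (unfold h; ring). rewrite !exp_plus. ring. }
  (* On the upper edge [Re s = 1 / 2 + 2 * l ^ 2]; zeta and the polynomial differ from 1 by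
     [O(2 ^ (- Re s))], the latter up to a factor [K1 * T ^ theta], and [2 * ln 2 >= 1]. *)
  assert (Het : forall x, - X <= x <= X -> Cmod (1 - Gz zeta t M (x, 2 * Y)%R) <= 14 * K1 * exp (theta * l - l ^ 2)).
  { intros x Hx'. set (s := spt t (x, 2 * Y)). assert (Hs : fst s = 1 / 2 + 2 * Y) by reflexivity.
    assert (Hln2 : 1 / 2 <= ln 2).
    { rewrite <- (ln_exp (1 / 2)). apply ln_le; [apply exp_pos|]. pose proof exp_le_3 as E3.
      assert (Q : exp (1 / 2) * exp (1 / 2) = exp 1) by (rewrite <- exp_plus; f_equal; field).
      destruct (Rle_dec (exp (1 / 2)) 2) as [Q0|Q0]; [exact Q0|]. assert (2 * 2 <= exp (1 / 2) * exp (1 / 2)) by (apply Rmult_le_compat; lra). lra. }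
    pose proof (zeta_right zeta s Hz ltac:(lra)) as Zr.
    pose proof (dirichlet_poly_near_1 a K1 _ Hx1 ltac:(lra) Hco s Ha1 ltac:(lra)) as Mr. fold M in Mr.
    assert (Q1 : exp (- fst s * ln 2) <= exp (- Y)).
    { apply exp_le. rewrite Hs. assert ((1 / 2 + 2 * Y) * (1 / 2) <= (1 / 2 + 2 * Y) * ln 2) by (mono_l; lra). lra. }
    assert (Q2 : exp ((1 - fst s) * ln 2) <= 2 * exp (- Y)).
    { replace ((1 - fst s) * ln 2) with (ln 2 + - fst s * ln 2) by ring. rewrite exp_plus, exp_ln by lra. lra. }
    assert (Q3 : exp (- Y) <= 1) by (rewrite <- exp_0; apply exp_le; lra).
    unfold Gz. fold s. replace (1 - zeta s * M s)%C with (- (zeta s - 1) - zeta s * (M s - 1))%C by ring.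
    step_le; [apply Cmod_triangle_minus|]. rewrite Cmod_opp, Cmod_mult. assert (Zb : Cmod (zeta s) <= 5).
    { replace (zeta s) with ((zeta s - 1) + 1)%C by ring. step_le; [apply Cmod_triangle|]. rewrite Cmod_1. lra. }
    unfold Rminus at 1. fold Y. rewrite exp_plus, <- Hx.
    set (x0 := Rpower T theta) in *. pose proof (exp_pos (- Y)) as PY.
    assert (Mr2 : Cmod (M s - 1) <= K1 * (x0 * (2 * exp (- Y)))).
    { step_le; [exact Mr|]. mono_l; [lra|]. mono_l; lra. }
    assert (Q5 : Cmod (zeta s) * Cmod (M s - 1) <= 5 * (K1 * (x0 * (2 * exp (- Y))))) by (apply Rmult_le_compat; try apply Cmod_ge_0; assumption).
    assert (1 * exp (- Y) <= (K1 * x0) * exp (- Y)) by (assert (1 * 1 <= K1 * x0) by (apply Rmult_le_compat; lra); mono_r; lra). lra. }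
  pose proof (local_bound av Y X L e ((1 + theta) * (1 + e) * l) (e * l) H (14 * K1 * exp (theta * l - l ^ 2)) ((1 - e) * de0) n la al (Gz zeta t M) Hav0 Hav) as LB.
  specialize (LB ltac:(rewrite HaX; assert (1 * Y <= PI / 2 * Y) by (mono_r; lra); lra) ltac:(lra) ltac:(lra) HYL ltac:(lra) ltac:(repeat mul_pos; lra)
    ltac:(mul_pos; lra) ltac:(mul_pos; lra) ltac:(lra) ltac:(lra) Hal).
  specialize (LB ltac:(intros i Hi; destruct (HFn i Hi) as (_ & _ & Q); unfold la; lra) Him Hnn).
  specialize (LB ltac:(intros z [Z1 _]; apply hol_Gz; [exact Hz|exact HM|lra])).
  specialize (LB ltac:(intros i Hi; destruct (HFn i Hi) as (Z1 & Z2 & _); destruct (Gz_divides zeta t M Hz HM _ Z1 Z2) as (g & G1 & G2);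
     exists g; split; [exact G1|intros z _; apply G2])). specialize (LB HH Het).
  set (W := (1 + theta) * (1 + e) * l + e * l + 2 * PI / ((1 - e) * de0)) in *.
  (* [W] adds the band length, about [(1 + theta) * l], to [2 * PI / de], about [l / A]; the small
     parameter [e] inflates the total by at most [1 + 2 * e]. *)
  assert (HW : 0 < W <= (1 + 2 * e) * (l * D)).
  { assert (E1 : 2 * PI / ((1 - e) * de0) = l / A * / (1 - e)) by (unfold de0; field; repeat split; lra).
    assert (E2 : / (1 - e) <= 1 + 2 * e).
    { apply (Rmult_le_reg_r (1 - e)); [lra|]. rewrite Rinv_l by lra.
      assert (e * e <= / 2 * e) by (mono_r; lra). lra. }
    assert (E3 : 0 < l / A) by (div_pos; lra). assert (0 < / (1 - e)) by (apply Rinv_0_lt_compat; lra).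
    unfold W. rewrite E1. split; [assert (0 < l / A * / (1 - e)) by (mul_pos; lra);
      assert (0 < (1 + theta) * (1 + e) * l) by (repeat mul_pos; lra); assert (0 < e * l) by (mul_pos; lra); lra|].
    assert (l / A * / (1 - e) <= l / A * (1 + 2 * e)) by (mono_l; lra).
    replace ((1 + 2 * e) * (l * D)) with ((1 + 2 * e) * (l * (1 + theta)) + l / A * (1 + 2 * e)) by (unfold D, clog; field; lra).
    assert (0 <= e * l * theta) by (repeat apply Rmult_le_pos; lra). lra. }
  (* About [kappa / (PI * A) * l ^ 3] zeros cost at most [av * (5 / 2)] each, with
     [av = PI / (2 * l ^ 2)]: this is the origin of [3 * kappa / A] in [cE]. *)
  assert (Hs : 0 <= rs (fun i => av * al i) n /\ 2 * rs (fun i => av * al i) n <= cE * l).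
  { split; [apply rs_nonneg; intros i Hi; destruct (Hal i Hi); apply Rmult_le_pos; lra|].
    assert (Q : rs (fun i => av * al i) n <= INR n * (av * (5 / 2))).
    { rewrite <- rs_const. apply rs_le. intros i Hi. destruct (Hal i Hi). mono_l; lra. }
    apply Rle_trans with (5 * (av * (kappa / (PI * A) * l ^ 3 + 1))).
    - apply Rle_trans with (5 * (av * INR n)); [lra|]. mono_l; [lra|]. mono_l; lra.
    - assert (E1 : av * (kappa / (PI * A) * l ^ 3) = kappa / (2 * A) * l) by (unfold av; field; lra).
      rewrite Rmult_plus_distr_l, E1, Rmult_1_r. unfold cE.
      replace ((3 * kappa / A + 1) * l) with (5 * (kappa / (2 * A) * l) + (kappa / (2 * A) * l + l)) by (field; lra).
      assert (0 < kappa / (2 * A) * l) by (mul_pos; [div_pos|]; lra). lra. }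
  pose proof (errors_small Kz l K1 n (rs (fun i => av * al i) n) W Hbig HK1 Hcount (proj1 Hs) (proj2 Hs)) as ES.
  specialize (ES ltac:(split; [lra|]; step_le; [apply HW|]; assert (0 < l * D) by (mul_pos; lra); apply Rle_trans with (2 * (l * D)); [mono_r; lra|lra])). cbv zeta in ES.
  pose proof (window_integral M av t X T HM HT ltac:(lra) ltac:(lra) ltac:(lra)) as WI.
  set (I0 := RInt (fun x => Cmod (1 - Gz zeta t M (x, 0))%C ^ 2 * wq av x) (- X) X) in *.
  set (I1 := RInt (fun u => fm M u * wq av (t - u)) T (2 * T)) in *. assert (HI0 : 0 <= I0).
  { apply RInt_ge_0; [lra| |intros; apply Rmult_le_pos; [apply pow2_ge_0|left; apply wq_pos]].
    apply ex_RInt_cont; [lra|]. intros x Hx'. apply (continuous_mult (K := R_AbsRing)); [|apply cont_wq].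
    apply (rcont_Cmod2 (fun x => 1 - Gz zeta t M (x, 0))%C), rcont_minus; [apply rcont_const|].
    apply (hol_rcont (Gz zeta t M) (fun x => (x, 0))); [apply hol_Gz; [exact Hz|exact HM|simpl; lra]|apply rcont_hline]. }
  assert (Hc : 2 / (1 + cos e) <= 1 + e).
  { pose proof (cos_ge_quad e ltac:(lra)) as C0. assert (Q : e ^ 2 <= e * (1 / 2)) by (simpl; rewrite Rmult_1_r; mono_l; lra).
    apply (Rmult_le_reg_r (1 + cos e)); [lra|]. unfold Rdiv. rewrite Rmult_assoc, Rinv_l by lra.
    apply Rle_trans with ((1 + e) * (2 - e / 4)); [lra|mono_l; lra]. }
  assert (Hex : 1 - e <= exp (- (av * (av * (25 / 4))))).
  { pose proof (exp_ge_1x (- (av * (av * (25 / 4))))). assert (Q : av * (av * (25 / 4)) <= av * (l / 4)) by (mono_l; lra). lra. }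
  assert (HS0 : 0 <= rs (fun i => wq av (la i)) n) by (apply rs_nonneg; intros; left; apply wq_pos).
  assert (F1 : (1 - e) * rs (fun i => wq av (la i)) n <= exp (- (av * (av * (25 / 4)))) * rs (fun i => wq av (la i)) n)
    by (mono_r; assumption). assert (F2 : W * (2 / (1 + cos e) * I0) <= (1 + 2 * e) * (l * D) * ((1 + e) * I1)).
  { assert (0 < 2 / (1 + cos e)) by (assert (0 < cos e) by (apply cos_gt_0; lra); div_pos; lra).
    apply Rmult_le_compat; [lra|apply Rmult_le_pos; lra|apply HW|apply Rmult_le_compat; lra]. }
  rewrite Rmult_plus_distr_l in LB.
  change (rs (fun i : nat => wq av (t - snd (nth i l' 0%C))) n) with (rs (fun i => wq av (la i)) n).
  apply (Rmult_le_compat_l (2 * PI)) in F1; [|lra].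
  step_le; [exact F1|]. step_le; [exact LB|]. rewrite Rplus_assoc. apply Rplus_le_compat; [exact F2|exact ES].
Qed.
End Pointwise.

(** * Averaging over the height *)

(** A primitive of [wq a], rising from [- (4 / a)] to 0; the total mass of the weight is [4 / a]. *)
Definition wqi (a x : R) : R := - (4 / a) / (1 + exp (a * x)).

(** Over a unit step the weight changes by a factor at most [exp a], so a sample agrees with the
    increment of the primitive up to that factor. *)
Lemma wqi_step a x : 0 < a -> exp (- a) * (wqi a (x + 1) - wqi a x) <= wq a x /\ exp (- a) * wq a x <= wqi a (x + 1) - wqi a x.
Proof.
  intros Ha. assert (Hd : forall y, is_derive (wqi a) y (wq a y)).
  { intros y. unfold wqi, wq. pose proof (exp_pos (a * y)). auto_derive; [lra|]. field. lra. }
  destruct (MVT_gen (wqi a) x (x + 1) (wq a)) as (c & Hc & E).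
  - intros y _. apply Hd.
  - intros y _. apply continuity_pt_filterlim, (ex_derive_continuous (V := RN)). eexists; apply Hd.
  - rewrite Rmin_left, Rmax_right in Hc by lra. replace (x + 1 - x) with 1 in E by ring. rewrite E, Rmult_1_r.
    assert (M : forall d, Rabs d <= 1 -> exp (- a) <= exp (- (a * Rabs d))) by (intros d Hd'; apply exp_le; nra).
    split.
    + replace x with (c + (x - c)) by ring. step_le; [|apply wq_shift, Ha].
      mono_r; [left; apply wq_pos|]. apply M. apply Rabs_le_between. lra.
    + replace c with (x + (c - x)) by ring. step_le; [|apply wq_shift, Ha].
      mono_r; [left; apply wq_pos|]. apply M. apply Rabs_le_between. lra.
Qed.
Lemma wqi_range a x : 0 < a -> - (4 / a) <= wqi a x <= 0.
Proof.
  intros Ha. unfold wqi. pose proof (exp_pos (a * x)). assert (H4 : 0 < 4 / a) by (div_pos; lra).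
  assert (0 < / (1 + exp (a * x)) <= 1).
  { split; [apply Rinv_0_lt_compat; lra|]. apply Rle_trans with (/ 1); [|rewrite Rinv_1; lra]. apply Rinv_le_contravar; lra. }
  replace (- (4 / a) / (1 + exp (a * x))) with (- (4 / a) * / (1 + exp (a * x))) by reflexivity. nra.
Qed.
Lemma wq_sum a x N : 0 < a -> exp (- a) * rs (fun k => wq a (x + INR k)) N <= wqi a (x + INR N) - wqi a x /\
  exp (- a) * (wqi a (x + INR N) - wqi a x) <= rs (fun k => wq a (x + INR k)) N.
Proof.
  intros Ha. induction N as [|N [I1 I2]]; [simpl; rewrite Rplus_0_r; lra|].
  destruct (wqi_step a (x + INR N) Ha) as [S1 S2]. rewrite S_INR. simpl rs.
  replace (x + (INR N + 1)) with (x + INR N + 1) by ring. split; lra.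
Qed.

Lemma wqi_low a w : 0 < a -> wqi a (- w) <= - (4 / a) * (1 - exp (- (a * w))) /\ - (4 / a) * exp (- (a * w)) <= wqi a w.
Proof.
  intros Ha. assert (H4 : 0 < 4 / a) by (div_pos; lra). unfold wqi.
  set (E := exp (- (a * w))). assert (HE : 0 < E) by apply exp_pos.
  replace (exp (a * - w)) with E by (unfold E; f_equal; ring).
  replace (exp (a * w)) with (/ E) by (unfold E; rewrite <- exp_Ropp; f_equal; ring).
  split; unfold Rdiv; rewrite <- ?Ropp_mult_distr_l; apply Ropp_le_contravar, Rmult_le_compat_l; try (unfold Rdiv in H4; lra).
  - apply (Rmult_le_reg_r (1 + E)); [lra|]. rewrite Rinv_l by lra. nra.
  - replace (/ (1 + / E)) with (E * / (1 + E)) by (field; lra). assert (/ (1 + E) <= 1); [|nra].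
    rewrite <- Rinv_1. apply Rinv_le_contravar; lra.
Qed.

Lemma wqi_mono a x y : 0 < a -> x <= y -> wqi a x <= wqi a y.
Proof.
  intros Ha Hxy. unfold wqi, Rdiv. rewrite <- !Ropp_mult_distr_l. apply Ropp_le_contravar, Rmult_le_compat_l.
  - apply Rlt_le, Rmult_lt_0_compat; [lra|apply Rinv_0_lt_compat, Ha].
  - pose proof (exp_pos (a * x)). apply Rinv_le_contravar; [lra|]. apply Rplus_le_compat_l, exp_le. nra.
Qed.

Lemma rs_sub f N j m : (j + m <= N)%nat -> (forall k, 0 <= f k) -> rs (fun i => f (j + i)%nat) m <= rs f N.
Proof.
  intros H Hf. apply Rle_trans with (rs f (j + m)).
  - clear H. induction m as [|m IH]; [simpl; rewrite Nat.add_0_r; apply rs_nonneg; auto|]. rewrite Nat.add_succ_r. simpl. lra.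
  - induction H as [|N H IH]; [lra|]. simpl. specialize (Hf N). lra.
Qed.

Lemma nat_floor x : 0 <= x -> exists n, INR n <= x < INR n + 1.
Proof.
  intros Hx. destruct (base_Int_part x) as [H1 H2]. exists (Z.to_nat (Int_part x)). assert (P : (0 <= Int_part x)%Z).
  { destruct (Z.lt_ge_cases (Int_part x) 0) as [H|H]; [|exact H]. assert (H0 : (Int_part x <= -1)%Z) by lia. apply IZR_le in H0. lra. }
  rewrite INR_IZR_INZ, Z2Nat.id by exact P. lra.
Qed.

(** Sampling [t] at unit steps: the weights seen by one zero telescope, and so do those seen by one point of the integral. *)
Lemma window_sum_lower a w t0 N g : 0 < a -> 2 <= w -> t0 + w <= g -> g + w + 1 <= t0 + INR N ->
  exp (- a) * (4 / a * (1 - 2 * exp (- (a * (w - 2))))) <=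
    rs (fun k => if Rle_dec (Rabs (t0 + INR k - g)) w then wq a (t0 + INR k - g) else 0) N.
Proof.
  (* Starting from the first sample above [g - w], about [2 * w - 1] samples stay in the window.
     Relative to [g] they begin below [- (w - 2)] and run past [w - 2], which is the origin of
     [w - 2] in the bound. *)
  intros Ha Hw Hg1 Hg2. destruct (nat_floor (g - w - t0) ltac:(lra)) as [j0 Hj0]. set (j := S j0).
  assert (Hj : INR j = INR j0 + 1) by apply S_INR. destruct (nat_floor (2 * w - 1) ltac:(lra)) as [m Hm].
  set (x0 := t0 + INR j - g). assert (Hx0 : - w <= x0 <= - w + 1) by (unfold x0; lra).
  set (f := fun k => if Rle_dec (Rabs (t0 + INR k - g)) w then wq a (t0 + INR k - g) else 0).
  apply Rle_trans with (rs (fun i => f (j + i)%nat) m).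
  - rewrite (rs_ext _ (fun i => wq a (x0 + INR i))).
    + destruct (wq_sum a x0 m Ha) as [_ S2]. step_le; [|exact S2]. mono_l; [left; apply exp_pos|].
      pose proof (wqi_mono a x0 (- (w - 2)) Ha ltac:(lra)) as M1. pose proof (wqi_mono a (w - 2) (x0 + INR m) Ha ltac:(lra)) as M2.
      destruct (wqi_low a (w - 2) Ha) as [W1 W2]. lra.
    + intros i Hi. unfold f. rewrite plus_INR. replace (t0 + (INR j + INR i) - g) with (x0 + INR i) by (unfold x0; ring).
      destruct Rle_dec as [Q|Q]; [reflexivity|]. exfalso. apply Q. apply Rabs_le_between. pose proof (pos_INR i).
      assert (INR i + 1 <= INR m) by (rewrite <- S_INR; apply le_INR; lia). lra.
  - apply (rs_sub f).
    + apply INR_le. rewrite plus_INR. lra.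
    + intros k. unfold f. destruct Rle_dec; [left; apply wq_pos|lra].
Qed.

Lemma length_filter_lsum (p : C -> bool) l : INR (length (filter p l)) = lsum (fun x => if p x then 1 else 0) l.
Proof. rewrite (lsum_filter p (fun _ => 1)), lsum_const. ring. Qed.

Definition rltb (x y : R) : bool := if Rlt_dec x y then true else false.

(** The pointwise bound is summed over [t] at unit steps. A zero away from the ends of [[T, 2 * T]]
    receives nearly the full mass [4 / a], a point [u] of the integral at most [exp a * (4 / a)];
    dividing by [4 / a] leaves the number of zeros against the unweighted integral. *)
Lemma average_bound (fr : R -> R) a w T X (S : list C) c1 c2 c3 d N : 0 < a -> 2 <= w -> 0 < d -> 0 <= X -> 0 < T ->
  0 <= c1 -> 0 <= c2 -> 0 <= c3 -> 2 * exp (- (a * (w - 2))) <= 1 ->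
  (forall u, T <= u <= 2 * T -> continuous fr u /\ 0 <= fr u) -> INR N <= T - 2 * X < INR N + 1 ->
  (forall t, T + X <= t <= 2 * T - X -> c1 * winsum a w t S <= c2 * RInt (fun u => fr u * wq a (t - u)) T (2 * T) + c3) ->
  NoDup S -> well_spaced d S -> (forall rho, In rho S -> T <= snd rho <= 2 * T) ->
  c1 * (exp (- a) * (1 - 2 * exp (- (a * (w - 2)))) * (INR (length S) - 2 * ((X + w + 2) / d + 1)))
    <= c2 * (exp a * RInt fr T (2 * T)) + c3 * T * (a / 4).
Proof.
  intros Ha Hw Hd HX HT Hc1 Hc2 Hc3 Hex Hfr HN Hpt HND Hws HS.
  set (t0 := T + X). set (lam := exp (- a) * (1 - 2 * exp (- (a * (w - 2))))).
  assert (H4 : 0 < 4 / a) by (div_pos; lra).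
  assert (Hlam : 0 <= lam) by (apply Rmult_le_pos; [left; apply exp_pos|lra]). set (J := RInt fr T (2 * T)).
  assert (Hk : forall k, (k < N)%nat -> T + X <= t0 + INR k <= 2 * T - X).
  { intros k Hk. pose proof (pos_INR k). assert (INR k + 1 <= INR N) by (rewrite <- S_INR; apply le_INR; lia). unfold t0. lra. }
  set (g := fun k u => fr u * wq a (t0 + INR k - u)). assert (Cg : forall k u, T <= u <= 2 * T -> continuous (g k) u).
  { intros k u Hu. apply (continuous_mult (K := R_AbsRing)); [apply Hfr, Hu|].
    apply (continuous_comp (fun u => t0 + INR k - u) (wq a)); [|apply cont_wq]. cont_derive. }
  assert (Eg : forall k, ex_RInt (g k) T (2 * T)) by (intros; apply ex_RInt_cont; [lra|apply Cg]).
  assert (S1 : c1 * rs (fun k => winsum a w (t0 + INR k) S) N <= c2 * rs (fun k => RInt (g k) T (2 * T)) N + INR N * c3).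
  { rewrite <- !rs_scal, <- rs_const, <- rs_plus. apply rs_le. intros k Hk'. apply Hpt, Hk, Hk'. }
  assert (S2 : rs (fun k => RInt (g k) T (2 * T)) N <= exp a * (4 / a) * J).
  { destruct (RInt_rs g N T (2 * T) (fun k _ => Eg k)) as [X1 X2]. rewrite <- X2. unfold J.
    assert (EJ : ex_RInt fr T (2 * T)) by (apply ex_RInt_cont; [lra|intros; apply Hfr; lra]).
    assert (ER : exp a * (4 / a) * RInt fr T (2 * T) = RInt (fun u => exp a * (4 / a) * fr u) T (2 * T))
      by (symmetry; apply (RInt_scal (V := RC) fr), EJ). rewrite ER.
    apply RInt_le; [lra|exact X1|apply (ex_RInt_scal (V := RN)), EJ|]. intros u Hu. unfold g.
    rewrite rs_scal, (Rmult_comm _ (fr u)).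
    mono_l; [apply Hfr; lra|]. rewrite (rs_ext _ (fun k => wq a ((t0 - u) + INR k))) by (intros; f_equal; ring).
    destruct (wq_sum a (t0 - u) N Ha) as [Q _]. pose proof (wqi_range a (t0 - u) Ha). pose proof (wqi_range a (t0 - u + INR N) Ha).
    rewrite exp_Ropp in Q. pose proof (exp_pos a). apply (Rmult_le_reg_l (/ exp a)); [apply Rinv_0_lt_compat; assumption|].
    rewrite <- Rmult_assoc, Rinv_l by lra. lra. }
  (* Zeros within [X + w + 2] of an end may see an incomplete window; being well spaced, they are
     few, and they are discarded. *)
  set (lo := fun rho : C => rltb (snd rho) (t0 + w)). set (hi := fun rho : C => rltb (2 * T - X - w - 2) (snd rho)).
  set (mid := fun rho : C => negb (lo rho || hi rho)).
  assert (S3 : 4 / a * lam * INR (length (filter mid S)) <= rs (fun k => winsum a w (t0 + INR k) S) N).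
  { unfold winsum. rewrite (lsum_rs_swap (fun k rho => if Rle_dec (Rabs (t0 + INR k - snd rho)) w then wq a (t0 + INR k - snd rho) else 0)).
    apply Rle_trans with (lsum (fun rho => if mid rho then 4 / a * lam else 0) S).
    - rewrite (lsum_filter mid (fun _ => 4 / a * lam)), lsum_const. lra.
    - apply lsum_le. intros rho Hr. unfold mid, lo, hi, rltb. destruct (Rlt_dec (snd rho) (t0 + w)) as [Q1|Q1];
        [|destruct (Rlt_dec (2 * T - X - w - 2) (snd rho)) as [Q2|Q2]]; simpl.
      1, 2: apply rs_nonneg; intros; destruct Rle_dec; [left; apply wq_pos|lra].
      replace (4 / a * lam) with (exp (- a) * (4 / a * (1 - 2 * exp (- (a * (w - 2)))))) by (unfold lam; ring).
      apply window_sum_lower; [exact Ha|exact Hw|lra|unfold t0; lra]. }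
  assert (S4 : INR (length S) - 2 * ((X + w + 2) / d + 1) <= INR (length (filter mid S))).
  { assert (P : forall p u, (forall rho, In rho S -> p rho = true -> u <= snd rho <= u + (X + w + 2)) ->
      INR (length (filter p S)) <= (X + w + 2) / d + 1).
    { intros p u Hp. apply (count_spaced d _ u); [exact Hd|lra|apply NoDup_filter, HND|apply well_spaced_filter, Hws|].
      intros rho Hr. apply filter_In in Hr. apply Hp; tauto. }
    pose proof (P lo T) as P1. pose proof (P hi (2 * T - X - w - 2)) as P2.
    assert (P1' : forall rho, In rho S -> lo rho = true -> T <= snd rho <= T + (X + w + 2)).
    { intros rho Hr. unfold lo, rltb. destruct Rlt_dec as [Q|Q]; [|discriminate]. intros _. specialize (HS rho Hr). unfold t0 in Q. lra. }
    assert (P2' : forall rho, In rho S -> hi rho = true -> 2 * T - X - w - 2 <= snd rho <= 2 * T - X - w - 2 + (X + w + 2)).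
    { intros rho Hr. unfold hi, rltb. destruct Rlt_dec as [Q|Q]; [|discriminate]. intros _. specialize (HS rho Hr). lra. }
    specialize (P1 P1'). specialize (P2 P2'). rewrite length_filter_lsum in P1, P2. rewrite length_filter_lsum.
    assert (Q : lsum (fun _ => 1) S <= lsum (fun rho => if lo rho then 1 else 0) S + lsum (fun rho => if hi rho then 1 else 0) S
       + lsum (fun rho => if mid rho then 1 else 0) S).
    { clear. induction S as [|x S IH]; simpl; [lra|]. unfold mid at 1. destruct (lo x), (hi x); simpl; lra. }
    rewrite lsum_const in Q. lra. } apply (Rmult_le_reg_l (4 / a)); [exact H4|].
  apply Rle_trans with (c1 * (4 / a * lam * INR (length (filter mid S)))).
  - replace (4 / a * (c1 * (lam * (INR (length S) - 2 * ((X + w + 2) / d + 1)))))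
      with (c1 * (4 / a * lam * (INR (length S) - 2 * ((X + w + 2) / d + 1)))) by ring.
    mono_l; [exact Hc1|]. mono_l; [apply Rmult_le_pos; lra|exact S4].
  - apply (Rmult_le_compat_l c1) in S3; [|exact Hc1]. apply (Rmult_le_compat_l c2) in S2; [|exact Hc2].
    assert (S5 : INR N * c3 <= T * c3) by (mono_r; lra).
    replace (4 / a * (c2 * (exp a * J) + c3 * T * (a / 4))) with (c2 * (exp a * (4 / a) * J) + T * c3) by (field; lra). lra.
Qed.

Lemma fm_integral_nonneg zeta a x T : is_riemann_zeta zeta -> 0 < T -> 0 <= RInt (fm zeta (dirichlet_poly a x)) T (2 * T).
Proof.
  intros Hz HT. apply RInt_ge_0; [lra| |intros; apply pow2_ge_0].
  apply ex_RInt_cont; [lra|]. intros u Hu. apply cont_fm; [exact Hz|intros; apply hol_dirichlet_poly|lra].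
Qed.

(** The half-width [w = 2 / e * l ^ 2] makes [a * w = PI / e], so the fraction
    [2 * exp (- (a * (w - 2)))] of the weight that falls outside is at most [e]. *)
Lemma eps_window e a l : 0 < e <= 1 / 10 -> 0 < a -> a * l ^ 2 = PI / 2 -> a <= e / 8 ->
  2 * exp (- (a * (2 / e * l ^ 2 - 2))) <= e /\ (1 - e) ^ 2 <= exp (- a) * (1 - 2 * exp (- (a * (2 / e * l ^ 2 - 2)))) /\ exp a <= 1 + e.
Proof.
  intros He Ha Hal Hae. pose proof PI_gt_3 as HPI. assert (H1 : 2 * exp (- (a * (2 / e * l ^ 2 - 2))) <= e).
  { replace (a * (2 / e * l ^ 2 - 2)) with (2 / e * (a * l ^ 2) - 2 * a) by ring. rewrite Hal.
    assert (Hk : 20 <= 2 / e) by (apply (Rmult_le_reg_r e); [lra|]; replace (2 / e * e) with 2 by (field; lra); lra).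
    assert (Q : exp (- (2 / e * (PI / 2) - 2 * a)) <= / exp (2 / e)) by (rewrite <- exp_Ropp; apply exp_le; nra).
    pose proof (exp_ge_1x (2 / e)) as X1. assert (/ exp (2 / e) <= / (2 / e)) by (apply Rinv_le_contravar; lra).
    replace (/ (2 / e)) with (e / 2) in H by (field; lra). lra. }
  split; [exact H1|]. pose proof (exp_ge_1x (- a)) as X1. split.
  - replace ((1 - e) ^ 2) with ((1 - e) * (1 - e)) by ring. apply Rmult_le_compat; lra.
  - assert (E : exp a * exp (- a) = 1) by (rewrite <- exp_plus, Rplus_opp_r; apply exp_0). pose proof (exp_pos a). nra.
Qed.

(** The numerator is at least [1 - 3 * e] and the denominator at most [1 + 5 * e]; the constant 10,
    with room to spare, becomes [C1]. *)
Lemma final_ratio e : 0 < e <= 1 / 10 -> Rabs ((1 - e) ^ 3 / ((1 + 2 * e) * (1 + e) ^ 2) - 1) <= 10 * e.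
Proof.
  intros He. set (b := (1 + 2 * e) * (1 + e) ^ 2). assert (e ^ 2 <= e / 10) by nra. assert (0 <= e ^ 3 <= e / 100) by nra.
  assert (Hb : 1 <= b <= 1 + 5 * e) by (unfold b; nra). assert (H3 : 1 - 3 * e <= (1 - e) ^ 3 <= 1) by nra.
  assert (Q : (1 - e) ^ 3 / b <= 1).
  { apply (Rmult_le_reg_r b); [lra|]. unfold Rdiv. rewrite Rmult_assoc, Rinv_l by lra. lra. }
  assert (Q2 : 1 - 10 * e <= (1 - e) ^ 3 / b).
  { apply (Rmult_le_reg_r b); [lra|]. unfold Rdiv. rewrite Rmult_assoc, Rinv_l by lra. nra. } rewrite Rabs_left1; lra.
Qed.

(** The order of the quantifiers records the dependence of constants: [C1] on zeta alone, [T0] not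
    on the coefficient bounds [K], and [C2] on [K] but not on [T], [S] or [a]. *)
Theorem propositionA : forall zeta : C -> C, is_riemann_zeta zeta -> exists C1 : R,
  forall A eps theta : R, 0 < A -> 0 < eps -> 0 < theta -> exists T0 : R, forall K : R -> R, exists C2 : R,
  forall (T : R) (S : list C) (a : nat -> C), T0 <= T -> zero_set zeta T S -> well_spaced (2 * PI * A / ln T) S ->
    coeff_bound K a -> a 1%nat = RtoC 1 -> exists E1 E2 : R, Rabs E1 <= C1 * eps /\
      Rabs E2 <= C2 * Rpower T (- 1 + eps) /\ mollified_mean_square zeta a theta T >= (1 + E1) / (1 + theta + 1 / A)
          * (INR (length S) / (T / (2 * PI) * ln T)) + E2.
Proof.
  intros zeta Hz. exists 10. intros A e theta HA He0 Hth. destruct (Rle_dec 1 (10 * e)) as [Hbig|Hsmall].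
  (* For [10 * e >= 1] the value [E1 = -1] is admissible and makes the main term 0; [T0 = 1] ensures
     that [T] is positive. *)
  { exists 1. intros K. exists 0. intros T S a HT _ _ _ _. exists (-1), 0.
    split; [rewrite Rabs_left by lra; lra|]. split; [rewrite Rabs_R0; lra|].
    replace (1 + -1) with 0 by ring. unfold Rdiv at 1. rewrite !Rmult_0_l, Rplus_0_r. apply Rle_ge.
    apply Rmult_le_pos; [left; apply Rinv_0_lt_compat; lra|]. apply (fm_integral_nonneg zeta a _ T Hz). lra. }
  assert (He : 0 < e <= 1 / 10) by lra. assert (He2 : 0 < e <= 1 / 2) by lra. set (kappa := 2 / e).
  assert (Hka : 1 <= kappa) by (unfold kappa; apply (Rmult_le_reg_r e); [lra|]; replace (2 / e * e) with 2 by (field; lra); lra).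
  destruct (L_ge A e theta kappa HA He2 Hth Hka) as [HL _]. pose proof (cE_pos A kappa HA Hka) as HcE.
  destruct (zeta_growth zeta ((10 + 2 * theta + (3 * kappa / A + 1)) / e) Hz ltac:(lra)) as (Kz & HKz & Hgrow).
  destruct (big_ev A e theta kappa Kz) as (l0 & Hl0).
  (* [C2] is the error [Q] below with [l ^ 5] replaced by [(5 / e) ^ 5], as
     [l ^ 5 <= (5 / e) ^ 5 * exp (e * l)]. The coefficient bound enters with exponent 1, whence
     [K 1]. *)
  exists (exp l0). intros K. exists (K 1 ^ 2 + 16 + 4 / A * (5 / e) ^ 5). intros T S a HT HS Hws Hco Ha1.
  assert (HT0 : 0 < T) by (pose proof (exp_pos l0); lra).
  set (l := ln T) in *. assert (HTl : T = exp l) by (unfold l; rewrite exp_ln by exact HT0; reflexivity).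
  assert (Hll : l0 <= l) by (unfold l; rewrite <- (ln_exp l0); apply ln_le; [apply exp_pos|exact HT]).
  pose proof (Hl0 l Hll) as HB. pose proof HB as (B0 & B1 & B2 & B3 & _ & _ & B6 & _).
  pose proof PI_gt_3 as HPI. pose proof PI_4 as HPI4.
  assert (HK1 : forall n, (1 <= n)%nat -> Cmod (a n) <= K 1 * INR n).
  { intros n Hn. rewrite <- (Rpower_1 (INR n)) by (apply lt_0_INR; lia). apply Hco; [lra|exact Hn]. }
  assert (HK : 1 <= K 1) by (pose proof (HK1 1%nat (le_n 1)) as Q; rewrite Ha1, Cmod_1 in Q; simpl in Q; lra).
  set (X := l ^ 4). set (w := kappa * l ^ 2). set (av := PI / (2 * l ^ 2)). set (M := dirichlet_poly a (Rpower T theta)).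
  set (D := clog A theta). pose proof (D_gt A theta HA Hth) as HD. fold D in HD.
  assert (Hl2 : l ^ 2 = l * l) by ring. assert (HY : 20 * l <= l ^ 2) by (rewrite Hl2; mono_r; lra).
  assert (HXY : X = l ^ 2 * l ^ 2) by (unfold X; ring). assert (Hav : av * l ^ 2 = PI / 2) by (unfold av; field; lra).
  assert (Hav0 : 0 < av) by (unfold av; div_pos; lra).
  assert (Hel : 25 <= e * l) by (apply (Rmult_le_compat_l e) in B6; [replace (e * (25 / e)) with 25 in B6 by (field; lra); lra|lra]).
  assert (Have : av <= e / 8).
  { apply (Rmult_le_reg_r (l ^ 2)); [lra|]. rewrite Hav, Hl2. assert (25 * l <= e * l * l) by (mono_r; lra). lra. }
  assert (Hw2 : 2 <= w /\ w + 2 <= X).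
  { unfold w. assert (1 * l ^ 2 <= kappa * l ^ 2) by (mono_r; lra).
    assert (kappa * l ^ 2 <= l / 4 * l ^ 2) by (mono_r; lra).
    assert (l * l ^ 2 <= l ^ 2 * l ^ 2) by (mono_r; lra). rewrite HXY. split; [lra|].
    assert (20 * l ^ 2 <= l * l ^ 2) by (mono_r; lra). lra. } assert (HTX : 2 * X <= T).
  { pose proof (pow_le_exp 5 1 l ltac:(lia) ltac:(lra) ltac:(lra)) as P5. rewrite Rmult_1_l, <- HTl in P5.
    replace ((INR 5 / 1) ^ 5) with 3125 in P5 by (simpl; field). replace (l ^ 5) with (l * X) in P5 by (unfold X; ring).
    assert (6250 * X <= l * X) by (mono_r; [rewrite HXY; nra|lra]). lra. }
  destruct (eps_window e av l He Hav0 Hav Have) as (W1 & W2 & W3). fold kappa in W1, W2. fold w in W1, W2.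
  destruct (nat_floor (T - 2 * X) ltac:(lra)) as (N & HN).
  assert (Hd : 0 < 2 * PI * A / l) by (div_pos; [mul_pos; lra|lra]). set (J := RInt (fm zeta M) T (2 * T)).
  assert (HJ : 0 <= J) by (apply fm_integral_nonneg; assumption).
  pose proof (average_bound (fm zeta M) av w T X S (2 * PI * (1 - e)) ((1 + 2 * e) * (l * D) * (1 + e)) (K 1 ^ 2 * exp (- (3 * l)))
    (2 * PI * A / l) N Hav0 (proj1 Hw2) Hd) as AB. fold J in AB. assert (HlD : 0 < l * D) by (mul_pos; lra).
  specialize (AB ltac:(lra) HT0 ltac:(apply Rmult_le_pos; lra) ltac:(repeat apply Rmult_le_pos; lra)
    ltac:(apply Rmult_le_pos; [apply pow2_ge_0|left; apply exp_pos]) ltac:(lra)).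
  specialize (AB ltac:(intros u Hu; split; [apply cont_fm; [exact Hz|intros; apply hol_dirichlet_poly|lra]|apply pow2_ge_0]) HN).
  assert (Hpt : forall t, T + X <= t <= 2 * T - X -> 2 * PI * (1 - e) * winsum av w t S <=
      (1 + 2 * e) * (l * D) * (1 + e) * RInt (fun u => fm zeta M u * wq av (t - u)) T (2 * T) + K 1 ^ 2 * exp (- (3 * l))).
  { intros t Ht.
    pose proof (pointwise zeta A e theta kappa Hz HA He2 Hth Hka Kz T (K 1) a S t HT0 HKz Hgrow HB HK HK1 Ha1 HS Hws Ht) as P.
    rewrite Rmult_assoc, (Rmult_assoc _ (1 + e)). exact P. }
  specialize (AB Hpt (proj1 HS) Hws (fun rho Hr => proj2 (proj2 HS rho Hr))).
  set (R0 := INR (length S)) in *. assert (HR0 : 0 <= R0) by apply pos_INR.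
  set (lam := exp (- av) * (1 - 2 * exp (- (av * (w - 2))))) in *.
  set (b := (1 + 2 * e) * (1 + e) ^ 2). set (Q := K 1 ^ 2 + 16 + 4 / A * l ^ 5). assert (Hlam1 : lam <= 1).
  { unfold lam. assert (exp (- av) <= 1) by (rewrite <- exp_0; apply exp_le; lra). pose proof (exp_pos (- av)).
    pose proof (exp_pos (- (av * (w - 2)))). assert (exp (- av) * (1 - 2 * exp (- (av * (w - 2)))) <= exp (- av) * 1) by (mono_l; lra). lra. }
  assert (HA5 : 0 < 4 / A) by (div_pos; lra). assert (Hl5 : 0 <= l ^ 5) by (apply pow_le; lra).
  (* The zeros discarded at each end number at most [l ^ 5 / (PI * A) + 1], since
     [X + w + 2 <= 2 * X] and the spacing is [2 * PI * A / l]. *)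
  assert (Main : 2 * PI * (1 - e) ^ 3 * R0 <= b * (l * D) * J + Q).
  { assert (M1 : (X + w + 2) / (2 * PI * A / l) + 1 <= l ^ 5 / (PI * A) + 1).
    { apply Rplus_le_compat_r. apply Rle_trans with (2 * X / (2 * PI * A / l)).
      - mono_r; [left; apply Rinv_0_lt_compat, Hd|lra].
      - right. unfold X. field. repeat split; lra. } set (M0 := (X + w + 2) / (2 * PI * A / l) + 1) in *.
    assert (HM0 : 0 <= M0) by (unfold M0; apply Rplus_le_le_0_compat; [apply Rmult_le_pos; [lra|left; apply Rinv_0_lt_compat, Hd]|lra]).
    assert (M2 : 2 * PI * (1 - e) * (lam * (2 * M0)) <= 16 + 4 / A * l ^ 5).
    { apply Rle_trans with (2 * PI * (2 * M0)).
      - assert (lam * (2 * M0) <= 1 * (2 * M0)) by (mono_r; lra).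
        assert (0 <= lam * (2 * M0)) by (apply Rmult_le_pos; [|lra]; step_le; [apply pow2_ge_0|exact W2]).
        assert (2 * PI * (1 - e) * (lam * (2 * M0)) <= 2 * PI * 1 * (lam * (2 * M0))) by (mono_r; [assumption|mono_l; lra]).
        assert (2 * PI * (lam * (2 * M0)) <= 2 * PI * (1 * (2 * M0))) by (mono_l; lra). lra.
      - apply Rle_trans with (4 * PI * (l ^ 5 / (PI * A) + 1)); [replace (2 * PI * (2 * M0)) with (4 * PI * M0) by ring; mono_l; lra|].
        replace (4 * PI * (l ^ 5 / (PI * A) + 1)) with (4 / A * l ^ 5 + 4 * PI) by (field; lra). lra. }
    assert (M3 : 2 * PI * (1 - e) ^ 3 * R0 <= 2 * PI * (1 - e) * (lam * R0)).
    { replace (2 * PI * (1 - e) ^ 3 * R0) with (2 * PI * (1 - e) * ((1 - e) ^ 2 * R0)) by ring.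
      mono_l; [apply Rmult_le_pos; lra|]. mono_r; [exact HR0|exact W2]. }
    assert (M4 : (1 + 2 * e) * (l * D) * (1 + e) * (exp av * J) <= b * (l * D) * J).
    { replace (b * (l * D) * J) with ((1 + 2 * e) * (l * D) * (1 + e) * ((1 + e) * J)) by (unfold b; ring).
      mono_l; [repeat apply Rmult_le_pos; lra|]. mono_r; [exact HJ|exact W3]. }
    assert (M5 : K 1 ^ 2 * exp (- (3 * l)) * T * (av / 4) <= K 1 ^ 2).
    { assert (E : exp (- (3 * l)) * T <= 1) by (rewrite HTl, <- exp_plus, <- exp_0; apply exp_le; lra).
      assert (0 <= exp (- (3 * l)) * T) by (apply Rmult_le_pos; [left; apply exp_pos|lra]).
      pose proof (pow2_ge_0 (K 1)). replace (K 1 ^ 2 * exp (- (3 * l)) * T * (av / 4)) with (K 1 ^ 2 * (exp (- (3 * l)) * T * (av / 4))) by ring.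
      rewrite <- (Rmult_1_r (K 1 ^ 2)) at 2. mono_l; [assumption|].
      assert (exp (- (3 * l)) * T * (av / 4) <= 1 * 1) by (apply Rmult_le_compat; lra). lra. }
    unfold Q. rewrite Rmult_minus_distr_l, Rmult_minus_distr_l in AB. lra. } assert (Hb : 1 <= b).
  { assert (1 * 1 ^ 2 <= b); [|lra]. apply Rmult_le_compat; [lra|apply pow2_ge_0|lra|apply pow_incr; lra]. }
  assert (Hbl : 1 <= b * (l * D)).
  { assert (1 * 1 <= l * D) by (apply Rmult_le_compat; lra). assert (1 * 1 <= b * (l * D)) by (apply Rmult_le_compat; lra). lra. }
  assert (HQ : 0 <= Q) by (unfold Q; pose proof (pow2_ge_0 (K 1)); assert (0 <= 4 / A * l ^ 5) by (apply Rmult_le_pos; lra); lra).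
  (* [Main] divided by [T * (b * (l * D))]: the main term acquires the coefficient
     [(1 - e) ^ 3 / b = 1 + E1], and [Q] becomes the error term. *)
  assert (HTb : 0 < T * (b * (l * D))) by (mul_pos; lra). exists ((1 - e) ^ 3 / b - 1), (- (Q / (T * (b * (l * D))))).
  split; [apply final_ratio, He|]. split.
  - rewrite Rabs_Ropp, Rabs_pos_eq by (apply Rmult_le_pos; [exact HQ|left; apply Rinv_0_lt_compat, HTb]).
    assert (ET : Rpower T (-1 + e) = exp (e * l) * / T).
    { unfold Rpower. fold l. replace (/ T) with (exp (- l)) by (rewrite HTl; apply exp_Ropp). rewrite <- exp_plus. f_equal. ring. }
    rewrite ET. apply Rle_trans with ((K 1 ^ 2 + 16 + 4 / A * (5 / e) ^ 5) * exp (e * l) * / T); [|right; ring].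
    apply Rmult_le_compat; [exact HQ|left; apply Rinv_0_lt_compat, HTb| |].
    + unfold Q. pose proof (pow_le_exp 5 e l ltac:(lia) ltac:(lra) ltac:(lra)) as P5. replace (INR 5) with 5 in P5 by (simpl; ring).
      assert (1 <= exp (e * l)) by (rewrite <- exp_0; apply exp_le; lra). pose proof (pow2_ge_0 (K 1)).
      apply (Rmult_le_compat_l (4 / A)) in P5; [|lra].
      assert ((K 1 ^ 2 + 16) * 1 <= (K 1 ^ 2 + 16) * exp (e * l)) by (mono_l; lra). lra.
    + apply Rinv_le_contravar; [exact HT0|]. rewrite <- (Rmult_1_r T) at 1. mono_l; lra.
  - change (mollified_mean_square zeta a theta T) with (/ T * J). fold (clog A theta). fold D. apply Rle_ge.
    replace ((1 + ((1 - e) ^ 3 / b - 1)) / D * (R0 / (T / (2 * PI) * l)) + - (Q / (T * (b * (l * D)))))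
      with ((2 * PI * (1 - e) ^ 3 * R0 - Q) * / (T * (b * (l * D)))) by (field; repeat split; lra).
    replace (/ T * J) with ((b * (l * D) * J) * / (T * (b * (l * D)))) by (field; repeat split; lra).
    mono_r; [left; apply Rinv_0_lt_compat, HTb|]. lra.
Qed.
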